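(* Let $(\alpha,\rho)\in\mathcal{A}$, let $X$ be the $\alpha$-stable process with parameters $(\alpha,\rho)$, and let $p(x)=\frac{\mathrm{d}}{\mathrm{d}x}\mathbb{P}(S_1\le x)$, $x>0$, be the probability density function of $S_1=\sup\{X_u : 0\le u\le 1\}$. Assume that $\alpha\notin\mathcal{L}\cup\mathbb{Q}$. Then for all $x>0$ $$ p(x)=\begin{cases} \displaystyle x^{-1-\alpha}\sum_{n\ge 0}\sum_{m\ge 0} b_{m,n+1}\,x^{-m-\alpha n}, & \text{if } \alpha\in(0,1),\\[3mm] \displaystyle x^{\alpha\rho-1}\sum_{n\ge 0}\sum_{m\ge 0} a_{m,n}\,x^{m+\alpha n}, & \text{if } \alpha\in(1,2). \end{cases} $$
   Context: Parameters. The admissible set is $$\mathcal{A}=\{\alpha\in(0,1),\ \rho\in(0,1)\}\cup\{\alpha=1,\ \rho=\tfrac12\}\cup\{\alpha\in(1,2),\ \rho\in[1-\alpha^{-1},\alpha^{-1}]\}.$$ Process. $X=(X_t)_{t\ge0}$ is the strictly $\alpha$-stable Lévy process started at $0$ with positivity parameter $\rho=\mathbb{P}(X_1>0)$, with the standard normalization of its scale: $\mathbb{E}[e^{\mathrm{i}zX_t}]=e^{-t\Psi(z)}$ for $z\in\mathbb{R}$, where $$\Psi(z)=|z|^{\alpha}\left(e^{\pi \mathrm{i}\alpha(\frac12-\rho)}\mathbf{1}_{\{z>0\}}+e^{-\pi \mathrm{i}\alpha(\frac12-\rho)}\mathbf{1}_{\{z<0\}}\right).$$ The set $\mathcal{L}$.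 $\mathcal{L}$ is the set of all real irrational numbers $x$ for which there exists a constant $b>1$ such that the inequality $\left|x-\frac pq\right|<\frac1{b^q}$ is satisfied for infinitely many pairs of integers $(p,q)$ with $q\ge1$. Coefficients. For $\alpha\notin\mathbb{Q}$ and integers $m\ge0$, $n\ge0$, $$a_{m,n}=\frac{(-1)^{m+n}}{\Gamma\left(1-\rho-n-\frac m\alpha\right)\Gamma(\alpha\rho+m+\alpha n)}\prod_{j=1}^{m}\frac{\sin\left(\frac\pi\alpha(\alpha\rho+j-1)\right)}{\sin\left(\frac{\pi j}{\alpha}\right)}\prod_{j=1}^{n}\frac{\sin(\pi\alpha(\rho+j-1))}{\sin(\pi\alpha j)},$$ where $1/\Gamma$ is the entire reciprocal Gamma function (zero at the poles of $\Gamma$), and for integers $m\ge0$, $n\ge1$, $$b_{m,n}=\frac{\Gamma\left(1-\rho-n-\frac m\alpha\right)\Gamma(\alpha\rho+m+\alpha n)}{\Gamma\left(1+n+\frac m\alpha\right)\Gamma(-m-\alpha n)}\,a_{m,n},$$ that is, after cancelling the common Gamma factors, $$b_{m,n}=\frac{(-1)^{m+n}}{\Gamma\left(1+n+\frac m\alpha\right)\Gamma(-m-\alpha n)}\prod_{j=1}^{m}\frac{\sin\left(\frac\pi\alpha(\alpha\rho+j-1)\right)}{\sin\left(\frac{\pi j}{\alpha}\right)}\prod_{j=1}^{n}\frac{\sin(\pi\alpha(\rho+j-1))}{\sin(\pi\alpha j)}.$$ Empty products equal $1$. *)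

(* Defs.v *)
From HB Require Import structures.
From mathcomp Require Import all_boot all_order all_algebra.
From mathcomp Require Import all_classical all_reals all_analysis.
From mathcomp Require Import complex.

Set Implicit Arguments.
Unset Strict Implicit.
Unset Printing Implicit Defensive.

Import Order.TTheory GRing.Theory Num.Theory.
Import numFieldNormedType.Exports.

Local Open Scope classical_set_scope.
Local Open Scope complex_scope.
Local Open Scope ring_scope.

Definition admissible (R : realType) (alpha rho : R) : Prop :=
  [\/ [/\ 0 < alpha < 1 & 0 < rho < 1],
      [/\ alpha = 1 & rho = 2^-1]
    | [/\ 1 < alpha < 2 & 1 - alpha^-1 <= rho <= alpha^-1]].

Definition cexp (R : realType) (a : R[i]) : R[i] :=
  (expR (complex.Re a))%:C * (cos (complex.Im a) +i* sin (complex.Im a)).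

(* E[exp(i z Y)]; cos (z Y) and sin (z Y) are bounded, so both expectations
   are finite. *)
Definition charfun (d : measure_display) (T : measurableType d) (R : realType)
    (P : probability T R) (Y : T -> R) (z : R) : R[i] :=
  fine 'E_P[fun w => cos (z * Y w)] +i* fine 'E_P[fun w => sin (z * Y w)].

(* Processes are indexed by all of R; only the times t >= 0 are constrained
   or used. *)
Section Levy_process.
Context (d : measure_display) (T : measurableType d) (R : realType).
Variables (P : probability T R) (X : R -> {RV P >-> R}).

Definition independent_increments : Prop :=
  forall (n : nat) (t : nat -> R) (A : nat -> set R),
    0 <= t 0%N -> {homo t : i j / (i <= j)%N >-> i <= j} ->
    (forall i, measurable (A i)) ->
    fine (P (\bigcap_(i < n)
               [set w | A i (X (t i.+1) w - X (t i) w)])) =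
    \prod_(i < n) fine (P [set w | A i (X (t i.+1) w - X (t i) w)]).

Definition stationary_increments : Prop :=
  forall (s t : R) (A : set R), 0 <= s <= t -> measurable A ->
    P [set w | A (X t w - X s w)] = P [set w | A (X (t - s) w - X 0 w)].

(* All paths, not just almost all of them, are required to be cadlag: then the
   running supremum is a finite supremum over a countable set of times on all
   of T, hence measurable. *)
Definition cadlag_paths : Prop :=
  forall w : T,
    (forall t : R, 0 <= t -> X u w @[u --> t^'+] --> X t w) /\
    (forall t : R, 0 < t -> cvg (X u w @[u --> t^'-])).

Definition Levy_process : Prop :=
  [/\ P [set w | X 0 w = 0] = 1%E,
      independent_increments, stationary_increments & cadlag_paths].

Definition strictly_stable (alpha : R) : Prop :=
  forall (k t : R) (A : set R), 0 < k -> 0 <= t -> measurable A ->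
    P [set w | A (X (k * t) w)] = P [set w | A (k `^ alpha^-1 * X t w)].

Definition running_sup (t : R) (w : T) : R := sup [set X u w | u in `[0, t]].

Definition sup_cdf (x : R) : R := fine (P [set w | running_sup 1 w <= x]).

Definition sup_density (x : R) : R := derive1 sup_cdf x.

End Levy_process.

Arguments Levy_process {d T R} P X.
Arguments strictly_stable {d T R} P X alpha.
Arguments sup_cdf {d T R} P X x.
Arguments sup_density {d T R} P X x.

Definition stable_exponent (R : realType) (alpha rho z : R) : R[i] :=
  let theta := pi * alpha * (2^-1 - rho) in
  (`|z| `^ alpha)%:C *
  (cexp (0 +i* theta) * (0 < z)%R%:R + cexp (0 -i* theta) * (z < 0)%R%:R).

Definition stable_process (d : measure_display) (T : measurableType d)
    (R : realType) (P : probability T R) (X : R -> {RV P >-> R})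
    (alpha rho : R) : Prop :=
  [/\ Levy_process P X, strictly_stable P X alpha,
      P [set w | 0 < X 1 w] = rho%:E
    & forall t z : R, 0 <= t ->
        charfun P (X t) z = cexp (- (t%:C * stable_exponent alpha rho z))].

Arguments stable_process {d T R} P X alpha rho.

Definition setL (R : realType) : set R :=
  [set x | irrational x /\
    exists b : R, 1 < b /\
      infinite_set [set pq : int * int | 1 <= pq.2 /\
        `|x - pq.1%:~R / pq.2%:~R| < (b ^ pq.2)^-1]].

(* Euler's integral, meaningful for 0 < x. *)
Definition Gamma (R : realType) (x : R) : R :=
  \int[lebesgue_measure]_(t in `]0, +oo[) (t `^ (x - 1) * expR (- t)).

(* The reciprocal Gamma function on the whole real line, through
   1 / Gamma(x) = x (x + 1) ... (x + n - 1) / Gamma(x + n), where n > |x|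
   makes x + n positive; it vanishes at 0, -1, -2, and so on. *)
Definition rGamma (R : realType) (x : R) : R :=
  let n := (Num.truncn `|x|).+1 in
  (\prod_(i < n) (x + i%:R)) / Gamma (x + n%:R).

Section coefficients.
Context (R : realType) (alpha rho : R).

Definition sin_prod (m n : nat) : R :=
  \prod_(1 <= j < m.+1)
    (sin (pi / alpha * (alpha * rho + j%:R - 1)) / sin (pi * j%:R / alpha)) *
  \prod_(1 <= j < n.+1)
    (sin (pi * alpha * (rho + j%:R - 1)) / sin (pi * alpha * j%:R)).

Definition coef_a (m n : nat) : R :=
  (-1) ^+ (m + n) *
  rGamma (1 - rho - n%:R - m%:R / alpha) *
  rGamma (alpha * rho + m%:R + alpha * n%:R) * sin_prod m n.

Definition coef_b (m n : nat) : R :=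
  (-1) ^+ (m + n) *
  rGamma (1 + n%:R + m%:R / alpha) *
  rGamma (- m%:R - alpha * n%:R) * sin_prod m n.

End coefficients.

(* s = \sum_(n >= 0) \sum_(m >= 0) u m n, with the inner series over m. *)
Definition iterated_sum (R : realType) (u : nat -> nat -> R) (s : R) : Prop :=
  (forall n, cvgn (series (fun m => u m n))) /\
  series (fun n => limn (series (fun m => u m n))) @ \oo --> s.

(* Main.v *)
(** Write M for the supremum, f(l) = E exp(-l M), c(l) = E exp(-l max(X_1, 0)), and let
    V, K be the Laplace transforms in t of f(t^(1/alpha)) and c(t^(1/alpha)).
    Spitzer's identity for the walks k |-> X_(k/N), which follows from the Rota-Baxter
    relation of x |-> max(x, 0), becomes -V' = K V as N tends to infinity.  Inverting the
    characteristic function gives K(q) = (1 - rho + J(q^(-1/alpha))) / q with an explicit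
    real integral J that satisfies J(l) + J(1/l) = rho and expands for small l in powers of
    l^alpha and of l; the coefficients are quotients of sines, and they grow at most
    geometrically because alpha is not in L.

    Hence W(q) = q V(q) solves W' = W J(q^(1/alpha)) / q and tends to 1 at infinity, so
    W(q) = q^rho W(1/q), and for large q it is the product of a power series in 1/q
    and one in q^(-1/alpha); the coefficients of these two series are the sine products of
    the theorem.  The Post-Widder formula inverts a Laplace transform
    sum k_s q^(s-1) termwise into sum k_s t^(-s) / Gamma(1-s).  It is applied twice, once in t
    and once in x, in the order (t first if alpha < 1, x first if alpha > 1) for which
    the intermediate series converges everywhere, and yields the distribution function
    of M as a double series that may be differentiated termwise. *)

Require Import Defs.
From mathcomp Require Import all_boot all_order all_algebra.
From mathcomp Require Import all_classical all_reals all_analysis.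
From mathcomp Require Import measurable_realfun ring lra.

Import Order.TTheory GRing.Theory Num.Theory.
Import numFieldNormedType.Exports.

Local Open Scope classical_set_scope.
Local Open Scope ring_scope.

Set Implicit Arguments.
Unset Strict Implicit.
Unset Printing Implicit Defensive.

(** * Integrals over the positive half-line *)

(** No complex analysis is used: complex integrands occur through their real parts, the rotation of
    a contour becomes a differential equation in the angle, and Laplace inversion looks only at
    large positive arguments. The obstacle is that the series of W converges for large q only, while
    the final double series must converge for every x > 0. Each inversion multiplies a coefficient
    by 1/Gamma(1 - s): superexponentially small for negative s, but possibly of size s^s for
    positive s. The first inversion is therefore one with negative exponents. It leaves the weight
    1/Gamma(1 + be * s), where s is the positive exponent of the second inversion and be is
    whichever of alpha and 1/alpha exceeds 1, so the weight beats s^s. The hypothesis on alpha gives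
    nonzero sines and exponential lower bounds for them. Bounding the sine products factor by factor
    would still lose a factor exponential in n^2; the recursion given by the logarithmic derivative
    of their generating series avoids that loss. *)

Lemma measurable_inv (R : realType) : measurable_fun [set: R] (@GRing.inv R).
Proof.
have -> : [set: R] = [set 0] `|` ~` [set 0] by rewrite setUv.
apply/measurable_funU => //; first exact: measurableC.
split; first exact: measurable_fun_set1.
apply: open_continuous_measurable_fun.
  by apply: closed_openC; exact: accessible_closed_set1 (@hausdorff_accessible _ (@Rhausdorff R)) _.
move=> x; rewrite inE/= => /eqP x0.
exact: inv_continuous.
Qed.

Lemma measurable_funV (d : measure_display) (T : measurableType d) (R : realType)
    (D : set T) (f : T -> R) :
  measurable_fun D f -> measurable_fun D (fun x => (f x)^-1).
Proof. by move=> mf; apply: (measurableT_comp (@measurable_inv R)). Qed.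

Lemma measurable_cosr (R : realType) : measurable_fun [set: R] (@cos R).
Proof. exact: continuous_measurable_fun (@continuous_cos R). Qed.

Lemma measurable_sinr (R : realType) : measurable_fun [set: R] (@sin R).
Proof. exact: continuous_measurable_fun (@continuous_sin R). Qed.

Lemma measurable_funpowR (d : measure_display) (T : measurableType d) (R : realType)
    (D : set T) (f : T -> R) (p : R) :
  measurable_fun D f -> measurable_fun D (fun x => f x `^ p).
Proof. by move=> mf; apply: (measurableT_comp (@measurable_powR R p)). Qed.

Lemma measurable_funexpR (d : measure_display) (T : measurableType d) (R : realType)
    (D : set T) (f : T -> R) :
  measurable_fun D f -> measurable_fun D (fun x => expR (f x)).
Proof. by move=> mf; apply: (measurableT_comp (@measurable_expR R)). Qed.

Lemma measurable_funcos (d : measure_display) (T : measurableType d) (R : realType)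
    (D : set T) (f : T -> R) :
  measurable_fun D f -> measurable_fun D (fun x => cos (f x)).
Proof. by move=> mf; apply: (measurableT_comp (@measurable_cosr R)). Qed.

Lemma measurable_funsin (d : measure_display) (T : measurableType d) (R : realType)
    (D : set T) (f : T -> R) :
  measurable_fun D f -> measurable_fun D (fun x => sin (f x)).
Proof. by move=> mf; apply: (measurableT_comp (@measurable_sinr R)). Qed.

Lemma measurable_funabs (d : measure_display) (T : measurableType d) (R : realType)
    (D : set T) (f : T -> R) :
  measurable_fun D f -> measurable_fun D (fun x => `|f x|).
Proof. by move=> mf; apply: (measurableT_comp (@normr_measurable R setT)). Qed.

Ltac meas1 := lazymatch goal with
  | |- measurable_fun _ (fun x => @?f x + @?g x)%R => apply: (@measurable_funD _ _ _ _ f g)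
  | |- measurable_fun _ (fun x => - @?f x)%R => apply: (@measurable_funN _ _ _ _ f)
  | |- measurable_fun _ (fun x => @?f x * @?g x)%R => apply: (@measurable_funM _ _ _ _ f g)
  | |- measurable_fun _ (fun x => (@?f x)^-1)%R => apply: (@measurable_funV _ _ _ _ f)
  | |- measurable_fun _ (fun x => @powR _ (@?f x) ?p) => apply: (@measurable_funpowR _ _ _ _ f p)
  | |- measurable_fun _ (fun x => @expR _ (@?f x)) => apply: (@measurable_funexpR _ _ _ _ f)
  | |- measurable_fun _ (fun x => @cos _ (@?f x)) => apply: (@measurable_funcos _ _ _ _ f)
  | |- measurable_fun _ (fun x => @sin _ (@?f x)) => apply: (@measurable_funsin _ _ _ _ f)
  | |- measurable_fun _ (fun x => `| @?f x |)%R => apply: (@measurable_funabs _ _ _ _ f)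
  | |- measurable_fun _ (fun x => (@?f x) ^+ ?n)%R => apply: (@measurable_funX _ _ _ _ f n)
  | |- measurable_fun _ (fun x => x) => exact: measurable_id
  | |- measurable_fun _ (fun x => x.1) => exact: (measurable_funS _ _ measurable_fst)
  | |- measurable_fun _ (fun x => x.2) => exact: (measurable_funS _ _ measurable_snd)
  | |- measurable_fun _ (fun _ => _) => first [exact: measurable_cst | assumption]
  | _ => assumption
  end.

Ltac meas := repeat meas1.

(** [Rintegral] is [fine] of an extended integral, hence 0 when that integral is infinite; this is
    why linearity and limits below come with [pintegrable]. *)
Definition pint (R : realType) (f : R -> R) : R :=
  \int[lebesgue_measure]_(t in `]0, +oo[) f t.

Definition pintegrable (R : realType) (f : R -> R) : Prop :=
  (@lebesgue_measure R).-integrable `]0, +oo[ (EFin \o f).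

Lemma mpos (R : realType) : measurable (`]0, +oo[ : set R).
Proof. exact: measurable_itv. Qed.

Lemma mposR (R : realType) : @measurable _ (measurableTypeR R) `]0, +oo[.
Proof. exact: measurable_itv. Qed.

Lemma in_pos (R : realType) (x : R) : (`]0, +oo[%classic : set R) x <-> 0 < x.
Proof. by rewrite /= in_itv/= andbT. Qed.

Lemma pintegrable_dom (R : realType) (f g : R -> R) :
  measurable_fun (`]0, +oo[ : set R) f -> (forall x : R, 0 < x -> `|f x| <= g x) ->
  pintegrable g -> pintegrable f.
Proof.
move=> mf fg; apply: le_integrable; [exact: mpos|exact/measurable_EFinP|].
move=> x /in_pos x0 /=; by rewrite lee_fin (le_trans (fg _ x0))// ler_norm.
Qed.

Lemma pintegrable_meas (R : realType) (f : R -> R) :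
  pintegrable f -> measurable_fun (`]0, +oo[ : set R) f.
Proof. by move=> /measurable_int/measurable_EFinP. Qed.

Lemma eq_pint (R : realType) (f g : R -> R) :
  (forall x : R, 0 < x -> f x = g x) -> pint f = pint g.
Proof. by move=> fg; apply: eq_Rintegral => x; rewrite inE => /in_pos; exact: fg. Qed.

Lemma eq_pintegrable (R : realType) (f g : R -> R) :
  (forall x : R, 0 < x -> f x = g x) -> pintegrable f -> pintegrable g.
Proof.
move=> fg; apply: eq_integrable; first exact: mpos.
by move=> x; rewrite inE => /in_pos x0 /=; rewrite fg.
Qed.

Lemma pintegrableD (R : realType) (f g : R -> R) :
  pintegrable f -> pintegrable g -> pintegrable (fun x => f x + g x).
Proof. by move=> hf hg; have := @integrableD _ _ _ (@lebesgue_measure R) _ (@mposR R) _ _ hf hg. Qed.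

Lemma pintegrableN (R : realType) (f : R -> R) :
  pintegrable f -> pintegrable (fun x => - f x).
Proof. by move=> hf; have := @integrableN _ _ _ (@lebesgue_measure R) _ _ hf. Qed.

Lemma pintegrableB (R : realType) (f g : R -> R) :
  pintegrable f -> pintegrable g -> pintegrable (fun x => f x - g x).
Proof. by move=> hf hg; have := @integrableB _ _ _ (@lebesgue_measure R) _ (@mposR R) _ _ hf hg. Qed.

Lemma pintegrableZ (R : realType) (k : R) (f : R -> R) :
  pintegrable f -> pintegrable (fun x => k * f x).
Proof. by move=> hf; have := @integrableZl _ _ _ (@lebesgue_measure R) _ (@mposR R) k _ hf. Qed.

Lemma pintegrable0 (R : realType) : pintegrable (fun _ : R => 0).
Proof. exact: integrable0. Qed.

Lemma pintD (R : realType) (f g : R -> R) : pintegrable f -> pintegrable g ->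
  pint (fun x => f x + g x) = pint f + pint g.
Proof. by move=> hf hg; rewrite /pint RintegralD. Qed.

Lemma pintB (R : realType) (f g : R -> R) : pintegrable f -> pintegrable g ->
  pint (fun x => f x - g x) = pint f - pint g.
Proof. by move=> hf hg; rewrite /pint RintegralB. Qed.

Lemma pintZ (R : realType) (k : R) (f : R -> R) : pintegrable f ->
  pint (fun x => k * f x) = k * pint f.
Proof. by move=> hf; rewrite /pint RintegralZl. Qed.

Lemma pintN (R : realType) (f : R -> R) : pintegrable f ->
  pint (fun x => - f x) = - pint f.
Proof.
by move=> hf; rewrite -mulN1r -pintZ//; apply: eq_pint => x _; rewrite mulN1r.
Qed.

Lemma pint0 (R : realType) : pint (fun _ : R => 0) = 0.
Proof. by rewrite /pint Rintegral_cst// mul0r. Qed.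

Lemma le_pint (R : realType) (f g : R -> R) : pintegrable f -> pintegrable g ->
  (forall x : R, 0 < x -> f x <= g x) -> pint f <= pint g.
Proof. by move=> hf hg fg; apply: le_Rintegral => // x /in_pos; exact: fg. Qed.

Lemma pint_ge0 (R : realType) (f : R -> R) :
  (forall x : R, 0 < x -> 0 <= f x) -> 0 <= pint f.
Proof. by move=> f0; apply: Rintegral_ge0 => x /in_pos; exact: f0. Qed.

Lemma le_norm_pint (R : realType) (f g : R -> R) : pintegrable f -> pintegrable g ->
  (forall x : R, 0 < x -> `|f x| <= g x) -> `|pint f| <= pint g.
Proof.
move=> hf hg fg; rewrite /pint; apply: (le_trans (@le_normr_Rintegral _ _ _ (@lebesgue_measure R) _ _ (@mposR R) hf)).
by apply: le_pint => //; exact: integrable_norm.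
Qed.

Lemma Rintegral_dct (d : measure_display) (T : measurableType d) (R : realType)
    (mu : {measure set T -> \bar R}) (D : set T) (f_ : nat -> T -> R) (f g : T -> R) :
  measurable D -> (forall n, measurable_fun D (f_ n)) ->
  (forall x, D x -> f_ n x @[n --> \oo] --> f x) ->
  (forall n x, D x -> `|f_ n x| <= g x) -> mu.-integrable D (EFin \o g) ->
  mu.-integrable D (EFin \o f) /\
  \int[mu]_(x in D) f_ n x @[n --> \oo] --> \int[mu]_(x in D) f x.
Proof.
move=> mD mf_ cf dom ig.
have mf : measurable_fun D f by exact: (measurable_fun_cvg mf_ cf).
have cvgE x : D x -> (f_ n x)%:E @[n --> \oo] --> (f x)%:E.
  by move=> Dx; apply: cvg_EFin; [exact: nearW|exact: cf].
have domE : forall x n, D x -> (`|(f_ n x)%:E| <= (g x)%:E)%E.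
  by move=> x n Dx; rewrite lee_fin; exact: dom.
have [h1 _ h2] := @dominated_convergence _ _ _ mu D mD (fun n x => (f_ n x)%:E)
  (fun x => (f x)%:E) (fun x => (g x)%:E)
  (fun n => (measurable_EFinP _ _).2 (mf_ n)) ((measurable_EFinP _ _).2 mf)
  (aeW _ cvgE) ig (aeW _ domE).
split=> //; apply: fine_cvg => /=.
rewrite fineK//; exact: integrable_fin_num.
Qed.

Lemma pint_dct (R : realType) (f_ : nat -> R -> R) (f g : R -> R) :
  (forall n, measurable_fun (`]0, +oo[ : set R) (f_ n)) ->
  (forall x : R, 0 < x -> f_ n x @[n --> \oo] --> f x) ->
  (forall n (x : R), 0 < x -> `|f_ n x| <= g x) -> pintegrable g ->
  pintegrable f /\ pint (f_ n) @[n --> \oo] --> pint f.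
Proof.
move=> mf cf dom ig.
have cf' x : (`]0, +oo[%classic : set R) x -> f_ n x @[n --> \oo] --> f x.
  by move=> /in_pos; exact: cf.
have dom' n x : (`]0, +oo[%classic : set R) x -> `|f_ n x| <= g x.
  by move=> /in_pos; exact: dom.
exact: (@Rintegral_dct _ _ _ (@lebesgue_measure R) _ f_ f g (@mposR R) mf cf' dom' ig).
Qed.

Lemma cvg_at_right_seq (R : realType) (u : nat -> R) (p : R) :
  (forall n, p < u n) -> u n @[n --> \oo] --> p -> u n @[n --> \oo] --> p^'+.
Proof.
move=> pu up A hA; have {}hA : \forall y \near p, p < y -> A y by exact: hA.
have : \forall n \near \oo, p < u n -> A (u n) by exact: up _ hA.
by apply: filterS => n; apply; exact: pu.
Qed.

Lemma cvg_natinv (R : realType) (k : nat) : ((n + k)%:R : R)^-1 @[n --> \oo] --> 0.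
Proof.
rewrite (cvg_shiftn k (fun n : nat => (n%:R : R)^-1)) -cvg_shiftS.
exact: cvg_harmonic.
Qed.

Lemma cvg_natinvr (R : realType) : (n.+2%:R : R)^-1 @[n --> \oo] --> 0^'+.
Proof.
apply: cvg_at_right_seq => [n|]; first by rewrite invr_gt0.
under eq_fun do rewrite -addn2; exact: cvg_natinv.
Qed.

Lemma cvg_natSSy (R : realType) : (n.+2%:R : R) @[n --> \oo] --> +oo.
Proof.
by rewrite (cvg_shiftS (fun n => n.+1%:R : R)) (cvg_shiftS (fun n => n%:R : R)); exact: cvgr_idn.
Qed.

Lemma is_derive_continuous (R : realType) (f : R -> R) (x l : R) :
  is_derive x 1 f l -> {for x, continuous f}.
Proof.
by move=> [h _]; apply: differentiable_continuous; exact/derivable1_diffP.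
Qed.

Lemma pos_open (R : realType) : open (`]0, +oo[%classic : set R).
Proof. exact: interval_open. Qed.

Lemma pos_continuous_meas (R : realType) (g : R -> R) :
  (forall x : R, 0 < x -> {for x, continuous g}) ->
  measurable_fun (`]0, +oo[ : set R) g.
Proof.
move=> cg; apply: open_continuous_measurable_fun; first exact: pos_open.
by move=> x; rewrite inE => /in_pos; exact: cg.
Qed.

(** Compact intervals that exhaust the half-line and are invariant under inversion. The shift by 2
    keeps the two endpoints distinct even at [n = 0]. *)
Definition box (R : realType) (n : nat) : set R := `[n.+2%:R^-1, n.+2%:R].

Arguments box : clear implicits.

Lemma box_lt (R : realType) (n : nat) : (n.+2%:R^-1 : R) < n.+2%:R.
Proof.
apply: (@lt_trans _ _ 1); first by rewrite invf_lt1// ltr1n.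
by rewrite ltr1n.
Qed.

Lemma box_pos (R : realType) (n : nat) (x : R) : box R n x -> 0 < x.
Proof. by rewrite /box/= in_itv/= => /andP[h _]; apply: lt_le_trans h; rewrite invr_gt0. Qed.

Lemma pint_box (R : realType) (g : R -> R) (n : nat) :
  pint (g \_ (box R n)) = \int[lebesgue_measure]_(x in box R n) g x.
Proof.
rewrite /pint -Rintegral_mkcondr; congr (\int[lebesgue_measure]_(x in _) g x).
by apply/seteqP; split => x /=; [by case|move=> h; split => //; apply/in_pos/box_pos/h].
Qed.

Lemma near_box (R : realType) (x : R) : 0 < x -> \forall n \near \oo, box R n x.
Proof.
move=> x0; near=> n; rewrite /box/= in_itv/=; apply/andP; split.
  rewrite -[leRHS]invrK lef_pV2 ?posrE ?invr_gt0//.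
  by near: n; exact: (cvgryPge _).1 (@cvg_natSSy R) _.
by near: n; exact: (cvgryPge _).1 (@cvg_natSSy R) _.
Unshelve. all: by end_near. Qed.

Lemma box_ftc (R : realType) (G g : R -> R) (n : nat) :
  (forall x : R, 0 < x -> is_derive x 1 G (g x)) ->
  (forall x : R, 0 < x -> {for x, continuous g}) ->
  (\int[lebesgue_measure]_(x in box R n) (g x)%:E = (G n.+2%:R - G n.+2%:R^-1)%:E)%E.
Proof.
move=> dG cg; rewrite EFinB /box.
have gt0 (x : R) : n.+2%:R^-1 <= x -> 0 < x by apply: lt_le_trans; rewrite invr_gt0.
apply: continuous_FTC2; first exact: box_lt.
- apply: continuous_in_subspaceT => x; rewrite inE/= in_itv/= => /andP[h _].
  exact: cg (gt0 _ h).
- split.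
  + move=> x; rewrite in_itv/= => /andP[h _].
    by have [] := dG x (gt0 _ (ltW h)).
  + apply: cvg_at_right_filter; apply: is_derive_continuous; apply: dG; exact: gt0.
  + apply: cvg_at_left_filter; apply: is_derive_continuous; apply: dG; apply: gt0.
    exact/ltW/box_lt.
- move=> x; rewrite in_itv/= => /andP[h _].
  by have [_ <-] := dG x (gt0 _ (ltW h)); rewrite derive1E.
Qed.

Lemma box_patch_meas (R : realType) (g : R -> R) (n : nat) :
  measurable_fun (`]0, +oo[ : set R) g ->
  measurable_fun (`]0, +oo[ : set R) (g \_ (box R n)).
Proof.
move=> mg; have mb : measurable (box R n) by exact: measurable_itv.
apply: (proj1 (measurable_restrict g mb (@mpos R))).
by apply: measurable_funS mg; [exact: mpos|move=> x []].
Qed.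

(** Each difference of [G] is the integral of [g] over a box, and [|g|] dominates. The limit is left
    as one sequence, so that no separate limits of [G] at 0 and at infinity have to be supplied. *)
Lemma pint_ftc_seq (R : realType) (G g : R -> R) :
  (forall x : R, 0 < x -> is_derive x 1 G (g x)) ->
  (forall x : R, 0 < x -> {for x, continuous g}) -> pintegrable g ->
  G n.+2%:R - G n.+2%:R^-1 @[n --> \oo] --> pint g.
Proof.
move=> dG cg ig.
have h n : pint (g \_ (box R n)) = G n.+2%:R - G n.+2%:R^-1.
  by rewrite pint_box /Rintegral (box_ftc n dG cg).
have [_] : pintegrable g /\ pint (g \_ (box R n)) @[n --> \oo] --> pint g.
  apply: (@pint_dct R (fun n => g \_ (box R n)) g (fun x => `|g x|)).
  - by move=> n; apply: box_patch_meas; exact: pos_continuous_meas cg.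
  - move=> x x0; apply: cvg_near_cst; apply: filterS (near_box x0) => n xn.
    by rewrite patchE mem_set.
  - by move=> n x x0; rewrite patchE; case: ifP => // _; rewrite normr0.
  - exact: integrable_norm.
by under eq_fun do rewrite h.
Qed.

Lemma pint_ftc (R : realType) (G g : R -> R) (l0 l1 : R) :
  (forall x : R, 0 < x -> is_derive x 1 G (g x)) ->
  (forall x : R, 0 < x -> {for x, continuous g}) ->
  pintegrable g -> G x @[x --> 0^'+] --> l0 -> G x @[x --> +oo] --> l1 ->
  pint g = l1 - l0.
Proof.
move=> dG cg ig G0 G1; have := pint_ftc_seq dG cg ig.
move=> /cvg_lim <-//; apply: cvg_lim => //; apply: cvgB.
  exact: cvg_comp (@cvg_natSSy R) G1.
exact: cvg_comp (@cvg_natinvr R) G0.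
Qed.

(** Monotone convergence along the boxes: a nonnegative derivative is integrable once the increments
    of its primitive converge. The basic comparison functions get their integrability this way. *)
Lemma pint_ftc_ge0_seq (R : realType) (G g : R -> R) (l : R) :
  (forall x : R, 0 < x -> is_derive x 1 G (g x)) ->
  (forall x : R, 0 < x -> {for x, continuous g}) ->
  (forall x : R, 0 < x -> 0 <= g x) ->
  G n.+2%:R - G n.+2%:R^-1 @[n --> \oo] --> l ->
  pintegrable g.
Proof.
move=> dG cg g0 Gl; apply/integrableP; split.
  by apply/measurable_EFinP; exact: pos_continuous_meas cg.
pose f_ n x := ((g \_ (box R n)) x)%:E.
have -> : (\int[lebesgue_measure]_(x in `]0%R, +oo[) `|(EFin \o g) x| =
    limn (fun n => \int[lebesgue_measure]_(x in `]0%R, +oo[) f_ n x))%E.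
  rewrite -monotone_convergence//.
  - apply: eq_integral => x; rewrite inE => /in_pos x0.
    apply/esym/cvg_lim => //; apply: cvg_near_cst; apply: filterS (near_box x0) => n xn.
    by rewrite /f_ patchE mem_set//= ger0_norm// g0.
  - by move=> n; apply/measurable_EFinP; apply: box_patch_meas; exact: pos_continuous_meas cg.
  - move=> n x /in_pos x0; rewrite /f_ patchE; case: ifP => // _.
    by rewrite lee_fin g0.
  - move=> x /in_pos x0 m n mn; rewrite /f_ !patchE lee_fin.
    case: ifPn => [|_]; last by case: ifP => // _; exact: g0.
    rewrite inE /box /= in_itv/= => /andP[h1 h2]; rewrite mem_set//= in_itv/=.
    rewrite (le_trans _ h1) ?(le_trans h2)//= ?ler_nat ?ltnS//.
    by rewrite lef_pV2 ?posrE// ler_nat !ltnS.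
have h n : (\int[lebesgue_measure]_(x in `]0%R, +oo[) f_ n x = (G n.+2%:R - G n.+2%:R^-1)%:E)%E.
  rewrite -(box_ftc n dG cg) /f_.
  have -> : (fun x => ((g \_ (box R n)) x)%:E) = ((EFin \o g) \_ (box R n)) by rewrite restrict_EFin.
  rewrite -integral_mkcondr; congr (integral _ _ _).
  by apply/seteqP; split => x /=; [by case|move=> xb; split => //; apply/in_pos/box_pos/xb].
under eq_fun do rewrite h.
have -> : (limn (fun n => (G n.+2%:R - G n.+2%:R^-1)%:E) = l%:E)%E.
  by apply: cvg_lim => //; apply: cvg_EFin; first exact: nearW.
exact: ltry.
Qed.

Lemma pint_ftc_ge0 (R : realType) (G g : R -> R) (l0 l1 : R) :
  (forall x : R, 0 < x -> is_derive x 1 G (g x)) ->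
  (forall x : R, 0 < x -> {for x, continuous g}) ->
  (forall x : R, 0 < x -> 0 <= g x) ->
  G x @[x --> 0^'+] --> l0 -> G x @[x --> +oo] --> l1 ->
  pintegrable g.
Proof.
move=> dG cg g0 G0 G1; apply: (pint_ftc_ge0_seq dG cg g0 (l := l1 - l0)).
apply: cvgB; first exact: cvg_comp (@cvg_natSSy R) G1.
exact: cvg_comp (@cvg_natinvr R) G0.
Qed.

(** Supplies [pint_ftc_seq] with a primitive when there is no closed one. The endpoint [x + 1] only
    provides an interval that contains [x] in its interior. *)
Lemma pos_antiderivative (R : realType) (f : R -> R) :
  (forall x : R, 0 < x -> {for x, continuous f}) -> pintegrable f ->
  exists F : R -> R, forall x : R, 0 < x -> is_derive x 1 F (f x).
Proof.
move=> cf iF.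
exists (fun x => \int[lebesgue_measure]_(t in [set` Interval (BRight 0) (BRight x)]) f t).
move=> x x0.
have iu : (@lebesgue_measure R).-integrable [set` Interval (BRight 0) (BRight (x + 1))] (EFin \o f).
  have mD : @measurable _ (measurableTypeR R) [set` Interval (BRight 0) (BRight (x + 1))].
    exact: measurable_itv.
  apply: (@integrableS _ _ _ (@lebesgue_measure R) _ _ _ (@mposR R) mD _ iF).
  by move=> y /=; rewrite !in_itv/= andbT => /andP[].
have xu : x < x + 1 by rewrite ltrDl.
have [h1 h2] := @continuous_FTC1 R f (BRight 0) x (x + 1) xu iu x0 (cf x x0).
move: h1 h2; set F := (fun x => _) => h1 h2.
exact: (DeriveDef h1 (etrans (esym (derive1E _ _)) h2)).
Qed.

Lemma is_derive_inv (R : realType) (F : R -> R) (x d : R) : 0 < x ->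
  is_derive x^-1 1 F d -> is_derive x 1 (fun z => F z^-1) (- (x ^- 2) * d).
Proof.
move=> x0 hF.
have h1 : is_derive x 1 (fun z : R => z^-1) (- (x ^- 2) *: 1).
  apply: is_deriveV; rewrite gt_eqF//.
have := @is_derive1_comp R F (fun z => z^-1) x d (- (x ^- 2) *: 1) hF h1.
by move=> h; apply: is_derive_eq; rewrite /GRing.scale/= mulr1 mulrC.
Qed.

(** If [F] is a primitive of [f], then [- F z^-1] is one of the substituted integrand, and inversion
    swaps the two endpoints of a box, so the increments are the same. Applied to [|f|] this gives
    integrability, applied to [f] the value. *)
Lemma pint_inv (R : realType) (f : R -> R) :
  (forall x : R, 0 < x -> {for x, continuous f}) -> pintegrable f ->
  pintegrable (fun z => z ^- 2 * f z^-1) /\ pint (fun z => z ^- 2 * f z^-1) = pint f.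
Proof.
move=> cf iF.
have main (g : R -> R) : (forall x : R, 0 < x -> {for x, continuous g}) ->
    pintegrable g -> exists2 G : R -> R,
    (forall x : R, 0 < x -> is_derive x 1 G (x ^- 2 * g x^-1)) &
    G n.+2%:R - G n.+2%:R^-1 @[n --> \oo] --> pint g.
  move=> cg ig; have [F dF] := pos_antiderivative cg ig.
  exists (fun z => - F z^-1).
    move=> x x0; have x1 : 0 < x^-1 by rewrite invr_gt0.
    have h := is_derive_inv x0 (dF _ x1).
    by apply: is_derive_eq; rewrite mulNr opprK.
  have := pint_ftc_seq dF cg ig.
  by under eq_fun do [rewrite -[X in F X - _]invrK addrC -[X in _ + X]opprK].
have cinv (g : R -> R) : (forall x : R, 0 < x -> {for x, continuous g}) ->
    forall x : R, 0 < x -> {for x, continuous (fun z : R => z ^- 2 * g z^-1)}.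
  move=> cg x x0; apply: cvgM.
    apply: cvgV; first by rewrite sqrf_eq0 gt_eqF.
    exact: exprn_continuous.
  apply: continuous_comp; first by apply: inv_continuous; rewrite gt_eqF.
  by apply: cg; rewrite invr_gt0.
have iinv : pintegrable (fun z => z ^- 2 * f z^-1).
  have cnf (x : R) : 0 < x -> {for x, continuous (fun z => `|f z|)}.
    by move=> x0; apply: continuous_comp (cf x x0) _; exact: norm_continuous.
  have inf : pintegrable (fun z => `|f z|) by exact: integrable_norm.
  have [G dG lG] := main _ cnf inf.
  have g0 (x : R) : 0 < x -> 0 <= x ^- 2 * `|f x^-1|.
    by move=> x0; rewrite mulr_ge0// invr_ge0 sqr_ge0.
  apply: (pintegrable_dom _ _ (pint_ftc_ge0_seq dG (cinv _ cnf) g0 lG)).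
  - exact: pos_continuous_meas (cinv _ cf).
  - by move=> x x0; rewrite normrM ger0_norm// invr_ge0 sqr_ge0.
split => //.
have [G dG lG] := main _ cf iF.
by have := pint_ftc_seq dG (cinv _ cf) iinv; move=> /cvg_lim <-//; exact: cvg_lim lG.
Qed.

Lemma is_derive_powR (R : realType) (p x : R) : 0 < x ->
  is_derive x 1 (@powR R ^~ p) (p * x `^ (p - 1)).
Proof.
move=> x0; apply: DeriveDef.
  by apply: derivable_powR; rewrite in_itv/= x0.
by rewrite -derive1E powR_derive1 // in_itv/= x0.
Qed.

Lemma continuous_powR (R : realType) (p x : R) : 0 < x ->
  {for x, continuous (@powR R ^~ p)}.
Proof. by move=> x0; apply: is_derive_continuous (is_derive_powR p x0). Qed.

Lemma cvgy_powR (R : realType) (s : R) : 0 < s -> x `^ s @[x --> +oo] --> (+oo : set_system R).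
Proof.
move=> s0; apply/cvgryPge => A; near=> x.
have A0 : 0 <= Num.max A 0 by rewrite le_max lexx orbT.
apply: (@le_trans _ _ (Num.max A 0)); first by rewrite le_max lexx.
rewrite -[X in X <= _](@powRr1 R)// -(@mulVf _ s) ?gt_eqF// powRrM.
apply: ge0_ler_powR; rewrite ?nnegrE ?powR_ge0 ?(ltW s0)//.
Unshelve. all: by end_near. Qed.

(** The derivative of atan(z^s) / s. It has order s - 1 at 0 and - s - 1 at infinity, so it is one
    comparison function for both ends. *)
Definition kers (R : realType) (s z : R) : R := z `^ (s - 1) / (1 + (z `^ s) ^+ 2).

Lemma kers_integrable (R : realType) (s : R) : 0 < s -> pintegrable (kers s).
Proof.
move=> s0.
have d1 (x : R) : 0 < x -> is_derive x 1 (fun z => s^-1 * atan (z `^ s)) (kers s x).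
  move=> x0; have dx := is_derive_powR s x0.
  apply: is_derive_eq; rewrite /kers /GRing.scale/=.
  by set a := x `^ (s - 1); set e := (1 + _)^-1; field; rewrite gt_eqF//.
have d2 (x : R) : 0 < x -> {for x, continuous (kers s)}.
  move=> x0; apply: cvgM; first exact: continuous_powR.
  apply: cvgV; first by rewrite gt_eqF// ltr_pwDl// sqr_ge0.
  by apply: cvgD; [exact: cvg_cst|apply: cvgM; exact: continuous_powR].
apply: (pint_ftc_ge0 d1 d2).
- by move=> x x0; rewrite /kers divr_ge0 ?powR_ge0 ?addr_ge0 ?sqr_ge0.
- apply: cvgZr; apply: continuous_cvg; first exact: continuous_atan.
  exact: powR_cvg0.
- by apply: cvgZr; apply: cvg_comp (cvgy_powR s0) (@cvgy_atan R).
Qed.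

Lemma le_kers (R : realType) (s z : R) : 0 < s -> 0 < z ->
  (z <= 1 -> z `^ (s - 1) <= 2 * kers s z) /\
  (1 <= z -> z `^ (- s - 1) <= 2 * kers s z).
Proof.
move=> s0 z0; have zs0 : 0 < z `^ s by exact: powR_gt0.
have zs1 : 0 < z `^ (s - 1) by exact: powR_gt0.
have d0 : 0 < 1 + (z `^ s) ^+ 2 by rewrite ltr_pwDl// sqr_ge0.
split=> z1; rewrite /kers mulrA ler_pdivlMr//.
  have : z `^ s <= 1 by rewrite -(powRr0 z); apply: ger_powR; [rewrite z0 z1|exact: ltW].
  by move=> h; rewrite [leRHS]mulrC ler_pM2l//; nra.
have : 1 <= z `^ s by rewrite -(powRr0 z); apply: ler_powR => //; rewrite ltW.
have -> : z `^ (s - 1) = z `^ (- s - 1) * (z `^ s) ^+ 2.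
  rewrite expr2 mulrA -!powRD ?(gt_eqF z0) ?implybT//; congr (_ `^ _); ring.
have : 0 < z `^ (- s - 1) by exact: powR_gt0.
by move=> h1 h2; rewrite mulrCA ler_pM2l//; nra.
Qed.

Lemma pintegrable_dom2 (R : realType) (s C : R) (f : R -> R) : 0 < s ->
  measurable_fun (`]0, +oo[ : set R) f ->
  (forall z : R, 0 < z -> z <= 1 -> `|f z| <= C * z `^ (s - 1)) ->
  (forall z : R, 1 <= z -> `|f z| <= C * z `^ (- s - 1)) ->
  pintegrable f.
Proof.
move=> s0 mf h1 h2.
have C0 : 0 <= C.
  by have := h2 1 (lexx _); rewrite powR1 mulr1; apply: le_trans.
apply: (pintegrable_dom (g := fun z => C * (2 * kers s z))) => //; last first.
  by do 2 apply: pintegrableZ; exact: kers_integrable.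
move=> x x0; have [k1 k2] := le_kers s0 x0.
have [x1|x1] := leP x 1.
  by apply: le_trans (h1 _ x0 x1) _; apply: ler_wpM2l => //; exact: k1.
apply: le_trans (h2 _ (ltW x1)) _; apply: ler_wpM2l => //; exact/k2/ltW.
Qed.

Lemma powR_le_expR (R : realType) (p : R) : exists2 C : R, 0 <= C &
  forall t : R, 1 <= t -> t `^ p * expR (- t) <= C.
Proof.
pose n := (Num.truncn `|p|).
exists n.+1`!%:R => // t t1.
have t0 : 0 <= t by exact: le_trans t1.
have h : t `^ p <= t ^+ n.+1.
  rewrite -powR_mulrn//; apply: ler_powR => //.
  by apply: le_trans (ler_norm p) _; apply/ltW; exact: truncnS_gt.
have := expR_ge1Dxn n t0; rewrite expRN ler_pdivrMr ?expR_gt0// => h2.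
apply: (le_trans h).
have : t ^+ n.+1 / n.+1`!%:R <= expR t by apply: le_trans h2; rewrite ler_wpDl.
by rewrite ler_pdivrMr ?ltr0n ?fact_gt0// mulrC.
Qed.

Lemma gamma_integrable (R : realType) (x a : R) : 0 < x -> 0 < a ->
  pintegrable (fun t => t `^ (x - 1) * expR (- (a * t))).
Proof.
move=> x0 a0.
have [C C0 hC] := powR_le_expR (x + x).
pose b := Num.min a 1.
have b0 : 0 < b by rewrite lt_min a0 ltr01.
apply: (@pintegrable_dom2 _ x (1 + C * b^-1 `^ (x + x) + expR 1 * a^-1 `^ (x + x) + C * (a^-1) `^ (x + x))) => //.
- meas.
- move=> z z0 z1; rewrite ger0_norm ?mulr_ge0 ?powR_ge0 ?expR_ge0// mulrC.
  apply: ler_wpM2r; first exact: powR_ge0.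
  apply: (@le_trans _ _ 1); first by rewrite -expR0 ler_expR oppr_le0 mulr_ge0 ?ltW.
  by rewrite -!addrA ler_wpDr// !addr_ge0// mulr_ge0// ?expR_ge0 ?powR_ge0.
- move=> z z1; have z0 : 0 < z by exact: lt_le_trans z1.
  rewrite ger0_norm ?mulr_ge0 ?powR_ge0 ?expR_ge0//.
  have -> : z `^ (x - 1) = z `^ (x + x) * z `^ (- x - 1).
    rewrite -powRD ?(gt_eqF z0) ?implybT//; congr (_ `^ _); ring.
  rewrite mulrAC; apply: ler_wpM2r; first exact: powR_ge0.
  have az0 : 0 < a * z by rewrite mulr_gt0.
  have -> : z `^ (x + x) = a^-1 `^ (x + x) * (a * z) `^ (x + x).
    by rewrite -powRM ?invr_ge0 ?(ltW a0) ?(ltW az0)// mulrA mulVf ?gt_eqF// mul1r.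
  have [az1|az1] := leP 1 (a * z).
    rewrite -mulrA [X in _ <= _ + X]mulrC; apply: (@le_trans _ _ (a^-1 `^ (x + x) * C)).
      by apply: ler_wpM2l; [exact: powR_ge0|exact: hC].
    by rewrite ler_wpDl// !addr_ge0// mulr_ge0// ?expR_ge0 ?powR_ge0.
  rewrite -mulrA; apply: (@le_trans _ _ (a^-1 `^ (x + x) * 1)).
    apply: ler_wpM2l; first exact: powR_ge0.
    apply: mulr_ile1; rewrite ?powR_ge0 ?expR_ge0//.
      by rewrite -(powRr0 (a * z)); apply: ger_powR; [rewrite az0 ltW|rewrite addr_ge0 ?ltW].
    by rewrite -expR0 ler_expR oppr_le0 ltW.
  rewrite mulr1; apply: (@le_trans _ _ (expR 1 * a^-1 `^ (x + x))).
    by rewrite ler_peMl ?powR_ge0// -expR0 ler_expR.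
  by rewrite -addrA addrCA ler_wpDr// !addr_ge0// mulr_ge0// ?expR_ge0 ?powR_ge0.
Qed.

Lemma exp_integrable (R : realType) (k : nat) (a : R) : 0 < a ->
  pintegrable (fun t => t ^+ k * expR (- (a * t))).
Proof.
move=> a0; have := @gamma_integrable R k.+1%:R a (ltr0Sn _ _) a0.
apply: eq_pintegrable => t t0; rewrite -powR_mulrn ?ltW//.
by congr (_ `^ _ * _); rewrite -natr1 addrK.
Qed.

Lemma exp0_integrable (R : realType) (a : R) : 0 < a ->
  pintegrable (fun t => expR (- (a * t))).
Proof.
move=> a0; have := exp_integrable 0 a0.
by apply: eq_pintegrable => t t0; rewrite expr0 mul1r.
Qed.

Lemma cvgy_powR_exp (R : realType) (p a : R) : 0 < a ->
  t `^ p * expR (- (a * t)) @[t --> +oo] --> 0.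
Proof.
move=> a0; have [C C0 hC] := powR_le_expR (p + 1).
apply/cvgr0Pnorm_le => e e0; near=> t.
have t0 : 0 < t by near: t; exact: nbhs_pinfty_gt.
have at0 : 0 < a * t by rewrite mulr_gt0.
have at1 : 1 <= a * t.
  rewrite mulrC -ler_pdivrMr//; near: t; apply: nbhs_pinfty_ge; exact: num_real.
rewrite ger0_norm ?mulr_ge0 ?powR_ge0 ?expR_ge0//.
have -> : t `^ p = a^-1 `^ p * (a * t) `^ p.
  by rewrite -powRM ?invr_ge0 ?(ltW a0) ?(ltW at0)// mulrA mulVf ?gt_eqF// mul1r.
have -> : (a * t) `^ p = (a * t) `^ (p + 1) * (a * t)^-1.
  by rewrite powRD ?(gt_eqF at0) ?implybT// powRr1 ?ltW// mulfK// gt_eqF.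
rewrite -mulrA mulrAC; apply: (@le_trans _ _ (a^-1 `^ p * (C / (a * t)))).
  apply: ler_wpM2l; first exact: powR_ge0.
  by apply: ler_wpM2r; [rewrite invr_ge0 ltW|exact: hC].
have h : (e * a)^-1 * (a^-1 `^ p * C) <= t.
  by near: t; apply: nbhs_pinfty_ge; exact: num_real.
by rewrite mulrA ler_pdivrMr// mulrA -ler_pdivrMl ?mulr_gt0.
Unshelve. all: by end_near. Qed.

Lemma is_derive_expN (R : realType) (a t : R) :
  is_derive t 1 (fun t => expR (- (a * t))) (- a * expR (- (a * t))).
Proof. apply: is_derive_eq; rewrite /GRing.scale/= mulr1; ring. Qed.

Lemma continuous_expN (R : realType) (a x : R) :
  {for x, continuous (fun t : R => expR (- (a * t)))}.
Proof. exact: is_derive_continuous (is_derive_expN a x). Qed.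

Lemma cvgy_expN (R : realType) (a : R) : 0 < a -> expR (- (a * t)) @[t --> +oo] --> 0.
Proof.
move=> a0; have := @cvgy_powR_exp R 0 a a0.
by under eq_fun do rewrite powRr0 mul1r.
Qed.

Lemma pint_exp (R : realType) (a : R) : 0 < a -> pint (fun t => expR (- (a * t))) = a^-1.
Proof.
move=> a0.
rewrite -[RHS]opprK -[RHS]sub0r; apply: (@pint_ftc _ (fun t => - a^-1 * expR (- (a * t)))).
- move=> x x0; have h := is_derive_expN a x.
  apply: is_derive_eq; rewrite /GRing.scale/=; set e := expR _; field; rewrite gt_eqF//.
- by move=> x x0; exact: continuous_expN.
- exact: exp0_integrable.
- rewrite -[X in _ --> X]mulr1 -[X in _ * X]expR0 -[X in expR X]oppr0 -[X in expR (- X)](mulr0 a).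
  by apply: cvgM; [exact: cvg_cst|apply: cvg_at_right_filter; exact: continuous_expN].
- rewrite -[X in _ --> X](mulr0 (- a^-1)); apply: cvgZr.
  by exact: cvgy_expN.
Qed.

(** Integration by parts: the difference of the two sides is the integral of the derivative of - t^x
    e^(- a t) / a, which vanishes at both ends. *)
Lemma pint_gammaS (R : realType) (x a : R) : 0 < x -> 0 < a ->
  pint (fun t => t `^ x * expR (- (a * t))) =
  x / a * pint (fun t => t `^ (x - 1) * expR (- (a * t))).
Proof.
move=> x0 a0; rewrite -pintZ; last exact: gamma_integrable.
have i1 : pintegrable (fun t => t `^ x * expR (- (a * t))).
  have := @gamma_integrable _ (x + 1) a _ a0; rewrite addrK; apply.
  by rewrite addr_gt0.
apply/eqP; rewrite -subr_eq0 -pintB//; last by apply: pintegrableZ; exact: gamma_integrable.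
apply/eqP.
rewrite -[RHS](subrr 0).
refine (@pint_ftc R (fun t => - a^-1 * (t `^ x * expR (- (a * t))))
  (fun t => t `^ x * expR (- (a * t)) - x / a * (t `^ (x - 1) * expR (- (a * t))))
  0 0 _ _ _ _ _).
- move=> t t0; have h := is_derive_expN a t; have h2 := is_derive_powR x t0.
  apply: is_derive_eq; rewrite /GRing.scale/=.
  by set u := t `^ x; set v := t `^ (x - 1); set e := expR _; field; rewrite gt_eqF//.
- move=> t t0;   apply: cvgB; first by apply: cvgM; [exact: continuous_powR|exact: continuous_expN].
  apply: cvgM; first exact: cvg_cst.
  by apply: cvgM; [exact: continuous_powR|exact: continuous_expN].
- apply: pintegrableB => //; apply: pintegrableZ; exact: gamma_integrable.
- rewrite -[X in _ --> X](mulr0 (- a^-1)); apply: cvgZr.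
  have h1 : expR (- (a * t)) @[t --> 0^'+] --> expR (- (a * 0)).
    by apply: cvg_at_right_filter; exact: continuous_expN.
  rewrite -[X in _ --> X](mul0r (expR (- (a * 0)))); exact: (cvgM (powR_cvg0 x0) h1).
- rewrite -[X in _ --> X](mulr0 (- a^-1)); apply: cvgZr.
  by exact: cvgy_powR_exp.
Qed.

Lemma pint_pow_exp (R : realType) (k : nat) (a : R) : 0 < a ->
  pint (fun t => t ^+ k * expR (- (a * t))) = k`!%:R / a ^+ k.+1.
Proof.
move=> a0; elim: k => [|k ih].
  rewrite fact0 expr1 mul1r -pint_exp//; apply: eq_pint => t _.
  by rewrite expr0 mul1r.
transitivity (pint (fun t => t `^ k.+1%:R * expR (- (a * t)))).
  by apply: eq_pint => t t0; rewrite powR_mulrn ?ltW.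
rewrite pint_gammaS//.
have -> : pint (fun t => t `^ (k.+1%:R - 1) * expR (- (a * t))) = k`!%:R / a ^+ k.+1.
  rewrite -ih; apply: eq_pint => t t0; rewrite -powR_mulrn ?ltW//.
  by rewrite -natr1 addrK.
by rewrite factS natrM mulrACA -invfM -exprS.
Qed.

(** The product majorant makes the integrand integrable for the product measure. The two domains are
    folded into it as indicator functions, since Fubini's theorem is applied on the whole product
    space. *)
Lemma fubini_dom (d1 d2 : measure_display) (T1 : measurableType d1)
    (T2 : measurableType d2) (R : realType)
    (m1 : {sigma_finite_measure set T1 -> \bar R})
    (m2 : {sigma_finite_measure set T2 -> \bar R})
    (D1 : set T1) (D2 : set T2) (f : T1 -> T2 -> R) (g : T1 -> R) (h : T2 -> R) :
  measurable D1 -> measurable D2 ->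
  measurable_fun setT (fun p : T1 * T2 => f p.1 p.2) ->
  m1.-integrable D1 (EFin \o g) -> m2.-integrable D2 (EFin \o h) ->
  (forall x y, D1 x -> D2 y -> `|f x y| <= g x * h y) ->
  m1.-integrable D1 (EFin \o (fun x => \int[m2]_(y in D2) f x y)) /\
  \int[m1]_(x in D1) (\int[m2]_(y in D2) f x y) =
  \int[m2]_(y in D2) (\int[m1]_(x in D1) f x y).
Proof.
move=> mD1 mD2 mf ig ih fgh.
pose F (p : T1 * T2) := (f p.1 p.2 * (\1_D1 p.1 * \1_D2 p.2))%:E.
have m1D1 : measurable_fun setT (fun p : T1 * T2 => \1_D1 p.1 : R).
  by apply: measurableT_comp; [exact: measurable_indic|exact: measurable_fst].
have m1D2 : measurable_fun setT (fun p : T1 * T2 => \1_D2 p.2 : R).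
  by apply: measurableT_comp; [exact: measurable_indic|exact: measurable_snd].
have mF : measurable_fun setT F.
  by apply/measurable_EFinP; apply: measurable_funM => //; apply: measurable_funM.
have mg : measurable_fun D1 g by move: ig => /measurable_int/measurable_EFinP.
have mh : measurable_fun D2 h by move: ih => /measurable_int/measurable_EFinP.
pose G x := (`|(g \_ D1) x|)%:E; pose H y := (`|(h \_ D2) y|)%:E.
have mG : measurable_fun setT G.
  apply/measurable_EFinP; apply: measurable_funabs.
  by apply/(measurable_restrict _ mD1 measurableT); rewrite setTI.
have mH : measurable_fun setT H.
  apply/measurable_EFinP; apply: measurable_funabs.
  by apply/(measurable_restrict _ mD2 measurableT); rewrite setTI.
have iG : (\int[m1]_x G x < +oo)%E.
  have /integrableP[_] := ig; rewrite integral_mkcond.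
  apply: le_lt_trans; rewrite le_eqVlt; apply/orP; left; apply/eqP.
  by apply: eq_integral => x _; rewrite /G !patchE; case: ifP => //; rewrite normr0.
have iH : (\int[m2]_x H x < +oo)%E.
  have /integrableP[_] := ih; rewrite integral_mkcond.
  apply: le_lt_trans; rewrite le_eqVlt; apply/orP; left; apply/eqP.
  by apply: eq_integral => x _; rewrite /H !patchE; case: ifP => //; rewrite normr0.
have G0 x : (0 <= G x)%E by rewrite lee_fin.
have H0 y : (0 <= H y)%E by rewrite lee_fin.
have FGH x y : (`|F (x, y)| <= G x * H y)%E.
  (* A patched function takes the value [point] off its domain; in [R] this is 0, so the majorants
     vanish there. *)
  have p0 : (point : R) = 0 by [].
  rewrite /F /G /H -EFinM lee_fin !patchE !indicE /= p0.
  case: ifPn => xD; last by rewrite mul0r mulr0 normr0 mul0r.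
  case: ifPn => yD; last by rewrite !mulr0 normr0 mulr0.
  rewrite !mulr1; move: xD yD; rewrite !inE => xD yD.
  by rewrite (le_trans (fgh _ _ xD yD))// -normrM ler_norm.
have iF : (m1 \x m2)%E.-integrable setT F.
  apply: (@integrable12ltyP _ _ _ _ _ m1 m2 F mF).2.
  apply: (@le_lt_trans _ _ (\int[m1]_x (G x * \int[m2]_y H y))%E).
    apply: ge0_le_integral => //.
    - by move=> x _; apply: integral_ge0.
    - have mF' : measurable_fun setT (abse \o F) by exact: measurableT_comp.
      by apply: (measurable_fun_fubini_tonelli_F (abse \o F)) => //=.
    - by apply: emeasurable_funM.
    - move=> x _; rewrite -ge0_integralZl//.
      apply: ge0_le_integral => //.
      + by apply: measurableT_comp => //; exact: (measurableT_comp mF (measurable_pair1 x)).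
      + by apply: emeasurable_funM.
  rewrite ge0_integralZr//; last exact: integral_ge0.
  by apply: lte_mul_pinfty => //; [exact: integral_ge0|rewrite ge0_fin_numE//; exact: integral_ge0].
have E1 x : D1 x -> (\int[m2]_y F (x, y) = \int[m2]_(y in D2) (f x y)%:E)%E.
  move=> xD; rewrite [RHS]integral_mkcond; apply: eq_integral => y _.
  by rewrite /F /= !indicE mem_set// patchE mul1r; case: ifP => _; rewrite ?mulr1 ?mulr0.
have E2 y : D2 y -> (\int[m1]_x F (x, y) = \int[m1]_(x in D1) (f x y)%:E)%E.
  move=> yD; rewrite [RHS]integral_mkcond; apply: eq_integral => x _.
  by rewrite /F /= !indicE (mem_set yD) patchE mulr1; case: ifP => _; rewrite ?mulr1 ?mulr0.
have Z1 x : ~ D1 x -> (\int[m2]_y F (x, y) = 0)%E.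
  move=> xD; apply: integral0_eq => y _.
  by rewrite /F /= !indicE memNset// mul0r mulr0.
have Z2 y : ~ D2 y -> (\int[m1]_x F (x, y) = 0)%E.
  move=> yD; apply: integral0_eq => x _.
  by rewrite /F /= !indicE (memNset yD) mulr0 mulr0.
have fin1 x : D1 x -> (\int[m2]_y F (x, y))%E \is a fin_num.
  move=> xD; rewrite fin_num_abs.
  have mFx : measurable_fun setT (fun y => F (x, y)).
    exact: (measurableT_comp mF (measurable_pair1 x)).
  apply: le_lt_trans (le_abse_integral _ _ _) _ => //.
  apply: (@le_lt_trans _ _ (\int[m2]_y (G x * H y))%E).
    apply: ge0_le_integral => //; [exact: measurableT_comp|exact: emeasurable_funM].
  by rewrite ge0_integralZl//; apply: lte_mul_pinfty.
have fin2 y : D2 y -> (\int[m1]_x F (x, y))%E \is a fin_num.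
  move=> yD; rewrite fin_num_abs.
  have mFx : measurable_fun setT (fun x => F (x, y)).
    exact: (measurableT_comp mF (measurable_pair2 y)).
  apply: le_lt_trans (le_abse_integral _ _ _) _ => //.
  apply: (@le_lt_trans _ _ (\int[m1]_x (G x * H y))%E).
    apply: ge0_le_integral => //; [exact: measurableT_comp|exact: emeasurable_funM].
  rewrite ge0_integralZr//; rewrite muleC; exact: lte_mul_pinfty.
have S1 : (\int[m1]_(x in D1) (\int[m2]_(y in D2) f x y)%:E = \int[m1 \x m2]_z F z)%E.
  rewrite -integral12_prod_meas1// integral_mkcond; apply: eq_integral => x _.
  rewrite patchE /fubini_F; case: ifPn => xD.
    by move: xD; rewrite inE => xD; rewrite /Rintegral -E1// fineK// fin1.
  by rewrite Z1//; move: xD; rewrite notin_setE.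
have S2 : (\int[m2]_(y in D2) (\int[m1]_(x in D1) f x y)%:E = \int[m1 \x m2]_z F z)%E.
  rewrite -integral21_prod_meas1// integral_mkcond; apply: eq_integral => y _.
  rewrite patchE /fubini_G; case: ifPn => yD.
    by move: yD; rewrite inE => yD; rewrite /Rintegral -E2// fineK// fin2.
  by rewrite Z2//; move: yD; rewrite notin_setE.
split.
- have := @integrableS _ _ _ m1 _ D1 (fubini_F m2 F) measurableT mD1 (@subsetT _ _)
    (integrable_fubini_F iF).
  apply: eq_integrable => // x; rewrite inE => xD /=.
  by rewrite /fubini_F /Rintegral -E1// fineK// fin1.
- by rewrite /Rintegral; congr fine; rewrite [LHS]S1 [RHS]S2.
Qed.

Lemma pint_fubini (R : realType) (f : R -> R -> R) (g h : R -> R) :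
  measurable_fun setT (fun p : R * R => f p.1 p.2) ->
  pintegrable g -> pintegrable h ->
  (forall x y : R, 0 < x -> 0 < y -> `|f x y| <= g x * h y) ->
  pintegrable (fun x => pint (f x)) /\
  pint (fun x => pint (f x)) = pint (fun y => pint (f ^~ y)).
Proof.
move=> mf ig ih fgh.
have fgh' (x y : R) : (`]0, +oo[%classic : set R) x -> (`]0, +oo[%classic : set R) y ->
    `|f x y| <= g x * h y.
  by move=> /in_pos x0 /in_pos y0; exact: fgh.
exact: (@fubini_dom _ _ _ _ R (@lebesgue_measure R) (@lebesgue_measure R) _ _ f g h
  (@mposR R) (@mposR R) mf ig ih fgh').
Qed.

Lemma prob_fubini (d : measure_display) (T : measurableType d) (R : realType)
    (P : probability T R) (f : T -> R -> R) (h : R -> R) :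
  measurable_fun setT (fun p : T * R => f p.1 p.2) ->
  pintegrable h -> (forall x (y : R), 0 < y -> `|f x y| <= h y) ->
  pintegrable (fun y => \int[P]_x (f x y)) /\
  \int[P]_x pint (f x) = pint (fun y => \int[P]_x (f x y)).
Proof.
move=> mf ih fgh.
have fgh' x (y : R) : [set: T] x -> (`]0, +oo[%classic : set R) y ->
    `|f x y| <= cst 1 x * h y.
  by move=> _ /in_pos y0; rewrite mul1r; exact: fgh.
have i1 : P.-integrable setT (EFin \o cst 1) by exact: finite_measure_integrable_cst.
split; last first.
  exact: (@fubini_dom _ _ _ _ R P (@lebesgue_measure R) _ _ f (cst 1) h
    measurableT (@mposR R) mf i1 ih fgh').2.
have mf' : measurable_fun setT (fun p : R * T => f p.2 p.1).
  exact: (measurableT_comp mf (@measurable_swap _ _ (Real_sort__canonical__measurable_structure_Measurable R) T)).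
have fgh2 (y : R) x : (`]0, +oo[%classic : set R) y -> [set: T] x ->
    `|f x y| <= h y * cst 1 x.
  by move=> /in_pos y0 _; rewrite mulr1; exact: fgh.
exact: (@fubini_dom _ _ _ _ R (@lebesgue_measure R) P _ _ (fun y x => f x y) h (cst 1)
    (@mposR R) measurableT mf' ih i1 fgh2).1.
Qed.

(** [c] times the pushforward gives every half-open interval its length, and Lebesgue measure is
    determined by these values. *)
Lemma lebesgue_measureM (R : realType) (c : {posnum R}) (A : set R) : measurable A ->
  pushforward (@lebesgue_measure R) ( *%R c%:num : measurableTypeR R -> measurableTypeR R) A =
  ((c%:num^-1)%:E * lebesgue_measure A)%E.
Proof.
move=> mA.
pose phi : measurableTypeR R -> measurableTypeR R := *%R c%:num.
have mphi : measurable_fun setT phi by exact: mulrl_measurable.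
have c0 : 0 <= c%:num by [].
pose K : {nonneg R} := NngNum c0.
pose nu : {measure set (measurableTypeR R) -> \bar R} :=
  mscale K (measure_function_pushforward__canonical__measure_function_Measure
              (@lebesgue_measure R) mphi).
have <- : nu A = lebesgue_measure A.
  apply/esym; apply: (@lebesgue_measure_unique _ nu) => // X /ocitvP[->|[[a b]/= ab ->]].
    by rewrite !measure0.
  have -> : nu `]a, b]%classic = (c%:num%:E * lebesgue_measure (phi @^-1` `]a, b]))%E by [].
  have -> : phi @^-1` `]a, b]%classic = `](a / c%:num), (b / c%:num)]%classic.
    apply/seteqP; split => x /=; rewrite !in_itv/= /phi ltr_pdivrMr// ler_pdivlMr// mulrC//.
  rewrite !lebesgue_measure_itv/= !lte_fin ab ltr_pM2r ?invr_gt0// ab.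
  by rewrite -!EFinB -EFinM -mulrBl mulrCA mulfV ?mulr1.
by rewrite /nu /mscale/= muleA -EFinM mulVf// mul1e.
Qed.

(** The pushforward under multiplication by [c] settles nonnegative integrands; the signed case is
    the difference of positive and negative parts. *)
Lemma pint_scale (R : realType) (c : R) (f : R -> R) : 0 < c ->
  measurable_fun setT f -> pintegrable f ->
  pintegrable (fun t => f (c * t)) /\ pint (fun t => f (c * t)) = c^-1 * pint f.
Proof.
move=> c0 mf iF.
pose C := PosNum c0.
pose phi : measurableTypeR R -> measurableTypeR R := *%R C%:num.
have mphi : measurable_fun setT phi by exact: mulrl_measurable.
have prephi : phi @^-1` `]0, +oo[%classic = `]0, +oo[%classic.
  by apply/seteqP; split => x /=; rewrite !in_itv/= !andbT /phi pmulr_rgt0.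
have mfE : measurable_fun setT (EFin \o f : measurableTypeR R -> _).
  exact/measurable_EFinP.
have ge0E (g : measurableTypeR R -> \bar R) : measurable_fun setT g -> (forall x, 0 <= g x)%E ->
    (\int[lebesgue_measure]_(x in `]0%R, +oo[) g (c * x)%R =
     (c^-1)%:E * \int[lebesgue_measure]_(x in `]0%R, +oo[) g x)%E.
  move=> mg g0.
  have := @ge0_integral_pushforward _ _ _ _ R phi mphi (@lebesgue_measure R) `]0, +oo[ g
    (@mposR R) (measurable_funTS mg) (fun x _ => g0 x).
  rewrite prephi => <-.
  have ci0 : 0 <= c^-1 by rewrite invr_ge0 ltW.
  pose K : {nonneg R} := NngNum ci0.
  rewrite (eq_measure_integral (mscale K (@lebesgue_measure R))).
    by rewrite ge0_integral_mscale//; exact: measurable_funTS.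
  by move=> A mA _; rewrite [LHS](lebesgue_measureM C mA).
have iF2 : pintegrable (fun t => f (c * t)).
  apply/integrableP; split.
    apply/measurable_EFinP; apply: measurable_funTS.
    exact: (measurableT_comp mf (mulrl_measurable (D := setT) c)).
  have /integrableP[_ h] := iF.
  have := ge0E (abse \o (EFin \o f)) (measurableT_comp (@abse_measurable R setT) mfE) (fun x => abse_ge0 _).
  move=> /= ->; apply: lte_mul_pinfty => //.
    by rewrite lee_fin invr_ge0 ltW.
split => //; rewrite /pint /Rintegral.
have mfp : measurable_fun setT ((EFin \o f)^\+%E : measurableTypeR R -> _).
  exact: measurable_funepos.
have mfn : measurable_fun setT ((EFin \o f)^\-%E : measurableTypeR R -> _).
  exact: measurable_funeneg.
have -> : (\int[lebesgue_measure]_(x in `]0%R, +oo[) (f (c * x))%:E =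
    (c^-1)%:E * \int[lebesgue_measure]_(x in `]0%R, +oo[) (f x)%:E)%E.
  rewrite integralE [in RHS]integralE.
  have e1 := ge0E _ mfp (fun x => funepos_ge0 _ x).
  have e2 := ge0E _ mfn (fun x => funeneg_ge0 _ x).
  rewrite muleBr//; last first.
    apply: fin_num_adde_defr.
    exact: (@integrable_pos_fin_num _ _ _ (@lebesgue_measure R) _ (@mposR R) _ iF).
  rewrite -[X in _ = (X - _)%E]e1 -[X in _ = (_ - X)%E]e2.
  by congr (_ - _)%E; apply: eq_integral => x _; rewrite ?funeposE ?funenegE.
by rewrite fineM//; exact: integrable_fin_num.
Qed.

Lemma pint_derive (R : realType) (f df : R -> R -> R) (a u v : R) (G : R -> R) :
  u < a -> a < v ->
  (forall x, u < x -> x < v -> pintegrable (f x)) ->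
  (forall x y : R, u < x -> x < v -> 0 < y -> is_derive x 1 (f ^~ y) (df x y)) ->
  pintegrable G ->
  (forall x y : R, u < x -> x < v -> 0 < y -> `|df x y| <= G y) ->
  is_derive a 1 (fun x => pint (f x)) (pint (df a)).
Proof.
move=> ua av intf dfE iG Gub.
have Ia : (`]u, v[%classic : set R) a by rewrite /= in_itv/= ua av.
have intf' x : (`]u, v[%classic : set R) x ->
    (@lebesgue_measure R).-integrable `]0, +oo[ (EFin \o f x).
  by rewrite /= in_itv/= => /andP[? ?]; exact: intf.
have der x y : (`]u, v[%classic : set R) x -> (`]0, +oo[%classic : set R) y ->
    derivable (f ^~ y) x 1.
  by rewrite /= in_itv/= => /andP[h1 h2] /in_pos y0; have [] := dfE _ _ h1 h2 y0.
have derE x y : u < x -> x < v -> 0 < y -> partial1of2 f x y = df x y.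
  by move=> h1 h2 y0; rewrite partial1of2E; have [_ ->] := dfE _ _ h1 h2 y0.
have iG' : (@lebesgue_measure R).-integrable `]0, +oo[ (EFin \o (fun y => `|G y|)).
  exact: integrable_norm.
have ub x y : (`]u, v[%classic : set R) x -> (`]0, +oo[%classic : set R) y ->
    `|partial1of2 f x y| <= `|G y|.
  rewrite /= in_itv/= => /andP[h1 h2] /in_pos y0.
  by rewrite derE// (le_trans (Gub _ _ h1 h2 y0))// ler_norm.
have h1 := @derivable_under_integral R _ _ (@lebesgue_measure R) f _ (@mposR R) a u v Ia
  intf' der _ (fun y => normr_ge0 (G y)) iG' ub.
have h2 := @differentiation_under_integral R _ _ (@lebesgue_measure R) f _ (@mposR R) a u v Ia
  intf' der _ (fun y => normr_ge0 (G y)) iG' ub.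
apply: (DeriveDef h1); rewrite -derive1E [LHS]h2.
by apply: eq_Rintegral => y; rewrite inE => /in_pos y0; exact: derE.
Qed.

Lemma is_derive_div (R : realType) (f g : R -> R) (x df dg : R) :
  is_derive x 1 f df -> is_derive x 1 g dg -> g x != 0 ->
  is_derive x 1 (fun z => f z / g z) ((df * g x - f x * dg) / (g x) ^+ 2).
Proof.
move=> hf hg gx.
have hV : is_derive x 1 (fun z => (g z)^-1) (- (g x) ^- 2 *: dg) by exact: is_deriveV.
apply: is_derive_eq.
rewrite /GRing.scale/=; set a := g x in gx *; set b := f x; field.
exact: gx.
Qed.

Lemma continuous_div (R : realType) (f g : R -> R) (x : R) : g x != 0 ->
  {for x, continuous f} -> {for x, continuous g} ->
  {for x, continuous (fun z => f z / g z)}.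
Proof. by move=> gx hf hg; apply: cvgM => //; exact: cvgV. Qed.

(** Integrand of the Mellin transform of 1 / (1 + z^al) at [w]; all later closed forms reduce to its
    integral. *)
Definition mell (R : realType) (w al z : R) : R := z `^ (w - 1) / (1 + z `^ al).

Lemma mell_ge0 (R : realType) (w al z : R) : 0 <= mell w al z.
Proof. by rewrite /mell divr_ge0 ?powR_ge0// addr_ge0// powR_ge0. Qed.

Lemma mell_integrable (R : realType) (w al : R) : 0 < w -> w < al -> pintegrable (mell w al).
Proof.
move=> w0 wal; pose s := Num.min w (al - w).
have s0 : 0 < s by rewrite lt_min w0 subr_gt0.
apply: (@pintegrable_dom2 _ s 1) => //; first by rewrite /mell; meas.
  move=> z z0 z1; rewrite ger0_norm ?mell_ge0// mul1r.
  apply: (@le_trans _ _ (z `^ (w - 1))).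
    by rewrite ler_pdivrMr ?ltr_pwDl ?powR_ge0// ler_peMr ?powR_ge0// lerDl powR_ge0.
  by apply: ger_powR; [rewrite z0 z1|rewrite lerB// ge_min lexx].
move=> z z1; have z0 : 0 < z by exact: lt_le_trans z1.
rewrite ger0_norm ?mell_ge0// mul1r.
apply: (@le_trans _ _ (z `^ (w - 1 - al))).
  rewrite powRB ?(gt_eqF z0) ?implybT//; apply: ler_wpM2l; first exact: powR_ge0.
  by rewrite lef_pV2 ?posrE ?powR_gt0 ?ltr_pwDl ?powR_ge0// lerDr.
apply: ler_powR => //; have : s <= al - w by rewrite ge_min lexx orbT.
lra.
Qed.

Lemma pintegrable_mell (R : realType) (w al C : R) (f : R -> R) : 0 < w -> w < al ->
  measurable_fun (`]0, +oo[ : set R) f ->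
  (forall z : R, 0 < z -> `|f z| <= C * mell w al z) -> pintegrable f.
Proof.
move=> w0 wal mf h; apply: (pintegrable_dom mf h).
by apply: pintegrableZ; exact: mell_integrable.
Qed.

(** * Mellin transforms and the integral J *)

Lemma is_derive_conv (R : realType) (f : R -> R) (x d d' : R) :
  is_derive x 1 f d -> d = d' -> is_derive x 1 f d'.
Proof. by move=> h <-. Qed.

Lemma continuous_comp1 (R : realType) (f g : R -> R) (x : R) :
  {for x, continuous f} -> {for f x, continuous g} -> {for x, continuous (fun z => g (f z))}.
Proof. by move=> hf hg; exact: continuous_comp hf hg. Qed.

Lemma continuous_powR_comp (R : realType) (f : R -> R) (p x : R) :
  {for x, continuous f} -> 0 < f x -> {for x, continuous (fun z => f z `^ p)}.
Proof.
move=> hf fx; refine (@continuous_comp1 R f (@powR R ^~ p) x hf _).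
exact: continuous_powR.
Qed.

(** [den th y] is |1 + y e^(i th)|^2, and 1 / (1 + y e^(i th)) has real part [kerC th y] and
    imaginary part [- kerS th y]. *)
Definition den (R : realType) (th y : R) : R := 1 + 2 * y * cos th + y ^+ 2.

Definition kerC (R : realType) (th y : R) : R := (1 + y * cos th) / den th y.

Definition kerS (R : realType) (th y : R) : R := y * sin th / den th y.

Lemma den_ge (R : realType) (th y : R) : 0 <= cos th -> 0 <= y -> 1 + y ^+ 2 <= den th y.
Proof. by move=> c0 y0; rewrite /den addrAC lerDl !mulr_ge0. Qed.

Lemma den_gt0 (R : realType) (th y : R) : 0 <= cos th -> 0 <= y -> 0 < den th y.
Proof.
by move=> c0 y0; apply: lt_le_trans (den_ge c0 y0); rewrite ltr_pwDl// sqr_ge0.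
Qed.

Lemma kerC_le (R : realType) (th y : R) : 0 <= cos th -> 0 <= y ->
  `|kerC th y| <= 2 / (1 + y).
Proof.
move=> c0 y0; have d0 := den_gt0 c0 y0; have d1 := den_ge c0 y0.
have c1 := cos_le1 th.
rewrite /kerC normrM normfV (gtr0_norm d0) ger0_norm ?addr_ge0 ?mulr_ge0//.
rewrite ler_pdivrMr// mulrAC ler_pdivlMr ?ltr_pwDl//.
have h : y * cos th <= y by rewrite ler_piMr.
apply: (@le_trans _ _ ((1 + y) * (1 + y))).
  by apply: ler_wpM2r; rewrite ?addr_ge0// lerD2l.
have q := sqr_ge0 (1 - y); lra.
Qed.

Lemma kerS_le (R : realType) (th y : R) : 0 <= cos th -> 0 <= y ->
  `|kerS th y| <= 2 / (1 + y).
Proof.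
move=> c0 y0; have d0 := den_gt0 c0 y0; have d1 := den_ge c0 y0.
have s1 : `|sin th| <= 1 by rewrite ler_norml sin_geN1 sin_le1.
rewrite /kerS !normrM normfV (gtr0_norm d0) (ger0_norm y0).
rewrite ler_pdivrMr// mulrAC ler_pdivlMr ?ltr_pwDl//.
have h : y * `|sin th| <= y by rewrite ler_piMr.
apply: (@le_trans _ _ (y * (1 + y))).
  by apply: ler_wpM2r; rewrite ?addr_ge0.
have q := sqr_ge0 (1 - y); lra.
Qed.

(** The kernels depend on y e^(i th) alone, so by the Cauchy-Riemann relation the angular derivative
    of one is, up to sign, y d/dy of the other. Hence [kerC'] and [kerS'] occur both in the
    derivatives in [th] and in those in [z]. *)
Definition kerC' (R : realType) (th y : R) : R := y * sin th * (1 - y ^+ 2) / den th y ^+ 2.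

Definition kerS' (R : realType) (th y : R) : R :=
  y * (cos th * (1 + y ^+ 2) + 2 * y) / den th y ^+ 2.

Lemma is_derive_kerC_th (R : realType) (th y : R) : den th y != 0 ->
  is_derive th 1 (fun t => kerC t y) (kerC' th y).
Proof.
move=> d0.
have h1 : is_derive th 1 (fun t => 1 + y * cos t) (- y * sin th).
  by apply: is_derive_eq; rewrite /GRing.scale/=; ring.
have h2 : is_derive th 1 (fun t => den t y) (- 2 * y * sin th).
  by rewrite /den; apply: is_derive_eq; rewrite /GRing.scale/=; ring.
rewrite /kerC; apply: (is_derive_conv (is_derive_div h1 h2 d0)).
by rewrite /kerC'; congr (_ / _); rewrite /den; ring.
Qed.

Lemma cos2_sin2 (R : realType) (x : R) : cos x ^+ 2 = 1 - sin x ^+ 2.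
Proof. by rewrite -(cos2Dsin2 x) addrK. Qed.

Lemma is_derive_kerS_th (R : realType) (th y : R) : den th y != 0 ->
  is_derive th 1 (fun t => kerS t y) (kerS' th y).
Proof.
move=> d0.
have h1 : is_derive th 1 (fun t => y * sin t) (y * cos th).
  by apply: is_derive_eq; rewrite /GRing.scale/=; ring.
have h2 : is_derive th 1 (fun t => den t y) (- 2 * y * sin th).
  by rewrite /den; apply: is_derive_eq; rewrite /GRing.scale/=; ring.
rewrite /kerS; apply: (is_derive_conv (is_derive_div h1 h2 d0)).
rewrite /kerS'; congr (_ / _); rewrite /den.
have := cos2_sin2 th; set c := cos th; set s := sin th => h.
transitivity (y * (c * (1 + y ^+ 2)) + 2 * y ^+ 2 * (c ^+ 2 + s ^+ 2)); first by ring.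
by rewrite h; ring.
Qed.

Lemma is_derive_kerC_z (R : realType) (th al z : R) : 0 < z -> den th (z `^ al) != 0 ->
  is_derive z 1 (fun z => kerC th (z `^ al)) (- (al / z) * kerS' th (z `^ al)).
Proof.
move=> z0 d0; have hp := is_derive_powR al z0.
have h1 : is_derive z 1 (fun z => 1 + z `^ al * cos th) (al * z `^ (al - 1) * cos th).
  by apply: is_derive_eq; rewrite /GRing.scale/=; ring.
have h2 : is_derive z 1 (fun z => den th (z `^ al))
    (al * z `^ (al - 1) * (2 * cos th + 2 * z `^ al)).
  by rewrite /den; apply: is_derive_eq; rewrite /GRing.scale/=; ring.
rewrite /kerC; apply: (is_derive_conv (is_derive_div h1 h2 d0)).
have -> : z `^ (al - 1) = z `^ al / z.
  by rewrite powRB ?powRr1 ?(gt_eqF z0) ?implybT// ltW.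
rewrite /kerS'; set y := z `^ al; rewrite -/y in d0.
rewrite [RHS]mulrA; congr (_ / _); rewrite /den; field.
by rewrite gt_eqF.
Qed.

Lemma is_derive_kerS_z (R : realType) (th al z : R) : 0 < z -> den th (z `^ al) != 0 ->
  is_derive z 1 (fun z => kerS th (z `^ al)) (al / z * kerC' th (z `^ al)).
Proof.
move=> z0 d0; have hp := is_derive_powR al z0.
have h1 : is_derive z 1 (fun z => z `^ al * sin th) (al * z `^ (al - 1) * sin th).
  by apply: is_derive_eq; rewrite /GRing.scale/=; ring.
have h2 : is_derive z 1 (fun z => den th (z `^ al))
    (al * z `^ (al - 1) * (2 * cos th + 2 * z `^ al)).
  by rewrite /den; apply: is_derive_eq; rewrite /GRing.scale/=; ring.
rewrite /kerS; apply: (is_derive_conv (is_derive_div h1 h2 d0)).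
have -> : z `^ (al - 1) = z `^ al / z.
  by rewrite powRB ?powRr1 ?(gt_eqF z0) ?implybT// ltW.
rewrite /kerC'; set y := z `^ al; rewrite -/y in d0.
rewrite [RHS]mulrA; congr (_ / _); rewrite /den; field.
by rewrite gt_eqF.
Qed.

Lemma continuous_kerC_z (R : realType) (th al z : R) : 0 < z -> 0 <= cos th ->
  {for z, continuous (fun z => kerC th (z `^ al))}.
Proof.
move=> z0 c0; apply: is_derive_continuous (is_derive_kerC_z _ _) => //.
by rewrite gt_eqF// den_gt0// powR_ge0.
Qed.

Lemma continuous_kerS_z (R : realType) (th al z : R) : 0 < z -> 0 <= cos th ->
  {for z, continuous (fun z => kerS th (z `^ al))}.
Proof.
move=> z0 c0; apply: is_derive_continuous (is_derive_kerS_z _ _) => //.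
by rewrite gt_eqF// den_gt0// powR_ge0.
Qed.

Lemma kerC'_le (R : realType) (th y : R) : 0 <= cos th -> 0 <= y ->
  `|kerC' th y| <= 4 / (1 + y).
Proof.
move=> c0 y0; have d0 := den_gt0 c0 y0; have d1 := den_ge c0 y0.
have s1 : `|sin th| <= 1 by rewrite ler_norml sin_geN1 sin_le1.
rewrite /kerC' !normrM normfV (gtr0_norm (exprn_gt0 _ d0)) (ger0_norm y0).
rewrite ler_pdivrMr ?exprn_gt0// [leRHS]mulrAC ler_pdivlMr ?ltr_pwDl//.
have h1 : `|1 - y ^+ 2| <= 1 + y ^+ 2.
  by apply: le_trans (ler_normB _ _) _; rewrite normr1 ger0_norm ?sqr_ge0.
have h2 : y * `|sin th| <= y by rewrite ler_piMr.
apply: (@le_trans _ _ (y * (1 + y ^+ 2) * (1 + y))).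
  by apply: ler_wpM2r; rewrite ?addr_ge0// ler_pM ?mulr_ge0.
apply: (@le_trans _ _ (4 * (1 + y ^+ 2) ^+ 2)); last first.
  have e0 : 0 <= 1 + y ^+ 2 by rewrite addr_ge0 ?sqr_ge0.
  by rewrite ler_pM2l// ler_pXn2r// nnegrE// ltW.
rewrite expr2 mulrAC mulrA; apply: ler_wpM2r; first by rewrite addr_ge0 ?sqr_ge0.
nra.
Qed.

Lemma kerS'_le (R : realType) (th y : R) : 0 <= cos th -> 0 <= y ->
  `|kerS' th y| <= 4 / (1 + y).
Proof.
move=> c0 y0; have d0 := den_gt0 c0 y0; have d1 := den_ge c0 y0.
have c1 := cos_le1 th.
rewrite /kerS' !normrM normfV (gtr0_norm (exprn_gt0 _ d0)) (ger0_norm y0).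
rewrite ler_pdivrMr ?exprn_gt0// [leRHS]mulrAC ler_pdivlMr ?ltr_pwDl//.
rewrite ger0_norm ?addr_ge0 ?mulr_ge0 ?addr_ge0 ?sqr_ge0//.
have h1 : cos th * (1 + y ^+ 2) + 2 * y <= 2 * (1 + y ^+ 2).
  have : cos th * (1 + y ^+ 2) <= 1 + y ^+ 2 by rewrite ler_piMl// addr_ge0 ?sqr_ge0.
  have q := sqr_ge0 (1 - y); lra.
apply: (@le_trans _ _ (y * (2 * (1 + y ^+ 2)) * (1 + y))).
  by apply: ler_wpM2r; rewrite ?addr_ge0// ler_wpM2l.
apply: (@le_trans _ _ (4 * (1 + y ^+ 2) ^+ 2)); last first.
  have e0 : 0 <= 1 + y ^+ 2 by rewrite addr_ge0 ?sqr_ge0.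
  by rewrite ler_pM2l// ler_pXn2r// nnegrE// ltW.
have -> : y * (2 * (1 + y ^+ 2)) * (1 + y) = (2 * y * (1 + y)) * (1 + y ^+ 2) by ring.
have -> : 4 * (1 + y ^+ 2) ^+ 2 = (4 * (1 + y ^+ 2)) * (1 + y ^+ 2) by ring.
apply: ler_wpM2r; first by rewrite addr_ge0 ?sqr_ge0.
nra.
Qed.

Definition MC (R : realType) (w al th : R) : R := pint (fun z => z `^ (w - 1) * kerC th (z `^ al)).

Definition MS (R : realType) (w al th : R) : R := pint (fun z => z `^ (w - 1) * kerS th (z `^ al)).

Lemma mell_bound (R : realType) (w al th C : R) (k : R -> R -> R) (z : R) :
  (forall y, 0 <= y -> `|k th y| <= C / (1 + y)) -> 0 < z ->
  `|z `^ (w - 1) * k th (z `^ al)| <= C * mell w al z.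
Proof.
move=> h z0; rewrite normrM ger0_norm ?powR_ge0// /mell mulrCA.
by apply: ler_wpM2l; [exact: powR_ge0|exact/h/powR_ge0].
Qed.

Lemma MC_integrable (R : realType) (w al th : R) : 0 <= cos th -> 0 < w -> w < al ->
  pintegrable (fun z => z `^ (w - 1) * kerC th (z `^ al)).
Proof.
move=> c0 w0 wal; apply: (pintegrable_mell (C := 2) w0 wal).
  by rewrite /kerC /den; meas.
by move=> z z0; apply: mell_bound => // y; exact: kerC_le.
Qed.

Lemma MS_integrable (R : realType) (w al th : R) : 0 <= cos th -> 0 < w -> w < al ->
  pintegrable (fun z => z `^ (w - 1) * kerS th (z `^ al)).
Proof.
move=> c0 w0 wal; apply: (pintegrable_mell (C := 2) w0 wal).
  by rewrite /kerS /den; meas.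
by move=> z z0; apply: mell_bound => // y; exact: kerS_le.
Qed.

Lemma MC'_integrable (R : realType) (w al th : R) : 0 <= cos th -> 0 < w -> w < al ->
  pintegrable (fun z => z `^ (w - 1) * kerC' th (z `^ al)).
Proof.
move=> c0 w0 wal; apply: (pintegrable_mell (C := 4) w0 wal).
  by rewrite /kerC' /den; meas.
by move=> z z0; apply: mell_bound => // y; exact: kerC'_le.
Qed.

Lemma MS'_integrable (R : realType) (w al th : R) : 0 <= cos th -> 0 < w -> w < al ->
  pintegrable (fun z => z `^ (w - 1) * kerS' th (z `^ al)).
Proof.
move=> c0 w0 wal; apply: (pintegrable_mell (C := 4) w0 wal).
  by rewrite /kerS' /den; meas.
by move=> z z0; apply: mell_bound => // y; exact: kerS'_le.
Qed.

Lemma mell_lim (R : realType) (w al C : R) (H : R -> R) : 0 < w -> w < al ->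
  (forall z : R, 0 < z -> `|H z| <= C * (z `^ w / (1 + z `^ al))) ->
  H z @[z --> 0^'+] --> 0 /\ H z @[z --> +oo] --> 0.
Proof.
move=> w0 wal hH.
have C0 : 0 <= C.
  have := le_trans (normr_ge0 _) (hH 1 ltr01).
  by rewrite !powR1 => h; rewrite -(@pmulr_lge0 _ (1 / (1 + 1)))//; apply: divr_gt0.
split; apply: norm_cvg0.
- apply: (@squeeze_cvgr _ _ _ _ (cst 0) (fun z => C * z `^ w)).
  + near=> z; have z0 : 0 < z by near: z; exact: nbhs_right_gt.
    rewrite normr_ge0/= (le_trans (hH z z0))// ler_wpM2l//.
    by rewrite ler_pdivrMr ?ltr_pwDl ?powR_ge0// ler_peMr ?powR_ge0// lerDl powR_ge0.
  + exact: cvg_cst.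
  + by rewrite -[X in _ --> X](mulr0 C); apply: cvgZr; exact: powR_cvg0.
- apply: (@squeeze_cvgr _ _ _ _ (cst 0) (fun z => C * (z `^ (al - w))^-1)).
  + near=> z; have z0 : 0 < z by near: z; exact: nbhs_pinfty_gt.
    rewrite normr_ge0/= (le_trans (hH z z0))// ler_wpM2l//.
    rewrite powRB ?(gt_eqF z0) ?implybT// invfM invrK mulrC.
    apply: ler_wpM2r; first exact: powR_ge0.
    by rewrite lef_pV2 ?posrE ?powR_gt0 ?ltr_pwDl ?powR_ge0// lerDr.
  + exact: cvg_cst.
  + rewrite -[X in _ --> X](mulr0 C); apply: cvgZr.
    have h := @cvgy_powR R (al - w); apply/(gtr0_cvgV0 _).2.
      by near=> z; apply: powR_gt0; near: z; exact: nbhs_pinfty_gt.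
    by apply: h; rewrite subr_gt0.
Unshelve. all: by end_near. Qed.

Lemma continuous_den (R : realType) (th y : R) : {for y, continuous (den th)}.
Proof.
apply: cvgD; last exact: exprn_continuous.
apply: cvgD; first exact: cvg_cst.
apply: cvgM; last exact: cvg_cst.
by apply: cvgM; [exact: cvg_cst|exact: cvg_id].
Qed.

Lemma continuous_kerC' (R : realType) (th y : R) : den th y != 0 -> {for y, continuous (kerC' th)}.
Proof.
move=> d0; apply: (@continuous_div R (fun y => y * sin th * (1 - y ^+ 2)) (fun y => den th y ^+ 2)).
- by rewrite expf_neq0.
- apply: cvgM; first by apply: cvgM; [exact: cvg_id|exact: cvg_cst].
  by apply: cvgB; [exact: cvg_cst|exact: exprn_continuous].
- by apply: cvgM; exact: continuous_den.
Qed.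

Lemma continuous_kerS' (R : realType) (th y : R) : den th y != 0 -> {for y, continuous (kerS' th)}.
Proof.
move=> d0; apply: (@continuous_div R (fun y => y * (cos th * (1 + y ^+ 2) + 2 * y)) (fun y => den th y ^+ 2)).
- by rewrite expf_neq0.
- apply: cvgM; first exact: cvg_id.
  apply: cvgD; last by apply: cvgM; [exact: cvg_cst|exact: cvg_id].
  apply: cvgM; first exact: cvg_cst.
  by apply: cvgD; [exact: cvg_cst|exact: exprn_continuous].
- by apply: cvgM; exact: continuous_den.
Qed.

(** Integration by parts with the boundary term z^w [kerC], which vanishes at both ends. It turns
    the angular derivative of [MS] into a multiple of [MC]; together with its companion below it
    makes the pair ([MC], [MS]) rotate as [th] varies. *)
Lemma MC_deriv_identity (R : realType) (w al th : R) : 0 <= cos th -> 0 < w -> w < al ->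
  w * MC w al th = al * pint (fun z => z `^ (w - 1) * kerS' th (z `^ al)).
Proof.
move=> c0 w0 wal.
have i1 := MC_integrable c0 w0 wal; have i2 := MS'_integrable c0 w0 wal.
have dn (z : R) : den th (z `^ al) != 0 by rewrite gt_eqF// den_gt0// powR_ge0.
rewrite /MC -!pintZ//; apply/eqP; rewrite -subr_eq0 -pintB; [|exact: pintegrableZ..].
apply/eqP; rewrite -[RHS](subrr 0).
have [l0 l1] : z `^ w * kerC th (z `^ al) @[z --> 0^'+] --> 0 /\
    z `^ w * kerC th (z `^ al) @[z --> +oo] --> 0.
  apply: (@mell_lim _ w al 2 (fun z => z `^ w * kerC th (z `^ al)) w0 wal) => z z0.
  rewrite normrM ger0_norm ?powR_ge0// mulrCA.
  by apply: ler_wpM2l; [exact: powR_ge0|exact/kerC_le/powR_ge0].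
refine (@pint_ftc R (fun z => z `^ w * kerC th (z `^ al))
  (fun z => w * (z `^ (w - 1) * kerC th (z `^ al)) - al * (z `^ (w - 1) * kerS' th (z `^ al)))
  0 0 _ _ _ l0 l1).
- move=> z z0; have h1 := is_derive_powR w z0; have h2 := is_derive_kerC_z z0 (dn z).
  apply: is_derive_eq; rewrite /GRing.scale/=.
  have -> : z `^ (w - 1) = z `^ w / z.
    by rewrite powRB ?powRr1 ?(gt_eqF z0) ?implybT// ltW.
  set k := kerC _ _; set k' := kerS' _ _; set u := z `^ w; field.
  by rewrite gt_eqF.
- move=> z z0.
  have ck : {for z, continuous (fun z => kerS' th (z `^ al))}.
    by apply: continuous_comp; [exact: continuous_powR|exact: continuous_kerS' (dn z)].
  have hp := @continuous_powR R (w - 1) z z0.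
  apply: cvgB; apply: cvgM; [exact: cvg_cst| |exact: cvg_cst|]; apply: cvgM => //.
    exact: continuous_kerC_z.
- by apply: pintegrableB; exact: pintegrableZ.
Qed.

Lemma MS_deriv_identity (R : realType) (w al th : R) : 0 <= cos th -> 0 < w -> w < al ->
  w * MS w al th = - al * pint (fun z => z `^ (w - 1) * kerC' th (z `^ al)).
Proof.
move=> c0 w0 wal.
have i1 := MS_integrable c0 w0 wal; have i2 := MC'_integrable c0 w0 wal.
have dn (z : R) : den th (z `^ al) != 0 by rewrite gt_eqF// den_gt0// powR_ge0.
rewrite /MS -!pintZ//; apply/eqP; rewrite -subr_eq0 -pintB; [|exact: pintegrableZ..].
apply/eqP; rewrite -[RHS](subrr 0).
have [l0 l1] : z `^ w * kerS th (z `^ al) @[z --> 0^'+] --> 0 /\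
    z `^ w * kerS th (z `^ al) @[z --> +oo] --> 0.
  apply: (@mell_lim _ w al 2 (fun z => z `^ w * kerS th (z `^ al)) w0 wal) => z z0.
  rewrite normrM ger0_norm ?powR_ge0// mulrCA.
  by apply: ler_wpM2l; [exact: powR_ge0|exact/kerS_le/powR_ge0].
refine (@pint_ftc R (fun z => z `^ w * kerS th (z `^ al))
  (fun z => w * (z `^ (w - 1) * kerS th (z `^ al)) - - al * (z `^ (w - 1) * kerC' th (z `^ al)))
  0 0 _ _ _ l0 l1).
- move=> z z0; have h1 := is_derive_powR w z0; have h2 := is_derive_kerS_z z0 (dn z).
  apply: is_derive_eq; rewrite /GRing.scale/=.
  have -> : z `^ (w - 1) = z `^ w / z.
    by rewrite powRB ?powRr1 ?(gt_eqF z0) ?implybT// ltW.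
  set k := kerS _ _; set k' := kerC' _ _; set u := z `^ w; field.
  by rewrite gt_eqF.
- move=> z z0.
  have ck : {for z, continuous (fun z => kerC' th (z `^ al))}.
    by apply: continuous_comp; [exact: continuous_powR|exact: continuous_kerC' (dn z)].
  have hp := @continuous_powR R (w - 1) z z0.
  apply: cvgB; apply: cvgM; [exact: cvg_cst| |exact: cvg_cst|]; apply: cvgM => //.
    exact: continuous_kerS_z.
- by apply: pintegrableB; exact: pintegrableZ.
Qed.

Lemma is_derive_MC (R : realType) (w al th : R) : - (pi / 2) < th -> th < pi / 2 ->
  0 < w -> w < al -> is_derive th 1 (MC w al) (- (w / al) * MS w al th).
Proof.
move=> t0 t1 w0 wal; have al0 : 0 < al by exact: lt_trans wal.
have cpos (x : R) : - (pi / 2) < x -> x < pi / 2 -> 0 <= cos x.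
  by move=> h1 h2; apply: cos_ge0_pihalf; rewrite !ltW.
have -> : - (w / al) * MS w al th = pint (fun z => z `^ (w - 1) * kerC' th (z `^ al)).
  rewrite mulNr mulrAC MS_deriv_identity//; last exact: cpos.
  by field; rewrite gt_eqF.
refine (@pint_derive R (fun t z => z `^ (w - 1) * kerC t (z `^ al))
  (fun t z => z `^ (w - 1) * kerC' t (z `^ al)) th (- (pi / 2)) (pi / 2)
  (fun z => 4 * mell w al z) t0 t1 _ _ _ _).
- by move=> x h1 h2; apply: MC_integrable => //; exact: cpos.
- move=> x z h1 h2 z0; have h := @is_derive_kerC_th R x (z `^ al).
  have dn : den x (z `^ al) != 0 by rewrite gt_eqF// den_gt0 ?powR_ge0// cpos.
  have {}h := h dn; apply: is_derive_eq; rewrite /GRing.scale/=; exact: erefl.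
- by apply: pintegrableZ; exact: mell_integrable.
- move=> x z h1 h2 z0; apply: mell_bound => // y; apply: kerC'_le; exact: cpos.
Qed.

Lemma is_derive_MS (R : realType) (w al th : R) : - (pi / 2) < th -> th < pi / 2 ->
  0 < w -> w < al -> is_derive th 1 (MS w al) (w / al * MC w al th).
Proof.
move=> t0 t1 w0 wal; have al0 : 0 < al by exact: lt_trans wal.
have cpos (x : R) : - (pi / 2) < x -> x < pi / 2 -> 0 <= cos x.
  by move=> h1 h2; apply: cos_ge0_pihalf; rewrite !ltW.
have -> : w / al * MC w al th = pint (fun z => z `^ (w - 1) * kerS' th (z `^ al)).
  rewrite mulrAC MC_deriv_identity//; last exact: cpos.
  by field; rewrite gt_eqF.
refine (@pint_derive R (fun t z => z `^ (w - 1) * kerS t (z `^ al))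
  (fun t z => z `^ (w - 1) * kerS' t (z `^ al)) th (- (pi / 2)) (pi / 2)
  (fun z => 4 * mell w al z) t0 t1 _ _ _ _).
- by move=> x h1 h2; apply: MS_integrable => //; exact: cpos.
- move=> x z h1 h2 z0; have h := @is_derive_kerS_th R x (z `^ al).
  have dn : den x (z `^ al) != 0 by rewrite gt_eqF// den_gt0 ?powR_ge0// cpos.
  have {}h := h dn; apply: is_derive_eq; rewrite /GRing.scale/=; exact: erefl.
- by apply: pintegrableZ; exact: mell_integrable.
- move=> x z h1 h2 z0; apply: mell_bound => // y; apply: kerS'_le; exact: cpos.
Qed.

Lemma derive0_eq (R : realType) (f : R -> R) (a b x y : R) :
  (forall t, a < t -> t < b -> is_derive t 1 f 0) ->
  a < x -> x < b -> a < y -> y < b -> f x = f y.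
Proof.
move=> df; wlog xy : x y / x < y.
  move=> h ax xb ay yb; have [xy|xy|->//] := ltgtP x y; first exact: h.
  by apply/esym; exact: h.
move=> ax xb ay yb.
have [||c _] := @MVT R f (fun=> 0) x y xy.
- move=> t; rewrite in_itv/= => /andP[xt ty].
  by apply: df; [exact: lt_trans ax xt|exact: lt_trans ty yb].
- apply: continuous_in_subspaceT => t; rewrite inE/= in_itv/= => /andP[xt ty].
  apply: is_derive_continuous (df t _ _); [exact: lt_le_trans ax xt|exact: le_lt_trans ty yb].
by rewrite mul0r => /eqP; rewrite subr_eq0 => /eqP.
Qed.

Lemma kerC0 (R : realType) (y : R) : 0 <= y -> kerC 0 y = (1 + y)^-1.
Proof. by move=> y0; rewrite /kerC /den cos0; field; rewrite !gt_eqF//; nra. Qed.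

Lemma kerS0 (R : realType) (y : R) : kerS 0 y = 0.
Proof. by rewrite /kerS sin0 mulr0 mul0r. Qed.

Lemma pihalf_gt0 (R : realType) : 0 < pi / 2 :> R.
Proof. by rewrite divr_gt0// pi_gt0. Qed.

(** [X] and [Y] are the pair ([MC], [MS]) rotated back by the angle [u * th]. Their derivatives
    vanish, so they keep the values they have at [th = 0], where [kerC] is 1 / (1 + y) and [kerS] is
    0. This replaces the rotation of a contour. *)
Lemma MC_MS_open (R : realType) (w al th : R) : - (pi / 2) < th -> th < pi / 2 ->
  0 < w -> w < al ->
  MC w al th = pint (mell w al) * cos (w / al * th) /\
  MS w al th = pint (mell w al) * sin (w / al * th).
Proof.
move=> t0 t1 w0 wal; have p0 := pihalf_gt0 R.
pose u := w / al.
pose X t := MC w al t * cos (u * t) + MS w al t * sin (u * t).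
pose Y t := MS w al t * cos (u * t) - MC w al t * sin (u * t).
have dX t : - (pi / 2) < t -> t < pi / 2 -> is_derive t 1 X 0.
  move=> h0 h1; have d1 := is_derive_MC h0 h1 w0 wal; have d2 := is_derive_MS h0 h1 w0 wal.
  apply: is_derive_eq; rewrite /GRing.scale/= -/u; ring.
have dY t : - (pi / 2) < t -> t < pi / 2 -> is_derive t 1 Y 0.
  move=> h0 h1; have d1 := is_derive_MC h0 h1 w0 wal; have d2 := is_derive_MS h0 h1 w0 wal.
  apply: is_derive_eq; rewrite /GRing.scale/= -/u; ring.
have n0 : - (pi / 2) < 0 :> R by rewrite oppr_lt0.
have eX := derive0_eq dX t0 t1 n0 p0; have eY := derive0_eq dY t0 t1 n0 p0.
have C0 : MC w al 0 = pint (mell w al).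
  by apply: eq_pint => z z0; rewrite kerC0// powR_ge0.
have S0 : MS w al 0 = 0.
  transitivity (pint (fun _ : R => 0)); last exact: pint0.
  by apply: eq_pint => z z0; rewrite kerS0 mulr0.
rewrite {2}/X C0 S0 mulr0 cos0 sin0 mulr1 mulr0 addr0 in eX.
rewrite {2}/Y C0 S0 mulr0 cos0 sin0 mulr0 mul0r subrr in eY.
have h := cos2Dsin2 (u * th).
split.
  rewrite -/u -eX -[LHS]mulr1 -h /X.
  move: eY; rewrite /Y; set c := cos _; set s := sin _; set C := MC _ _ _; set S := MS _ _ _.
  move=> eY; transitivity ((C * c + S * s) * c - s * (S * c - C * s)); first by ring.
  by rewrite eY mulr0 subr0.
rewrite -/u -eX -[LHS]mulr1 -h /X.
move: eY; rewrite /Y; set c := cos _; set s := sin _; set C := MC _ _ _; set S := MS _ _ _.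
move=> eY; transitivity ((C * c + S * s) * s + c * (S * c - C * s)); first by ring.
by rewrite eY mulr0 addr0.
Qed.

(** At the angle pi / 2 the cosine kernel is 1 / (1 + y^2), that is, the integrand with [al]
    doubled. The formula for smaller angles reaches this one by dominated convergence. *)
Lemma mell_double (R : realType) (w al : R) : 0 < w -> w < al ->
  pint (mell w (2 * al)) = pint (mell w al) * cos (w / al * (pi / 2)).
Proof.
move=> w0 wal; have p0 := pihalf_gt0 R.
pose t (n : nat) : R := pi / 2 - n.+2%:R^-1.
have tlim : t n @[n --> \oo] --> pi / 2.
  rewrite -[X in _ --> X]subr0; apply: cvgB; first exact: cvg_cst.
  by under eq_fun do rewrite -addn2; exact: cvg_natinv.
have tn n : - (pi / 2) < t n /\ t n < pi / 2.
  rewrite /t; have h1 : n.+2%:R^-1 < 1 :> R by rewrite invf_lt1// ltr1n.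
  have h2 : 0 < n.+2%:R^-1 :> R by rewrite invr_gt0.
  have h3 := @pihalf_ge1 R; move: h1 h2 h3; move: (_^-1) (pi / 2) => e p h1 h2 h3.
  by split; lra.
have cn n : 0 <= cos (t n).
  by have [h1 h2] := tn n; apply: cos_ge0_pihalf; rewrite !ltW.
have [_ h] : pintegrable (fun z => z `^ (w - 1) * kerC (pi / 2) (z `^ al)) /\
    MC w al (t n) @[n --> \oo] --> MC w al (pi / 2).
  apply: (@pint_dct R (fun n z => z `^ (w - 1) * kerC (t n) (z `^ al)) _ (fun z => 2 * mell w al z)).
  - by move=> n; rewrite /kerC /den; meas.
  - move=> z z0; apply: cvgM; first exact: cvg_cst.
    apply: (@cvg_comp _ _ _ t (fun th => kerC th (z `^ al)) _ _ _ tlim).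
    have dn : den (pi / 2) (z `^ al) != 0.
      by rewrite gt_eqF// den_gt0 ?powR_ge0// cos_pihalf.
    exact: is_derive_continuous (is_derive_kerC_th dn).
  - by move=> n z z0; apply: mell_bound => // y; exact: kerC_le.
  - by apply: pintegrableZ; exact: mell_integrable.
have -> : pint (mell w (2 * al)) = MC w al (pi / 2).
  apply: eq_pint => z z0; rewrite /mell /kerC /den cos_pihalf !mulr0 !addr0 mul1r.
  by rewrite -powR_mulrn ?powR_ge0// -powRrM (mulrC al).
rewrite -(cvg_lim _ h)//; apply: cvg_lim => //.
under eq_fun do rewrite (MC_MS_open (tn _).1 (tn _).2 w0 wal).1.
apply: cvgM; first exact: cvg_cst.
apply: continuous_cvg; first exact: continuous_cos.
by apply: cvgM; first exact: cvg_cst.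
Qed.

Lemma sin_div_lim (R : realType) (x : R) :
  2 ^+ n * sin (x / 2 ^+ n) @[n --> \oo] --> x.
Proof.
have [->|x0] := eqVneq x 0.
  by under eq_fun do rewrite mul0r sin0 mulr0; exact: cvg_cst.
have hd : is_derive (0 : R) 1 sin (cos 0) by exact: is_derive_sin.
have [hd1 hd2] := hd.
have h0 : x / 2 ^+ n @[n --> \oo] --> 0.
  rewrite -[X in _ --> X](mulr0 x); apply: cvgZr.
  under eq_fun do rewrite -exprVn.
  by apply: cvg_expr; rewrite ger0_norm// invf_lt1// ltr1n.
have hn n : x / 2 ^+ n != 0 by rewrite mulf_neq0// invr_eq0 expf_neq0.
move: hd1 => /cvg_ex[/= l hl].
have el : l = 1.
  have := hd2; rewrite /derive => hd3.
  by rewrite -cos0 -hd3; apply/esym/cvg_lim.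
move: hl; rewrite el => /cvgr_dnbhsP/(_ (fun n => x / 2 ^+ n) (conj hn h0)) h.
rewrite -[X in _ --> X](mulr1 x).
have h2 : (fun n : nat => x * ((x / 2 ^+ n)^-1 *: (sin ((x / 2 ^+ n)%:A + 0) - sin 0))) @ \oo --> x * 1.
  by apply: cvgM h; exact: cvg_cst.
apply: cvg_trans h2.
apply: near_eq_cvg; near=> n => /=.
rewrite addr0 sin0 subr0 /GRing.scale/= mulr1.
have : (2 ^+ n : R) != 0 by rewrite expf_neq0.
move=> t0; field; rewrite ?t0 ?x0//.
Unshelve. all: by end_near. Qed.

(** For large [be] the integrand approaches z^(w - 1) cut off at 1, whose integral is 1 / w. A
    comparison with an exactly integrable function gives the rate. *)
Lemma mell_large (R : realType) (w : R) : 0 < w ->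
  exists2 K : R, 0 <= K & forall be : R, 4 * w <= be ->
  `|pint (mell w be) - w^-1| <= K / be.
Proof.
move=> w0.
exists (2 * w * (4 * pint (kers w))).
  by rewrite !mulr_ge0 ?(ltW w0)//; apply: pint_ge0 => z z0; rewrite /kers divr_ge0 ?powR_ge0// addr_ge0 ?sqr_ge0.
move=> be wbe; have be0 : 0 < be by nra.
have wlt : w < be by nra.
pose p := w / be.
have p0 : 0 < p by rewrite divr_gt0.
(* With this exponent [g] is the derivative of w^-1 (1 + z^(- be))^(- p), so its integral is exactly
   1 / w. *)
pose g z := z `^ (w - 1) * (1 + z `^ be) `^ (- p - 1).
have y0 (z : R) : 0 < 1 + z `^ be by rewrite ltr_pwDl ?powR_ge0.
have ig : pintegrable g.
  apply: (pintegrable_mell (C := 1) w0 wlt); first by rewrite /g; meas.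
  move=> z z0; rewrite ger0_norm ?mulr_ge0 ?powR_ge0// mul1r /mell.
  apply: ler_wpM2l; first exact: powR_ge0.
  rewrite -[leRHS]powR_inv1 ?(ltW (y0 _))//; apply: ler_powR; first by rewrite lerDl powR_ge0.
  by rewrite -[leRHS]sub0r lerD2r oppr_le0 ltW.
have eg : pint g = w^-1.
  rewrite -[RHS]subr0.
  refine (@pint_ftc R (fun z => w^-1 * (z `^ (- be) + 1) `^ (- p)) g 0 w^-1 _ _ ig _ _).
  - move=> z z0; have h1 := is_derive_powR (- be) z0.
    have q0 : 0 < z `^ (- be) + 1 by rewrite ltr_wpDl ?powR_ge0.
    have h2 : is_derive z 1 (fun z => z `^ (- be) + 1) (- be * z `^ (- be - 1)).
      by apply: is_derive_eq; rewrite addr0.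
    have h3 := is_derive_powR (- p) q0.
    have h4 := @is_derive1_comp R _ _ z _ _ h3 h2.
    have h5 : is_derive z 1 (fun z => w^-1 * (z `^ (- be) + 1) `^ (- p))
       (w^-1 * ((- be * z `^ (- be - 1)) * (- p * (z `^ (- be) + 1) `^ (- p - 1)))).
      apply: is_derive_eq; rewrite /GRing.scale/=; ring.
    apply: (is_derive_conv h5); rewrite /g.
    have -> : z `^ (- be) + 1 = z `^ (- be) * (1 + z `^ be).
      by rewrite mulrDr mulr1 -powRD ?(gt_eqF z0) ?implybT// addNr powRr0 addrC.
    rewrite powRM ?powR_ge0 ?(ltW (y0 _))// -powRrM.
    have -> : z `^ (w - 1) = z `^ (- be - 1) * z `^ (- be * (- p - 1)).
      rewrite -powRD ?(gt_eqF z0) ?implybT//; congr (_ `^ _); rewrite /p; field; rewrite gt_eqF//.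
    rewrite /p; set a := z `^ (- be - 1); set b := z `^ _; set c := (1 + _) `^ _.
    by field; rewrite !gt_eqF.
  - move=> z z0; apply: cvgM; first exact: continuous_powR.
    have hc : {for z, continuous (fun z : R => 1 + z `^ be : R)}.
      by apply: cvgD; [exact: cvg_cst|exact: continuous_powR].
    have hg : {for z, continuous (fun z : R => (1 + z `^ be) `^ (- p - 1) : R)}.
      refine (@continuous_powR_comp R (fun z => 1 + z `^ be) (- p - 1) z hc (y0 z)).
    exact: hg.
  - rewrite -[X in _ --> X](mulr0 w^-1); apply: cvgZr.
    have k1 : (1 + z `^ be) `^ (- p) @[z --> 0^'+] --> (1 + 0) `^ (- p).
      apply: (@continuous_cvg _ _ _ _ _ (fun z : R => 1 + z `^ be) (@powR R ^~ (- p))); first by apply: continuous_powR; rewrite addr0.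
      by apply: cvgD; [exact: cvg_cst|exact: powR_cvg0].
    have hl : (1 + z `^ be) `^ (- p) * z `^ w @[z --> 0^'+] --> 0.
      rewrite -[X in _ --> X](mulr0 ((1 + 0) `^ (- p))); exact: cvgM k1 (powR_cvg0 w0).
    apply: cvg_trans hl; apply: near_eq_cvg; near=> z; have z0 : 0 < z by near: z; exact: nbhs_right_gt.
    have -> : z `^ (- be) + 1 = z `^ (- be) * (1 + z `^ be).
      by rewrite mulrDr mulr1 -powRD ?(gt_eqF z0) ?implybT// addNr powRr0 addrC.
    rewrite powRM ?powR_ge0 ?(ltW (y0 _))// -powRrM mulrC; congr (_ * _); congr (_ `^ _).
    by rewrite /p; field; rewrite gt_eqF.
  - rewrite -[X in _ --> X](mulr1 w^-1); apply: cvgZr.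
    have -> : nbhs (1 : R) = nbhs ((0 + 1 : R) `^ (- p)) by rewrite add0r powR1.
    apply: (@continuous_cvg _ _ _ _ _ (fun z : R => z `^ (- be) + 1) (@powR R ^~ (- p))); first by apply: continuous_powR; rewrite add0r.
    apply: cvgD; last exact: cvg_cst.
    under eq_fun do rewrite powRN.
    apply/(gtr0_cvgV0 _).2; last exact: cvgy_powR.
    by near=> z; apply: powR_gt0; near: z; exact: nbhs_pinfty_gt.
rewrite -eg -pintB//; last exact: mell_integrable.
have -> : 2 * w * (4 * pint (kers w)) / be = pint (fun z => (8 * p) * kers w z).
  by rewrite pintZ; [rewrite /p; ring|exact: kers_integrable].
apply: le_norm_pint.
- by apply: pintegrableB => //; exact: mell_integrable.
- by apply: pintegrableZ; exact: kers_integrable.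
move=> z z0.
have -> : mell w be z - g z = z `^ (w - 1) / (1 + z `^ be) * (1 - (1 + z `^ be) `^ (- p)).
  rewrite /mell /g mulrBr mulr1; congr (_ - _); rewrite -mulrA; congr (_ * _).
  by rewrite powRD ?(gt_eqF (y0 _)) ?implybT// powR_inv1 ?(ltW (y0 _))// mulrC.
set Y := 1 + z `^ be.
have Y1 : 1 <= Y by rewrite lerDl powR_ge0.
have Y0 : 0 < Y by exact: lt_le_trans Y1.
have b1 : Y `^ (- p) <= 1.
  by rewrite -(powRr0 Y); apply: ler_powR => //; rewrite oppr_le0 ltW.
(* 1 - Y^(- p) is at most p ln Y, hence at most 2 p Y^(1/2). What remains of Y is Y^(- 1/2), and
   [4 * w <= be] makes it at most z^(- 2 w) for z > 1. *)
have b2 : 1 - Y `^ (- p) <= 2 * p * Y `^ 2^-1.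
  rewrite /powR (gt_eqF Y0).
  have h1 := expR_ge1Dx (- p * ln Y).
  have h2 : 0 <= ln Y by exact: ln_ge0.
  have h3 := expR_ge1Dx (2^-1 * ln Y).
  have : p * ln Y <= 2 * p * (2^-1 * ln Y + 1) by nra.
  nra.
rewrite normrM ger0_norm; last by rewrite divr_ge0 ?powR_ge0 ?(ltW Y0).
rewrite ger0_norm ?subr_ge0//.
apply: (@le_trans _ _ (z `^ (w - 1) / Y * (2 * p * Y `^ 2^-1))).
  by apply: ler_wpM2l => //; rewrite divr_ge0 ?powR_ge0 ?(ltW Y0).
have -> : z `^ (w - 1) / Y * (2 * p * Y `^ 2^-1) = 2 * p * (z `^ (w - 1) * Y `^ (- 2^-1)).
  have -> : Y `^ (- 2^-1) = Y `^ 2^-1 / Y.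
    rewrite -[X in _ / X](powRr1 (ltW Y0)) -powRB ?(gt_eqF Y0) ?implybT//; congr (_ `^ _); lra.
  by ring.
have -> : 8 * p * kers w z = 2 * p * (4 * kers w z) by ring.
apply: ler_wpM2l; first by rewrite mulr_ge0// ltW.
have [k1 k2] := le_kers w0 z0.
have kp : 0 <= kers w z by rewrite /kers divr_ge0 ?powR_ge0// addr_ge0 ?sqr_ge0.
have [z1|z1] := leP z 1.
  apply: (@le_trans _ _ (z `^ (w - 1))); last by have := k1 z1; lra.
  rewrite ler_piMr ?powR_ge0//; have h := @ler_powR _ Y Y1 (- 2^-1) 0.
  by rewrite powRr0 in h; apply: h; lra.
apply: (@le_trans _ _ (z `^ (- w - 1))); last by have := k2 (ltW z1); lra.
have -> : z `^ (- w - 1) = z `^ (w - 1) * z `^ (- (2 * w)).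
  rewrite -powRD ?(gt_eqF z0) ?implybT//; congr (_ `^ _); lra.
apply: ler_wpM2l; first exact: powR_ge0.
apply: (@le_trans _ _ ((z `^ be) `^ (- 2^-1))).
  rewrite !powRN lef_pV2 ?posrE ?powR_gt0//.
  apply: ge0_ler_powR; rewrite ?nnegrE ?powR_ge0 ?(ltW Y0)//.
  by rewrite lerDr.
rewrite -powRrM; apply: ler_powR; first exact: ltW.
lra.
Unshelve. all: by end_near. Qed.

(** Duplication makes the product of the integral at 2^n [al] and 2^n sin(x / 2^n) independent of
    [n], with x = pi w / al. As [n] grows the integral tends to 1 / w and the sine factor to x. *)
Lemma mell_value (R : realType) (w al : R) : 0 < w -> w < al ->
  pint (mell w al) = pi / al / sin (pi * w / al).
Proof.
move=> w0 wal; have al0 : 0 < al by exact: lt_trans wal.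
pose x := pi * w / al.
have s0 : 0 < sin x.
  apply: sin_gt0_pi; rewrite divr_gt0 ?mulr_gt0 ?pi_gt0//=.
  by rewrite ltr_pdivrMr// ltr_pM2l ?pi_gt0.
have step n : pint (mell w (2 ^+ n * al)) * (2 ^+ n * sin (x / 2 ^+ n)) =
    pint (mell w al) * sin x.
  elim: n => [|n <-]; first by rewrite expr0 mul1r divr1 mul1r.
  have wn : w < 2 ^+ n * al.
    by apply: lt_le_trans wal _; rewrite ler_peMl ?(ltW al0)// -natrX ler1n expn_gt0.
  rewrite exprS -mulrA mell_double//.
  have -> : w / (2 ^+ n * al) * (pi / 2) = x / (2 * 2 ^+ n).
    have t0 : (2 ^+ n : R) != 0 by rewrite expf_neq0.
    have a0 : al != 0 by rewrite gt_eqF.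
    by rewrite /x; move: t0; set t := 2 ^+ n => t0; field; rewrite t0 a0.
  have -> : x / 2 ^+ n = x / (2 * 2 ^+ n) + x / (2 * 2 ^+ n).
    have t0 : (2 ^+ n : R) != 0 by rewrite expf_neq0.
    by move: t0; set t := 2 ^+ n => t0; field; rewrite t0.
  rewrite sinD; ring.
have [K K0 hK] := mell_large w0.
have h1 : pint (mell w (2 ^+ n * al)) @[n --> \oo] --> w^-1.
  apply/subr_cvg0; apply: norm_cvg0.
  have kc : K / (2 ^+ n * al) @[n --> \oo] --> 0.
    rewrite -[X in _ --> X](mulr0 (K / al)).
    have E n : K / (2 ^+ n * al) = K / al * 2^-1 ^+ n by rewrite invfM exprVn; ring.
    under eq_fun do rewrite E.
    apply: cvgZr.
    by apply: cvg_expr; rewrite ger0_norm// invf_lt1// ltr1n.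
  apply: (@squeeze_cvgr _ _ _ _ (cst 0) _ _ _ _ _ kc); last exact: cvg_cst.
  near=> n; rewrite normr_ge0/=; apply: hK.
  rewrite -ler_pdivrMr//.
  apply: (@le_trans _ _ n%:R); first by near: n; exact: nbhs_infty_ger.
  by rewrite -natrX ler_nat ltnW// ltn_expl.
have h2 := @sin_div_lim R x.
have h3 : pint (mell w (2 ^+ n * al)) * (2 ^+ n * sin (x / 2 ^+ n)) @[n --> \oo] --> w^-1 * x.
  exact: cvgM h1 h2.
have : pint (mell w al) * sin x = w^-1 * x.
  rewrite -(cvg_lim _ h3)//; apply/esym/cvg_lim => //.
  by under eq_fun do rewrite step; exact: cvg_cst.
move=> /(canRL (mulfK (lt0r_neq0 s0))) ->.
by congr (_ / _); rewrite /x; field; rewrite !gt_eqF.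
Unshelve. all: by end_near. Qed.

Lemma MC_value (R : realType) (w al th : R) : - (pi / 2) < th -> th < pi / 2 ->
  0 < w -> w < al -> MC w al th = pi / al * cos (w / al * th) / sin (pi * w / al).
Proof.
by move=> t0 t1 w0 wal; rewrite (MC_MS_open t0 t1 w0 wal).1 mell_value// mulrAC.
Qed.

Lemma MS_value (R : realType) (w al th : R) : - (pi / 2) < th -> th < pi / 2 ->
  0 < w -> w < al -> MS w al th = pi / al * sin (w / al * th) / sin (pi * w / al).
Proof.
by move=> t0 t1 w0 wal; rewrite (MC_MS_open t0 t1 w0 wal).2 mell_value// mulrAC.
Qed.

Lemma MS0_integrable (R : realType) (al th : R) : 0 <= cos th -> 0 < al ->
  pintegrable (fun z => z^-1 * kerS th (z `^ al)).
Proof.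
move=> c0 al0.
apply: (@pintegrable_dom2 _ al 2) => //; first by rewrite /kerS /den; meas.
- move=> z z0 z1; have y0 : 0 <= z `^ al by exact: powR_ge0.
  have d0 := den_gt0 c0 y0; have d1 := den_ge c0 y0.
  rewrite normrM /kerS !normrM !normfV (gtr0_norm d0) (ger0_norm y0) (gtr0_norm z0).
  have -> : z `^ (al - 1) = z^-1 * z `^ al.
    by rewrite powRB ?powRr1 ?(gt_eqF z0) ?implybT 1?mulrC// ltW.
  rewrite [leRHS]mulrCA; apply: ler_wpM2l; first by rewrite invr_ge0 ltW.
  rewrite ler_pdivrMr//.
  have s1 : `|sin th| <= 1 by rewrite ler_norml sin_geN1 sin_le1.
  apply: (@le_trans _ _ (z `^ al)); first by rewrite ler_piMr.
  have := sqr_ge0 (z `^ al) => q.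
  rewrite mulrAC ler_peMl//; nra.
- move=> z z1; have z0 : 0 < z by exact: lt_le_trans z1.
  have y0 : 0 < z `^ al by exact: powR_gt0.
  have d0 := den_gt0 c0 (ltW y0); have d1 := den_ge c0 (ltW y0).
  rewrite normrM /kerS !normrM !normfV (gtr0_norm d0) (gtr0_norm y0) (gtr0_norm z0).
  have -> : z `^ (- al - 1) = z^-1 * (z `^ al)^-1.
    by rewrite powRB ?powRN ?powRr1 ?(gt_eqF z0) ?implybT 1?mulrC// ltW.
  rewrite [leRHS]mulrCA; apply: ler_wpM2l; first by rewrite invr_ge0 ltW.
  rewrite ler_pdivrMr// mulrAC ler_pdivlMr//.
  have s1 : `|sin th| <= 1 by rewrite ler_norml sin_geN1 sin_le1.
  apply: (@le_trans _ _ (z `^ al * z `^ al)).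
    by apply: ler_wpM2r; [exact: ltW|rewrite ler_piMr// ltW].
  have := sqr_ge0 (z `^ al) => q; nra.
Qed.

(** The case w = 0 of [MS_value], where an arctangent of (z^al + cos th) / sin th is a primitive.
    Oddness in [th] reduces to [0 < th]. *)
Lemma MS0_value (R : realType) (al th : R) : - (pi / 2) < th -> th < pi / 2 -> 0 < al ->
  pint (fun z => z^-1 * kerS th (z `^ al)) = th / al.
Proof.
move=> t0 t1 al0.
wlog th0 : th t0 t1 / 0 < th.
  move=> h; have [th0|th0|->] := ltgtP th 0; last 2 first.
  - exact: h.
  - rewrite mul0r -[RHS](@pint0 R); apply: eq_pint => z z0.
    by rewrite kerS0 mulr0.
  have h1 : - (pi / 2) < - th by rewrite ltrN2.
  have h2 : - th < pi / 2 by rewrite ltrNl.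
  have h3 := h _ h1 h2; rewrite oppr_gt0 in h3.
  apply: oppr_inj; rewrite -mulNr -h3// -pintN; last first.
    by apply: MS0_integrable => //; apply: cos_ge0_pihalf; rewrite !ltW.
  apply: eq_pint => z z0; rewrite /kerS /den cosN sinN; ring.
have c0 : 0 < cos th by apply: cos_gt0_pihalf; rewrite t0 t1.
have s0 : 0 < sin th by apply: sin_gt0_pihalf; rewrite th0 t1.
have a0 : atan (cos th / sin th) = pi / 2 - th.
  have <- : tan (pi / 2 - th) = cos th / sin th.
    by rewrite /tan addrC sinDpihalf cosDpihalf cosN sinN opprK.
  by rewrite tanK// in_itv/=; apply/andP; split; lra.
have -> : th / al = al^-1 * (pi / 2) - al^-1 * atan (cos th / sin th) by rewrite a0; ring.
refine (@pint_ftc R (fun z => al^-1 * atan ((z `^ al + cos th) / sin th)) _ _ _ _ _ _ _ _).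
- move=> z z0; have h1 := is_derive_powR al z0.
  have h2 : is_derive z 1 (fun z => (z `^ al + cos th) / sin th) (al * z `^ (al - 1) / sin th).
    by apply: is_derive_eq; rewrite /GRing.scale/=; ring.
  have h3 := is_derive1_atan ((z `^ al + cos th) / sin th).
  have h4 := @is_derive1_comp R _ _ z _ _ h3 h2.
  have h5 : is_derive z 1 (fun z => al^-1 * atan ((z `^ al + cos th) / sin th))
     (al^-1 * ((1 + ((z `^ al + cos th) / sin th) ^+ 2)^-1 * (al * z `^ (al - 1) / sin th))).
    by apply: is_derive_eq.
  apply: (is_derive_conv h5).
  have -> : z `^ (al - 1) = z^-1 * z `^ al.
    by rewrite powRB ?powRr1 ?(gt_eqF z0) ?implybT 1?mulrC// ltW.
  have y0 : 0 <= z `^ al by exact: powR_ge0.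
  have d0 := den_gt0 (ltW c0) y0.
  rewrite /kerS; set y := z `^ al in d0 *.
  have e : den th y = sin th ^+ 2 + (y + cos th) ^+ 2.
    have := cos2Dsin2 th; rewrite /den => e; rewrite -{1}e; ring.
  rewrite e in d0 *; move: s0 d0; set s := sin th; set c := cos th => s0 d0.
  field; rewrite !gt_eqF//.
- move=> z z0; apply: cvgM; first by apply: inv_continuous; rewrite gt_eqF.
  exact: continuous_kerS_z (ltW c0).
- exact: MS0_integrable (ltW c0) al0.
- apply: cvgZr; apply: continuous_cvg; first exact: continuous_atan.
  apply: cvgZl; rewrite -[X in _ --> X]add0r; apply: cvgD; last exact: cvg_cst.
  exact: powR_cvg0.
- apply: cvgZr; apply: cvg_comp (@cvgy_atan R).
  apply/cvgryPge => A; near=> z.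
  rewrite ler_pdivlMr// -lerBlDr.
  by near: z; exact: (cvgryPge _).1 (cvgy_powR al0) _.
Unshelve. all: by end_near. Qed.

(* [z^a Re (e^(i phi) / ((1 + z^al e^(i th)) (la + i z)))] in real form. *)
Definition WI (R : realType) (al th la phi a z : R) : R :=
  z `^ a * (la * (cos phi + z `^ al * cos (phi - th)) + z * (sin phi + z `^ al * sin (phi - th)))
  / (den th (z `^ al) * (la ^+ 2 + z ^+ 2)).

Lemma WI_meas (R : realType) (al th la phi a : R) D : measurable_fun (D : set R) (WI al th la phi a).
Proof. by rewrite /WI /den; meas. Qed.

Lemma WI_le (R : realType) (al th la phi a z : R) : 0 <= cos th -> 0 < la -> 0 < z ->
  `|WI al th la phi a z| <= 4 * (z `^ a / ((1 + z `^ al) * (la + z))).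
Proof.
move=> c0 la0 z0; rewrite /WI; set y := z `^ al.
have y0 : 0 <= y by exact: powR_ge0.
have d0 := den_gt0 c0 y0; have d1 := den_ge c0 y0.
have q0 : 0 < la ^+ 2 + z ^+ 2 by rewrite addr_gt0 ?exprn_gt0.
have cle x : `|cos x| <= 1 :> R by rewrite ler_norml cos_geN1 cos_le1.
have sle x : `|sin x| <= 1 :> R by rewrite ler_norml sin_geN1 sin_le1.
rewrite !normrM normfV (ger0_norm (powR_ge0 _ _)) mulrCA -mulrA.
apply: ler_wpM2l; first exact: powR_ge0.
rewrite (gtr0_norm (mulr_gt0 d0 q0)) ler_pdivrMr ?mulr_gt0//.
have h1 : `|la * (cos phi + y * cos (phi - th)) + z * (sin phi + y * sin (phi - th))| <= (1 + y) * (la + z).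
  apply: le_trans (ler_normD _ _) _; rewrite !normrM (gtr0_norm la0) (gtr0_norm z0).
  have h u v : `|u| <= 1 -> `|v| <= 1 -> `|u + y * v| <= 1 + y.
    move=> ha hb; apply: le_trans (ler_normD _ _) _; rewrite normrM (ger0_norm y0).
    by rewrite lerD// ler_piMr.
  rewrite mulrDr; apply: lerD; rewrite mulrC; apply: ler_wpM2r; rewrite ?(ltW la0) ?(ltW z0)//.
    exact: h.
  exact: h.
apply: (le_trans h1).
have p1 : 0 < 1 + y by rewrite ltr_pwDl.
have p2 : 0 < la + z by rewrite addr_gt0.
rewrite mulrAC ler_pdivlMr ?mulr_gt0//.
have e1 : (1 + y) ^+ 2 <= 2 * den th y by have := sqr_ge0 (1 - y); lra.
have e2 : (la + z) ^+ 2 <= 2 * (la ^+ 2 + z ^+ 2) by have := sqr_ge0 (la - z); lra.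
apply: (@le_trans _ _ ((1 + y) ^+ 2 * (la + z) ^+ 2)); first by rewrite !expr2 mulrACA.
apply: (@le_trans _ _ ((2 * den th y) * (2 * (la ^+ 2 + z ^+ 2)))).
  by apply: ler_pM => //; exact: sqr_ge0.
by rewrite mulrACA; have -> : 2 * 2 = 4 :> R by ring.
Qed.

Lemma WI_dom_integrable (R : realType) (al la a : R) : 0 < la ->
  -1 < a -> a < al -> pintegrable (fun z => 4 * (z `^ a / ((1 + z `^ al) * (la + z)))).
Proof.
move=> la0 a1 aal; pose s := Num.min (a + 1) (al - a).
have s0 : 0 < s by rewrite lt_min subr_gt0 aal andbT -ltrBlDr sub0r.
have nn z : 0 < z -> `|4 * (z `^ a / ((1 + z `^ al) * (la + z)))| = 4 * (z `^ a / ((1 + z `^ al) * (la + z))).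
  move=> z0; rewrite ger0_norm// mulr_ge0// divr_ge0 ?powR_ge0// mulr_ge0 ?addr_ge0 ?powR_ge0//; exact: ltW.
apply: (@pintegrable_dom2 _ s (4 / la + 4)) => //; first by meas.
- move=> z z0 z1; rewrite nn//.
  have y0 : 0 <= z `^ al by exact: powR_ge0.
  have h : z `^ a <= z `^ (s - 1).
    by apply: ger_powR; [rewrite z0 z1|rewrite lerBlDr ge_min lexx].
  apply: (@le_trans _ _ (4 * (z `^ (s - 1) / la))).
    apply: ler_wpM2l => //; apply: ler_pM; rewrite ?powR_ge0 ?invr_ge0//.
      by rewrite mulr_ge0 ?addr_ge0 ?(ltW la0) ?(ltW z0).
    rewrite lef_pV2 ?posrE ?mulr_gt0 ?ltr_pwDl ?(ltW z0)//.
    rewrite mulrDl mul1r -addrA lerDl addr_ge0 ?(ltW z0) ?mulr_ge0 ?addr_ge0 ?(ltW la0) ?(ltW z0)//.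
  rewrite mulrCA mulrC ler_wpM2r ?powR_ge0// lerDl//.
- move=> z z1; have z0 : 0 < z by exact: lt_le_trans z1.
  rewrite nn//.
  have y0 : 0 < z `^ al by exact: powR_gt0.
  apply: (@le_trans _ _ (4 * z `^ (- s - 1))); last first.
    by apply: ler_wpM2r; rewrite ?powR_ge0// lerDr divr_ge0 ?(ltW la0).
  apply: ler_wpM2l => //.
  apply: (@le_trans _ _ (z `^ (a - al - 1))); last first.
    by apply: ler_powR => //; have : s <= al - a by [rewrite ge_min lexx orbT]; lra.
  rewrite -addrA powRD ?(gt_eqF z0) ?implybT//; apply: ler_wpM2l; first exact: powR_ge0.
  have -> : z `^ (- al - 1) = (z `^ al * z)^-1.
    by rewrite powRB ?powRN ?powRr1 ?(gt_eqF z0) ?implybT ?invfM// ltW.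
  rewrite lef_pV2 ?posrE ?mulr_gt0 ?ltr_pwDl ?(ltW y0) ?(ltW z0) ?addr_gt0//.
  by apply: ler_pM; rewrite ?(ltW y0) ?(ltW z0)// ?lerDr//; apply: ltW.
Qed.

Lemma WI_integrable (R : realType) (al th la phi a : R) : 0 <= cos th -> 0 < la ->
  -1 < a -> a < al -> pintegrable (WI al th la phi a).
Proof.
move=> c0 la0 a1 aal; apply: (pintegrable_dom _ _ (WI_dom_integrable la0 a1 aal)).
  exact: WI_meas.
by move=> z z0; exact: WI_le.
Qed.

(** Raising [phi] by [th] and [a] by [al] multiplies the complex integrand by z^al e^(i th), so the
    sum cancels the factor 1 + z^al e^(i th) of the denominator. *)
Lemma WI_N (R : realType) (al th la phi a z : R) : 0 <= cos th -> 0 < la -> 0 < z ->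
  WI al th la phi a z + WI al th la (phi + th) (a + al) z =
  z `^ a * (la * cos phi + z * sin phi) / (la ^+ 2 + z ^+ 2).
Proof.
move=> c0 la0 z0; rewrite /WI addrK.
have -> : z `^ (a + al) = z `^ a * z `^ al by rewrite powRD// (gt_eqF z0) implybT.
set y := z `^ al; have y0 : 0 <= y by exact: powR_ge0.
have d0 := den_gt0 c0 y0.
have q0 : 0 < la ^+ 2 + z ^+ 2 by rewrite addr_gt0 ?exprn_gt0.
have -> : z `^ a * (la * cos phi + z * sin phi) / (la ^+ 2 + z ^+ 2) =
   z `^ a * (la * cos phi + z * sin phi) * den th y / (den th y * (la ^+ 2 + z ^+ 2)).
  by move: d0; set d := den th y => d0; field; rewrite !gt_eqF.
rewrite -mulrDl; congr (_ / _).
rewrite /den !cosD !sinD !cosN !sinN.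
have := cos2_sin2 th; set c := cos th; set s := sin th => h.
set A := z `^ a; set C := cos phi; set S := sin phi.
ring.
Qed.

(** Raising [phi] by pi / 2 and [a] by 1 multiplies the complex integrand by i z, so this
    combination cancels the factor la + i z. *)
Lemma WI_M (R : realType) (al th la phi a z : R) : 0 <= cos th -> 0 < la -> 0 < z ->
  la * WI al th la phi a z + WI al th la (phi + pi / 2) (a + 1) z =
  z `^ a * (cos phi * kerC th (z `^ al) + sin phi * kerS th (z `^ al)).
Proof.
move=> c0 la0 z0; rewrite /WI.
have -> : z `^ (a + 1) = z `^ a * z by rewrite powRD ?powRr1 ?(gt_eqF z0) ?implybT// ltW.
have -> : phi + pi / 2 - th = (phi - th) + pi / 2 by ring.
rewrite !cosDpihalf !sinDpihalf cosB sinB /kerC /kerS.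
set y := z `^ al; have y0 : 0 <= y by exact: powR_ge0.
have d0 := den_gt0 c0 y0.
have q0 : 0 < la ^+ 2 + z ^+ 2 by rewrite addr_gt0 ?exprn_gt0.
move: d0; set d := den th y => d0.
have d1 : d != 0 by rewrite gt_eqF.
have q1 : la ^+ 2 + z ^+ 2 != 0 by rewrite gt_eqF.
set A := z `^ a; set c := cos phi; set s := sin phi; set C := cos th; set S := sin th.
by field; rewrite d1 q1.
Qed.

(** After scaling by [la] the integrand is a combination of two Mellin integrands of 1 / (1 + z^2),
    at a + 1 and a + 2; both converge exactly for -1 < a < 0. *)
Lemma Bint_value (R : realType) (la phi a : R) : 0 < la -> -1 < a -> a < 0 ->
  pint (fun z => z `^ a * (la * cos phi + z * sin phi) / (la ^+ 2 + z ^+ 2)) =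
  la `^ a * pi * cos (phi - pi * (a + 1) / 2) / sin (pi * (a + 1)).
Proof.
move=> la0 a1 a0.
have w0 : 0 < a + 1 by lra.
have w1 : a + 1 < 2 by lra.
have w2 : 0 < a + 2 by lra.
have w3 : a + 2 < 2 by lra.
pose g (z : R) := cos phi * mell (a + 1) 2 z + sin phi * mell (a + 2) 2 z.
have i1 := mell_integrable w0 w1; have i2 := mell_integrable w2 w3.
have ig : pintegrable g by apply: pintegrableD; exact: pintegrableZ.
have mg : measurable_fun setT g by rewrite /g /mell; meas.
have li0 : 0 < la^-1 by rewrite invr_gt0.
have [ig' eg] := pint_scale li0 mg ig.
transitivity (pint (fun z => la `^ (a - 1) * g (la^-1 * z))).
  apply: eq_pint => z z0; rewrite /g /mell addrK.
  have -> : a + 2 - 1 = a + 1 by ring.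
  have u0 : 0 <= la^-1 * z by rewrite mulr_ge0 ?ltW.
  rewrite (@powR_mulrn _ _ 2)// [(la^-1 * z) `^ (a + 1)]powRD; last by rewrite gt_eqF ?implybT// mulr_gt0.
  rewrite powRr1//.
  have -> : la `^ (a - 1) = la `^ a / la by rewrite powRB ?(gt_eqF la0) ?implybT// powRr1// ltW.
  have -> : (la^-1 * z) `^ a = (la `^ a)^-1 * z `^ a.
    by rewrite powRM ?(ltW li0) ?(ltW z0)// -(powR_inv1 (ltW la0)) -powRrM mulN1r powRN.
  have la_n : la `^ a != 0 by rewrite gt_eqF// powR_gt0.
  have q0 : la ^+ 2 + z ^+ 2 != 0 by rewrite gt_eqF// addr_gt0 ?exprn_gt0.
  move: la_n; set L := la `^ a; set Z := z `^ a => la_n.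
  by field; rewrite q0 la_n !gt_eqF.
rewrite (pintZ _ ig') eg invrK /g (pintD (pintegrableZ _ i1) (pintegrableZ _ i2)).
rewrite (pintZ _ i1) (pintZ _ i2) !mell_value//.
have -> : la `^ a = la `^ (a - 1) * la.
  by rewrite -[X in _ * X](powRr1 (ltW la0)) -powRD ?(gt_eqF la0) ?implybT// subrK.
set x := pi * (a + 1) / 2.
have -> : pi * (a + 2) / 2 = x + pi / 2 by rewrite /x; ring.
have -> : pi * (a + 1) = x + x by rewrite /x; field.
have pp := @pi_gt0 R.
have x0 : 0 < x by rewrite /x divr_gt0// mulr_gt0.
have x1 : x < pi / 2 by rewrite /x ltr_pM2r// gtr_pMr// -ltrBrDr subrr.
have s0 : 0 < sin x by apply: sin_gt0_pihalf; rewrite x0 x1.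
have c0 : 0 < cos x.
  by apply: cos_gt0_pihalf; rewrite x1 andbT (lt_trans _ x0)// oppr_lt0 divr_gt0.
rewrite sinDpihalf sinD cosB.
clear -s0 c0; set s := sin x in s0 *; set c := cos x in c0 *; set p := pi; set L := _ `^ _.
have sn : s != 0 by rewrite gt_eqF.
have cn : c != 0 by rewrite gt_eqF.
have -> : s * c + c * s = 2 * (s * c) by ring.
by field; rewrite sn cn.
Qed.

Lemma WI_N_step (R : realType) (al th la phi a : R) : 0 <= cos th -> 0 < la -> 0 < al ->
  -1 < a -> a < 0 ->
  pint (WI al th la phi a) + pint (WI al th la (phi + th) (a + al)) =
  la `^ a * pi * cos (phi - pi * (a + 1) / 2) / sin (pi * (a + 1)).
Proof.
move=> c0 la0 al0 a1 a0; rewrite -Bint_value// -pintD; last 2 first.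
- by apply: WI_integrable => //; exact: lt_trans al0.
- by apply: WI_integrable => //; lra.
by apply: eq_pint => z z0; rewrite WI_N.
Qed.

Lemma WI_M_step (R : realType) (al th la phi a : R) : - (pi / 2) < th -> th < pi / 2 ->
  0 < la -> -1 < a -> a < al - 1 ->
  la * pint (WI al th la phi a) + pint (WI al th la (phi + pi / 2) (a + 1)) =
  pi / al * cos (phi - (a + 1) / al * th) / sin (pi * (a + 1) / al).
Proof.
move=> t0 t1 la0 a1 a2.
have c0 : 0 <= cos th by apply/ltW/cos_gt0_pihalf; rewrite t0 t1.
have w0 : 0 < a + 1 by lra.
have w1 : a + 1 < al by lra.
have i1 : pintegrable (WI al th la phi a) by apply: WI_integrable => //; lra.
have i2 : pintegrable (WI al th la (phi + pi / 2) (a + 1)) by apply: WI_integrable => //; lra.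
rewrite -pintZ// -pintD//; last exact: pintegrableZ.
transitivity (cos phi * MC (a + 1) al th + sin phi * MS (a + 1) al th); last first.
  by rewrite MC_value// MS_value// cosB; ring.
rewrite /MC /MS -!pintZ; [|exact: MS_integrable|exact: MC_integrable].
rewrite -pintD; [|apply: pintegrableZ; exact: MC_integrable|apply: pintegrableZ; exact: MS_integrable].
by apply: eq_pint => z z0; rewrite WI_M// addrK; ring.
Qed.

Lemma poisson_integrable (R : realType) (la : R) : 0 < la ->
  pintegrable (fun z => la / (la ^+ 2 + z ^+ 2)).
Proof.
move=> la0; have li0 : 0 < la^-1 by rewrite invr_gt0.
have mk : measurable_fun setT (kers (1 : R)) by rewrite /kers; meas.
have [h _] := pint_scale li0 mk (@kers_integrable R 1 ltr01).
apply: (eq_pintegrable _ (pintegrableZ la^-1 h)) => z z0.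
rewrite /kers subrr powRr0 powRr1; last by rewrite mulr_ge0// ltW.
field; rewrite !gt_eqF ?addr_gt0 ?exprn_gt0//.
Qed.

Lemma poisson_value (R : realType) (la : R) : 0 < la ->
  pint (fun z => la / (la ^+ 2 + z ^+ 2)) = pi / 2.
Proof.
move=> la0; have li0 : 0 < la^-1 by rewrite invr_gt0.
rewrite -[RHS]subr0 -(@atan0 R).
refine (@pint_ftc R (fun z => atan (la^-1 * z)) _ _ _ _ _ (poisson_integrable la0) _ _).
- move=> z z0.
  have h2 : is_derive z 1 (fun z => la^-1 * z) la^-1.
    by apply: is_derive_eq; rewrite /GRing.scale/= mulr1.
  have h3 := is_derive1_atan (la^-1 * z).
  apply: (is_derive_conv (@is_derive1_comp R _ _ z _ _ h3 h2)).
  by field; rewrite !gt_eqF ?addr_gt0 ?exprn_gt0.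
- move=> z z0; apply: (@continuous_div R (fun=> la) (fun z => la ^+ 2 + z ^+ 2)).
  + by rewrite gt_eqF ?addr_gt0 ?exprn_gt0.
  + exact: cvg_cst.
  + by apply: cvgD; [exact: cvg_cst|exact: exprn_continuous].
- apply: (@continuous_cvg _ _ _ _ _ (fun z => la^-1 * z) (@atan R)); first exact: continuous_atan.
  rewrite -[X in _ --> X](mulr0 la^-1); apply: cvgZr.
  exact: cvg_at_right_filter cvg_id.
- apply: cvg_comp (@cvgy_atan R).
  apply/cvgryPge => A; near=> z.
  rewrite mulrC (ler_pdivlMr _ _ la0).
  by near: z; apply: nbhs_pinfty_ge; exact: num_real.
Unshelve. all: by end_near. Qed.

(** At a = 0 the reduction [WI_N] leads to a term of order [al], outside the range of
    [WI_integrable]. [WI_M] removes that same term, so the two identities are combined pointwise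
    before integrating. *)
Lemma WI_start (R : realType) (al th la : R) : - (pi / 2) < th -> th < pi / 2 ->
  0 < al -> 0 < la ->
  pint (WI al th la 0 0) = pi / 2 - th / al + la * pint (WI al th la (th - pi / 2) (al - 1)).
Proof.
move=> t0 t1 al0 la0.
have c0 : 0 <= cos th by apply/ltW/cos_gt0_pihalf; rewrite t0 t1.
have i1 : pintegrable (WI al th la 0 0) by apply: WI_integrable => //; lra.
have i2 : pintegrable (WI al th la (th - pi / 2) (al - 1)) by apply: WI_integrable => //; lra.
have -> : pi / 2 - th / al = pint (fun z => la / (la ^+ 2 + z ^+ 2) - z^-1 * kerS th (z `^ al)).
  rewrite pintB; [|exact: poisson_integrable|exact: MS0_integrable].
  by rewrite poisson_value// MS0_value.
rewrite -pintZ// -pintD; [|apply: pintegrableB; [exact: poisson_integrable|exact: MS0_integrable]|exact: pintegrableZ].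
apply: eq_pint => z z0; rewrite /WI.
have -> : z `^ (al - 1) = z `^ al / z by rewrite powRB ?(gt_eqF z0) ?implybT// powRr1// ltW.
have -> : th - pi / 2 - th = - (pi / 2) by ring.
rewrite powRr0 cos0 sin0 sub0r !cosN !sinN cos_pihalf sin_pihalf.
rewrite cosB sinB cos_pihalf sin_pihalf /kerS.
set y := z `^ al; have y0 : 0 <= y by exact: powR_ge0.
have d0 := den_gt0 c0 y0.
have q0 : 0 < la ^+ 2 + z ^+ 2 by rewrite addr_gt0 ?exprn_gt0.
have -> : la / (la ^+ 2 + z ^+ 2) = la * den th y / (den th y * (la ^+ 2 + z ^+ 2)).
  by move: d0; set d := den th y => d0; field; rewrite !gt_eqF.
have h : la * den th y = la * (1 + 2 * y * cos th + y ^+ 2) by [].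
rewrite h; move: d0; set d := den th y => d0.
by field; rewrite !gt_eqF.
Qed.

(** The substitution z -> 1/z in the second integral gives an integrand whose sum with the first is
    free of products of the two denominators: a Poisson kernel minus the kernel of [MS0_value]. *)
Lemma WI_sym (R : realType) (al th la : R) : - (pi / 2) < th -> th < pi / 2 ->
  0 < al -> 0 < la ->
  pint (WI al th la 0 0) + pint (WI al th la^-1 0 0) = pi / 2 - th / al.
Proof.
move=> t0 t1 al0 la0.
have c0 : 0 <= cos th by apply/ltW/cos_gt0_pihalf; rewrite t0 t1.
have li0 : 0 < la^-1 by rewrite invr_gt0.
have i1 : pintegrable (WI al th la 0 0) by apply: WI_integrable => //; lra.
have i2 : pintegrable (WI al th la^-1 0 0) by apply: WI_integrable => //; lra.
have ci (z : R) : 0 < z -> {for z, continuous (WI al th la^-1 0 0)}.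
  move=> z0.
  have cp : {for z, continuous (fun z : R => z `^ al)} by exact: continuous_powR.
  apply: (@continuous_div R (fun z => z `^ 0 * (la^-1 * (cos 0 + z `^ al * cos (0 - th)) + z * (sin 0 + z `^ al * sin (0 - th))))
     (fun z => den th (z `^ al) * (la^-1 ^+ 2 + z ^+ 2))).
  - by rewrite gt_eqF// mulr_gt0 ?den_gt0 ?powR_ge0 ?addr_gt0 ?exprn_gt0.
  - apply: cvgM; first exact: continuous_powR.
    apply: cvgD; apply: cvgM; [exact: cvg_cst| |exact: cvg_id|];
      apply: cvgD; [exact: cvg_cst| |exact: cvg_cst|]; apply: cvgM => //; exact: cvg_cst.
  - apply: cvgM; last by apply: cvgD; [exact: cvg_cst|exact: exprn_continuous].
    have h : {for z, continuous (fun z : R => den th (z `^ al))}.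
      by refine (@continuous_comp1 R (fun z => z `^ al) (den th) z cp _); exact: continuous_den.
    exact: h.
have [i3 <-] := pint_inv ci i2.
rewrite -pintD//.
have -> : pi / 2 - th / al = pint (fun z => la / (la ^+ 2 + z ^+ 2) - z^-1 * kerS th (z `^ al)).
  rewrite pintB; [|exact: poisson_integrable|exact: MS0_integrable].
  by rewrite poisson_value// MS0_value.
apply: eq_pint => z z0; rewrite /WI.
have -> : z^-1 `^ al = (z `^ al)^-1.
  by rewrite -(powR_inv1 (ltW z0)) -powRrM mulN1r powRN.
rewrite !powRr0 cos0 sin0 sub0r cosN sinN /kerS.
have y0 : 0 < z `^ al by exact: powR_gt0.
move: y0; set y := z `^ al => y0.
have d0 := den_gt0 c0 (ltW y0).
have q0 : 0 < la ^+ 2 + z ^+ 2 by rewrite addr_gt0 ?exprn_gt0.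
have -> : la / (la ^+ 2 + z ^+ 2) = la * den th y / (den th y * (la ^+ 2 + z ^+ 2)).
  by move: d0; set d := den th y => d0; field; rewrite !gt_eqF.
have h : la * den th y = la * (1 + 2 * y * cos th + y ^+ 2) by [].
have -> : den th y^-1 = den th y / y ^+ 2 by rewrite /den; field; rewrite gt_eqF.
rewrite h; move: d0; set d := den th y => d0.
have q1 : la ^+ 2 + z ^+ 2 != 0 by rewrite gt_eqF.
have q2 : z ^+ 2 + la ^+ 2 != 0 by rewrite addrC gt_eqF.
by field; rewrite ?q1 ?q2 !gt_eqF.
Qed.

Definition theta (R : realType) (al rho : R) : R := pi * al * (2^-1 - rho).

(** The J of the overview: 1/pi times the integral of Re 1 / ((1 + z^al e^(i theta)) (la + i z)). *)
Definition JI (R : realType) (al rho la : R) : R :=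
  pi^-1 * pint (WI al (theta al rho) la 0 0).

(** The integrand of [JI] times (- z^al e^(i theta))^N (- la / (i z))^M: the remainder left when
    both denominators are expanded geometrically, to orders [N] and [M]. *)
Definition RR (R : realType) (al rho la : R) (M N : nat) : R :=
  pi^-1 * (-1) ^+ (M + N) * la ^+ M *
  pint (WI al (theta al rho) la (N%:R * theta al rho - M%:R * (pi / 2)) (al * N%:R - M%:R)).

(** At [n = 0] the quotient 0 / 0 is 0, so sums over this family may start at 0. *)
Definition sratio (R : realType) (tau om : R) (n : nat) : R :=
  (-1) ^+ n * sin (n%:R * tau) / sin (n%:R * om).

Lemma sin_addn_pi (R : realType) (n : nat) (x : R) :
  sin (n%:R * pi + x) = (-1) ^+ n * sin x.
Proof.
elim: n => [|n ih]; first by rewrite mul0r add0r expr0 mul1r.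
have -> : n.+1%:R * pi + x = n%:R * pi + x + pi :> R by rewrite -natr1; ring.
by rewrite sinDpi ih exprS; ring.
Qed.

Lemma sin_subn_pi (R : realType) (n : nat) (x : R) :
  sin (n%:R * pi - x) = - (-1) ^+ n * sin x.
Proof. by rewrite sin_addn_pi sinN mulrN mulNr. Qed.

(** The order al N - M lies in the range of [WI_N_step]. Its sine denominator is that of N pi al
    shifted by a multiple of pi, which accounts for the sign (-1)^M. *)
Lemma RR_N (R : realType) (al rho la : R) (M N : nat) :
  - (pi / 2) < theta al rho -> theta al rho < pi / 2 -> 0 < al -> 0 < la ->
  sin (N%:R * (pi * al)) != 0 ->
  -1 < al * N%:R - M%:R -> al * N%:R - M%:R < 0 ->
  RR al rho la M N = sratio (pi * al * rho) (pi * al) N * (la `^ al) ^+ N + RR al rho la M N.+1.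
Proof.
move=> t0 t1 al0 la0 sn a1 a2.
have c0 : 0 <= cos (theta al rho) by apply/ltW/cos_gt0_pihalf; rewrite t0 t1.
have h := WI_N_step (N%:R * theta al rho - M%:R * (pi / 2)) c0 la0 al0 a1 a2.
rewrite /RR.
have -> : N.+1%:R * theta al rho - M%:R * (pi / 2) =
  N%:R * theta al rho - M%:R * (pi / 2) + theta al rho by rewrite -natr1; ring.
have -> : al * N.+1%:R - M%:R = al * N%:R - M%:R + al by rewrite -natr1; ring.
move: h; set I1 := pint _; set I2 := pint _ => h.
have {h}-> : I1 = la `^ (al * N%:R - M%:R) * pi * (- sin (N%:R * (pi * al * rho)) / (- (-1) ^+ M * sin (N%:R * (pi * al)))) - I2.
  apply/(canRL (addrK _)); rewrite h -mulrA; congr (_ * (_ / _)).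
    by rewrite -cosDpihalf -[LHS]cosN; congr cos; rewrite /theta; field.
  have -> : pi * (al * N%:R - M%:R + 1) = pi - (M%:R * pi - N%:R * (pi * al)) by ring.
  by rewrite -[pi in pi - _]mul1r (sin_subn_pi 1) expr1 opprK mul1r sin_subn_pi.
have -> : la `^ (al * N%:R - M%:R) = (la `^ al) ^+ N / la ^+ M.
  by rewrite powRB ?(gt_eqF la0) ?implybT// powRrM !powR_mulrn// ?powR_ge0// ltW.
rewrite /sratio addnS exprS exprD.
have l0 : la ^+ M != 0 by rewrite expf_neq0// gt_eqF.
have p0 : pi != 0 :> R by rewrite gt_eqF// pi_gt0.
have e1 : (-1) ^+ M * (-1) ^+ M = 1 :> R by rewrite -exprMn mulrNN mulr1 expr1n.
have e2 : ((-1) ^+ M)^-1 = (-1) ^+ M :> R by rewrite -exprVn invrN1.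
move: l0 p0 sn; set L := la ^+ M; set p := pi; set S := sin (N%:R * (_ * _)) => l0 p0 sn; clearbody S L p.
rewrite mulNr invrN invfM e2.
have -> : - sin (N%:R * (p * al * rho)) * - ((-1) ^+ M / S) = (-1) ^+ M * (sin (N%:R * (p * al * rho)) / S) by ring.
move: e1; set E := (-1) ^+ M => e1.
transitivity ((-1) ^+ N * (E * E) * (la `^ al) ^+ N * (sin (N%:R * (p * al * rho)) / S)
  - p^-1 * (E * (-1) ^+ N) * L * I2); first by field; rewrite sn l0 p0.
by rewrite e1; ring.
Qed.

Lemma RR_M (R : realType) (al rho la : R) (M N : nat) :
  - (pi / 2) < theta al rho -> theta al rho < pi / 2 -> 0 < al -> 0 < la ->
  sin (M%:R * (pi / al)) != 0 ->
  0 < al * N%:R - M%:R -> al * N%:R - M%:R < al ->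
  RR al rho la M N = al^-1 * (sratio (pi * rho) (pi / al) M * la ^+ M) + RR al rho la M.+1 N.
Proof.
move=> t0 t1 al0 la0 sn a1 a2.
have a3 : -1 < al * N%:R - M.+1%:R by rewrite -natr1; lra.
have a4 : al * N%:R - M.+1%:R < al - 1 by rewrite -natr1; lra.
have h := WI_M_step (N%:R * theta al rho - M.+1%:R * (pi / 2)) t0 t1 la0 a3 a4.
rewrite /RR.
have E1 : N%:R * theta al rho - M%:R * (pi / 2) =
  N%:R * theta al rho - M.+1%:R * (pi / 2) + pi / 2 by rewrite -natr1; ring.
have E2 : al * N%:R - M%:R = al * N%:R - M.+1%:R + 1 by rewrite -natr1; ring.
rewrite E1 {1}E2.
move: h; set I1 := pint _; set I2 := pint _ => h.
have {h}-> : I2 = pi / al * (- sin (M%:R * (pi * rho)) / (- (-1) ^+ N * sin (M%:R * (pi / al)))) - la * I1.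
  apply/(canRL (addrK _)); rewrite addrC h -mulrA; congr (_ * (_ / _)).
    rewrite -cosDpihalf -[LHS]cosN; congr cos; rewrite -E2 /theta -natr1; field.
    by rewrite gt_eqF.
  have -> : pi * (al * N%:R - M.+1%:R + 1) / al = N%:R * pi - M%:R * (pi / al).
    by rewrite -E2; field; rewrite gt_eqF.
  by rewrite sin_subn_pi.
rewrite /sratio addSn exprS exprD [la ^+ M.+1]exprS.
have p0 : pi != 0 :> R by rewrite gt_eqF// pi_gt0.
have e1 : (-1) ^+ N * (-1) ^+ N = 1 :> R by rewrite -exprMn mulrNN mulr1 expr1n.
have e2 : ((-1) ^+ N)^-1 = (-1) ^+ N :> R by rewrite -exprVn invrN1.
have al1 : al != 0 by rewrite gt_eqF.
move: p0 sn; set L := la ^+ M; set p := pi; set S := sin (M%:R * (_ / _)) => p0 sn; clearbody S L p.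
rewrite mulNr invrN invfM e2.
have -> : - sin (M%:R * (p * rho)) * - ((-1) ^+ N / S) = (-1) ^+ N * (sin (M%:R * (p * rho)) / S) by ring.
move: e1; set E := (-1) ^+ N => e1.
transitivity (al^-1 * ((-1) ^+ M * (E * E) * L * (sin (M%:R * (p * rho)) / S))
  - p^-1 * ((-1) ^+ M * E) * L * la * I1); first by field; rewrite sn al1 p0.
by rewrite e1; ring.
Qed.

Lemma JI_start (R : realType) (al rho la : R) :
  - (pi / 2) < theta al rho -> theta al rho < pi / 2 -> 0 < al -> 0 < la ->
  JI al rho la = rho + RR al rho la 1 1.
Proof.
move=> t0 t1 al0 la0; rewrite /JI /RR WI_start// !mulr1 !mul1r.
have -> : pi / 2 - theta al rho / al = pi * rho by rewrite /theta; field; rewrite gt_eqF.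
have pn : pi != 0 :> R by rewrite gt_eqF// pi_gt0.
rewrite expr1 sqrrN expr1n mulr1 mulrDr mulKf//; ring.
Qed.

Lemma JI_sym (R : realType) (al rho la : R) :
  - (pi / 2) < theta al rho -> theta al rho < pi / 2 -> 0 < al -> 0 < la ->
  JI al rho la + JI al rho la^-1 = rho.
Proof.
move=> t0 t1 al0 la0; rewrite /JI -mulrDr WI_sym// /theta.
have pn : pi != 0 :> R by rewrite gt_eqF// pi_gt0.
by move: pn; generalize (pi : R) => p pn; field; rewrite pn gt_eqF.
Qed.

(** A staircase in the strip -1 < al N - M < al, descending to (1, 1): below al - 1 the last move
    raised [M], above it the last move raised [N], and in either case the preceding point is again
    in the strip. The induction is on M + N. *)
Lemma JI_partial (R : realType) (al rho la : R) :
  - (pi / 2) < theta al rho -> theta al rho < pi / 2 -> 0 < al -> 0 < la ->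
  (forall n, (0 < n)%N -> sin (n%:R * (pi * al)) != 0) ->
  (forall n, (0 < n)%N -> sin (n%:R * (pi / al)) != 0) ->
  (forall m n : nat, (0 < n)%N -> al * n%:R != m%:R) ->
  forall M N, (0 < M)%N -> (0 < N)%N -> -1 < al * N%:R - M%:R -> al * N%:R - M%:R < al ->
  JI al rho la = rho +
    \sum_(1 <= n < N) sratio (pi * al * rho) (pi * al) n * (la `^ al) ^+ n +
    al^-1 * \sum_(1 <= m < M) sratio (pi * rho) (pi / al) m * la ^+ m + RR al rho la M N.
Proof.
move=> t0 t1 al0 la0 sa sb irr M N.
move: {2}(M + N)%N (leqnn (M + N)) => k; elim: k M N => [|k ih] M N.
  by rewrite leqn0 addn_eq0 => /andP[/eqP -> _].
move=> MNk M0 N0 v0 v1.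
have Mr : 1 <= M%:R :> R by rewrite ler1n.
have Nr : 1 <= N%:R :> R by rewrite ler1n.
have [c|c|c] := ltgtP (al * N%:R - M%:R) (al - 1).
- have M1 : (1 < M)%N.
    rewrite ltn_neqAle M0 andbT eq_sym; apply/eqP => M1; subst M.
    by move: c; apply/negP; rewrite -leNgt lerD2r ler_peMr// ltW.
  case: M M1 MNk M0 v0 v1 Mr c => // M M1 MNk M0 v0 v1 Mr c.
  have e : al * N%:R - M%:R = al * N%:R - M.+1%:R + 1 by rewrite -natr1; ring.
  have w0 : 0 < al * N%:R - M%:R by rewrite e; lra.
  have w1 : al * N%:R - M%:R < al by rewrite e; lra.
  rewrite (ih M N)//; [|lra].
  rewrite (RR_M t0 t1 al0 la0 (sb M M1) w0 w1) (@big_nat_recr _ _ _ M)//=; ring.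
- have N1 : (1 < N)%N.
    rewrite ltn_neqAle N0 andbT eq_sym; apply/eqP => N1; subst N.
    move: c; rewrite mulr1 ltrD2l ltrN2; lra.
  case: N N1 MNk N0 v0 v1 Nr c => // N N1 MNk N0 v0 v1 Nr c.
  have e : al * N%:R - M%:R = al * N.+1%:R - M%:R - al by rewrite -natr1; ring.
  have w0 : -1 < al * N%:R - M%:R by rewrite e; lra.
  have w1 : al * N%:R - M%:R < 0 by rewrite e; lra.
  rewrite (ih M N)//; [|by rewrite addnS in MNk|lra].
  rewrite (RR_N t0 t1 al0 la0 (sa N N1) w0 w1) (@big_nat_recr _ _ _ N)//=; ring.
(* Equality means al (N - 1) = M - 1, which irrationality allows only at the starting point. *)
- have : N = 1%N.
    case: N N0 MNk v0 v1 Nr c => // -[//|N] N0 MNk v0 v1 Nr c; exfalso.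
    case: M M0 MNk v0 v1 Mr c => // M M0 MNk v0 v1 Mr c.
    have /eqP := irr M N.+1 isT; apply.
    by move: c; rewrite -(natr1 M) -(natr1 N.+1) => c; lra.
  move=> N1; subst N.
  have : M = 1%N by apply/eqP; rewrite -(eqr_nat R); apply/eqP; lra.
  move=> M1; subst M.
  by rewrite !big_geq// mulr0 !addr0 JI_start.
Qed.

(** Bounding la + z below by z leaves a Mellin integrand, whose integral has sin(pi (al N - M) / al)
    in the denominator; up to sign this is sin(M pi / al). *)
Lemma RR_le (R : realType) (al rho la : R) (M N : nat) :
  - (pi / 2) < theta al rho -> theta al rho < pi / 2 -> 0 < al -> 0 < la ->
  0 < al * N%:R - M%:R -> al * N%:R - M%:R < al ->
  `|RR al rho la M N| <= 4 / al * (la ^+ M / `|sin (M%:R * (pi / al))|).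
Proof.
move=> t0 t1 al0 la0 w0 w1.
have c0 : 0 <= cos (theta al rho) by apply/ltW/cos_gt0_pihalf; rewrite t0 t1.
have e : sin (M%:R * (pi / al)) = - (-1) ^+ N * sin (pi * (al * N%:R - M%:R) / al).
  rewrite -sin_subn_pi; congr sin; field; by rewrite gt_eqF.
have s0 : 0 < sin (pi * (al * N%:R - M%:R) / al).
  apply: sin_gt0_pi; rewrite divr_gt0 ?mulr_gt0 ?pi_gt0//=.
  by rewrite ltr_pdivrMr// ltr_pM2l ?pi_gt0.
have -> : `|sin (M%:R * (pi / al))| = sin (pi * (al * N%:R - M%:R) / al).
  by rewrite e normrM normrN normrX normrN1 expr1n mul1r (gtr0_norm s0).
rewrite /RR !normrM normrX normrN1 expr1n mulr1 (ger0_norm (exprn_ge0 _ (ltW la0))).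
rewrite gtr0_norm ?invr_gt0 ?pi_gt0//.
set a := al * N%:R - M%:R in w0 w1 s0 *.
have i1 := mell_integrable w0 w1.
have h : `|pint (WI al (theta al rho) la (N%:R * theta al rho - M%:R * (pi / 2)) a)|
    <= 4 * (pi / al / sin (pi * a / al)).
  rewrite -mell_value// -pintZ//; apply: le_norm_pint.
  - by apply: WI_integrable => //; lra.
  - exact: pintegrableZ.
  move=> z z0; apply: le_trans (WI_le _ _ _ c0 la0 z0) _.
  apply: ler_wpM2l => //; rewrite /mell (@powRB _ z a 1) ?(gt_eqF z0) ?implybT// powRr1 ?(ltW z0)//.
  rewrite -mulrA; apply: ler_wpM2l; first exact: powR_ge0.
  have y0 : 0 <= z `^ al by exact: powR_ge0.
  rewrite -invfM lef_pV2 ?posrE ?mulr_gt0 ?ltr_pwDl ?addr_gt0 ?(ltW z0)//.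
  rewrite mulrC; apply: ler_wpM2l; first by rewrite addr_ge0.
  by rewrite lerDr ltW.
apply: (@le_trans _ _ (pi^-1 * la ^+ M * (4 * (pi / al / sin (pi * a / al))))).
  by apply: ler_wpM2l => //; rewrite mulr_ge0 ?invr_ge0 ?(ltW (pi_gt0 R))// exprn_ge0 ?ltW.
rewrite le_eqVlt; apply/orP; left; apply/eqP.
have := pi_gt0 R; move: s0; set S := sin _; clearbody S.
generalize (pi : R) => p s0 p0; field.
by rewrite !gt_eqF.
Qed.

Lemma cvg_le_cst (R : realType) (T : Type) (F : set_system T) {FF : ProperFilter F}
    (f : T -> R) (l M : R) :
  f x @[x --> F] --> l -> (\forall x \near F, f x <= M) -> l <= M.
Proof.
move=> h hM; rewrite -(cvg_lim _ h)//; apply: limr_le => //.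
by apply/cvg_ex; exists l.
Qed.

(** * Geometrically dominated series *)

Definition gsum (R : realType) (u : nat -> R) : R := limn (series u).

Lemma eq_gsum (R : realType) (u v : nat -> R) : (forall n, u n = v n) -> gsum u = gsum v.
Proof. by move=> h; rewrite (_ : u = v)//; exact/funext. Qed.

Lemma series_geo_le (R : realType) (u : nat -> R) (C r : R) : 0 <= r -> r < 1 ->
  (forall n, `|u n| <= C * r ^+ n) -> forall N M, (N <= M)%N ->
  `|series u M - series u N| <= C * r ^+ N / (1 - r).
Proof.
move=> r0 r1 hu N M NM; rewrite sub_series_geq//.
have q0 : 0 < 1 - r by rewrite subr_gt0.
apply: le_trans (ler_norm_sum _ _ _) _.
apply: (@le_trans _ _ (\sum_(N <= k < M) C * r ^+ k)); first by apply: ler_sum => i _.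
rewrite ler_pdivlMr//.
have C0 : 0 <= C by have := le_trans (normr_ge0 _) (hu 0%N); rewrite expr0 mulr1.
suff -> : (\sum_(N <= k < M) C * r ^+ k) * (1 - r) = C * r ^+ N - C * r ^+ M.
  by rewrite gerBl mulr_ge0// exprn_ge0.
elim: M NM => [|M ih] NM; first by move: NM; rewrite leqn0 => /eqP ->; rewrite big_geq// mul0r subrr.
move: NM; rewrite leq_eqVlt => /orP[/eqP <-|NM]; first by rewrite big_geq// mul0r subrr.
by rewrite big_nat_recr//= mulrDl ih// exprS; ring.
Qed.

Lemma gsum_cvg (R : realType) (u : nat -> R) (C r : R) : 0 <= r -> r < 1 ->
  (forall n, `|u n| <= C * r ^+ n) -> series u @ \oo --> gsum u.
Proof.
move=> r0 r1 hu; have : cvgn (series u); last by [].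
apply: normed_cvg; apply: (@series_le_cvg R (fun n => `|u n|) (geometric C r)) => //.
- by move=> n; apply: le_trans (hu n).
- by apply: is_cvg_geometric_series; rewrite ger0_norm.
Qed.

Lemma gsum_eq (R : realType) (u : nat -> R) (s : R) : series u @ \oo --> s -> gsum u = s.
Proof. by move=> h; apply: cvg_lim. Qed.

Lemma gsum_tail (R : realType) (u : nat -> R) (C r : R) : 0 <= r -> r < 1 ->
  (forall n, `|u n| <= C * r ^+ n) -> forall N,
  `|gsum u - series u N| <= C * r ^+ N / (1 - r).
Proof.
move=> r0 r1 hu N; have h := gsum_cvg r0 r1 hu.
have h2 : `|series u M - series u N| @[M --> \oo] --> `|gsum u - series u N|.
  by apply: cvg_norm; apply: cvgB => //; exact: cvg_cst.
apply: (cvg_le_cst h2).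
by near=> M; apply: series_geo_le => //; near: M; exact: nbhs_infty_ge.
Unshelve. all: by end_near. Qed.

Lemma gsum_le (R : realType) (u : nat -> R) (C r : R) : 0 <= r -> r < 1 ->
  (forall n, `|u n| <= C * r ^+ n) -> `|gsum u| <= C / (1 - r).
Proof.
move=> r0 r1 hu; have := gsum_tail r0 r1 hu 0.
by rewrite /series/= big_geq// subr0 expr0 mulr1.
Qed.

Lemma gsumD (R : realType) (u v : nat -> R) (C D r : R) : 0 <= r -> r < 1 ->
  (forall n, `|u n| <= C * r ^+ n) -> (forall n, `|v n| <= D * r ^+ n) ->
  gsum (fun n => u n + v n) = gsum u + gsum v.
Proof.
move=> r0 r1 hu hv; apply: gsum_eq.
have -> : series (fun n => u n + v n) = (fun n => series u n + series v n).
  by apply/funext => n; rewrite /series/= big_split.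
by apply: cvgD; [exact: gsum_cvg hu|exact: gsum_cvg hv].
Qed.

Lemma gsumZ (R : realType) (u : nat -> R) (C r k : R) : 0 <= r -> r < 1 ->
  (forall n, `|u n| <= C * r ^+ n) -> gsum (fun n => k * u n) = k * gsum u.
Proof.
move=> r0 r1 hu; apply: gsum_eq.
have -> : series (fun n => k * u n) = (fun n => k * series u n).
  by apply/funext => n; rewrite /series/= big_distrr.
by apply: cvgZr; exact: gsum_cvg hu.
Qed.

(** Geometric tails are uniformly small and the head converges termwise. The filter is arbitrary
    because the lemma serves both sequences and difference quotients. *)
Lemma gsum_tannery (R : realType) (T : Type) (F : set_system T) {FF : ProperFilter F}
    (u : T -> nat -> R) (v : nat -> R) (C r : R) : 0 <= r -> r < 1 ->
  (\forall k \near F, forall i, `|u k i| <= C * r ^+ i) ->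
  (forall i, u k i @[k --> F] --> v i) -> gsum (u k) @[k --> F] --> gsum v.
Proof.
move=> r0 r1 hu huv.
have hv i : `|v i| <= C * r ^+ i.
  have h : `|u k i| @[k --> F] --> `|v i| by apply: cvg_norm; exact: huv.
  by apply: (cvg_le_cst h); apply: filterS hu => k; apply.
have q0 : 0 < 1 - r by rewrite subr_gt0.
have tl : C * r ^+ N / (1 - r) @[N --> \oo] --> 0.
  rewrite -(mul0r (1 - r)^-1); apply: cvgZl.
  by apply: cvg_geometric; rewrite ger0_norm.
apply/cvgrPdist_le => e e0.
have e3 : 0 < e / 3 by rewrite divr_gt0.
have [N _ /(_ N (leqnn N)) hN] := (cvgrPdist_le _ _).1 tl (e / 3) e3.
have hs : series (u k) N @[k --> F] --> series v N.
  rewrite /series/=; elim: N {hN} => [|N ih].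
    rewrite big_geq//; under eq_fun do rewrite big_geq//; exact: cvg_cst.
  by rewrite big_nat_recr//=; under eq_fun do rewrite big_nat_recr//=; exact: cvgD.
near=> k.
have hk : forall i, `|u k i| <= C * r ^+ i by near: k.
have h1 := gsum_tail r0 r1 hk N; have h2 := gsum_tail r0 r1 hv N.
have h3 : `|series v N - series (u k) N| <= e / 3.
  by near: k; exact: (cvgrPdist_le _ _).1 hs _ e3.
have h4 : C * r ^+ N / (1 - r) <= e / 3 by apply: le_trans hN; rewrite sub0r normrN ler_norm.
have -> : gsum v - gsum (u k) = (gsum v - series v N) + (series v N - series (u k) N)
   + - (gsum (u k) - series (u k) N) by ring.
apply: le_trans (ler_normD _ _) _; rewrite normrN.
have h5 := ler_normD (gsum v - series v N) (series v N - series (u k) N).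
lra.
Unshelve. all: by end_near. Qed.

(** The N-th partial sum of the product series is the sum over i < N of u_i times a partial sum of
    [v] of length N - i. For fixed i that factor tends to the whole sum of [v], with a geometric
    majorant in i. *)
Lemma gsum_cauchy (R : realType) (u v : nat -> R) (C D r : R) : 0 <= r -> r < 1 ->
  (forall n, `|u n| <= C * r ^+ n) -> (forall n, `|v n| <= D * r ^+ n) ->
  series (fun n => \sum_(i < n.+1) u i * v (n - i)%N) @ \oo --> gsum u * gsum v.
Proof.
move=> r0 r1 hu hv.
have D0 : 0 <= D by have := le_trans (normr_ge0 _) (hv 0%N); rewrite expr0 mulr1.
have q0 : 0 < 1 - r by rewrite subr_gt0.
pose w N i := if (i < N)%N then u i * series v (N - i)%N else 0.
have sE N : series (fun n => \sum_(i < n.+1) u i * v (n - i)%N) N = \sum_(i < N) u i * series v (N - i)%N.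
  elim: N => [|N ih]; first by rewrite /series/= big_geq// big_ord0.
  have -> : series (fun n => \sum_(i < n.+1) u i * v (n - i)%N) N.+1 = series (fun n => \sum_(i < n.+1) u i * v (n - i)%N) N + \sum_(i < N.+1) u i * v (N - i)%N.
    by rewrite /series/= big_nat_recr.
  rewrite ih !big_ord_recr/= addrA -big_split/=.
  congr (_ + _); last by rewrite subSnn subnn /series/= big_nat1.
 
  apply: eq_bigr => i _; rewrite -mulrDr; congr (_ * _).
  by rewrite subSn ?(ltnW (ltn_ord i))// /series/= big_nat_recr.
have wE N : gsum (w N) = \sum_(i < N) u i * series v (N - i)%N.
  apply: gsum_eq; apply: (@cvg_trans _ (cst (\sum_(i < N) u i * series v (N - i)%N) @ \oo)); last exact: cvg_cst.
  apply: near_eq_cvg; near=> M; have NM : (N <= M)%N by near: M; exact: nbhs_infty_ge.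
  rewrite /series/= (big_cat_nat (leq0n N) NM)//= big_mkord [X in _ = _ + X]big1_seq ?addr0; last first.
    by move=> i /=; rewrite mem_index_iota => /andP[Ni _]; rewrite /w ltnNge Ni.
  by apply: eq_bigr => i _; rewrite /w ltn_ord.
have -> : gsum u * gsum v = gsum (fun i => u i * gsum v).
  by rewrite mulrC -(gsumZ _ r0 r1 hu); apply: eq_gsum => n; rewrite mulrC.
have -> : series (fun n => \sum_(i < n.+1) u i * v (n - i)%N) = fun N => gsum (w N).
  by apply/funext => N; rewrite sE wE.
apply: (gsum_tannery (C := C * (D / (1 - r))) r0 r1).
- near=> N => i; rewrite /w; case: ifPn => _; last first.
    rewrite normr0 mulr_ge0 ?exprn_ge0// mulr_ge0 ?divr_ge0 ?(ltW q0)//.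
    by have := le_trans (normr_ge0 _) (hu 0%N); rewrite expr0 mulr1.
  rewrite normrM mulrAC; apply: ler_pM => //.
  have := series_geo_le r0 r1 hv (leq0n (N - i)).
  by rewrite [series v 0]/series/= big_geq// subr0 expr0 mulr1.
- move=> i; apply: (@cvg_trans _ (u i * series v (N - i)%N @[N --> \oo])).
    apply: near_eq_cvg; near=> N.
    by rewrite /w; case: ifPn => //; rewrite -leqNgt leqNgt; have -> : (i < N)%N by near: N; exact: nbhs_infty_gt.
  apply: cvgZr; rewrite -(cvg_shiftn i).
  by under eq_fun do rewrite addnK; exact: gsum_cvg hv.
Unshelve. all: by end_near. Qed.

Definition dsum (R : realType) (u : nat -> nat -> R) : R :=
  gsum (fun n => gsum (fun m => u m n)).

(** A product of geometric bounds in both indices: under it every exchange of limit and double sum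
    below is an instance of [dsum_tannery]. *)
Definition dgeo (R : realType) (C r : R) (u : nat -> nat -> R) : Prop :=
  forall m n, `|u m n| <= C * r ^+ m * r ^+ n.

Lemma dgeo_row (R : realType) (C r : R) (u : nat -> nat -> R) n : dgeo C r u ->
  forall m, `|u m n| <= C * r ^+ n * r ^+ m.
Proof. by move=> h m; rewrite mulrAC; exact: h. Qed.

Lemma dgeo_gsum (R : realType) (C r : R) (u : nat -> nat -> R) : 0 <= r -> r < 1 -> dgeo C r u ->
  forall n, `|gsum (fun m => u m n)| <= C / (1 - r) * r ^+ n.
Proof. by move=> r0 r1 h n; rewrite mulrAC; exact: gsum_le r0 r1 (dgeo_row n h). Qed.

Lemma eq_dsum (R : realType) (u v : nat -> nat -> R) : (forall m n, u m n = v m n) -> dsum u = dsum v.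
Proof. by move=> h; apply: eq_gsum => n; apply: eq_gsum. Qed.

Lemma dsum_iterated (R : realType) (C r : R) (u : nat -> nat -> R) : 0 <= r -> r < 1 ->
  dgeo C r u -> iterated_sum u (dsum u).
Proof.
move=> r0 r1 h; split.
  by move=> n; apply/cvg_ex; exists (gsum (fun m => u m n)); exact: gsum_cvg r0 r1 (dgeo_row n h).
exact: gsum_cvg r0 r1 (dgeo_gsum r0 r1 h).
Qed.

Lemma dsumD (R : realType) (u v : nat -> nat -> R) (C D r : R) : 0 <= r -> r < 1 ->
  dgeo C r u -> dgeo D r v -> dsum (fun m n => u m n + v m n) = dsum u + dsum v.
Proof.
move=> r0 r1 hu hv; rewrite /dsum -(gsumD r0 r1 (dgeo_gsum r0 r1 hu) (dgeo_gsum r0 r1 hv)).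
by apply: eq_gsum => n; exact: gsumD r0 r1 (dgeo_row n hu) (dgeo_row n hv).
Qed.

Lemma dsumZ (R : realType) (u : nat -> nat -> R) (C r k : R) : 0 <= r -> r < 1 ->
  dgeo C r u -> dsum (fun m n => k * u m n) = k * dsum u.
Proof.
move=> r0 r1 hu; rewrite /dsum -(gsumZ _ r0 r1 (dgeo_gsum r0 r1 hu)).
by apply: eq_gsum => n; exact: gsumZ r0 r1 (dgeo_row n hu).
Qed.

Lemma dsum_prod (R : realType) (u v : nat -> R) (C D r : R) : 0 <= r -> r < 1 ->
  (forall n, `|u n| <= C * r ^+ n) -> (forall n, `|v n| <= D * r ^+ n) ->
  dsum (fun m n => u n * v m) = gsum u * gsum v.
Proof.
move=> r0 r1 hu hv; rewrite mulrC -(gsumZ _ r0 r1 hu); apply: eq_gsum => n.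
by rewrite (gsumZ _ r0 r1 hv) mulrC.
Qed.

Lemma dsum_tannery (R : realType) (T : Type) (F : set_system T) {FF : ProperFilter F}
    (u : T -> nat -> nat -> R) (v : nat -> nat -> R) (C r : R) : 0 <= r -> r < 1 ->
  (\forall k \near F, dgeo C r (u k)) ->
  (forall m n, u k m n @[k --> F] --> v m n) -> dsum (u k) @[k --> F] --> dsum v.
Proof.
move=> r0 r1 hu huv; apply: (gsum_tannery (C := C / (1 - r)) r0 r1).
- by apply: filterS hu => k hk; exact: dgeo_gsum r0 r1 hk.
- move=> n; apply: (gsum_tannery (C := C * r ^+ n) r0 r1) => //.
  by apply: filterS hu => k hk; exact: dgeo_row.
Qed.

(** * Small denominators and products of sines *)

Lemma cos_pi4_ge (R : realType) : 2^-1 <= cos (pi / 4 : R).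
Proof.
have pp := @pi_gt0 R.
have c0 : 0 <= cos (pi / 4 : R) by apply: cos_ge0_pihalf; apply/andP; split; lra.
have := cos_mulr2n (pi / 4 : R).
have -> : (pi / 4) *+ 2 = pi / 2 :> R by rewrite mulr2n; field.
rewrite cos_pihalf mulr2n; clear pp; move: c0; generalize (cos (pi / 4 : R)) => c c0 h.
by nra.
Qed.

Lemma sin_lb (R : realType) (x : R) : 0 <= x -> x <= pi / 2 -> x / 4 <= sin x.
Proof.
move=> x0 x1; have pp := @pi_gt0 R.
have ph := (@pihalf_02_cos_pihalf R).1.
have hc (y : R) : 0 <= y -> y <= pi / 4 -> 2^-1 <= cos y.
  move=> y0 y1; apply: le_trans (cos_pi4_ge R) _.
  rewrite leNgt ltr_cos ?in_itv/= -?leNgt//; apply/andP; split; lra.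
have [x2|x2] := leP x (pi / 4).
  move: x0; rewrite le_eqVlt => /orP[/eqP <-|x0]; first by rewrite mul0r sin0.
  have [c] := @MVT R sin cos 0 x x0 (fun y _ => is_derive_sin y)
     (continuous_subspaceT (@continuous_sin R)).
  rewrite in_itv/= sin0 !subr0 => /andP[c0 c1] ->.
  have := hc c (ltW c0) (ltW (lt_le_trans c1 x2)) => h; clear -h x0; nra.
have := hc (pi / 2 - x); rewrite -cosN opprB cosBpihalf => h.
have {}h : 2^-1 <= sin x by apply: h; lra.
lra.
Qed.

Lemma sin_pi_lb (R : realType) (y d : R) : 0 <= y -> (forall m : nat, d <= `|y - m%:R|) ->
  d / 8 <= `|sin (pi * y)|.
Proof.
move=> y0 hd; have pp := @pi_ge2 R.
have /andP[m0 m1] := truncn_itv y0; move: m0 m1; set m := Num.truncn y => m0 m1.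
have e : pi * y = m%:R * pi + pi * (y - m%:R) by ring.
rewrite e sin_addn_pi normrM normrX normrN1 expr1n mul1r.
have d0 := hd m; have d1 := hd m.+1.
rewrite ger0_norm ?subr_ge0// in d0.
rewrite distrC ger0_norm ?subr_ge0 ?(ltW m1)// in d1.
move: m0 m1 d0 d1; rewrite -natr1; set t := y - m%:R => m0 m1 d0 d1.
have t0 : 0 <= t by rewrite subr_ge0.
have {}d1 : d <= 1 - t by rewrite /t; lra.
have t1 : 0 <= 1 - t by rewrite /t; lra.
clear m0 m1; clearbody t; move: pp; set p := pi => pp.
apply: le_trans (ler_norm _).
have [h|h] := leP t 2^-1.
  apply: (@le_trans _ _ (p * t / 4)); last by apply: sin_lb; rewrite -/p; nra.
  nra.
have -> : p * t = 1%:R * p - p * (1 - t) by ring.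
rewrite sin_subn_pi expr1 opprK mul1r.
apply: (@le_trans _ _ (p * (1 - t) / 4)); last by apply: sin_lb; rewrite -/p; nra.
nra.
Qed.

(** Base 2 in the definition of [setL]: only finitely many pairs come closer than 2^(- q). Each of
    them is at positive distance since [al] is irrational, and [c] is the smallest of these
    distances, capped by 1. *)
Lemma nonLiouville_lb (R : realType) (al : R) : ~ (@setL R `|` @rational R) al ->
  exists2 c : R, 0 < c & forall m n : nat, (0 < n)%N -> c * 2^-1 ^+ n <= `|al * n%:R - m%:R|.
Proof.
move=> hal.
have irr : irrational al by move=> h; apply: hal; right.
have irr2 (m n : nat) : (0 < n)%N -> 0 < `|al * n%:R - m%:R|.
  move=> n0; rewrite normr_gt0 subr_eq0; apply/eqP => h; apply: irr.
  exists (m%:R / n%:R) => //=; rewrite fmorph_div/= !ratr_nat -h mulfK//.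
  by rewrite pnatr_eq0 -lt0n.
have fin : finite_set [set pq : int * int | 1 <= pq.2 /\
        `|al - pq.1%:~R / pq.2%:~R| < (2 ^ pq.2)^-1].
  apply: contrapT => h; apply: hal; left; split => //.
  by exists 2; split => //; rewrite ltr1n.
have /finite_seqP[s hs] := fin.
have [c c0 hc] : exists2 c : R, 0 < c & forall m n : nat, (0 < n)%N ->
    (m%:Z, n%:Z) \in s -> c <= `|al * n%:R - m%:R|.
  elim: s {hs} => [|[p q] s [c c0 ih]]; first by exists 1.
  pose c' := `|al * (`|q|%N)%:R - (`|p|%N)%:R|.
  have [q0|q0] := posnP `|q|%N.
    exists c => // m n n0; rewrite inE => /orP[/eqP[_ e]|]; last exact: ih.
    by move: q0; rewrite -e/= => n0'; rewrite n0' in n0.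
  exists (Num.min c c'); first by rewrite lt_min c0 irr2.
  move=> m n n0; rewrite inE => /orP[/eqP[e1 e2]|h].
    by rewrite ge_min; apply/orP; right; rewrite /c' -e1 -e2.
  by rewrite ge_min (ih m n n0 h).
exists (Num.min c 1); first by rewrite lt_min c0 ltr01.
move=> m n n0.
have hm0 : 0 < Num.min c 1 by rewrite lt_min c0 ltr01.
have [h|h] := boolP ((m%:Z, n%:Z) \in s).
  apply: le_trans (hc m n n0 h); apply: (@le_trans _ _ (Num.min c 1)).
    by rewrite ler_piMr ?(ltW hm0)// exprn_ile1// invf_le1// ler1n.
  by rewrite ge_min lexx.
have : ~ [set` s] (m%:Z, n%:Z) by rewrite /=; exact/negP.
rewrite -hs /= => /not_andP[]; first by rewrite lez_nat n0.
move=> /negP; rewrite -leNgt => h2.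
have nr : 0 < n%:R :> R by rewrite ltr0n.
apply: (@le_trans _ _ (1 * 2^-1 ^+ n)).
  by apply: ler_wpM2r; [rewrite exprn_ge0|rewrite ge_min lexx orbT].
rewrite mul1r exprVn.
have -> : al * n%:R - m%:R = n%:R * (al - m%:R / n%:R).
  by field; rewrite gt_eqF.
rewrite normrM (gtr0_norm nr); apply: le_trans h2 _.
by rewrite ler_peMl// ler1n.
Qed.

(** The bound for pi / al reduces to the one for [al] through |m / al - n| = |al n - m| / al. Only n
    up to about B m matters, where B >= 1 / al, which is why the base becomes 2^B; larger n are at
    distance at least 1. *)
Lemma sin_alpha_lb (R : realType) (al : R) : 0 < al -> ~ (@setL R `|` @rational R) al ->
  exists c b : R, [/\ 0 < c, 1 <= b,
   (forall n, (0 < n)%N -> c / b ^+ n <= `|sin (n%:R * (pi * al))|) &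
   (forall n, (0 < n)%N -> c / b ^+ n <= `|sin (n%:R * (pi / al))|)].
Proof.
move=> al0 hal; have [c c0 hc] := nonLiouville_lb hal.
pose B := (Num.truncn al^-1).+1.
have hB : al^-1 <= B%:R by exact/ltW/truncnS_gt.
(* The four entries serve the cases 1 <= n <= B m + 1, multiples of pi al, n = 0, and n > B m + 1;
   each contains the factor 1/8 lost in [sin_pi_lb]. *)
pose c1 := Num.min (c / 2 / al / 8) (Num.min (c / 8) (Num.min (al^-1 / 8) 8^-1)).
have c10 : 0 < c1.
  rewrite !lt_min invr_gt0 ltr0n andbT.
  by rewrite (divr_gt0 (divr_gt0 (divr_gt0 c0 _) al0)) ?(divr_gt0 c0)// divr_gt0// invr_gt0.
exists c1, (2 ^+ B); split => //.
- by rewrite exprn_ege1// ler1n.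
- move=> n n0.
  have -> : n%:R * (pi * al) = pi * (al * n%:R) by ring.
  apply: le_trans (sin_pi_lb _ (hc^~ n ^~ n0)); last by rewrite mulr_ge0 ?(ltW al0).
  rewrite -exprM mulrAC; apply: ler_pM; rewrite ?invr_ge0 ?exprn_ge0 ?(ltW c10)//.
    by rewrite /c1 !ge_min lexx orbT.
  rewrite exprVn lef_pV2 ?posrE ?exprn_gt0//.
  by apply: ler_weXn2l; [rewrite ler1n|rewrite leq_pmull].
- move=> m m0.
  have -> : m%:R * (pi / al) = pi * (m%:R / al) by ring.
  have mr : 0 < m%:R :> R by rewrite ltr0n.
  have key n : c1 * 8 / 2 ^+ B ^+ m <= `|m%:R / al - n%:R|.
    have B1 : 1 <= (2 ^+ B) ^+ m :> R by rewrite -exprM exprn_ege1// ler1n.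
    have B0 : 0 < (2 ^+ B) ^+ m :> R by exact: lt_le_trans B1.
    have [n0|n0] := posnP n.
      rewrite n0 subr0 ger0_norm; last by rewrite divr_ge0 ?(ltW al0)// ltW.
      apply: (@le_trans _ _ (c1 * 8)).
        by rewrite ler_pdivrMr// ler_peMr// mulr_ge0 ?(ltW c10).
      apply: (@le_trans _ _ al^-1); last first.
        by rewrite ler_peMl ?ler1n// invr_ge0 ltW.
      by rewrite -ler_pdivlMr// /c1 !ge_min lexx !orbT.
    have [nB|nB] := leqP n (B * m).+1.
      have -> : m%:R / al - n%:R = - ((al * n%:R - m%:R) / al) by field; rewrite gt_eqF.
      rewrite normrN normrM normfV (gtr0_norm al0).
      rewrite ler_pdivlMr//; apply: le_trans (hc m n n0).
      apply: (@le_trans _ _ (c / 2 * ((2 ^+ B) ^+ m)^-1)).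
        rewrite mulrAC; apply: ler_wpM2r; first by rewrite invr_ge0 ltW.
        have : c1 <= c / 2 / al / 8 by rewrite ge_min lexx.
        rewrite ler_pdivlMr// ler_pdivlMr// => h; lra.
      rewrite -mulrA; apply: ler_wpM2l; first exact: ltW.
      rewrite -exprM -invfM -exprS exprVn lef_pV2 ?posrE ?exprn_gt0//.
      by apply: ler_weXn2l; rewrite ?ler1n.
    apply: (@le_trans _ _ (c1 * 8)).
      by rewrite ler_pdivrMr// ler_peMr// mulr_ge0 ?(ltW c10).
    have h1 : m%:R / al <= B%:R * m%:R by rewrite mulrC ler_wpM2r// ltW.
    have h2 : (B * m).+2%:R <= n%:R :> R by rewrite ler_nat.
    move: h2; rewrite -!natr1 natrM => h2.
    rewrite distrC ger0_norm; last by lra.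
    have h3 : B%:R * m%:R + 2 <= n%:R :> R by lra.
    apply: (@le_trans _ _ 1); last by lra.
    have : c1 <= 8^-1 by rewrite /c1 !ge_min lexx !orbT.
    by move=> h; lra.
  have -> : c1 / (2 ^+ B) ^+ m = c1 * 8 / (2 ^+ B) ^+ m / 8.
    have B0 : (2 ^+ B) ^+ m != 0 :> R by rewrite -exprM expf_neq0.
    by move: B0; set b := _ ^+ m => B0; field.
  by apply: sin_pi_lb key; rewrite divr_ge0 ?(ltW al0)// ltW.
Qed.

(** Up to a phase this is the q-binomial coefficient (a; q)_n / (q; q)_n with a = e^(2 i tau) and q
    = e^(2 i om). *)
Definition sprod (R : realType) (tau om : R) (n : nat) : R :=
  \prod_(j < n) (sin (tau + j%:R * om) / sin (j.+1%:R * om)).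

Lemma sprodS (R : realType) (tau om : R) (n : nat) : sin (n.+1%:R * om) != 0 ->
  sprod tau om n.+1 * sin (n.+1%:R * om) = sprod tau om n * sin (tau + n%:R * om).
Proof. by move=> h; rewrite /sprod big_ord_recr/= mulrA divfK. Qed.

(** Imaginary and real parts of one exponential sum. Passing from m to m + 1 multiplies it by e^(i
    tau) and adds one term, which mixes the parts; hence the joint induction. *)
Lemma sprod_cos_sin (R : realType) (tau om : R) (m : nat) :
  (forall k, (0 < k)%N -> sin (k%:R * om) != 0) ->
  \sum_(j < m.+1) sprod tau om j * sin ((m - j)%:R * tau - j%:R * om) = 0 /\
  sin tau * \sum_(j < m.+1) sprod tau om j * cos ((m - j)%:R * tau - j%:R * om) =
  sprod tau om m * sin (tau + m%:R * om).
Proof.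
move=> h; elim: m => [|m [ih1 ih2]].
  rewrite !big_ord_recl !big_ord0 subnn /sprod big_ord0 /= !mul0r subr0 sin0 cos0; split; first ring.
  by rewrite !addr0 mulr1 mul1r mulr1.
have E (j : 'I_m.+1) : (m.+1 - j)%:R * tau - j%:R * om = (m - j)%:R * tau - j%:R * om + tau.
  by rewrite subSn ?(leq_ord j)// -natr1; ring.
have Z : 0 * tau - m.+1%:R * om = - (m.+1%:R * om) by ring.
rewrite [X in X = 0]big_ord_recr [X in sin tau * X]big_ord_recr/= subnn Z sinN cosN.
have -> : \sum_(j < m.+1) sprod tau om j * sin ((m.+1 - j)%:R * tau - j%:R * om) =
   cos tau * (\sum_(j < m.+1) sprod tau om j * sin ((m - j)%:R * tau - j%:R * om)) +
   sin tau * (\sum_(j < m.+1) sprod tau om j * cos ((m - j)%:R * tau - j%:R * om)).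
  rewrite !big_distrr -big_split/=; apply: eq_bigr => j _.
  by rewrite E sinD; ring.
have -> : \sum_(j < m.+1) sprod tau om j * cos ((m.+1 - j)%:R * tau - j%:R * om) =
   cos tau * (\sum_(j < m.+1) sprod tau om j * cos ((m - j)%:R * tau - j%:R * om)) -
   sin tau * (\sum_(j < m.+1) sprod tau om j * sin ((m - j)%:R * tau - j%:R * om)).
  rewrite !big_distrr -sumrB/=; apply: eq_bigr => j _.
  by rewrite E cosD; ring.
have hS := sprodS tau (h m.+1 isT).
rewrite ih1 mulr0 add0r ih2 mulr0 subr0; split; first by rewrite mulrN hS subrr.
rewrite sinD; set Yc := \sum_(j < _) _ in ih2 *.
rewrite mulrDr mulrCA ih2 -hS; ring.
Qed.

(** Coefficient form of x F' = F G, where F generates the products and G the quotients of sines. The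
    induction multiplies by sin((n + 1) om) and splits n + 1 as (n + 1 - j) + j in the addition
    formula; the cosine terms are then summed by [sprod_cos_sin]. *)
Lemma sprod_rec (R : realType) (tau om : R) (n : nat) :
  (forall k, (0 < k)%N -> sin (k%:R * om) != 0) ->
  n%:R * sprod tau om n =
  \sum_(j < n) sprod tau om j * (sin ((n - j)%:R * tau) / sin ((n - j)%:R * om)).
Proof.
move=> h; elim: n => [|n ih]; first by rewrite mul0r big_ord0.
apply: (mulIf (h n.+1 isT)).
have hS := sprodS tau (h n.+1 isT).
rewrite -mulrA hS -[n.+1%:R in LHS]natr1 mulrDl mulrA ih mul1r.
have [_ <-] := sprod_cos_sin tau n h.
rewrite [RHS]big_distrl/=.
have e1 (j : 'I_n.+1) : sprod tau om j * (sin ((n.+1 - j)%:R * tau) / sin ((n.+1 - j)%:R * om)) *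
   sin (n.+1%:R * om) =
   sprod tau om j * sin ((n.+1 - j)%:R * tau) * cos (j%:R * om) +
   (sprod tau om j * sin (j%:R * om)) * (sin ((n.+1 - j)%:R * tau) / sin ((n.+1 - j)%:R * om) * cos ((n.+1 - j)%:R * om)).
  have sn : sin ((n.+1 - j)%:R * om) != 0 by apply: h; rewrite subn_gt0.
  have -> : n.+1%:R * om = (n.+1 - j)%:R * om + j%:R * om.
    by rewrite -mulrDl -natrD subnK// ltnW.
  rewrite sinD; move: sn; set S := sin ((n.+1 - j)%:R * om) => sn; field.
  exact: sn.
under [RHS]eq_bigr do rewrite e1.
rewrite big_split/= [X in _ = _ + X]big_ord_recl/= mul0r sin0 mulr0 mul0r add0r.
have -> : \sum_(i < n) sprod tau om (bump 0 i) * sin ((bump 0 i)%:R * om) *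
   (sin ((n.+1 - bump 0 i)%:R * tau) / sin ((n.+1 - bump 0 i)%:R * om) * cos ((n.+1 - bump 0 i)%:R * om)) =
   \sum_(i < n) sprod tau om i * sin (tau + i%:R * om) *
   (sin ((n - i)%:R * tau) / sin ((n - i)%:R * om) * cos ((n - i)%:R * om)).
  by apply: eq_bigr => i _; rewrite /bump/= add1n subSS sprodS//; exact: h.
have -> : (\sum_(j < n) sprod tau om j * (sin ((n - j)%:R * tau) / sin ((n - j)%:R * om))) *
   sin (tau + n%:R * om) =
  \sum_(j < n.+1) sprod tau om j * sin ((n - j)%:R * tau) * cos (tau + j%:R * om) +
  \sum_(i < n) sprod tau om i * sin (tau + i%:R * om) *
   (sin ((n - i)%:R * tau) / sin ((n - i)%:R * om) * cos ((n - i)%:R * om)).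
  rewrite big_ord_recr/= subnn !mul0r sin0 mulr0 mul0r addr0 big_distrl -big_split/=.
  apply: eq_bigr => j _.
  have sn : sin ((n - j)%:R * om) != 0 by apply: h; rewrite subn_gt0.
  have -> : tau + n%:R * om = (n - j)%:R * om + (tau + j%:R * om).
    by rewrite addrCA -mulrDl -natrD subnK// ltnW.
  set Z := tau + j%:R * om; clearbody Z.
  rewrite sinD; move: sn; set S := sin ((n - j)%:R * om) => sn; field.
  exact: sn.
rewrite addrAC; congr (_ + _).
rewrite big_distrr -big_split/=; apply: eq_bigr => j _.
rewrite subSn ?(leq_ord j)// -natr1 mulrDl mul1r sinD cosB cosD; ring.
Qed.

Definition pcoef (R : realType) (tau om : R) (n : nat) : R := (-1) ^+ n * sprod tau om n.

Lemma sratio0 (R : realType) (tau om : R) : sratio tau om 0 = 0.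
Proof. by rewrite /sratio !mul0r sin0 mulr0 mul0r. Qed.

Lemma pcoef_rec (R : realType) (tau om : R) (n : nat) :
  (forall k, (0 < k)%N -> sin (k%:R * om) != 0) ->
  n%:R * pcoef tau om n = \sum_(j < n.+1) pcoef tau om j * sratio tau om (n - j)%N.
Proof.
move=> h; rewrite big_ord_recr/= subnn sratio0 mulr0 addr0.
rewrite /pcoef mulrCA sprod_rec// big_distrr/=; apply: eq_bigr => j _.
have -> : (-1) ^+ n = (-1) ^+ j * (-1) ^+ (n - j) :> R by rewrite -exprD subnKC// ltnW.
by rewrite /sratio; ring.
Qed.

Lemma sratio_le (R : realType) (tau om c b : R) : 0 < c -> 1 <= b ->
  (forall n, (0 < n)%N -> c / b ^+ n <= `|sin (n%:R * om)|) ->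
  forall n, `|sratio tau om n| <= c^-1 * b ^+ n.
Proof.
move=> c0 b1 h n; have b0 : 0 < b by exact: lt_le_trans b1.
have [->|n0] := posnP n.
  by rewrite sratio0 normr0 mulr_ge0 ?invr_ge0 ?exprn_ge0 ?ltW.
have bn : 0 < b ^+ n by rewrite exprn_gt0.
have s0 : 0 < `|sin (n%:R * om)| by apply: lt_le_trans (h n n0); rewrite divr_gt0.
rewrite /sratio !normrM normrX normrN1 expr1n mul1r normfV.
have s1 : `|sin (n%:R * tau)| <= 1 by rewrite ler_norml sin_geN1 sin_le1.
rewrite ler_pdivrMr//; apply: (le_trans s1).
rewrite -(@ler_pM2l _ (c / b ^+ n)) ?divr_gt0// mulr1.
apply: (le_trans (h n n0)).
rewrite le_eqVlt; apply/orP; left; apply/eqP.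
by move: bn; set B := b ^+ n => bn; field; rewrite !gt_eqF.
Qed.

(** In the recursion for n p_n each of the n summands is at most (b (1 + 1/c))^n. The factorwise
    estimate of the product would only give a power of [b] quadratic in [n]. *)
Lemma pcoef_le (R : realType) (tau om c b : R) : 0 < c -> 1 <= b ->
  (forall n, (0 < n)%N -> c / b ^+ n <= `|sin (n%:R * om)|) ->
  forall n, `|pcoef tau om n| <= (b * (1 + c^-1)) ^+ n.
Proof.
move=> c0 b1 h; have b0 : 0 < b by exact: lt_le_trans b1.
have hr := sratio_le tau c0 b1 h.
have sn k : (0 < k)%N -> sin (k%:R * om) != 0.
  by move=> k0; rewrite -normr_gt0; apply: lt_le_trans (h k k0); rewrite divr_gt0 ?exprn_gt0.
set C := c^-1 in hr *; have C0 : 0 < C by rewrite invr_gt0.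
elim/ltn_ind => n ih.
have [->|n0] := posnP n; first by rewrite /pcoef /sprod big_ord0 !expr0 mulr1 normr1.
have nr : 0 < n%:R :> R by rewrite ltr0n.
rewrite -(ler_pM2l nr) -{1}(gtr0_norm nr) -normrM pcoef_rec// big_ord_recr/= subnn sratio0 mulr0 addr0.
apply: le_trans (ler_norm_sum _ _ _) _.
apply: (@le_trans _ _ (\sum_(i < n) (b * (1 + C)) ^+ n)); last first.
  by rewrite sumr_const card_ord mulr_natl.
apply: ler_sum => j _; rewrite normrM.
apply: (@le_trans _ _ ((b * (1 + C)) ^+ j * (C * b ^+ (n - j)))); first by apply: ler_pM => //; exact: ih.
have -> : (b * (1 + C)) ^+ n = (b * (1 + C)) ^+ j * (b * (1 + C)) ^+ (n - j).
  by rewrite -exprD subnKC// ltnW.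
apply: ler_wpM2l; first by rewrite exprn_ge0 ?mulr_ge0 ?addr_ge0 ?ltW.
rewrite exprMn mulrC; apply: ler_wpM2l; first by rewrite exprn_ge0// ltW.
have nj : (0 < n - j)%N by rewrite subn_gt0.
rewrite -(prednK nj) exprS; apply: (@le_trans _ _ ((1 + C) * 1)); first by rewrite mulr1 lerDr.
apply: ler_wpM2l; first by rewrite addr_ge0 ?ltW.
by rewrite exprn_ege1// lerDl ltW.
Qed.

(** * Gamma function and Post-Widder inversion *)

Lemma is_derive_cvg (R : realType) (f : R -> R) (x l : R) :
  h^-1 * (f (h + x) - f x) @[h --> 0^'] --> l -> is_derive x 1 f l.
Proof.
move=> hl; have hl' : h^-1 *: (f (h *: 1 + x) - f x) @[h --> 0^'] --> l.
  by apply: cvg_trans hl; apply: near_eq_cvg; near=> h; rewrite /GRing.scale/= mulr1.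
apply: DeriveDef; first by apply/cvg_ex; exists l.
exact: cvg_lim hl'.
Unshelve. all: by end_near. Qed.

(** The intermediate power c^(e - 1) is largest at one endpoint or the other, according to the sign
    of e - 1; the sum of both endpoint values avoids the distinction. *)
Lemma powR_mvt (R : realType) (e a b x y : R) : 0 < a ->
  a <= x -> x <= b -> a <= y -> y <= b ->
  `|x `^ e - y `^ e| <= `|x - y| * (`|e| * (a `^ (e - 1) + b `^ (e - 1))).
Proof.
move=> a0 ax xb ay yb.
wlog xy : x y ax xb ay yb / x < y.
  move=> h; have [xy|xy|->] := ltgtP x y; first exact: h.
    by rewrite distrC [`|x - y|]distrC; exact: h.
  by rewrite !subrr normr0 mul0r.
have x0 : 0 < x by exact: lt_le_trans ax.
have hd z : z \in `]x, y[ -> is_derive z 1 (@powR R ^~ e) (e * z `^ (e - 1)).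
  by rewrite in_itv/= => /andP[xz _]; exact: is_derive_powR (lt_trans x0 xz).
have hc : {within `[x, y], continuous (@powR R ^~ e)}.
  apply: derivable_within_continuous => z; rewrite in_itv/= => /andP[xz _].
  by have [] := is_derive_powR e (lt_le_trans x0 xz).
have [c] := MVT xy hd hc.
rewrite in_itv/= => /andP[xc cy] h.
rewrite distrC h normrM normrM [`|y - x|]distrC mulrC.
apply: ler_wpM2l => //; apply: ler_wpM2l => //.
have c0 : 0 < c by exact: lt_trans xc.
rewrite ger0_norm ?powR_ge0//.
have [e1|e1] := leP 0 (e - 1).
  apply: (@le_trans _ _ (b `^ (e - 1))); last by rewrite lerDr powR_ge0.
  apply: ge0_ler_powR => //; rewrite ?nnegrE ?(ltW c0)//.
    by rewrite (le_trans (ltW x0))// (le_trans (ltW xy)).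
  exact: le_trans (ltW cy) yb.
apply: (@le_trans _ _ (a `^ (e - 1))); last by rewrite lerDl powR_ge0.
rewrite -(opprK (e - 1)) powRN [leRHS]powRN lef_pV2 ?posrE ?powR_gt0//.
apply: ge0_ler_powR => //; rewrite ?nnegrE ?(ltW c0) ?(ltW a0)//.
  by rewrite oppr_ge0 ltW.
exact: le_trans ax (ltW xc).
Qed.

Lemma mulSn_geo (R : realType) (x : R) (n : nat) : 0 <= x -> x < 1 -> n.+1%:R * x ^+ n <= (1 - x)^-1.
Proof.
move=> x0 x1; have q0 : 0 < 1 - x by rewrite subr_gt0.
rewrite -[leRHS]mul1r ler_pdivlMr//.
apply: (@le_trans _ _ ((\sum_(i < n.+1) x ^+ i) * (1 - x))).
  apply: ler_wpM2r; first exact: ltW.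
  rewrite mulr_natl -[n.+1 in leLHS]card_ord -sumr_const; apply: ler_sum => i _.
  by apply: ler_wiXn2l => //; [exact: ltW|rewrite -ltnS].
by rewrite mulrC -opprB mulNr -subrX1 opprB gerBl exprn_ge0.
Qed.

(* The coefficient families are only required to be geometric at each point q > q0;
   a polynomial factor in the indices is absorbed by enlarging the ratio. *)
Definition geo_beyond (R : realType) (q0 : R) (a e : nat -> nat -> R) : Prop :=
  forall q, q0 < q -> exists C r : R, [/\ 0 <= r, r < 1 & dgeo C r (fun m n => a m n * q `^ e m n)].

Definition lin_bounded (R : realType) (e : nat -> nat -> R) : Prop :=
  exists2 K : R, 0 <= K & forall m n, `|e m n| <= K * (m.+1%:R * n.+1%:R).

(** Half of the decay is spent on the polynomial factor: with r = x^2, the quantity (m + 1) x^m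
    stays below 1 / (1 - x). *)
Lemma dgeo_poly (R : realType) (C r : R) (u w : nat -> nat -> R) : 0 <= r -> r < 1 -> dgeo C r u ->
  lin_bounded w -> exists C' r' : R, [/\ 0 <= r', r' < 1 & dgeo C' r' (fun m n => w m n * u m n)].
Proof.
move=> r0 r1 hu [K K0 hw]; pose x := Num.sqrt r.
have x0 : 0 <= x by exact: sqrtr_ge0.
have xx : r = x * x by rewrite -expr2 sqr_sqrtr.
have x1 : x < 1 by rewrite -sqrtr1 ltr_sqrt.
have C0 : 0 <= C by have := le_trans (normr_ge0 _) (hu 0%N 0%N); rewrite !expr0 !mulr1.
have q0 : 0 < 1 - x by rewrite subr_gt0.
exists (K * C * (1 - x)^-1 * (1 - x)^-1), x; split => // m n.
rewrite normrM.
apply: (@le_trans _ _ (K * (m.+1%:R * n.+1%:R) * (C * r ^+ m * r ^+ n))); first exact: ler_pM.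
have -> : K * (m.+1%:R * n.+1%:R) * (C * r ^+ m * r ^+ n) =
   K * C * (m.+1%:R * x ^+ m) * (n.+1%:R * x ^+ n) * x ^+ m * x ^+ n.
  by rewrite xx !exprMn; ring.
apply: ler_wpM2r; first exact: exprn_ge0.
apply: ler_wpM2r; first exact: exprn_ge0.
have h1 := mulSn_geo m x0 x1; have h2 := mulSn_geo n x0 x1.
by apply: ler_pM => //; rewrite ?mulr_ge0 ?exprn_ge0//; apply: ler_pM => //; rewrite ?mulr_ge0 ?exprn_ge0.
Qed.

Lemma dgeo_mono (R : realType) (C r s : R) (u : nat -> nat -> R) : 0 <= r -> r <= s ->
  dgeo C r u -> dgeo C s u.
Proof.
move=> r0 rs hu m n; apply: le_trans (hu m n) _.
have C0 : 0 <= C by have := le_trans (normr_ge0 _) (hu 0%N 0%N); rewrite !expr0 !mulr1.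
have s0 : 0 <= s by exact: le_trans rs.
have hr k : r ^+ k <= s ^+ k by apply: lerXn2r; rewrite ?nnegrE.
by apply: ler_pM; rewrite ?mulr_ge0 ?exprn_ge0// ler_wpM2l.
Qed.

Lemma dgeo_add (R : realType) (C r D s : R) (u v : nat -> nat -> R) :
  0 <= r -> r < 1 -> 0 <= s -> s < 1 -> dgeo C r u -> dgeo D s v ->
  exists E t : R, [/\ 0 <= t, t < 1 & forall m n, `|u m n| + `|v m n| <= E * t ^+ m * t ^+ n].
Proof.
move=> r0 r1 s0 s1 hu hv; exists (C + D), (Num.max r s); split.
- by rewrite le_max r0.
- by rewrite gt_max r1.
have rm : r <= Num.max r s by rewrite le_max lexx.
have sm : s <= Num.max r s by rewrite le_max lexx orbT.
move=> m n; rewrite !mulrDl; apply: lerD; first exact: (dgeo_mono r0 rm hu).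
exact: (dgeo_mono s0 sm hv).
Qed.

Lemma powR_subr1 (R : realType) (q e : R) : 0 < q -> q `^ (e - 1) = q `^ e / q.
Proof. by move=> q0; rewrite powRB ?(gt_eqF q0) ?implybT// powRr1// ltW. Qed.

Lemma geo_beyond_deriv (R : realType) (q0 : R) (a e : nat -> nat -> R) : 0 <= q0 ->
  lin_bounded e -> geo_beyond q0 a e ->
  geo_beyond q0 (fun m n => a m n * e m n) (fun m n => e m n - 1).
Proof.
move=> q00 le ha q q1; have [C [r [r0 r1 hr]]] := ha q q1.
have qp : 0 < q by exact: le_lt_trans q1.
have [C' [r' [r0' r1' h]]] := dgeo_poly r0 r1 hr le.
exists (q^-1 * C'), r'; split => // m n.
have -> : a m n * e m n * q `^ (e m n - 1) = q^-1 * (e m n * (a m n * q `^ e m n)).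
  by rewrite powR_subr1//; ring.
rewrite normrM ger0_norm ?invr_ge0 ?(ltW qp)// -!mulrA; apply: ler_wpM2l.
  by rewrite invr_ge0 ltW.
by have := h m n; rewrite -!mulrA.
Qed.

(** Tannery's theorem for difference quotients. By the mean value estimate they are dominated by the
    differentiated series at two points [x < q < y], both beyond [q0]. *)
Lemma dsum_derive (R : realType) (q0 : R) (a e : nat -> nat -> R) (q : R) : 0 <= q0 ->
  lin_bounded e -> geo_beyond q0 a e -> q0 < q ->
  is_derive q 1 (fun q => dsum (fun m n => a m n * q `^ e m n))
    (dsum (fun m n => a m n * e m n * q `^ (e m n - 1))).
Proof.
move=> q00 le ha q1; have qp : 0 < q by exact: le_lt_trans q1.
pose x := (q0 + q) / 2; pose y := q + 1.
have x0 : q0 < x by rewrite /x; lra.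
have xp : 0 < x by exact: le_lt_trans x0.
have xq : x < q by rewrite /x; lra.
have qy : q < y by rewrite /y; lra.
have y0 : q0 < y by exact: lt_trans qy.
have yp : 0 < y by exact: lt_trans qy.
have hb := geo_beyond_deriv q00 le ha.
have [C1 [r1 [r10 r11 h1]]] := hb x x0.
have [C2 [r2 [r20 r21 h2]]] := hb y y0.
have [E [t [t0 t1 hE]]] := dgeo_add r10 r11 r20 r21 h1 h2.
have key z : x <= z -> z <= y -> forall m n, `|a m n * (z `^ e m n - q `^ e m n)| <=
   `|z - q| * (E * t ^+ m * t ^+ n).
  move=> xz zy m n; rewrite normrM.
  have := powR_mvt (e m n) xp xz zy (ltW xq) (ltW qy) => hp.
  apply: (@le_trans _ _ (`|a m n| * (`|z - q| * (`|e m n| * (x `^ (e m n - 1) + y `^ (e m n - 1)))))).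
    exact: ler_wpM2l.
  rewrite mulrCA; apply: ler_wpM2l => //; apply: le_trans (hE m n).
  by rewrite !normrM ![`|powR _ _|]ger0_norm ?powR_ge0//; lra.
apply: is_derive_cvg.
have [Ca [ra [ra0 ra1 hq]]] := ha q q1.
have E0 : 0 <= E.
  have := le_trans (addr_ge0 (normr_ge0 _) (normr_ge0 _)) (hE 0%N 0%N).
  by rewrite !expr0 !mulr1.
have hlim : dsum (fun m n => h^-1 * (a m n * ((h + q) `^ e m n - q `^ e m n))) @[h --> 0^'] -->
    dsum (fun m n => a m n * e m n * q `^ (e m n - 1)).
  apply: (dsum_tannery (C := E) t0 t1).
    near=> h => m n.
    have hn : h != 0 by near: h; exact: nbhs_dnbhs_neq.
    have hs : `|h| < Num.min (q - x) (y - q).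
      near: h; apply: dnbhs0_lt; by rewrite lt_min !subr_gt0 xq.
    have {hs} [hx hy] : x <= h + q /\ h + q <= y.
      move: hs; rewrite lt_min => /andP[s1 s2]; have := ler_norm h; have := ler_norm (- h); rewrite normrN.
      by split; lra.
    rewrite normrM normfV; have := key (h + q) hx hy m n; rewrite addrK => hk.
    by rewrite ler_pdivrMl ?normr_gt0.
  move=> m n.
  have [hd hv] := is_derive_powR (e m n) qp.
  have hc : h^-1 *: ((h *: 1 + q) `^ e m n - q `^ e m n) @[h --> 0^'] --> e m n * q `^ (e m n - 1).
    by rewrite -hv; exact: hd.
  have hc2 : a m n * (h^-1 *: ((h *: 1 + q) `^ e m n - q `^ e m n)) @[h --> 0^'] --> a m n * (e m n * q `^ (e m n - 1)).
    exact: cvgZr hc.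
  rewrite -mulrA; apply: cvg_trans hc2; apply: near_eq_cvg; near=> h.
  by rewrite /GRing.scale/= mulr1 mulrCA.
apply: cvg_trans hlim; apply: near_eq_cvg; near=> h.
have hs : `|h| < Num.min (q - x) (y - q).
  near: h; apply: dnbhs0_lt; by rewrite lt_min !subr_gt0 xq.
have [hx hy] : x <= h + q /\ h + q <= y.
  move: hs; rewrite lt_min => /andP[s1 s2]; have := ler_norm h; have := ler_norm (- h); rewrite normrN.
  by split; lra.
have hk m n := key (h + q) hx hy m n.
have hd : dgeo (`|h| * E) t (fun m n => a m n * ((h + q) `^ e m n - q `^ e m n)).
  by move=> m n; apply: le_trans (hk m n) _; rewrite addrK !mulrA.
rewrite (dsumZ _ t0 t1 hd); congr (_ * _).
have [Cb [rb [rb0 rb1 hhq]]] := ha (h + q) (lt_le_trans x0 hx).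
pose rr := Num.max ra rb.
have rr0 : 0 <= rr by rewrite le_max ra0.
have rr1 : rr < 1 by rewrite gt_max ra1.
have g1 : dgeo Cb rr (fun m n => a m n * (h + q) `^ e m n).
  by apply: dgeo_mono hhq => //; rewrite le_max lexx orbT.
have g2 : dgeo Ca rr (fun m n => -1 * (a m n * q `^ e m n)).
  have ram : ra <= rr by rewrite le_max lexx.
  by move=> m n; rewrite mulN1r normrN; exact: (dgeo_mono ra0 ram hq).
rewrite -[X in _ = _ + X]mulN1r -(dsumZ _ ra0 ra1 hq) -(dsumD rr0 rr1 g1 g2).
by apply: eq_dsum => m n; rewrite mulrBr mulN1r.
Unshelve. all: by end_near. Qed.

Lemma pos_homo (R : realType) (G g : R -> R) (a b : R) : 0 < a -> a <= b ->
  (forall z : R, 0 < z -> is_derive z 1 G (g z)) ->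
  (forall z : R, a < z -> z < b -> 0 <= g z) -> G a <= G b.
Proof.
move=> a0; rewrite le_eqVlt => /orP[/eqP -> //|ab] dG g0.
have hd z : z \in `]a, b[ -> is_derive z 1 G (g z).
  by rewrite in_itv/= => /andP[xz _]; exact: dG (lt_trans a0 xz).
have hc : {within `[a, b], continuous G}.
  apply: derivable_within_continuous => z; rewrite in_itv/= => /andP[xz _].
  by have [] := dG z (lt_le_trans a0 xz).
have [c] := MVT ab hd hc.
rewrite in_itv/= => /andP[ac cb] h.
by rewrite -subr_ge0 h mulr_ge0 ?subr_ge0 ?(ltW ab)// g0.
Qed.

(** * The Gamma function and its reciprocal *)

Lemma GammaE (R : realType) (x : R) : Gamma x = pint (fun t => t `^ (x - 1) * expR (- (1 * t))).
Proof. by apply: eq_pint => t _; rewrite mul1r. Qed.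

Lemma GammaS (R : realType) (x : R) : 0 < x -> Gamma (x + 1) = x * Gamma x.
Proof. by move=> x0; rewrite !GammaE addrK pint_gammaS// divr1. Qed.

(** Only the part of Euler's integral beyond [x] is kept, and there t^x >= x^x. Both estimates are
    made on a primitive [F] of the integrand. *)
Lemma Gamma_ge (R : realType) (x : R) : 0 < x -> x `^ x * expR (- x) <= Gamma (x + 1).
Proof.
move=> x0; rewrite GammaE addrK; pose f t : R := t `^ x * expR (- (1 * t)).
have i0 : pintegrable f.
  by have := @gamma_integrable R (x + 1) 1 (addr_gt0 x0 ltr01) ltr01; rewrite addrK.
have cf (z : R) : 0 < z -> {for z, continuous f}.
  by move=> z0; apply: cvgM; [exact: continuous_powR|exact: continuous_expN].
have [F dF] := pos_antiderivative cf i0.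
have hlim := pint_ftc_seq dF cf i0.
have hE : expR (- (1 * n.+2%:R)) @[n --> \oo] --> (0 : R).
  have h := @cvgy_expN R 1 ltr01; refine (@cvg_comp _ _ _ (fun n : nat => n.+2%:R : R) (fun t => expR (- (1 * t))) _ _ _ (@cvg_natSSy R) h).
have hl2 : x `^ x * (expR (- x) - expR (- (1 * n.+2%:R))) - (F n.+2%:R - F n.+2%:R^-1) @[n --> \oo] -->
    x `^ x * (expR (- x) - 0) - pint f.
  by apply: cvgB => //; apply: cvgZr; apply: cvgB => //; exact: cvg_cst.
rewrite -subr_le0 -[X in X - _ <= 0]/(x `^ x * expR (- x)) -[expR (- x)]subr0.
apply: (cvg_le_cst hl2); near=> n.
have n1 : x <= n.+2%:R by near: n; exact: (cvgryPge _).1 (@cvg_natSSy R) _.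
have n2 : n.+2%:R^-1 <= x.
  rewrite -[leRHS]invrK lef_pV2 ?posrE ?invr_gt0//.
  by near: n; exact: (cvgryPge _).1 (@cvg_natSSy R) _.
have h1 : F n.+2%:R^-1 <= F x.
  by apply: (pos_homo _ n2 dF); rewrite ?invr_gt0// => z _ _; rewrite mulr_ge0 ?powR_ge0 ?expR_ge0.
have h2 : F x + x `^ x * expR (- (1 * x)) <= F n.+2%:R + x `^ x * expR (- (1 * n.+2%:R)).
  apply: (@pos_homo R (fun z => F z + x `^ x * expR (- (1 * z))) (fun z => f z - x `^ x * expR (- (1 * z))) x n.+2%:R x0 n1).
    move=> z z0; have := dF z z0 => hF; have he := is_derive_expN 1 z.
    by apply: is_derive_eq; rewrite /GRing.scale/=; ring.
  move=> z xz _; rewrite -mulrBl mulr_ge0 ?expR_ge0// subr_ge0.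
  by apply: ge0_ler_powR; rewrite ?nnegrE ?(ltW x0) ?(ltW xz)// (le_trans (ltW x0) (ltW xz)).
by rewrite mul1r in h2; lra.
Unshelve. all: by end_near. Qed.

Lemma Gamma_gt0 (R : realType) (x : R) : 0 < x -> 0 < Gamma x.
Proof.
move=> x0; have := Gamma_ge x0; rewrite GammaS// => h.
have : 0 < x * Gamma x by apply: lt_le_trans h; rewrite mulr_gt0 ?powR_gt0 ?expR_gt0.
by rewrite pmulr_rgt0.
Qed.

Lemma Gamma1 (R : realType) : Gamma (1 : R) = 1.
Proof.
rewrite GammaE -[RHS]invr1 -(pint_exp (@ltr01 R)).
by apply: eq_pint => t _; rewrite subrr powRr0 mul1r.
Qed.

Lemma Gamma_prod (R : realType) (x : R) (n k : nat) : 0 < x + n%:R ->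
  Gamma (x + (n + k)%:R) = (\prod_(n <= i < n + k) (x + i%:R)) * Gamma (x + n%:R).
Proof.
move=> h; elim: k => [|k ih]; first by rewrite addn0 big_geq// mul1r.
rewrite addnS -natr1 addrA GammaS; last first.
  by rewrite natrD addrA ltr_pwDl.
by rewrite ih big_nat_recr ?leq_addr//=; ring.
Qed.

(** Lengthening the product multiplies it and the value of Gamma by the same nonzero factors. This
    frees the shift, which the definition fixes in terms of |x|. *)
Lemma rGammaE (R : realType) (x : R) (n : nat) : 0 < x + n%:R ->
  rGamma x = (\prod_(i < n) (x + i%:R)) / Gamma (x + n%:R).
Proof.
move=> hn; rewrite /rGamma; set m := (Num.truncn `|x|).+1.
have hm : 0 < x + m%:R.
  have h1 : `|x| < m%:R by exact: truncnS_gt.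
  have := ler_norm (- x); rewrite normrN; lra.
have aux (p q : nat) : (p <= q)%N -> 0 < x + p%:R ->
    (\prod_(i < p) (x + i%:R)) / Gamma (x + p%:R) = (\prod_(i < q) (x + i%:R)) / Gamma (x + q%:R).
  move=> pq hp; rewrite -(subnKC pq) Gamma_prod// -!(big_mkord xpredT (fun i => x + i%:R)).
  rewrite (big_cat_nat (leq0n p) (leq_addr _ p))//=.
  have g0 := Gamma_gt0 hp.
  have pn : \prod_(p <= i < p + (q - p)) (x + i%:R) != 0.
    rewrite prodf_seq_neq0; apply/allP => i; rewrite mem_index_iota => /andP[pi _]; apply/implyP => _.
    by rewrite gt_eqF// (lt_le_trans hp)// lerD2l ler_nat.
  by move: pn; set Y := \prod_(p <= i < _) _ => pn; field; rewrite pn gt_eqF.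
by have [h|/ltnW h] := leqP n m; [rewrite (aux n m)|rewrite (aux m n)].
Qed.

Lemma rGammaV (R : realType) (x : R) : 0 < x -> rGamma x = (Gamma x)^-1.
Proof. by move=> x0; rewrite (@rGammaE _ x 0) ?addr0// big_ord0 mul1r. Qed.

Lemma rGammaS (R : realType) (x : R) : rGamma x = x * rGamma (x + 1).
Proof.
pose n := (Num.truncn `|x|).+1.
have hm : 0 < x + n%:R.
  have h1 : `|x| < n%:R by exact: truncnS_gt.
  have := ler_norm (- x); rewrite normrN; lra.
have hs : 0 < x + n.+1%:R by apply: lt_le_trans hm _; rewrite lerD2l ler_nat.
have hs' : 0 < x + 1 + n%:R by rewrite -addrA nat1r.
rewrite (rGammaE hs) (rGammaE hs') big_ord_recl addr0 -mulrA -addrA nat1r; congr (_ * (_ / _)).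
by apply: eq_bigr => i _; rewrite /= /bump/= add1n -addrA nat1r.
Qed.

Lemma rGamma0 (R : realType) : rGamma (0 : R) = 0.
Proof. by rewrite rGammaS mul0r. Qed.

Lemma rGammaN (R : realType) (n : nat) : rGamma (- n%:R : R) = 0.
Proof.
elim: n => [|n ih]; first by rewrite oppr0 rGamma0.
by rewrite rGammaS -natr1 opprD subrK ih mulr0.
Qed.

(** (k + 1)^s [gauss k s] is Gauss's approximation to 1 / Gamma(1 - s), and also the factor that the
    k-th Post-Widder mean puts on a power q^(s - 1). *)
Definition gauss (R : realType) (k : nat) (s : R) : R := \prod_(j < k) (1 - s / j.+1%:R).

Lemma gauss_shift (R : realType) (k : nat) (s : R) :
  gauss k s * (k.+1%:R - s) = (1 - s) * gauss k (s - 1).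
Proof.
elim: k => [|k ih]; first by rewrite /gauss !big_ord0 mul1r mulr1.
rewrite /gauss !big_ord_recr/= -!/(gauss _ _) mulrA -ih.
rewrite -(natr1 k.+1); field.
by rewrite nat1r pnatr_eq0.
Qed.

Lemma pint_gamma_pow (R : realType) (k : nat) (sg q : R) : 0 <= sg -> 0 < q ->
  pint (fun u => u `^ (k%:R + sg) * expR (- (q * u))) =
  (\prod_(j < k) (sg + j.+1%:R)) * (q ^- k.+1 * q `^ (- sg)) * Gamma (1 + sg).
Proof.
move=> s0 q0; elim: k => [|k ih].
  rewrite big_ord0 mul1r expr1 add0r.
  have m1 : measurable_fun setT (fun u : R => u `^ sg * expR (- u)) by meas.
  have s1 : 0 < sg + 1 by rewrite ltr_wpDl.
  have i1 : pintegrable (fun u : R => u `^ sg * expR (- u)).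
    have := @gamma_integrable R (sg + 1) 1 s1 ltr01; rewrite addrK.
    by apply: eq_pintegrable => t _; rewrite mul1r.
  have [i2 e2] := pint_scale q0 m1 i1.
  have -> : Gamma (1 + sg) = pint (fun u : R => u `^ sg * expR (- u)).
    by apply: eq_pint => t _; rewrite addrAC subrr add0r.
  rewrite mulrAC -e2 mulrC -pintZ//; apply: eq_pint => u u0.
  rewrite powRM ?(ltW q0) ?(ltW u0)// powRN.
  have : q `^ sg != 0 by rewrite gt_eqF// powR_gt0.
  by move=> h; rewrite -!mulrA mulKf.
have -> : k.+1%:R + sg = k%:R + sg + 1 by rewrite -natr1; ring.
have h := @pint_gammaS R (k%:R + sg + 1) q _ q0.
have {}h := h (ltr_wpDl (addr_ge0 (ler0n _ _) s0) ltr01).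
rewrite addrK in h; rewrite h ih big_ord_recr/= -(natr1 k) [q ^+ k.+2]exprS.
field; by rewrite expf_neq0 ?andbT gt_eqF.
Qed.

Definition pwI (R : realType) (k : nat) (t : R) (g : R -> R) : Prop :=
  pintegrable (fun u => u ^+ k * expR (- (k.+1%:R / t * u)) * g u).

(** The mean of [g] for the Gamma law of shape k + 1 and rate (k + 1) / t. *)
Definition pw (R : realType) (k : nat) (t : R) (g : R -> R) : R :=
  (k.+1%:R / t) ^+ k.+1 / k`!%:R * pint (fun u => u ^+ k * expR (- (k.+1%:R / t * u)) * g u).

Lemma pw_quad (R : realType) (k : nat) (t A B : R) : 0 < t ->
  pwI k t (fun u => A + B * (u - t) ^+ 2) /\
  pw k t (fun u => A + B * (u - t) ^+ 2) = A + B * t ^+ 2 / k.+1%:R.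
Proof.
move=> t0; set q := k.+1%:R / t; have q0 : 0 < q by rewrite divr_gt0.
have i0 := exp_integrable k q0; have i1 := exp_integrable k.+1 q0; have i2 := exp_integrable k.+2 q0.
have iA := pintegrableZ (A + B * t ^+ 2) i0.
have iB := pintegrableZ (- 2 * B * t) i1.
have iC := pintegrableZ B i2.
have iAB := pintegrableD iA iB.
have iT := pintegrableD iAB iC.
have E (u : R) : 0 < u -> (A + B * t ^+ 2) * (u ^+ k * expR (- (q * u))) + - 2 * B * t * (u ^+ k.+1 * expR (- (q * u)))
   + B * (u ^+ k.+2 * expR (- (q * u))) = u ^+ k * expR (- (q * u)) * (A + B * (u - t) ^+ 2).
  by move=> u0; rewrite !exprS; ring.
split; first exact: eq_pintegrable E iT.
rewrite /pw -/q -(eq_pint E) (pintD iAB iC) (pintD iA iB) (pintZ _ i0) (pintZ _ i1) (pintZ _ i2) !pint_pow_exp//.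
rewrite !factS !natrM -(natr1 k.+1).
have f0 : k`!%:R != 0 :> R by rewrite pnatr_eq0 -lt0n fact_gt0.
have k0 : k.+1%:R != 0 :> R by rewrite pnatr_eq0.
have qk : q ^+ k.+1 != 0 by rewrite expf_neq0// gt_eqF.
rewrite [q ^+ k.+3]exprS [q ^+ k.+2]exprS.
have -> : t = k.+1%:R / q by rewrite /q invf_div mulrCA mulfV ?mulr1.
have qn : q != 0 by rewrite gt_eqF.
move: f0 k0 qk; set fk := k`!%:R; set K := k.+1%:R; set Q := q ^+ k.+1 => f0 k0 qk.
clearbody fk K Q q; field.
by rewrite f0 k0 qk qn.
Qed.

(** Chebyshev's inequality in the form used below: a quadratic majorant around the mean [t] costs
    only the variance t^2 / (k + 1). *)
Lemma pw_le (R : realType) (k : nat) (t A B : R) (g : R -> R) : 0 < t -> pwI k t g ->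
  (forall u : R, 0 < u -> g u <= A + B * (u - t) ^+ 2) -> pw k t g <= A + B * t ^+ 2 / k.+1%:R.
Proof.
move=> t0 ig hg; have [i2 <-] := pw_quad k A B t0.
apply: ler_wpM2l; first by rewrite divr_ge0// exprn_ge0// divr_ge0// ltW.
apply: le_pint => // u u0; apply: ler_wpM2l; last exact: hg.
by rewrite mulr_ge0 ?expR_ge0// exprn_ge0// ltW.
Qed.

Lemma pwN (R : realType) (k : nat) (t : R) (g : R -> R) : pwI k t g ->
  pwI k t (fun u => - g u) /\ pw k t (fun u => - g u) = - pw k t g.
Proof.
move=> ig; have E (u : R) : 0 < u -> - (u ^+ k * expR (- (k.+1%:R / t * u)) * g u) =
  u ^+ k * expR (- (k.+1%:R / t * u)) * - g u by move=> _; rewrite mulrN.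
split; first exact: eq_pintegrable E (pintegrableN ig).
by rewrite /pw -(eq_pint E) pintN// mulrN.
Qed.

Lemma cvg_div_nat (R : realType) (B : R) : B / k.+1%:R @[k --> \oo] --> 0.
Proof.
rewrite -(mulr0 B); apply: cvgZr; have := @cvg_natinv R 1.
by under eq_fun do rewrite addn1.
Qed.

Lemma cvg_pw_const (R : realType) (A B : R) : A + B / k.+1%:R @[k --> \oo] --> A.
Proof.
rewrite -[X in _ --> X]addr0; apply: cvgD; first exact: cvg_cst.
exact: cvg_div_nat.
Qed.

Lemma gauss_pw (R : realType) (k : nat) (sg : R) : 0 <= sg ->
  pwI k 1 (fun u => u `^ sg) /\
  pw k 1 (fun u => u `^ sg) = k.+1%:R `^ (- sg) * gauss k (- sg) * Gamma (1 + sg).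
Proof.
move=> s0; have q0 : 0 < k.+1%:R / 1 :> R by rewrite divr1.
have E (u : R) : 0 < u -> u `^ (k%:R + sg) * expR (- (k.+1%:R / 1 * u)) =
    u ^+ k * expR (- (k.+1%:R / 1 * u)) * u `^ sg.
  by move=> u0; rewrite powRD ?(gt_eqF u0) ?implybT// powR_mulrn ?(ltW u0)//; ring.
split.
  apply: eq_pintegrable E _.
  have := @gamma_integrable R (k%:R + sg + 1) (k.+1%:R / 1) _ q0; rewrite addrK; apply.
  by rewrite ltr_wpDl// addr_ge0.
rewrite /pw -(eq_pint E) pint_gamma_pow// divr1 /gauss.
have -> : \prod_(j < k) (1 - - sg / j.+1%:R) = (\prod_(j < k) (sg + j.+1%:R)) / k`!%:R.
  elim: k {q0 E} => [|k ih]; first by rewrite !big_ord0 fact0 divr1.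
  rewrite !big_ord_recr/= ih factS natrM.
  have f0 : k`!%:R != 0 :> R by rewrite pnatr_eq0 -lt0n fact_gt0.
  have k0 : k.+1%:R != 0 :> R by rewrite pnatr_eq0.
  move: f0 k0; set f := k`!%:R; set K := k.+1%:R => f0 k0; clearbody f K; field.
  by rewrite f0 k0.
have k0 : k.+1%:R ^+ k.+1 != 0 :> R by rewrite expf_neq0// pnatr_eq0.
move: k0; set Q := _ ^+ k.+1; set X := \prod_(j < k) _; set Y := powR _ _; set Z := Gamma _.
by clearbody Q X Y Z => k0; transitivity (X * Y * Z / k`!%:R * (Q / Q)); [ring|rewrite mulfV//; ring].
Qed.

Lemma norm_powR_sub1 (R : realType) (u sg : R) : 0 < u -> 0 <= sg -> sg <= 1 -> `|u `^ sg - 1| <= `|u - 1|.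
Proof.
move=> u0 s0 s1; have [u1|u1] := leP 1 u.
  have h1 : 1 <= u `^ sg by rewrite -(powRr0 u); apply: ler_powR.
  have h2 : u `^ sg <= u by rewrite -[leRHS]powRr1 ?(ltW u0)//; apply: ler_powR.
  by rewrite !ger0_norm ?subr_ge0// lerD2r.
have u01 : 0 < u <= 1 by rewrite u0 ltW.
have h1 : u `^ sg <= 1 by rewrite -(powRr0 u); apply: ger_powR.
have h2 : u <= u `^ sg by rewrite -[leLHS]powRr1 ?(ltW u0)//; apply: ger_powR.
rewrite distrC [`|u - 1|]distrC !ger0_norm ?subr_ge0 ?(ltW u1)//; lra.
Qed.

(** By [gauss_pw] the quantity is a mean of u^sg, up to the factor Gamma(1 + sg). The law
    concentrates at 1, and for 0 <= sg <= 1 the power deviates from 1 by at most |u - 1|. *)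
Lemma gauss_cvg_base (R : realType) (sg : R) : 0 <= sg -> sg <= 1 ->
  k.+1%:R `^ (- sg) * gauss k (- sg) @[k --> \oo] --> (Gamma (1 + sg))^-1.
Proof.
move=> s0 s1; have G0 : 0 < Gamma (1 + sg) by apply: Gamma_gt0; rewrite ltr_pwDl.
have h : pw k 1 (fun u : R => u `^ sg) @[k --> \oo] --> (1 : R).
  apply/cvgrPdist_le => e e0; have e2 : 0 < e / 2 by rewrite divr_gt0.
  near=> k; have [ik _] := gauss_pw k s0.
  have hk : (2 * e)^-1 / k.+1%:R <= e / 2.
    rewrite ler_pdivrMr// -ler_pdivrMl//.
    apply: le_trans (_ : _ <= k%:R) _; last by rewrite ler_nat.
    by near: k; exact: nbhs_infty_ger.
  (* y <= e/2 + y^2 / (2 e), since (y - e)^2 >= 0: it turns the linear deviation into a majorant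
     that [pw_le] accepts. *)
  have q (u : R) : `|u - 1| <= e / 2 + (2 * e)^-1 * (u - 1) ^+ 2.
    rewrite -(real_normK (num_real (u - 1))); have := normr_ge0 (u - 1).
    set y := `|u - 1| => y0; rewrite -subr_ge0.
    have -> : e / 2 + (2 * e)^-1 * y ^+ 2 - y = (2 * e)^-1 * (y - e) ^+ 2.
      by field; rewrite gt_eqF.
    by rewrite mulr_ge0 ?sqr_ge0// invr_ge0 mulr_ge0// ltW.
  have u1 : pw k 1 (fun u : R => u `^ sg) <= 1 + e / 2 + (2 * e)^-1 * 1 ^+ 2 / k.+1%:R.
    apply: pw_le => // u u0; have := norm_powR_sub1 u0 s0 s1; have := q u.
    have := ler_norm (u `^ sg - 1); lra.
  have [iN eN] := pwN ik.
  have u2 : - pw k 1 (fun u : R => u `^ sg) <= -1 + e / 2 + (2 * e)^-1 * 1 ^+ 2 / k.+1%:R.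
    rewrite -eN; apply: pw_le => // u u0; have := norm_powR_sub1 u0 s0 s1; have := q u.
    have := ler_norm (- (u `^ sg - 1)); rewrite normrN; lra.
  rewrite expr1n mulr1 in u1 u2.
  move: u1 u2 hk; set P := pw _ _ _; set H := _ / k.+1%:R; clearbody P H => u1 u2 hk.
  by rewrite ler_norml; apply/andP; split; clear -u1 u2 hk; lra.
have -> : (Gamma (1 + sg))^-1 = 1 * (Gamma (1 + sg))^-1 by rewrite mul1r.
have h2 : pw k 1 (fun u : R => u `^ sg) * (Gamma (1 + sg))^-1 @[k --> \oo] --> 1 * (Gamma (1 + sg))^-1 by exact: cvgZl.
apply: cvg_trans h2; apply: near_eq_cvg; near=> k.
by have [_ ->] := gauss_pw k s0; rewrite mulfK// gt_eqF.
Unshelve. all: by end_near. Qed.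

(** The range -1 <= s <= 0 is the base case; [gauss_shift], the counterpart of the recursion of 1 /
    Gamma, raises [s] by one. *)
Lemma gauss_cvg (R : realType) (s : R) : -1 <= s ->
  k.+1%:R `^ s * gauss k s @[k --> \oo] --> rGamma (1 - s).
Proof.
move=> s1; have := ltW (truncnS_gt s); move: (Num.truncn s).+1 => N.
elim: N s s1 => [|N ih] s s1 sN.
  have := @gauss_cvg_base R (- s); rewrite opprK rGammaV; last by rewrite subr_gt0 (le_lt_trans sN).
  by apply; lra.
have [s0|s0] := leP s 0.
  have := @gauss_cvg_base R (- s); rewrite opprK rGammaV; last by rewrite subr_gt0 (le_lt_trans s0).
  by apply; lra.
have sN' : s - 1 <= N%:R by rewrite lerBlDr natr1.
have s1' : -1 <= s - 1 by lra.
have {ih}h := ih _ s1' sN'.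
have h0 : 1 + - s / k.+1%:R @[k --> \oo] --> (1 : R) by exact: cvg_pw_const.
have h1 : (1 + - s / k.+1%:R)^-1 @[k --> \oo] --> (1^-1 : R) by apply: cvgV; rewrite ?oner_neq0.
have h2 : (1 - s) * (k.+1%:R `^ (s - 1) * gauss k (s - 1)) @[k --> \oo] --> (1 - s) * rGamma (1 - (s - 1)).
  exact: cvgZr.
have h3 : (1 - s) * (k.+1%:R `^ (s - 1) * gauss k (s - 1)) * (1 + - s / k.+1%:R)^-1 @[k --> \oo] -->
    (1 - s) * rGamma (1 - (s - 1)) * 1^-1 by exact: cvgM h2 h1.
have -> : rGamma (1 - s) = (1 - s) * rGamma (1 - (s - 1)) * 1^-1.
  by rewrite invr1 mulr1 rGammaS; congr (_ * rGamma _); ring.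
apply: cvg_trans h3; apply: near_eq_cvg; near=> k.
have ks : s < k.+1%:R.
  apply: lt_trans (_ : _ < k%:R) _; last by rewrite ltr_nat.
  by near: k; exact: nbhs_infty_gtr.
have k0 : 0 < k.+1%:R :> R by rewrite ltr0n.
have gs := gauss_shift k s.
rewrite powR_subr1// mulrCA -gs.
have : k.+1%:R - s != 0 by rewrite subr_eq0 gt_eqF.
have : k.+1%:R != 0 :> R by rewrite gt_eqF.
set K := k.+1%:R; set G := gauss k s; set P := K `^ s; clearbody K G P => K0 Ks.
have -> : 1 + - s / K = (K - s) / K by field.
by field; rewrite K0 Ks.
Unshelve. all: by end_near. Qed.

Lemma powR_expR (R : realType) (y sg : R) : (expR y) `^ sg = expR (sg * y).
Proof. by rewrite /powR gt_eqF ?expR_gt0// expRK. Qed.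

Lemma powR_1D_le (R : realType) (x s : R) : 0 <= s -> 0 <= x -> (1 + x) `^ s <= expR (s * x).
Proof.
move=> s0 x0; rewrite -powR_expR; apply: ge0_ler_powR => //; rewrite ?nnegrE ?expR_ge0 ?addr_ge0//.
exact: expR_ge1Dx.
Qed.

Lemma expR_inv_le (R : realType) (k : nat) (s : R) : 0 <= s ->
  expR (s / k.+2%:R) <= (k.+2%:R / k.+1%:R) `^ s.
Proof.
move=> s0; rewrite -powR_expR; apply: ge0_ler_powR => //; rewrite ?nnegrE ?expR_ge0 ?divr_ge0//.
have h := expR_ge1Dx (- k.+2%:R^-1 : R).
rewrite expRN in h; have e0 := expR_gt0 (k.+2%:R^-1 : R).
rewrite ler_pdivlMr// mulrC -ler_pdivlMr//.
have k2 : 0 < k.+2%:R :> R by rewrite ltr0n.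
have -> : k.+1%:R = k.+2%:R * (1 - k.+2%:R^-1) :> R.
  by rewrite mulrBr mulr1 mulfV ?gt_eqF// -(natr1 k.+1) addrK.
by apply: ler_wpM2l; [exact: ltW|exact: h].
Qed.

Lemma expR_ge_pow (R : realType) (x : R) (n : nat) : 0 <= x -> x ^+ n / n`!%:R <= expR x.
Proof.
move=> x0; case: n => [|n]; last by apply: le_trans (expR_ge1Dxn n x0); rewrite lerDr.
by rewrite expr0 fact0 divr1; apply: le_trans (expR_ge1Dx x); rewrite lerDl.
Qed.

Lemma powR_self_ge (R : realType) (s : R) : 0 <= s -> expR (s - 1) <= s `^ s.
Proof.
rewrite le_eqVlt => /orP[/eqP <-|s0].
  by rewrite powRr0 sub0r -[leRHS]expR0 ler_expR; lra.
rewrite /powR gt_eqF// ler_expR.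
have h : ln s^-1 <= s^-1 - 1.
  have {1}-> : s^-1 = 1 + (s^-1 - 1) by ring.
  by apply: le_ln1Dx; rewrite ltrBDl subrr invr_gt0.
rewrite lnV ?posrE// in h.
have : s * - ln s <= s * (s^-1 - 1) by rewrite ler_pM2l.
rewrite mulrBr mulfV ?gt_eqF//; lra.
Qed.

(** (k + 1)^s is first spread over the factors as e^(s / (j + 1)). Factors with j + 1 > s are then
    at most 1, because 1 - x <= e^(- x). For the others, the product of s / (j + 1) is at most e^s
    and the exponentials contribute e^s (k + 1)^s, at most e^s s^s. *)
Lemma gauss_le (R : realType) (k : nat) (s : R) : 0 <= s ->
  `|k.+1%:R `^ s * gauss k s| <= expR (2 * s + 1) * s `^ s.
Proof.
move=> s0.
have h1 : `|k.+1%:R `^ s * gauss k s| <= \prod_(j < k) (`|1 - s / j.+1%:R| * expR (s / j.+1%:R)).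
  elim: k => [|k ih]; first by rewrite /gauss !big_ord0 powR1 mulr1 normr1.
  rewrite /gauss !big_ord_recr/= -/(gauss k s).
  have -> : k.+2%:R = k.+1%:R * (1 + k.+1%:R^-1) :> R.
    by rewrite mulrDr mulr1 mulfV ?pnatr_eq0// natr1.
  rewrite powRM ?ler0n ?addr_ge0//.
  rewrite mulrACA normrM mulrC [leRHS]mulrC; apply: ler_pM => //.
  rewrite normrM [leRHS]mulrC ger0_norm ?powR_ge0//; apply: ler_wpM2r => //.
  by apply: powR_1D_le; rewrite ?invr_ge0.
apply: le_trans h1 _.
(* Since s^s >= e^(s - 1), the additional 1 in the exponent keeps the bound above the empty product
   for small [s]. *)
have e1 : 1 <= expR (2 * s + 1) * s `^ s.
  apply: (@le_trans _ _ (expR (2 * s + 1) * expR (s - 1))).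
    by rewrite -expRD -[leLHS]expR0 ler_expR; lra.
  by apply: ler_wpM2l; [exact: expR_ge0|exact: powR_self_ge].
elim: k => [|k ih]; first by rewrite big_ord0.
have [ks|ks] := leP k.+1%:R s; last first.
  rewrite big_ord_recr/=; apply: le_trans ih.
  rewrite ler_piMr//; first by apply: prodr_ge0 => j _; rewrite mulr_ge0 ?expR_ge0.
  have x0 : 0 <= s / k.+1%:R by rewrite divr_ge0.
  have x1 : s / k.+1%:R <= 1 by rewrite ler_pdivrMr// mul1r ltW.
  rewrite ger0_norm ?subr_ge0// -[expR _]invrK -expRN ler_pdivrMr ?expR_gt0// mul1r.
  exact: expR_ge1Dx.
have s1 : 1 <= s by apply: le_trans ks; rewrite ler1n.
have sp : 0 < s by exact: lt_le_trans s1.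
rewrite big_split/=.
have p1 : \prod_(j < k.+1) `|1 - s / j.+1%:R| <= expR s.
  apply: le_trans (expR_ge_pow k.+1 s0).
  have -> : s ^+ k.+1 / (k.+1)`!%:R = \prod_(j < k.+1) (s / j.+1%:R).
    elim: k.+1 => [|n ihn]; first by rewrite big_ord0 expr0 fact0 divr1.
    rewrite big_ord_recr/= -ihn factS natrM exprS invfM; ring.
  apply: ler_prod => j _; rewrite normr_ge0/=.
  have j1 : 1 <= s / j.+1%:R.
    by rewrite ler_pdivlMr// mul1r; apply: le_trans ks; rewrite ler_nat ltn_ord.
  by rewrite distrC ger0_norm ?subr_ge0// gerBl.
have p2 : \prod_(j < k.+1) expR (s / j.+1%:R) <= expR s * k.+1%:R `^ s.
  elim: k {ih ks p1} => [|k ihk]; first by rewrite big_ord1 divr1 powR1 mulr1.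
  rewrite big_ord_recr/=.
  apply: (@le_trans _ _ (expR s * k.+1%:R `^ s * (k.+2%:R / k.+1%:R) `^ s)).
    apply: ler_pM => //; rewrite ?expR_ge0//; first by apply: prodr_ge0 => j _; exact: expR_ge0.
    exact: expR_inv_le.
  by rewrite -mulrA -powRM ?divr_ge0// mulrCA mulfV ?mulr1// pnatr_eq0.
apply: (@le_trans _ _ (expR s * (expR s * k.+1%:R `^ s))).
  by apply: ler_pM => //; apply: prodr_ge0 => j _; rewrite ?expR_ge0.
rewrite mulrA; apply: ler_pM; rewrite ?powR_ge0 ?mulr_ge0 ?expR_ge0//.
  by rewrite -expRD ler_expR; lra.
by apply: ge0_ler_powR => //; rewrite ?nnegrE.
Qed.

(** k^(- sg) [gauss k (- sg)] is nonincreasing in k, so its value at [k0] is a bound, and there each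
    factor is at most 1 + sg. The power k0^(- sg) that remains can be made to beat any geometric
    growth. *)
Lemma gaussN_le (R : realType) (k k0 : nat) (sg : R) : 0 <= sg -> (0 < k0)%N -> (k0 <= k)%N ->
  0 <= gauss k (- sg) /\ k.+1%:R `^ (- sg) * gauss k (- sg) <= (1 + sg) ^+ k0 * k0%:R `^ (- sg).
Proof.
move=> s0 k00 kk.
have g0 n : 0 <= gauss n (- sg).
  by apply: prodr_ge0 => j _; rewrite mulNr opprK addr_ge0// divr_ge0.
split=> //.
apply: (@le_trans _ _ (k%:R `^ (- sg) * gauss k (- sg))).
  apply: ler_wpM2r => //; rewrite !powRN lef_pV2 ?posrE ?powR_gt0 ?ltr0n// ?(leq_trans k00 kk)//.
  by apply: ge0_ler_powR => //; rewrite ?nnegrE// ler_nat.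
rewrite -(subnKC kk); elim: (k - k0)%N => [|n ih].
  rewrite addn0 mulrC; apply: ler_wpM2r; first exact: powR_ge0.
  rewrite /gauss -[leRHS]mul1r -[k0 in leRHS]card_ord -prodr_const mul1r.
  apply: ler_prod => j _; rewrite mulNr opprK addr_ge0 ?divr_ge0//= lerD2l.
  by rewrite ler_pdivrMr// ler_peMr// ler1n.
apply: le_trans ih; rewrite addnS.
have : (0 < k0 + n)%N by rewrite addn_gt0 k00.
case: (k0 + n)%N => // N _.
rewrite /gauss big_ord_recr/= -/(gauss _ _) mulNr opprK.
rewrite mulrCA [leRHS]mulrC; apply: ler_wpM2l; first exact: g0.
apply: (@le_trans _ _ (N.+2%:R `^ (- sg) * (N.+2%:R / N.+1%:R) `^ sg)).
  apply: ler_wpM2l; first exact: powR_ge0.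
  by apply: le_trans (expR_inv_le N s0); exact: expR_ge1Dx.
rewrite powRM ?invr_ge0// mulrA -powRD; last by rewrite pnatr_eq0 implybT.
by rewrite addNr powRr0 mul1r -(powR_inv1 (ler0n R N.+1)) -powRrM mulN1r.
Qed.

(** The recursion of [gauss_cvg] read in the other direction, for s < -1. *)
Lemma gauss_cvg_all (R : realType) (s : R) :
  k.+1%:R `^ s * gauss k s @[k --> \oo] --> rGamma (1 - s).
Proof.
have := ltW (truncnS_gt (- s)); move: (Num.truncn (- s)).+1 => N.
elim: N s => [|N ih] s sN; first by apply: gauss_cvg; move: sN; rewrite mulr0n; lra.
have [s0|s0] := leP (-1) s; first exact: gauss_cvg.
have sN' : - (s + 1) <= N%:R by move: sN; rewrite -natr1; lra.
have h := ih _ sN'.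
have h0 : 1 + - (s + 1) / k.+1%:R @[k --> \oo] --> (1 : R) by exact: cvg_pw_const.
have h3 : (- s)^-1 * (k.+1%:R `^ (s + 1) * gauss k (s + 1) * (1 + - (s + 1) / k.+1%:R)) @[k --> \oo] -->
    (- s)^-1 * (rGamma (1 - (s + 1)) * 1) by apply: cvgZr; exact: cvgM h h0.
have sn : - s != 0 by rewrite oppr_eq0 lt_eqF//; lra.
have -> : rGamma (1 - s) = (- s)^-1 * (rGamma (1 - (s + 1)) * 1).
  rewrite [rGamma (1 - (s + 1))]rGammaS.
  have -> : 1 - (s + 1) = - s by ring.
  by rewrite mulr1 (mulKf sn) addrC.
apply: cvg_trans h3; apply: near_eq_cvg; near=> k.
have k0 : 0 < k.+1%:R :> R by rewrite ltr0n.
have gs := gauss_shift k (s + 1); rewrite addrK in gs.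
have e1 : 1 - (s + 1) = - s by ring.
rewrite e1 in gs.
have -> : gauss k s = (- s)^-1 * (gauss k (s + 1) * (k.+1%:R - (s + 1))) by rewrite gs mulKf.
have -> : k.+1%:R `^ s = k.+1%:R `^ (s + 1) / k.+1%:R by rewrite -powR_subr1// addrK.
have sn' : s != 0 by rewrite -oppr_eq0.
move: k0; set K := k.+1%:R => k0; clearbody K; field.
by rewrite sn' gt_eqF.
Unshelve. all: by end_near. Qed.

Lemma superexp_bound (R : realType) (K de : R) : 0 < K -> 0 < de ->
  exists2 C : R, 1 <= C & forall s : R, 0 <= s -> K `^ s * s `^ (- (de * s)) <= C.
Proof.
move=> K0 d0; pose c := expR (ln K / de).
have c0 : 0 < c by exact: expR_gt0.
(* With c = K^(1/de) the quantity is exp(de s ln(c / s)), and ln(c / s) <= c / s - 1. *)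
exists (expR (de * c)); first by rewrite -[leLHS]expR0 ler_expR mulr_ge0// ltW.
move=> s; rewrite le_eqVlt => /orP[/eqP <-|s0].
  by rewrite mulr0 oppr0 !powRr0 mulr1 -[leLHS]expR0 ler_expR mulr_ge0// ltW.
rewrite /powR !gt_eqF// -expRD ler_expR.
have h : ln (c / s) <= c / s - 1.
  have {1}-> : c / s = 1 + (c / s - 1) by ring.
  by apply: le_ln1Dx; rewrite ltrBDl subrr divr_gt0.
rewrite ln_div ?posrE// expRK in h.
have : de * s * (ln K / de - ln s) <= de * s * (c / s - 1) by rewrite ler_pM2l ?mulr_gt0.
have -> : de * s * (ln K / de - ln s) = s * ln K + - (de * s) * ln s by field; rewrite gt_eqF.
have -> : de * s * (c / s - 1) = de * c - de * s by field; rewrite gt_eqF.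
move=> h2; by apply: (le_trans h2); rewrite gerBl mulr_ge0 ?ltW.
Qed.

Lemma rGamma1D_le (R : realType) (x : R) : 0 <= x -> 0 < rGamma (1 + x) /\ rGamma (1 + x) <= expR x * x `^ (- x).
Proof.
move=> x0; have x1 : 0 < 1 + x by rewrite ltr_pwDl.
have G0 := Gamma_gt0 x1.
rewrite rGammaV// invr_gt0; split => //.
move: x0; rewrite le_eqVlt => /orP[/eqP <-|x0].
  by rewrite addr0 Gamma1 invr1 expR0 oppr0 powRr0 mul1r.
have h := Gamma_ge x0; rewrite addrC in h.
rewrite powRN -[expR x]invrK -expRN -invfM lef_pV2 ?posrE ?mulr_gt0 ?expR_gt0 ?powR_gt0//.
by rewrite mulrC.
Qed.

(** 1 / Gamma(1 + be s) decays like s^(- be s), while [gauss_le] grows like s^s. Since be > 1, a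
    factor s^(- (be - 1) s) is left, and it absorbs every geometric factor by [superexp_bound]. *)
Lemma hard_dom (R : realType) (be A d x : R) (c s : nat -> nat -> R) :
  1 < be -> 1 <= A -> 0 < d -> 0 < x ->
  (forall m n, `|c m n| <= A ^+ (m + n)) -> (forall m n, d * (m + n)%:R <= s m n) ->
  exists C : R, forall m n, `|c m n * rGamma (1 + be * s m n)| *
     (x `^ s m n * (expR (2 * s m n + 1) * s m n `^ s m n)) <= C * 2^-1 ^+ m * 2^-1 ^+ n.
Proof.
move=> be1 A1 d0 x0 hc hs.
have A0 : 0 < A by exact: lt_le_trans A1.
have b0 : 0 < be by exact: lt_trans be1.
(* All bases raised to the power s: (2 A)^(1/d) covers (2 A)^(m + n) because d (m + n) <= s, the 2
   there being what leaves the ratio 1/2, and e^(2 + be) collects the exponentials of [gauss_le] and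
   [rGamma1D_le]. *)
pose K := (2 * A) `^ d^-1 * x * expR (2 + be).
have K0 : 0 < K by rewrite !mulr_gt0 ?powR_gt0 ?mulr_gt0 ?expR_gt0.
have d1 : 0 < be - 1 by rewrite subr_gt0.
have [C C1 hC] := superexp_bound K0 d1.
exists (expR 1 * C) => m n.
have s0 : 0 <= s m n by apply: le_trans (hs m n); rewrite mulr_ge0// ltW.
have bs0 : 0 <= be * s m n by rewrite mulr_ge0// ltW.
have [g0 g1] := rGamma1D_le bs0.
rewrite normrM (gtr0_norm g0) -[leRHS]mulrA -exprD exprVn ler_pdivlMr ?exprn_gt0//.
have e1 : A ^+ (m + n) * 2 ^+ (m + n) <= ((2 * A) `^ d^-1) `^ s m n.
  rewrite -exprMn mulrC -powRrM -powR_mulrn ?mulr_ge0 ?(ltW A0)//.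
  apply: ler_powR; first by rewrite -[leLHS]mulr1; apply: ler_pM => //; rewrite ler1n.
  by rewrite mulrC ler_pdivlMr// mulrC.
have e2 : (be * s m n) `^ (- (be * s m n)) <= s m n `^ (- (be * s m n)).
  move: s0; rewrite le_eqVlt => /orP[/eqP <-|s0]; first by rewrite mulr0 oppr0.
  rewrite !powRN lef_pV2 ?posrE ?powR_gt0 ?mulr_gt0//.
  by apply: ge0_ler_powR; rewrite ?nnegrE ?(ltW s0)// ler_peMl ?ltW.
move: (s m n) s0 bs0 g0 g1 e1 e2 => t t0 bt0 g0 g1 e1 e2.
have hCt := hC t t0.
move: g0 g1; generalize (rGamma (1 + be * t)) => G g0 g1.
have -> : `|c m n| * G * (x `^ t * (expR (2 * t + 1) * t `^ t)) * 2 ^+ (m + n) =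
   (`|c m n| * 2 ^+ (m + n)) * (G * (x `^ t * (expR (2 * t + 1) * t `^ t))) by ring.
apply: (@le_trans _ _ (((2 * A) `^ d^-1) `^ t *
   (expR (be * t) * t `^ (- (be * t)) * (x `^ t * (expR (2 * t + 1) * t `^ t))))).
  apply: ler_pM; rewrite ?mulr_ge0 ?exprn_ge0 ?powR_ge0 ?expR_ge0 ?(ltW g0)//.
    by apply: le_trans e1; apply: ler_wpM2r; rewrite ?exprn_ge0.
  apply: ler_wpM2r; first by rewrite !mulr_ge0 ?powR_ge0 ?expR_ge0.
  by apply: (le_trans g1); apply: ler_wpM2l; [exact: expR_ge0|].
apply: (@le_trans _ _ (expR 1 * (K `^ t * t `^ (- ((be - 1) * t))))); last by apply: ler_wpM2l; rewrite ?expR_ge0.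
have -> : K `^ t = ((2 * A) `^ d^-1) `^ t * x `^ t * expR (t * (2 + be)).
  have p1 : 0 <= (2 * A) `^ d^-1 by exact: powR_ge0.
  by rewrite /K (powRM _ (mulr_ge0 p1 (ltW x0)) (expR_ge0 _)) (powRM _ p1 (ltW x0)) powR_expR.
have -> : expR (2 * t + 1) = expR (t * (2 + be)) * expR 1 * expR (- (be * t)).
  by rewrite -!expRD; congr expR; ring.
have -> : t `^ (- ((be - 1) * t)) = t `^ (- (be * t)) * t `^ t.
  move: t0; rewrite le_eqVlt => /orP[/eqP <-|t0]; first by rewrite !mulr0 oppr0 !powRr0 mulr1.
  by rewrite -powRD ?(gt_eqF t0) ?implybT//; congr (_ `^ _); ring.
have e3 : expR (be * t) * expR (- (be * t)) = 1 by rewrite -expRD subrr expR0.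
rewrite le_eqVlt; apply/orP; left; apply/eqP.
move: e3; set a := expR (be * t); set b := expR (- _) => e3.
set P := (_ `^ _) `^ t; set Q := t `^ _; set Y := x `^ t; set Z := expR (t * _); set W := t `^ t.
transitivity (a * b * (P * Q * Y * Z * W * expR 1)); first ring.
by rewrite e3; ring.
Qed.

(** (-1)^k times the k-th derivative of the Laplace transform of [g]. *)
Definition lapk (R : realType) (k : nat) (g : R -> R) (q : R) : R :=
  pint (fun u => u ^+ k * expR (- (q * u)) * g u).

Lemma lapk_integrable (R : realType) (k : nat) (g : R -> R) (M q : R) :
  measurable_fun (`]0, +oo[ : set R) g -> (forall u : R, 0 < u -> `|g u| <= M) -> 0 < q ->
  pintegrable (fun u => u ^+ k * expR (- (q * u)) * g u).
Proof.
move=> mg gM q0; apply: (pintegrable_dom _ _ (pintegrableZ M (exp_integrable k q0))).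
  by apply: measurable_funM => //; meas.
move=> u u0; rewrite normrM mulrC [`|u ^+ k * _|]ger0_norm; last first.
  by rewrite mulr_ge0 ?expR_ge0// exprn_ge0// ltW.
by apply: ler_wpM2r; [rewrite mulr_ge0 ?expR_ge0// exprn_ge0// ltW|exact: gM].
Qed.

Lemma lapk_derive (R : realType) (k : nat) (g : R -> R) (M q : R) :
  measurable_fun (`]0, +oo[ : set R) g -> (forall u : R, 0 < u -> `|g u| <= M) -> 0 < q ->
  is_derive q 1 (lapk k g) (- lapk k.+1 g q).
Proof.
move=> mg gM q0; rewrite /lapk -pintN; last exact: lapk_integrable gM q0.
have q2 : 0 < q / 2 by rewrite divr_gt0.
refine (@pint_derive R (fun q u => u ^+ k * expR (- (q * u)) * g u)
  (fun q u => - (u ^+ k.+1 * expR (- (q * u)) * g u)) q (q / 2) (q + 1)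
  (fun u => M * (u ^+ k.+1 * expR (- (q / 2 * u)))) _ _ _ _ _ _); rewrite ?ltrDl//; first lra.
- by move=> x x1 x2; apply: lapk_integrable gM (lt_trans q2 x1).
- move=> x y x1 x2 y0; have h : is_derive x 1 (fun x => expR (- (x * y))) (- y * expR (- (x * y))).
    by apply: is_derive_eq; rewrite /GRing.scale/=; ring.
  by apply: is_derive_eq; rewrite /GRing.scale/= exprS; ring.
- by apply: pintegrableZ; exact: exp_integrable.
- move=> x y x1 x2 y0; rewrite normrN normrM mulrC; have yk : 0 <= y ^+ k.+1 by rewrite exprn_ge0// ltW.
  rewrite [`|_ * expR _|]ger0_norm ?mulr_ge0 ?expR_ge0//.
  apply: ler_pM; rewrite ?mulr_ge0 ?expR_ge0//; first exact: gM.
  by apply: ler_wpM2l => //; rewrite ler_expR lerN2 ler_pM2r// ltW.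
Qed.

Lemma lin_boundedB (R : realType) (e : nat -> nat -> R) (x : R) :
  lin_bounded e -> lin_bounded (fun m n => e m n - x).
Proof.
move=> [K K0 hK]; exists (K + `|x|); first by rewrite addr_ge0.
move=> m n; apply: le_trans (ler_normB _ _) _; rewrite mulrDl; apply: lerD; first exact: hK.
by rewrite ler_peMr// -natrM ler1n muln_gt0.
Qed.

(** Differentiating q^(s - 1) k times yields the product of the j + 1 - s, with the sign built into
    [lapk]; divided by k! it is [gauss k s]. *)
Lemma lapk_series (R : realType) (g : R -> R) (M q0 : R) (kap s : nat -> nat -> R) :
  measurable_fun (`]0, +oo[ : set R) g -> (forall u : R, 0 < u -> `|g u| <= M) -> 0 <= q0 ->
  lin_bounded s -> geo_beyond q0 kap (fun m n => s m n - 1) ->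
  (forall q, q0 < q -> lapk 0 g q = dsum (fun m n => kap m n * q `^ (s m n - 1))) ->
  forall k, geo_beyond q0 (fun m n => kap m n * \prod_(j < k) (j.+1%:R - s m n)) (fun m n => s m n - 1 - k%:R) /\
  forall q, q0 < q -> lapk k g q =
    dsum (fun m n => kap m n * (\prod_(j < k) (j.+1%:R - s m n)) * q `^ (s m n - 1 - k%:R)).
Proof.
move=> mg gM q00 ls gb h0; elim=> [|k [ih1 ih2]].
  split=> q q1.
    have [C [r [r0 r1 hr]]] := gb q q1; exists C, r; split => // m n.
    by have := hr m n; rewrite big_ord0 mulr1 subr0.
  by rewrite (h0 _ q1); apply: eq_dsum => m n; rewrite big_ord0 mulr1 subr0.
have le := lin_boundedB k%:R (lin_boundedB 1 ls).
have gb' := geo_beyond_deriv q00 le ih1.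
have E m n q : kap m n * \prod_(j < k.+1) (j.+1%:R - s m n) * q `^ (s m n - 1 - k.+1%:R) =
  -1 * (kap m n * \prod_(j < k) (j.+1%:R - s m n) * (s m n - 1 - k%:R) * q `^ (s m n - 1 - k%:R - 1)).
  have -> : s m n - 1 - k.+1%:R = s m n - 1 - k%:R - 1 by rewrite -natr1; ring.
  by rewrite big_ord_recr/= -natr1; ring.
split=> q q1; have [C [r [r0 r1 hr]]] := gb' q q1.
  by exists C, r; split => // m n; rewrite E mulN1r normrN; exact: hr.
have qp : 0 < q by exact: le_lt_trans q1.
have d1 := dsum_derive q00 le ih1 q1.
have d2 := lapk_derive k mg gM qp.
have d3 : is_derive q 1 (lapk k g) (dsum (fun m n => kap m n * \prod_(j < k) (j.+1%:R - s m n) * (s m n - 1 - k%:R) * q `^ (s m n - 1 - k%:R - 1))).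
  apply: near_eq_is_derive d1; near=> y; apply/esym/ih2.
  by near: y; exact: lt_nbhsr.
have : - lapk k.+1 g q = dsum (fun m n => kap m n * \prod_(j < k) (j.+1%:R - s m n) * (s m n - 1 - k%:R) * q `^ (s m n - 1 - k%:R - 1)).
  by have [_ <-] := d2; have [_ <-] := d3.
move=> /(congr1 -%R); rewrite opprK => ->.
by rewrite -[LHS]mulN1r -(dsumZ (-1) r0 r1 hr); apply: eq_dsum => m n; rewrite E.
Unshelve. all: by end_near. Qed.

(* Post-Widder inversion: the k-th derivative of the Laplace transform at (k+1)/t is the mean of g
   under a Gamma law of mean t and variance t^2/(k+1). *)
Lemma pw_series (R : realType) (g : R -> R) (M q0 : R) (kap s : nat -> nat -> R) :
  measurable_fun (`]0, +oo[ : set R) g -> (forall u : R, 0 < u -> `|g u| <= M) -> 0 <= q0 ->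
  (forall u v : R, 0 < u -> u <= v -> g v <= g u) ->
  lin_bounded s -> geo_beyond q0 kap (fun m n => s m n - 1) ->
  (forall q, q0 < q -> lapk 0 g q = dsum (fun m n => kap m n * q `^ (s m n - 1))) ->
  (forall t : R, 0 < t -> exists (C r : R) (k0 : nat), [/\ 0 <= r, r < 1 & forall k, (k0 <= k)%N ->
     dgeo C r (fun m n => kap m n * ((k.+1%:R / t) `^ s m n * gauss k (s m n)))]) ->
  geo_beyond 0 (fun m n => kap m n * rGamma (1 - s m n)) (fun m n => - s m n) /\
  forall t, 0 < t -> g t = dsum (fun m n => kap m n * rGamma (1 - s m n) * t `^ (- s m n)).
Proof.
move=> mg gM q00 gmono ls gb h0 dom.
have tq (t : R) (k : nat) (x : R) : 0 < t -> (k.+1%:R / t) `^ x = k.+1%:R `^ x * t `^ (- x).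
  move=> t0; rewrite powRM ?invr_ge0 ?(ltW t0)//.
  by rewrite -(powR_inv1 (ltW t0)) -powRrM mulN1r.
have lim1 (t : R) m n : 0 < t -> kap m n * ((k.+1%:R / t) `^ s m n * gauss k (s m n)) @[k --> \oo] -->
    kap m n * rGamma (1 - s m n) * t `^ (- s m n).
  move=> t0; have h := @gauss_cvg_all R (s m n).
  have h2 : kap m n * t `^ (- s m n) * (k.+1%:R `^ s m n * gauss k (s m n)) @[k --> \oo] -->
     kap m n * t `^ (- s m n) * rGamma (1 - s m n) by exact: cvgZr.
  rewrite mulrAC; apply: cvg_trans h2; apply: near_eq_cvg; near=> k.
  by rewrite tq//; ring.
have gb2 : geo_beyond 0 (fun m n => kap m n * rGamma (1 - s m n)) (fun m n => - s m n).
  move=> t t0; have [C [r [k0 [r0 r1 hk]]]] := dom t t0; exists C, r; split => // m n.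
  have h : `|kap m n * ((k.+1%:R / t) `^ s m n * gauss k (s m n))| @[k --> \oo] -->
     `|kap m n * rGamma (1 - s m n) * t `^ (- s m n)| by apply: cvg_norm; exact: lim1.
  by apply: (cvg_le_cst h); near=> k; apply: hk; near: k; exact: nbhs_infty_ge.
split=> //; pose h t := dsum (fun m n => kap m n * rGamma (1 - s m n) * t `^ (- s m n)).
have lN : lin_bounded (fun m n => - s m n).
  by have [K K0 hK] := ls; exists K => // m n; rewrite normrN.
have ch (t : R) : 0 < t -> {for t, continuous h}.
  by move=> t0; apply: is_derive_continuous (dsum_derive (lexx 0) lN gb2 t0).
have M0 : 0 <= M by exact: le_trans (normr_ge0 _) (gM 1 ltr01).
(* At q = (k + 1) / t the normalized k-th derivative becomes termwise a Gauss approximation, and the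
   hypothesis [dom] is the majorant for Tannery's theorem. *)
have pwL (t : R) : 0 < t -> pw k t g @[k --> \oo] --> h t.
  move=> t0; have [C [r [k0 [r0 r1 hk]]]] := dom t t0.
  have hl : dsum (fun m n => kap m n * ((k.+1%:R / t) `^ s m n * gauss k (s m n))) @[k --> \oo] --> h t.
    apply: (dsum_tannery (C := C) r0 r1); last by move=> m n; exact: lim1.
    by near=> k; apply: hk; near: k; exact: nbhs_infty_ge.
  apply: cvg_trans hl; apply: near_eq_cvg; near=> k.
  have kq : q0 < k.+1%:R / t.
    rewrite ltr_pdivlMr//; apply: lt_trans (_ : _ < k%:R) _; last by rewrite ltr_nat.
    by near: k; exact: nbhs_infty_gtr.
  have qp : 0 < k.+1%:R / t by exact: le_lt_trans kq.
  have [gbk hL] := lapk_series mg gM q00 ls gb h0 k.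
  have [C' [r' [r0' r1' hr']]] := gbk _ kq.
  rewrite /pw -/(lapk k g _) hL// -(dsumZ _ r0' r1' hr'); apply: eq_dsum => m n.
  have -> : gauss k (s m n) = (\prod_(j < k) (j.+1%:R - s m n)) / k`!%:R.
    rewrite /gauss; elim: (k) => [|i ih]; first by rewrite !big_ord0 fact0 divr1.
    rewrite !big_ord_recr/= ih factS natrM invfM.
    have -> : 1 - s m n / i.+1%:R = (i.+1%:R - s m n) / i.+1%:R by rewrite mulrBl mulfV// pnatr_eq0.
    by ring.
  have -> : s m n - 1 - k%:R = s m n - k.+1%:R by rewrite -natr1; ring.
  rewrite powRB ?(gt_eqF qp) ?implybT// powR_mulrn ?(ltW qp)//.
  have : (k.+1%:R / t) ^+ k.+1 != 0 by rewrite expf_neq0// gt_eqF.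
  have : k`!%:R != 0 :> R by rewrite pnatr_eq0 -lt0n fact_gt0.
  set Q := _ ^+ k.+1; set f := k`!%:R; set P := \prod_(j < k) _; set Y := powR _ _ => f0 Q0.
  by clearbody Q f P Y; field; rewrite f0 Q0.
have pI (t : R) k : 0 < t -> pwI k t g by move=> t0; apply: lapk_integrable gM _; rewrite // divr_gt0.
(* Continuity of [g] is not assumed, so the limit [h t] is compared with values of [g] at other
   points. Right of [a] monotonicity gives g u <= g a; left of [a] the quadratic term is at least 2
   M. *)
have up (a t : R) : 0 < a -> a < t -> h t <= g a.
  move=> a0 at0; have t0 : 0 < t by exact: lt_trans at0.
  have h1 : pw k t g - (2 * M / (t - a) ^+ 2) * t ^+ 2 / k.+1%:R @[k --> \oo] --> h t - 0.
    by apply: cvgB; [exact: pwL|exact: cvg_div_nat].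
  rewrite subr0 in h1; apply: (cvg_le_cst h1); near=> k; rewrite lerBlDr.
  apply: pw_le => //; first exact: pI.
  move=> u u0; have ta : 0 < t - a by rewrite subr_gt0.
  have [au|ua] := leP a u.
    apply: (@le_trans _ _ (g a)); first exact: gmono.
    by rewrite lerDl mulr_ge0 ?sqr_ge0// divr_ge0 ?sqr_ge0// mulr_ge0.
  have h2 : 2 * M <= 2 * M / (t - a) ^+ 2 * (u - t) ^+ 2.
    rewrite mulrAC ler_pdivlMr ?exprn_gt0//; apply: ler_wpM2l; first by rewrite mulr_ge0.
    have -> : (u - t) ^+ 2 = (t - u) ^+ 2 by ring.
    by apply: lerXn2r; rewrite ?nnegrE; lra.
  have := gM u u0; have := gM a a0; rewrite !ler_norml => /andP[x1 _] /andP[_ x2]; lra.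
have dn (t b : R) : 0 < t -> t < b -> g b <= h t.
  move=> t0 tb; have b0 : 0 < b by exact: lt_trans tb.
  rewrite -lerN2.
  have h1 : - pw k t g - (2 * M / (t - b) ^+ 2) * t ^+ 2 / k.+1%:R @[k --> \oo] --> - h t - 0.
    apply: cvgB; first by apply: cvgN; exact: pwL.
    exact: cvg_div_nat.
  rewrite subr0 in h1; apply: (cvg_le_cst h1); near=> k; rewrite lerBlDr.
  have [iN <-] := pwN (pI t k t0).
  apply: pw_le => // u u0; have ta : 0 < b - t by rewrite subr_gt0.
  have bt : 0 < (t - b) ^+ 2 by rewrite -sqrrN opprB exprn_gt0.
  have [au|ua] := leP u b.
    apply: (@le_trans _ _ (- g b)); first by rewrite lerN2; exact: gmono.
    by rewrite lerDl mulr_ge0 ?sqr_ge0// divr_ge0 ?sqr_ge0// mulr_ge0.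
  have h2 : 2 * M <= 2 * M / (t - b) ^+ 2 * (u - t) ^+ 2.
    rewrite mulrAC ler_pdivlMr//; apply: ler_wpM2l; first by rewrite mulr_ge0.
    have -> : (t - b) ^+ 2 = (b - t) ^+ 2 by ring.
    by apply: lerXn2r; rewrite ?nnegrE; lra.
  have := gM u u0; have := gM b b0; rewrite !ler_norml => /andP[x1 x1'] /andP[x2' x2]; lra.
(* The two comparisons bound [g t] by values of [h] on either side of [t], and [h] is continuous. *)
move=> t t0; apply/eqP; rewrite eq_le; apply/andP; split.
  have cl : - h y @[y --> t^'-] --> - h t by apply: cvgN; exact: cvg_at_left_filter (ch t t0).
  rewrite -lerN2; apply: (cvg_le_cst cl); near=> y; rewrite lerN2; apply: dn.
    by near: y; exact: nbhs_left_gt.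
  by near: y; exact: nbhs_left_lt.
have cr : h y @[y --> t^'+] --> h t by exact: cvg_at_right_filter (ch t t0).
by apply: (cvg_le_cst cr); near=> y; apply: up => //; near: y; exact: nbhs_right_gt.
Unshelve. all: by end_near. Qed.

(** For negative exponents [gaussN_le] leaves (t / k0)^sg, which beats A^(m + n) with a factor 2^(m
    + n) to spare once k0 >= (2 A)^(1/d) t. The threshold [k0] therefore depends on [t]. *)
Lemma easy_dom (R : realType) (A d t : R) (c sg : nat -> nat -> R) :
  1 <= A -> 0 < d -> 0 < t ->
  (forall m n, `|c m n| <= A ^+ (m + n)) -> (forall m n, d * (m + n)%:R <= sg m n) ->
  lin_bounded sg ->
  exists (C r : R) (k0 : nat), [/\ 0 <= r, r < 1 & forall k, (k0 <= k)%N ->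
     dgeo C r (fun m n => c m n * ((k.+1%:R / t) `^ (- sg m n) * gauss k (- sg m n)))].
Proof.
move=> A1 d0 t0 hc hs ls.
have A0 : 0 < A by exact: lt_le_trans A1.
have A2 : 1 <= 2 * A by rewrite -[leLHS]mulr1; apply: ler_pM => //; rewrite ler1n.
pose B := (2 * A) `^ d^-1 * t.
pose k0 := (Num.truncn B).+1.
have k0B : B <= k0%:R by exact/ltW/truncnS_gt.
pose x : R := 2^-1.
have x0 : 0 <= x by rewrite invr_ge0.
have x1 : x < 1 by rewrite invf_lt1// ltr1n.
have s0 m n : 0 <= sg m n by apply: le_trans (hs m n); rewrite mulr_ge0// ltW.
have ls1 : lin_bounded (fun m n => 1 + sg m n).
  have [K K0 hK] := lin_boundedB (-1) ls; exists K => // m n.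
  by have := hK m n; rewrite opprK addrC.
(* The polynomial factor (1 + sg)^k0 only enlarges the ratio. *)
have [C [r [r0 r1 hC]]] : exists C r : R, [/\ 0 <= r, r < 1 &
    dgeo C r (fun m n => (1 + sg m n) ^+ k0 * (x ^+ m * x ^+ n))].
  elim: k0 {k0B} => [|i [C [r [r0 r1 hr]]]].
    exists 1, x; split => // m n; rewrite expr0 !mul1r ger0_norm ?mulr_ge0 ?exprn_ge0//.
  have [C' [r' [r0' r1' hr']]] := dgeo_poly r0 r1 hr ls1.
  by exists C', r'; split => // m n; rewrite exprS -mulrA; exact: hr'.
exists C, r, k0; split => // k kk m n; apply: le_trans (hC m n).
have [g0 g1] := gaussN_le (s0 m n) (ltn0Sn _ : (0 < k0)%N) kk.
rewrite !normrM (ger0_norm g0) (ger0_norm (powR_ge0 _ _)).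
have pk : 0 <= (1 + sg m n) ^+ k0 by rewrite exprn_ge0// addr_ge0.
rewrite (ger0_norm pk) (ger0_norm (exprn_ge0 m x0)) (ger0_norm (exprn_ge0 n x0)).
have k1 : 0 < k0%:R :> R by rewrite ltr0n.
have -> : (k.+1%:R / t) `^ (- sg m n) = k.+1%:R `^ (- sg m n) * t `^ sg m n.
  by rewrite powRM ?invr_ge0 ?(ltW t0)// -[t^-1](powR_inv1 (ltW t0)) -powRrM mulrNN mul1r.
have e1 : A ^+ (m + n) * (t `^ sg m n * k0%:R `^ (- sg m n)) <= x ^+ m * x ^+ n.
  rewrite -exprD exprVn powRN -(ler_pM2r (powR_gt0 (sg m n) k1)).
  rewrite -mulrA divfK ?gt_eqF ?powR_gt0// mulrC ler_pdivlMl ?exprn_gt0//.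
  rewrite mulrCA -exprMn.
  rewrite -ler_pdivlMl ?powR_gt0//.
  have -> : (t `^ sg m n)^-1 * k0%:R `^ sg m n = (k0%:R / t) `^ sg m n.
    by rewrite powRM ?invr_ge0 ?(ltW t0)// -[t^-1](powR_inv1 (ltW t0)) -powRrM mulN1r powRN mulrC.
  have kt : (2 * A) `^ d^-1 <= k0%:R / t by rewrite ler_pdivlMr.
  have p1 : 1 <= (2 * A) `^ d^-1.
    by rewrite -[leLHS](powRr0 (2 * A)); apply: ler_powR => //; rewrite invr_ge0 ltW.
  apply: (@le_trans _ _ (((2 * A) `^ d^-1) `^ sg m n)).
    rewrite -powRrM -powR_mulrn ?(le_trans ler01)//; apply: ler_powR => //.
    by rewrite mulrC ler_pdivlMr// mulrC.
  apply: ge0_ler_powR; rewrite ?nnegrE ?powR_ge0//.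
  by rewrite divr_ge0// ltW.
apply: (@le_trans _ _ (A ^+ (m + n) * (t `^ sg m n * ((1 + sg m n) ^+ k0 * k0%:R `^ (- sg m n))))).
  apply: ler_pM => //; first by rewrite !mulr_ge0 ?powR_ge0.
  rewrite mulrAC [leRHS]mulrC; apply: ler_wpM2r => //; exact: powR_ge0.
have E (u v w z : R) : u * (v * (w * z)) = w * (u * (v * z)) by ring.
by rewrite E; exact: (ler_wpM2l pk e1).
Qed.

(** * Spitzer's identity *)

Definition bmeas (d : measure_display) (T : measurableType d) (R : realType) (g : T -> R) : Prop :=
  measurable_fun setT g /\ exists M : R, forall x, `|g x| <= M.

Lemma bmeas_comp (d d' : measure_display) (T : measurableType d) (T' : measurableType d')
    (R : realType) (g : T' -> R) (f : T -> T') :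
  bmeas g -> measurable_fun setT f -> bmeas (fun x => g (f x)).
Proof.
move=> [mg [M hM]] mf; split; last by exists M.
exact: (measurableT_comp mg mf).
Qed.

Lemma bmeas_integrable (d : measure_display) (T : measurableType d) (R : realType)
    (P : probability T R) (g : T -> R) : bmeas g -> P.-integrable setT (EFin \o g).
Proof.
move=> [mg [M hM]].
have i1 : P.-integrable setT (EFin \o cst M) by exact: finite_measure_integrable_cst.
apply: (le_integrable measurableT _ _ i1); first exact/measurable_EFinP.
by move=> x _ /=; rewrite lee_fin (le_trans (hM x))// ler_norm.
Qed.

Definition Ex (d : measure_display) (T : measurableType d) (R : realType)
    (P : probability T R) (g : T -> R) : R := \int[P]_w g w.

Lemma eq_Ex (d : measure_display) (T : measurableType d) (R : realType)
    (P : probability T R) (f g : T -> R) : (forall w, f w = g w) -> Ex P f = Ex P g.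
Proof. by move=> h; apply: eq_Rintegral => w _; exact: h. Qed.

Lemma ExD (d : measure_display) (T : measurableType d) (R : realType)
    (P : probability T R) (f g : T -> R) : bmeas f -> bmeas g ->
  Ex P (fun w => f w + g w) = Ex P f + Ex P g.
Proof. by move=> hf hg; rewrite /Ex RintegralD//; exact: bmeas_integrable. Qed.

Lemma ExZ (d : measure_display) (T : measurableType d) (R : realType)
    (P : probability T R) (k : R) (f : T -> R) : bmeas f ->
  Ex P (fun w => k * f w) = k * Ex P f.
Proof. by move=> hf; rewrite /Ex RintegralZl//; exact: bmeas_integrable. Qed.

Lemma Ex_cst (d : measure_display) (T : measurableType d) (R : realType)
    (P : probability T R) (k : R) : Ex P (fun=> k) = k.
Proof. by rewrite /Ex /Rintegral integral_cst//= (_ : P setT = 1%E) ?mule1//; exact: probability_setT. Qed.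

Lemma bmeasD (d : measure_display) (T : measurableType d) (R : realType) (f g : T -> R) :
  bmeas f -> bmeas g -> bmeas (fun w => f w + g w).
Proof.
move=> [mf [M hM]] [mg [M' hM']]; split; first exact: measurable_funD.
by exists (M + M') => x; apply: le_trans (ler_normD _ _) _; exact: lerD.
Qed.

Lemma bmeas_cst (d : measure_display) (T : measurableType d) (R : realType) (k : R) :
  bmeas (fun _ : T => k).
Proof. by split; [exact: measurable_cst|exists `|k|]. Qed.

Lemma bmeasM (d : measure_display) (T : measurableType d) (R : realType) (f g : T -> R) :
  bmeas f -> bmeas g -> bmeas (fun w => f w * g w).
Proof.
move=> [mf [M hM]] [mg [M' hM']]; split; first exact: measurable_funM.
exists (M * M') => x; rewrite normrM; exact: ler_pM.
Qed.

Lemma bmeasN (d : measure_display) (T : measurableType d) (R : realType) (f : T -> R) :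
  bmeas f -> bmeas (fun w => - f w).
Proof.
move=> [mf [M hM]]; split; first exact: measurable_funN.
by exists M => x; rewrite normrN.
Qed.

Lemma ExB (d : measure_display) (T : measurableType d) (R : realType)
    (P : probability T R) (f g : T -> R) : bmeas f -> bmeas g ->
  Ex P (fun w => f w - g w) = Ex P f - Ex P g.
Proof.
move=> hf hg; rewrite ExD//; last exact: bmeasN.
by congr (_ + _); rewrite -[RHS]mulN1r -ExZ//; apply: eq_Ex => w; rewrite mulN1r.
Qed.

Lemma Ex_sum (d : measure_display) (T : measurableType d) (R : realType)
    (P : probability T R) (n : nat) (f : 'I_n -> T -> R) : (forall i, bmeas (f i)) ->
  bmeas (fun w => \sum_(i < n) f i w) /\
  Ex P (fun w => \sum_(i < n) f i w) = \sum_(i < n) Ex P (f i).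
Proof.
elim: n f => [|n ih] f hf.
  split; first by under eq_fun do rewrite big_ord0; exact: bmeas_cst.
  by rewrite big_ord0 -[RHS](Ex_cst P 0); apply: eq_Ex => w; rewrite big_ord0.
have [h1 h2] := ih (fun i => f (widen_ord (leqnSn n) i)) (fun i => hf _).
split.
  by under eq_fun do rewrite big_ord_recr/=; exact: bmeasD.
rewrite big_ord_recr/= -h2 -ExD//; apply: eq_Ex => w; by rewrite big_ord_recr.
Qed.

Lemma Ex_le (d : measure_display) (T : measurableType d) (R : realType)
    (P : probability T R) (f g : T -> R) : bmeas f -> bmeas g -> (forall w, f w <= g w) ->
  Ex P f <= Ex P g.
Proof. by move=> hf hg h; apply: le_Rintegral => //; exact: bmeas_integrable. Qed.

Lemma Ex_norm_le (d : measure_display) (T : measurableType d) (R : realType)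
    (P : probability T R) (f : T -> R) (M : R) : measurable_fun setT f -> (forall w, `|f w| <= M) ->
  `|Ex P f| <= M.
Proof.
move=> mf hM; have bf : bmeas f by split => //; exists M.
rewrite ler_norml; apply/andP; split.
  rewrite -(Ex_cst P (- M)); apply: Ex_le => //; first exact: bmeas_cst.
  by move=> w; have := hM w; rewrite ler_norml => /andP[].
rewrite -(Ex_cst P M); apply: Ex_le => //; first exact: bmeas_cst.
by move=> w; have := hM w; rewrite ler_norml => /andP[].
Qed.

Lemma bmeas_Ex (d d' : measure_display) (Y : measurableType d') (T : measurableType d) (R : realType)
    (P : probability T R) (f : Y * T -> R) : bmeas f ->
  bmeas (fun y => Ex P (fun w => f (y, w))).
Proof.
move=> [mf [M hM]].
have mfy y : measurable_fun setT (fun w => f (y, w)) by exact: (measurableT_comp mf (measurable_pair1 y)).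
split; last by exists M => y; apply: Ex_norm_le.
(* Tonelli's measurability statement concerns nonnegative functions, hence the shift by the bound
   [M]. *)
have E y : Ex P (fun w => f (y, w)) = Ex P (fun w => f (y, w) + M) - M.
  rewrite ExD; [by rewrite Ex_cst addrK|by split => //; exists M|exact: bmeas_cst].
under eq_fun do rewrite E.
apply: measurable_funB; last exact: measurable_cst.
pose F (p : Y * T) := (f p + M)%:E.
have F0 p : (0 <= F p)%E by rewrite lee_fin; have := hM p; rewrite ler_norml => /andP[]; lra.
have mF : measurable_fun setT F by apply/measurable_EFinP; apply: measurable_funD.
have := @measurable_fun_fubini_tonelli_F _ _ Y T R P F mF F0.
move=> h; apply: (measurableT_comp (@fine_measurable R setT measurableT) h).
Qed.

Lemma Ex_swap (d d' : measure_display) (T : measurableType d) (T' : measurableType d') (R : realType)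
    (P : probability T R) (P' : probability T' R) (f : T * T' -> R) : bmeas f ->
  Ex P (fun x => Ex P' (fun y => f (x, y))) = Ex P' (fun y => Ex P (fun x => f (x, y))).
Proof.
move=> [mf [M hM]].
have i1 : P.-integrable setT (EFin \o cst M) by exact: finite_measure_integrable_cst.
have i2 : P'.-integrable setT (EFin \o cst 1) by exact: finite_measure_integrable_cst.
apply: (@fubini_dom _ _ T T' R P P' setT setT (fun x y => f (x, y)) (cst M) (cst 1) measurableT measurableT _ i1 i2 _).2.
  by apply: eq_measurable_fun mf => -[].
by move=> x y _ _; rewrite /= mulr1.
Qed.

Lemma pair_measure_eq (d1 d2 : measure_display) (T1 : measurableType d1) (T2 : measurableType d2)
    (R : realType) (m1 m2 : {measure set (T1 * T2) -> \bar R}) :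
  (m1 setT < +oo)%E ->
  (forall A B, measurable A -> measurable B -> m1 (A `*` B) = m2 (A `*` B)) ->
  forall D, measurable D -> m1 D = m2 D.
Proof.
move=> fin h D mD.
pose C : set (set (T1 * T2)) := [set A `*` B | A in measurable & B in measurable].
apply: (@measure_unique _ R _ C (fun=> setT)) => //.
- by rewrite measurable_prod_measurableType.
- move=> _ _ [A1 mA1 [B1 mB1 <-]] [A2 mA2 [B2 mB2 <-]].
  rewrite -setXI; exists (A1 `&` A2); first exact: measurableI.
  by exists (B1 `&` B2) => //; exact: measurableI.
- by move=> i; exists setT => //; exists setT => //; rewrite setXTT.
- by apply/seteqP; split => // x _; exists 0%N.
- by move=> _ [A mA [B mB <-]]; exact: h.
Qed.

(** The law of (U, V) under P and the law of (U', V') under P x P agree on rectangles, hence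
    everywhere. The primed variables allow each factor to be replaced by one of the same law. *)
Lemma indep_Ex (d d1 d2 : measure_display) (T : measurableType d) (T1 : measurableType d1)
    (T2 : measurableType d2) (R : realType) (P : probability T R)
    (U U' : T -> T1) (V V' : T -> T2) (G : T1 * T2 -> R) :
  measurable_fun setT U -> measurable_fun setT V -> measurable_fun setT U' -> measurable_fun setT V' ->
  (forall A B, measurable A -> measurable B ->
     P (U @^-1` A `&` V @^-1` B) = (P (U' @^-1` A) * P (V' @^-1` B))%E) ->
  bmeas G -> Ex P (fun w => G (U w, V w)) = Ex P (fun x => Ex P (fun y => G (U' x, V' y))).
Proof.
move=> mU mV mU' mV' h bG; have [mG [M hM]] := bG.
pose phi w := (U w, V w); pose psi (p : T * T) := (U' p.1, V' p.2).
have mphi : measurable_fun setT phi by exact: measurable_fun_pair.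
have mpsi : measurable_fun setT psi.
  by apply: measurable_fun_pair; [exact: (measurableT_comp mU' measurable_fst)|exact: (measurableT_comp mV' measurable_snd)].
pose m1 := measure_function_pushforward__canonical__measure_function_Measure P mphi.
pose m2 := measure_function_pushforward__canonical__measure_function_Measure (P \x P)%E mpsi.
have e12 D : measurable D -> m1 D = m2 D.
  apply: pair_measure_eq.
    by rewrite /m1 /= /pushforward preimage_setT probability_setT ltry.
  move=> A B mA mB; rewrite /m1 /m2 /= /pushforward.
  have -> : phi @^-1` (A `*` B) = U @^-1` A `&` V @^-1` B by [].
  have -> : psi @^-1` (A `*` B) = (U' @^-1` A) `*` (V' @^-1` B) by [].
  rewrite product_measure1E// ?h//.
    by rewrite -[X in measurable X]setTI; exact: mU'.
  by rewrite -[X in measurable X]setTI; exact: mV'.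
have mGE : measurable_fun setT (EFin \o G) by exact/measurable_EFinP.
have bGphi : bmeas (G \o phi) by exact: bmeas_comp.
have i1 : P.-integrable setT (EFin \o (G \o phi)) by exact: bmeas_integrable.
have i2 : (P \x P)%E.-integrable setT (EFin \o (G \o psi)).
  have i0 : (P \x P)%E.-integrable setT (EFin \o cst M).
    have mc : measurable_fun setT (EFin \o cst M : T * T -> \bar R).
      by apply/measurable_EFinP; exact: measurable_cst.
    apply: (integrable12ltyP P P mc).2.
    have PT : P setT = 1%E by exact: probability_setT.
    under eq_integral do rewrite /= integral_cst//= PT mule1.
    by rewrite integral_cst//= PT mule1 ltry.
  have mGp : measurable_fun setT (EFin \o (G \o psi)) by exact: (measurableT_comp mGE mpsi).
  apply: (le_integrable measurableT mGp _ i0).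
  by move=> x _ /=; rewrite lee_fin (le_trans (hM _))// ler_norm.
have e1 := @integral_pushforward _ _ _ _ R phi mphi P setT (EFin \o G) mGE i1 measurableT.
have e2 := @integral_pushforward _ _ _ _ R psi mpsi (P \x P)%E setT (EFin \o G) mGE i2 measurableT.
have e3 : (\int[pushforward P phi]_y (EFin \o G) y = \int[pushforward (P \x P)%E psi]_y (EFin \o G) y)%E.
  exact: (@eq_measure_integral _ _ R setT m2 m1 (EFin \o G) (fun A mA _ => e12 A mA)).
have e4 := integral12_prod_meas1 i2.
rewrite /Ex /Rintegral; congr fine.
rewrite preimage_setT in e1; rewrite preimage_setT in e2.
transitivity (\int[P]_x fubini_F P (EFin \o (G \o psi)) x)%E.
  by rewrite e4; transitivity (\int[pushforward P phi]_y (EFin \o G) y)%E; [rewrite e1|rewrite e3 e2].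
apply: eq_integral => x _; rewrite /fubini_F /=.
rewrite fineK//; apply: integrable_fin_num => //.
apply: bmeas_integrable; apply: (bmeas_comp bG).
by apply: measurable_fun_pair => //; exact: measurable_cst.
Qed.

Definition pospart (R : realType) (x : R) : R := Num.max x 0.

Lemma measurable_pospart (R : realType) : measurable_fun setT (@pospart R).
Proof. by apply: measurable_maxr; [exact: measurable_id|exact: measurable_cst]. Qed.

Lemma measurable_funpospart (d : measure_display) (T : measurableType d) (R : realType) (f : T -> R) :
  measurable_fun setT f -> measurable_fun setT (fun x => pospart (f x)).
Proof. by move=> mf; exact: (measurableT_comp (@measurable_pospart R) mf). Qed.

(* The Rota-Baxter relation of the projection h |-> h o pospart. *)
Lemma pospart_RB (R : realType) (h : R -> R) (a b : R) :
  h (pospart a + pospart b) + h (pospart (a + b)) =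
  h (pospart (a + pospart b)) + h (pospart (pospart a + b)).
Proof.
rewrite /pospart; have [a0|a0] := leP a 0; have [b0|b0] := leP b 0.
- by rewrite !addr0 !add0r (max_r a0) (max_r b0) (max_r (_ : a + b <= 0)) ?addr0// -[leRHS]addr0; exact: lerD.
- by rewrite !add0r (max_l (ltW b0)) addrC.
- by rewrite !addr0 (max_l (ltW a0)).
- by rewrite (max_l (ltW (addr_gt0 a0 b0))).
Qed.

Lemma telescope_ord (R : realType) (a B : nat -> R) (n : nat) :
  \sum_(i < n) (a i.+1 + B i.+1 - a i.+2) = \sum_(i < n) B i.+1 + (a 1%N - a n.+1).
Proof.
elim: n => [|n ih]; first by rewrite !big_ord0 subrr addr0.
by rewrite !big_ord_recr/= ih; ring.
Qed.

(** Induction on [n]. The Rota-Baxter relation writes the k-th summand for n + 1 as a_k + B_k -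
    a_(k+1); the a's telescope to one copy of the left-hand expectation, and the induction
    hypothesis, applied with the first step held fixed, sums the B's to n further copies. *)
Lemma spitzer (d : measure_display) (T : measurableType d) (R : realType) (P : probability T R)
    (D M : nat -> T -> R) :
  (forall k, measurable_fun setT (D k)) -> (forall k, measurable_fun setT (M k)) ->
  (forall w, M 0%N w = 0) ->
  (forall k g, bmeas g -> Ex P (fun w => g (D k.+1 w)) = Ex P (fun x => Ex P (fun y => g (D k x + D 1%N y)))) ->
  (forall n g, bmeas g -> Ex P (fun w => g (M n.+1 w)) =
     Ex P (fun y => Ex P (fun z => g (pospart (D 1%N y + M n z))))) ->
  forall n g, bmeas g -> n%:R * Ex P (fun w => g (M n w)) =
    \sum_(k < n) Ex P (fun x => Ex P (fun z => g (pospart (D k.+1 x) + M (n - k.+1)%N z))).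
Proof.
move=> mD mM M0 HF2 HF3.
have mDc (d' : measure_display) (Y : measurableType d') k (f : Y -> T) : measurable_fun setT f -> measurable_fun setT (fun y => D k (f y)).
  by move=> mf; exact: (measurableT_comp (mD k) mf).
have mMc (d' : measure_display) (Y : measurableType d') k (f : Y -> T) : measurable_fun setT f -> measurable_fun setT (fun y => M k (f y)).
  by move=> mf; exact: (measurableT_comp (mM k) mf).
have mshift (x : R) : measurable_fun setT (fun z : R => x + z).
  by apply: measurable_funD; [exact: measurable_cst|exact: measurable_id].
elim=> [|n ih] g bg; first by rewrite mul0r big_ord0.
pose a k := Ex P (fun x => Ex P (fun z => g (pospart (D k x + M (n.+1 - k)%N z)))).
pose B k := Ex P (fun y => Ex P (fun x => Ex P (fun z => g (pospart (pospart (D k x) + (D 1%N y + M (n - k)%N z)))))).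
have t11 : measurable_fun setT (fun p : T * T * T => p.1.1) by exact: (measurableT_comp measurable_fst measurable_fst).
have t12 : measurable_fun setT (fun p : T * T * T => p.1.2) by exact: (measurableT_comp measurable_snd measurable_fst).
have t2 : measurable_fun setT (fun p : T * T * T => p.2) by exact: measurable_snd.
(* The relation is used at D_k and D_1 + M_(n-k): the positive part of the second has the law of
   M_(n+1-k), and the sum of the two is an independent copy of D_(k+1) plus M_(n-k). *)
have step k : (0 < k)%N -> (k <= n)%N ->
    Ex P (fun x => Ex P (fun z => g (pospart (D k x) + M (n.+1 - k)%N z))) = a k + B k - a k.+1.
  move=> k0 kn.
  pose F1 (p : T * T * T) := g (pospart (D k p.1.1 + pospart (D 1%N p.1.2 + M (n - k)%N p.2))).
  pose F2 (p : T * T * T) := g (pospart (pospart (D k p.1.1) + (D 1%N p.1.2 + M (n - k)%N p.2))).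
  pose F3 (p : T * T * T) := g (pospart (D k p.1.1 + (D 1%N p.1.2 + M (n - k)%N p.2))).
  have m3 : measurable_fun setT (fun p : T * T * T => D 1%N p.1.2 + M (n - k)%N p.2).
    by apply: measurable_funD; [exact: mDc|exact: mMc].
  have b1 : bmeas F1.
    by apply: bmeas_comp bg _; apply: measurable_funpospart; apply: measurable_funD; [exact: mDc|exact: measurable_funpospart].
  have b2 : bmeas F2.
    by apply: bmeas_comp bg _; apply: measurable_funpospart; apply: measurable_funD => //; apply: measurable_funpospart; exact: mDc.
  have b3 : bmeas F3.
    by apply: bmeas_comp bg _; apply: measurable_funpospart; apply: measurable_funD => //; exact: mDc.
  pose E3 (F : T * T * T -> R) := Ex P (fun x => Ex P (fun y => Ex P (fun z => F (x, y, z)))).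
  have b3' (F : T * T * T -> R) : bmeas F -> bmeas (fun q : T * T => Ex P (fun z => F (q, z))).
    exact: bmeas_Ex.
  have sub (F F' : T * T * T -> R) : bmeas F -> bmeas F' ->
      E3 (fun p => F p + F' p) = E3 F + E3 F'.
    move=> bF bF'; rewrite /E3 -ExD; last 2 first.
    - by apply: bmeas_Ex (b3' _ bF).
    - by apply: bmeas_Ex (b3' _ bF').
    apply: eq_Ex => x; rewrite -ExD; last 2 first.
    - exact: bmeas_comp (b3' _ bF) (measurable_pair1 x).
    - exact: bmeas_comp (b3' _ bF') (measurable_pair1 x).
    apply: eq_Ex => y; rewrite -ExD//.
      exact: bmeas_comp bF (measurable_pair1 (x, y)).
    exact: bmeas_comp bF' (measurable_pair1 (x, y)).
  have nk : (n.+1 - k = (n - k).+1)%N by rewrite subSn.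
  have -> : Ex P (fun x => Ex P (fun z => g (pospart (D k x) + M (n.+1 - k)%N z))) =
      E3 (fun p => F1 p + F2 p + - F3 p).
    apply: eq_Ex => x; rewrite nk (HF3 _ (fun z => g (pospart (D k x) + z))); last exact: bmeas_comp bg (mshift _).
    apply: eq_Ex => y; apply: eq_Ex => z; rewrite /F1 /F2 /F3 /=.
    have := pospart_RB g (D k x) (D 1%N y + M (n - k)%N z); lra.
  rewrite (sub (fun p => F1 p + F2 p) (fun p => - F3 p)) ?(sub F1 F2)//; [|exact: bmeasD|exact: bmeasN].
  have -> : E3 F1 = a k.
    apply: eq_Ex => x; rewrite nk (HF3 _ (fun z => g (pospart (D k x + z))))//.
    by apply: bmeas_comp bg _; apply: measurable_funpospart; exact: mshift.
  have -> : E3 F2 = B k.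
    rewrite /E3 /B; have := @Ex_swap _ _ T T R P P (fun q => Ex P (fun z => F2 (q, z))) (b3' _ b2).
    by move=> ->.
  have -> : E3 (fun p => - F3 p) = - a k.+1; last by [].
    pose H u := Ex P (fun z => g (pospart (u + M (n - k)%N z))).
    have bH : bmeas H.
      apply: (@bmeas_Ex _ _ _ _ R P (fun p : R * T => g (pospart (p.1 + M (n - k)%N p.2)))).
      apply: bmeas_comp bg _; apply: measurable_funpospart; apply: measurable_funD; first exact: measurable_fst.
      by apply: (mMc _ _ _ _); exact: measurable_snd.
    have e := HF2 k H bH.
    rewrite /a subSS -/(H _) e.
    have eN (F : T -> R) : bmeas F -> Ex P (fun w => - F w) = - Ex P F.
      by move=> bF; rewrite -mulN1r -ExZ//; apply: eq_Ex => w; rewrite mulN1r.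
    rewrite -eN; last first.
      apply: (@bmeas_Ex _ _ _ _ R P (fun p : T * T => H (D k p.1 + D 1%N p.2))).
      by apply: bmeas_comp bH _; apply: measurable_funD; apply: (mDc _ _ _ _); [exact: measurable_fst|exact: measurable_snd].
    apply: eq_Ex => x; rewrite -eN; last first.
      by apply: bmeas_comp bH _; apply: measurable_funD => //; exact: measurable_cst.
    apply: eq_Ex => y; rewrite /H -eN; last first.
      apply: bmeas_comp bg _; apply: measurable_funpospart; apply: measurable_funD => //; exact: measurable_cst.
    by apply: eq_Ex => z; rewrite /F3 /= addrA.
(* The induction hypothesis for the function that sends z to g of the positive part of D_1 + z, then
   averaged over the first step. *)
have SB : n%:R * Ex P (fun w => g (M n.+1 w)) = \sum_(k < n) B k.+1.
  rewrite (HF3 _ _ bg) -ExZ; last first.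
    apply: (@bmeas_Ex _ _ _ _ R P (fun p : T * T => g (pospart (D 1%N p.1 + M n p.2)))).
    by apply: bmeas_comp bg _; apply: measurable_funpospart; apply: measurable_funD; [apply: (mDc _ _ _ _); exact: measurable_fst|apply: (mMc _ _ _ _); exact: measurable_snd].
  pose f (i : 'I_n) (y : T) := Ex P (fun x => Ex P (fun z => g (pospart (pospart (D i.+1 x) + (D 1%N y + M (n - i.+1)%N z))))).
  have bf i : bmeas (f i).
    pose F (q : T * T * T) := g (pospart (pospart (D i.+1 q.1.2) + (D 1%N q.1.1 + M (n - i.+1)%N q.2))).
    have bF : bmeas F.
      apply: bmeas_comp bg _; apply: measurable_funpospart; apply: measurable_funD; first by apply: measurable_funpospart; exact: mDc.
      by apply: measurable_funD; [exact: mDc|exact: mMc].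
    have bF' : bmeas (fun q : T * T => Ex P (fun z => F (q, z))) by exact: bmeas_Ex.
    exact: (@bmeas_Ex _ _ _ _ R P (fun q : T * T => Ex P (fun z => F (q, z)))).
  have [_ <-] := Ex_sum P bf; apply: eq_Ex => y.
  rewrite (ih (fun z => g (pospart (D 1%N y + z)))); last first.
    by apply: bmeas_comp bg _; apply: measurable_funpospart; exact: mshift.
  apply: eq_bigr => i _; apply: eq_Ex => x; apply: eq_Ex => z.
  by congr (g (pospart _)); ring.
rewrite -natr1 mulrDl mul1r SB big_ord_recr/= subnn.
under [X in _ = X + _]eq_bigr => i _ do rewrite (step i.+1 isT (ltn_ord i)).
have -> : \sum_(i < n) (a i.+1 + B i.+1 - a i.+2) = \sum_(i < n) B i.+1 + (a 1%N - a n.+1).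
  exact: telescope_ord.
have -> : Ex P (fun w => g (M n.+1 w)) = a 1%N by rewrite (HF3 _ _ bg) /a subSS subn0.
have -> : Ex P (fun x => Ex P (fun z => g (pospart (D n.+1 x) + M 0%N z))) = a n.+1.
  rewrite /a subnn; apply: eq_Ex => x; apply: eq_Ex => z; by rewrite !M0 !addr0.
by rewrite -addrA subrK.
Qed.

(** * Random walks embedded in the process *)

Definition step (d : measure_display) (T : measurableType d) (R : realType)
    (P : probability T R) (X : R -> {RV P >-> R}) (h : R) (j : nat) (w : T) : R :=
  X (j.+1%:R * h) w - X (j%:R * h) w.

(** The maximum of X((j + i) h) - X(j h) over 0 <= i <= m, built from its first step (Lindley's
    recursion): the recursive call involves later steps only, so it is independent of the steps
    before it. *)
Fixpoint walk_max (d : measure_display) (T : measurableType d) (R : realType)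
    (P : probability T R) (X : R -> {RV P >-> R}) (h : R) (j m : nat) (w : T) : R :=
  if m is m'.+1 then pospart (step X h j w + walk_max X h j.+1 m' w) else 0.

Lemma measurable_RV (d : measure_display) (T : measurableType d) (R : realType)
    (P : probability T R) (X : R -> {RV P >-> R}) (t : R) : measurable_fun setT (X t : T -> R).
Proof. exact: measurable_funP. Qed.

Lemma measurable_step (d : measure_display) (T : measurableType d) (R : realType)
    (P : probability T R) (X : R -> {RV P >-> R}) (h : R) (j : nat) :
  measurable_fun setT (step X h j).
Proof. by apply: measurable_funB; exact: measurable_RV. Qed.

Lemma measurable_walk_max (d : measure_display) (T : measurableType d) (R : realType)
    (P : probability T R) (X : R -> {RV P >-> R}) (h : R) (j m : nat) :
  measurable_fun setT (walk_max X h j m).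
Proof.
elim: m j => [|m ih] j; first exact: measurable_cst.
by apply: measurable_funpospart; apply: measurable_funD; [exact: measurable_step|exact: ih].
Qed.

Definition step_event (d : measure_display) (T : measurableType d) (R : realType)
    (P : probability T R) (X : R -> {RV P >-> R}) (h : R) (A : nat -> set R) (n : nat) : set T :=
  \bigcap_(i < n) [set w | A i (step X h i w)].

Lemma step_eventS (d : measure_display) (T : measurableType d) (R : realType)
    (P : probability T R) (X : R -> {RV P >-> R}) (h : R) (A : nat -> set R) (n : nat) :
  step_event X h A n.+1 = step_event X h A n `&` step X h n @^-1` A n.
Proof.
apply/seteqP; split => w.
  by move=> hw; split; [move=> i /= hi; exact: hw (ltnW hi : (i < n.+1)%N)|exact: hw (ltnSn n)].
move=> [h1 h2] i /=; rewrite ltnS leq_eqVlt => /orP[/eqP ->//|hi]; exact: h1.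
Qed.

Lemma measurable_preim (d d' : measure_display) (T : measurableType d) (T' : measurableType d')
    (f : T -> T') (A : set T') : measurable_fun setT f -> measurable A -> measurable (f @^-1` A).
Proof. by move=> mf mA; rewrite -[X in measurable X]setTI; exact: mf. Qed.

Lemma measurable_step_event (d : measure_display) (T : measurableType d) (R : realType)
    (P : probability T R) (X : R -> {RV P >-> R}) (h : R) (A : nat -> set R) (n : nat) :
  (forall i, measurable (A i)) -> measurable (step_event X h A n).
Proof.
move=> mA; elim: n => [|n ih].
  by rewrite /step_event (_ : \bigcap_(i < 0) _ = setT)//; apply/seteqP; split.
rewrite step_eventS; apply: measurableI => //.
by apply: measurable_preim => //; exact: measurable_step.
Qed.

Lemma fine_prob_inj (d : measure_display) (T : measurableType d) (R : realType)
    (P : probability T R) (A : set T) (x : R) : measurable A -> fine (P A) = x -> P A = x%:E.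
Proof. by move=> mA <-; rewrite fineK// fin_num_measure. Qed.

Lemma step_event_prob (d : measure_display) (T : measurableType d) (R : realType)
    (P : probability T R) (X : R -> {RV P >-> R}) (h : R) (A : nat -> set R) (n : nat) :
  Levy_process P X -> 0 < h -> (forall i, measurable (A i)) ->
  P (step_event X h A n.+1) = (P (step_event X h A n) * P (step X h 0 @^-1` A n))%E.
Proof.
move=> [_ indep stat _] h0 mA.
have hI k : fine (P (step_event X h A k)) = \prod_(i < k) fine (P (step X h i @^-1` A i)).
  apply: (indep k (fun i => i%:R * h) A) => //; first by rewrite mul0r.
  by move=> i j ij; rewrite ler_pM2r// ler_nat.
have mS k : measurable (step X h k @^-1` A k) by apply: measurable_preim => //; exact: measurable_step.
have e : P (step X h n @^-1` A n) = P (step X h 0 @^-1` A n).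
  have h1 := stat (n%:R * h) (n.+1%:R * h) (A n).
  have -> : P (step X h n @^-1` A n) = P [set w | A n (X (n.+1%:R * h - n%:R * h) w - X 0 w)].
    apply: h1 => //; rewrite mulr_ge0 ?(ltW h0)//=; by rewrite ler_pM2r// ler_nat.
  congr (P _); apply/seteqP; rewrite /step mul1r mul0r.
  have -> : n.+1%:R * h - n%:R * h = h by rewrite -natr1; ring.
  by split.
have m0 := measurable_step_event X h n mA; have m1 := measurable_step_event X h n.+1 mA.
rewrite (fine_prob_inj m1 (hI _)) (fine_prob_inj m0 (hI _)) -e.
rewrite -[P (step X h n @^-1` A n)]fineK ?fin_num_measure// -EFinM.
by rewrite big_ord_recr.
Qed.

(** Induction on [m] for all [j] and all events. Restricted to the event [E], the pair of step j and
    the later maximum has P(E) times the law of the pair at j = 0: on rectangles this is the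
    induction hypothesis, with the condition on step j added to the event. *)
Lemma walk_max_indep (d : measure_display) (T : measurableType d) (R : realType)
    (P : probability T R) (X : R -> {RV P >-> R}) (h : R) (m j : nat) (A : nat -> set R) (B : set R) :
  Levy_process P X -> 0 < h -> (forall i, measurable (A i)) -> measurable B ->
  P (step_event X h A j `&` walk_max X h j m @^-1` B) =
  (P (step_event X h A j) * P (walk_max X h 0 m @^-1` B))%E.
Proof.
move=> hL h0; elim: m j A B => [|m ih] j A B mA mB.
  have [hB|hB] := pselect (B 0).
    have -> : walk_max X h j 0 @^-1` B = setT by apply/seteqP; split.
    by rewrite setIT probability_setT mule1.
  have -> : walk_max X h j 0 @^-1` B = set0 by apply/seteqP; split.
  by rewrite setI0 measure0 mule0.
set E := step_event X h A j; have mE : measurable E by exact: measurable_step_event.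
pose phi j w := (step X h j w, walk_max X h j.+1 m w).
have mphi i : measurable_fun setT (phi i).
  by apply: measurable_fun_pair; [exact: measurable_step|exact: measurable_walk_max].
have c0 : 0 <= fine (P E) by exact: fine_ge0.
pose C : {nonneg R} := NngNum c0.
have EP : ((fine (P E))%:E = P E)%E by rewrite fineK// fin_num_measure.
pose m1 := measure_function_pushforward__canonical__measure_function_Measure (mrestr P mE) (mphi j).
pose m2 := mscale C (measure_function_pushforward__canonical__measure_function_Measure P (mphi 0%N)).
have e12 D : measurable D -> m1 D = m2 D.
  apply: pair_measure_eq.
    rewrite /m1 /= /pushforward preimage_setT /mrestr setTI.
    by rewrite -EP ltry.
  move=> A' B' mA' mB'.
  have -> : m1 (A' `*` B') = P (E `&` step X h j @^-1` A' `&` walk_max X h j.+1 m @^-1` B').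
    rewrite /m1 /= /pushforward /mrestr; congr (P _).
    by rewrite setIC setIA.
  transitivity (P E * P (step X h 0 @^-1` A' `&` walk_max X h 1 m @^-1` B'))%E; last first.
    by rewrite /= /mscale/= /pushforward EP.
  pose A2 i := if (i < j)%N then A i else A'.
  have mA2 i : measurable (A2 i) by rewrite /A2; case: ifP.
  have E2 : step_event X h A2 j = E.
    by apply: eq_bigcapr => i /= ij; rewrite /A2 ij.
  have E3 : step_event X h A2 j.+1 = E `&` step X h j @^-1` A'.
    by rewrite step_eventS E2 /A2 ltnn.
  rewrite -E3 ih// step_event_prob// E2 /A2 ltnn -muleA; congr (_ * _)%E.
  have E1 : step_event X h (fun=> A') 1 = step X h 0 @^-1` A'.
    rewrite step_eventS /step_event (_ : \bigcap_(i < 0) _ = setT) ?setTI//.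
    by apply/seteqP; split.
  by rewrite -E1 ih.
pose S := (fun p : R * R => pospart (p.1 + p.2)) @^-1` B.
have mS : measurable S.
  apply: measurable_preim => //; apply: measurable_funpospart.
  by apply: measurable_funD; [exact: measurable_fst|exact: measurable_snd].
have := e12 S mS; rewrite {1}/m1 {1}/m2 /= /mscale/= /pushforward /mrestr EP.
by rewrite setIC.
Qed.

Lemma walk_spitzer (d : measure_display) (T : measurableType d) (R : realType)
    (P : probability T R) (X : R -> {RV P >-> R}) (h : R) (n : nat) (g : R -> R) :
  Levy_process P X -> 0 < h -> bmeas g ->
  n%:R * Ex P (fun w => g (walk_max X h 0 n w)) =
  \sum_(k < n) Ex P (fun x => Ex P (fun z =>
     g (pospart (X (k.+1%:R * h) x - X 0 x) + walk_max X h 0 (n - k.+1) z))).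
Proof.
move=> hL h0 bg; pose D k w := X (k%:R * h) w - X 0 w.
have mD k : measurable_fun setT (D k) by apply: measurable_funB; exact: measurable_RV.
have D1 : D 1%N = step X h 0 by rewrite /D /step mul0r.
have mW k := measurable_walk_max X h 0 k.
apply: (@spitzer _ T R P D (walk_max X h 0)) => // [k {}g {}bg|m {}g {}bg].
(* Times 0, k h, (k + 1) h, constant from there on: a nondecreasing sequence whose first two
   increments are the ones wanted. *)
- pose t i := if i is i'.+1 then (if i' is _.+1 then k.+1%:R * h else k%:R * h) else 0.
  have [_ indep stat _] := hL.
  have bG : bmeas (fun p : R * R => g (p.1 + p.2)).
    by apply: bmeas_comp bg _; apply: measurable_funD; [exact: measurable_fst|exact: measurable_snd].
  have := @indep_Ex _ _ _ T R R R P (D k) (D k) (step X h k) (D 1%N) (fun p => g (p.1 + p.2))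
    (mD k) (measurable_step X h k) (mD k) (mD 1%N) _ bG.
  move=> <-.
    by apply: eq_Ex => w; congr g; rewrite /D /step /=; ring.
  move=> A B mA mB.
  have mDA : measurable (D k @^-1` A) by exact: measurable_preim.
  have mSB : measurable (step X h k @^-1` B) by apply: measurable_preim => //; exact: measurable_step.
  pose A2 (i : nat) := if i is 0%N then A else B.
  have hi := indep 2 t A2.
  have E2 : \bigcap_(i < 2) [set w | A2 i (X (t i.+1) w - X (t i) w)] = D k @^-1` A `&` step X h k @^-1` B.
    apply/seteqP; split => w.
      by move=> hw; split; [exact: (hw 0%N isT)|exact: (hw 1%N isT)].
    by move=> [h1 h2] [|[|i]].
  rewrite E2 in hi.
  have -> : P (D k @^-1` A `&` step X h k @^-1` B) =
     (fine (P (D k @^-1` A)) * fine (P (step X h k @^-1` B)))%:E.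
    apply: fine_prob_inj; first exact: measurableI.
    rewrite hi//; first by rewrite !big_ord_recl big_ord0 mulr1.
      apply: homo_leq => //; first by move=> x y z; exact: le_trans.
      case=> [|[|i]] //=; first by rewrite mulr_ge0// ltW.
      by rewrite ler_pM2r// ler_nat.
    by case.
  rewrite EFinM !fineK ?fin_num_measure//; congr (_ * _)%E.
  have hk : 0 <= k%:R * h <= k.+1%:R * h.
    by rewrite mulr_ge0 ?(ltW h0)//= ler_pM2r// ler_nat.
  have -> : P (step X h k @^-1` B) = P [set w | B (X (k.+1%:R * h - k%:R * h) w - X 0 w)] by exact: stat.
  congr (P _); rewrite /D mul1r.
  by have -> : k.+1%:R * h - k%:R * h = h by rewrite -natr1; ring.
- have bG : bmeas (fun p : R * R => g (pospart (p.1 + p.2))).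
    apply: bmeas_comp bg _; apply: measurable_funpospart.
    by apply: measurable_funD; [exact: measurable_fst|exact: measurable_snd].
  have := @indep_Ex _ _ _ T R R R P (D 1%N) (D 1%N) (walk_max X h 1 m) (walk_max X h 0 m)
    (fun p => g (pospart (p.1 + p.2))) (mD 1%N) (measurable_walk_max X h 1 m) (mD 1%N) (mW m) _ bG.
  move=> <-; first by rewrite D1.
  move=> A B mA mB; rewrite D1.
  have E1 : step_event X h (fun=> A) 1 = step X h 0 @^-1` A.
    rewrite step_eventS /step_event (_ : \bigcap_(i < 0) _ = setT) ?setTI//.
    by apply/seteqP; split.
  by rewrite -E1; exact: walk_max_indep.
Qed.

(** * The Laplace transform of the supremum *)

(** The case of [indep_Ex] in which the second variable is constant. *)
Lemma law_Ex (d : measure_display) (T : measurableType d) (R : realType) (P : probability T R)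
    (U V : T -> R) (g : R -> R) : measurable_fun setT U -> measurable_fun setT V ->
  (forall A, measurable A -> P (U @^-1` A) = P (V @^-1` A)) -> bmeas g ->
  Ex P (fun w => g (U w)) = Ex P (fun w => g (V w)).
Proof.
move=> mU mV h bg.
have m0 : measurable_fun setT (fun _ : T => 0 : R) by exact: measurable_cst.
have bG : bmeas (fun p : R * R => g p.1) by apply: bmeas_comp bg _; exact: measurable_fst.
have := @indep_Ex _ _ _ T R R R P U V (fun=> 0) (fun=> 0) (fun p => g p.1) mU m0 mV m0 _ bG.
move=> -> //=; first by apply: eq_Ex => w; rewrite Ex_cst.
move=> A B mA mB; have E : P (U @^-1` A) = P (V @^-1` A) by exact: h.
have [hB|hB] := pselect (B 0).
  have -> : (fun _ : T => 0) @^-1` B = setT by apply/seteqP; split.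
  have PT : P setT = 1%E by exact: probability_setT.
  by rewrite setIT -E PT mule1.
have -> : (fun _ : T => 0) @^-1` B = set0 by apply/seteqP; split.
by rewrite setI0 measure0 mule0.
Qed.

Lemma Ex_ae (d : measure_display) (T : measurableType d) (R : realType) (P : probability T R)
    (A : set T) (f g : T -> R) : measurable A -> P A = 1%E -> bmeas f -> bmeas g ->
  (forall w, A w -> f w = g w) -> Ex P f = Ex P g.
Proof.
move=> mA PA bf bg h; have [mf _] := bf; have [mg _] := bg.
rewrite /Ex /Rintegral; congr fine; apply: ae_eq_integral => //; [exact/measurable_EFinP|exact/measurable_EFinP|].
exists (~` A); split; first exact: measurableC.
  by have := probability_setC P mA; rewrite PA subee.
by move=> w /= hw Aw; apply: hw => _; rewrite h.
Qed.

Lemma exp_neg_norm (R : realType) (a b : R) : 0 <= a -> 0 <= b -> `|expR (- (a * b))| <= 1.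
Proof.
by move=> a0 b0; rewrite ger0_norm ?expR_ge0// -[leRHS]expR0 ler_expR oppr_le0; exact: mulr_ge0.
Qed.

Lemma bmeas_exp (R : realType) (la : R) : 0 <= la -> bmeas (fun x : R => expR (- (la * pospart x))).
Proof.
move=> la0; split.
  apply: measurable_funexpR; apply: measurable_funN; apply: measurable_funM; first exact: measurable_cst.
  exact: measurable_pospart.
by exists 1 => x; apply: exp_neg_norm => //; rewrite /pospart le_max lexx orbT.
Qed.

Lemma pospart_ge0 (R : realType) (x : R) : 0 <= pospart x.
Proof. by rewrite /pospart le_max lexx orbT. Qed.

Lemma pospart_id (R : realType) (x : R) : 0 <= x -> pospart x = x.
Proof. by move=> x0; rewrite /pospart max_l. Qed.

Lemma pospartM (R : realType) (a x : R) : 0 <= a -> pospart (a * x) = a * pospart x.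
Proof. by move=> a0; rewrite /pospart maxr_pMr// mulr0. Qed.

Lemma walk_max_ge0 (d : measure_display) (T : measurableType d) (R : realType)
    (P : probability T R) (X : R -> {RV P >-> R}) (h : R) (j m : nat) w : 0 <= walk_max X h j m w.
Proof. by case: m => //= m; exact: pospart_ge0. Qed.

Definition cpos (d : measure_display) (T : measurableType d) (R : realType)
    (P : probability T R) (X : R -> {RV P >-> R}) (la : R) : R :=
  Ex P (fun w => expR (- (la * pospart (X 1 w)))).

Definition umax (d : measure_display) (T : measurableType d) (R : realType)
    (P : probability T R) (X : R -> {RV P >-> R}) (h la : R) (n : nat) : R :=
  Ex P (fun w => expR (- (la * walk_max X h 0 n w))).

Lemma measurable_start (d : measure_display) (T : measurableType d) (R : realType)
    (P : probability T R) (X : R -> {RV P >-> R}) : measurable [set w | X 0 w = 0].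
Proof.
have -> : [set w | X 0 w = 0] = X 0 @^-1` [set 0] by [].
by apply: measurable_preim; [exact: measurable_RV|exact: measurable_set1].
Qed.

Lemma cpos_scale (d : measure_display) (T : measurableType d) (R : realType)
    (P : probability T R) (X : R -> {RV P >-> R}) (al la t : R) :
  Levy_process P X -> strictly_stable P X al -> 0 < t -> 0 <= la ->
  Ex P (fun w => expR (- (la * pospart (X t w - X 0 w)))) = cpos X (la * t `^ al^-1).
Proof.
move=> [P0 _ _ _] st t0 la0.
have bg := bmeas_exp la0; have mX s := @measurable_RV _ T R P X s.
rewrite (Ex_ae (g := fun w => expR (- (la * pospart (X t w)))) (measurable_start X) P0); last first.
- by move=> w /= ->; rewrite subr0.
- by apply: bmeas_comp bg (mX t).
- by apply: bmeas_comp bg _; exact: measurable_funB.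
have mV : measurable_fun setT (fun w => t `^ al^-1 * X 1 w) by apply: measurable_funM; [exact: measurable_cst|exact: mX].
rewrite (law_Ex (mX t) mV _ bg).
  by apply: eq_Ex => w; rewrite pospartM ?powR_ge0// mulrA.
by move=> A mA; have := st t 1 A t0 ler01 mA; rewrite mulr1.
Qed.

Lemma umax_rec (d : measure_display) (T : measurableType d) (R : realType)
    (P : probability T R) (X : R -> {RV P >-> R}) (al h la : R) (n : nat) :
  Levy_process P X -> strictly_stable P X al -> 0 < h -> 0 <= la ->
  n%:R * umax X h la n = \sum_(k < n) cpos X (la * (k.+1%:R * h) `^ al^-1) * umax X h la (n - k.+1).
Proof.
move=> hL st h0 la0; have bg := bmeas_exp la0.
have E m w : expR (- (la * walk_max X h 0 m w)) = expR (- (la * pospart (walk_max X h 0 m w))).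
  by rewrite pospart_id// walk_max_ge0.
have -> : umax X h la n = Ex P (fun w => expR (- (la * pospart (walk_max X h 0 n w)))).
  by apply: eq_Ex => w; rewrite E.
rewrite (walk_spitzer n hL h0 bg); apply: eq_bigr => k _.
rewrite -(cpos_scale hL st) ?mulr_gt0// [RHS]mulrC -ExZ; last first.
  apply: bmeas_comp bg _; apply: measurable_funB; exact: measurable_RV.
apply: eq_Ex => x; rewrite /umax [RHS]mulrC -ExZ; last first.
  split; last first.
    by exists 1 => w; apply: exp_neg_norm => //; exact: walk_max_ge0.
  apply: measurable_funexpR; apply: measurable_funN; apply: measurable_funM; first exact: measurable_cst.
  exact: measurable_walk_max.
apply: eq_Ex => z; rewrite pospart_id; last by rewrite addr_ge0 ?pospart_ge0 ?walk_max_ge0.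
by rewrite mulrDr opprD expRD.
Qed.

Lemma umax0 (d : measure_display) (T : measurableType d) (R : realType)
    (P : probability T R) (X : R -> {RV P >-> R}) (h la : R) : umax X h la 0 = 1.
Proof. by rewrite -[RHS](Ex_cst P); apply: eq_Ex => w; rewrite /= mulr0 oppr0 expR0. Qed.

(** [strictly_stable] speaks of one time at a time and gives no scaling of the whole path. Spitzer's
    recursion needs no more: it determines [umax], and depends on [h] and [la] only through la
    h^(1/al). *)
Lemma umax_scale (d : measure_display) (T : measurableType d) (R : realType)
    (P : probability T R) (X : R -> {RV P >-> R}) (al h la : R) (n : nat) :
  Levy_process P X -> strictly_stable P X al -> 0 < h -> 0 <= la ->
  umax X h la n = umax X 1 (la * h `^ al^-1) n.
Proof.
move=> hL st h0 la0; elim/ltn_ind: n => n ih.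
have [->|n0] := posnP n; first by rewrite !umax0.
have nr : n%:R != 0 :> R by rewrite pnatr_eq0 -lt0n.
have la1 : 0 <= la * h `^ al^-1 by rewrite mulr_ge0// powR_ge0.
apply: (mulfI nr); rewrite (umax_rec n hL st h0 la0) (umax_rec n hL st ltr01 la1).
apply: eq_bigr => k _; have kn : (n - k.+1 < n)%N by rewrite ltn_subrL n0.
have -> : umax X h la (n - k.+1) = umax X 1 (la * h `^ al^-1) (n - k.+1) by exact: ih.
have -> : la * (k.+1%:R * h) `^ al^-1 = la * h `^ al^-1 * (k.+1%:R * 1) `^ al^-1.
  by rewrite powRM ?(ltW h0)// mulr1 -mulrA; congr (_ * _); rewrite mulrC.
by [].
Qed.

Lemma umax_bound (d : measure_display) (T : measurableType d) (R : realType)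
    (P : probability T R) (X : R -> {RV P >-> R}) (h la : R) (n : nat) : 0 <= la ->
  `|umax X h la n| <= 1.
Proof.
move=> la0; apply: Ex_norm_le.
  apply: measurable_funexpR; apply: measurable_funN; apply: measurable_funM; first exact: measurable_cst.
  exact: measurable_walk_max.
by move=> w; apply: exp_neg_norm => //; exact: walk_max_ge0.
Qed.

Lemma cpos_bound (d : measure_display) (T : measurableType d) (R : realType)
    (P : probability T R) (X : R -> {RV P >-> R}) (la : R) : 0 <= la -> `|cpos X la| <= 1.
Proof.
move=> la0; apply: Ex_norm_le.
  exact: (measurableT_comp (bmeas_exp la0).1 (measurable_RV X 1)).
by move=> w; apply: exp_neg_norm => //; exact: pospart_ge0.
Qed.

Lemma walk_max_ge (d : measure_display) (T : measurableType d) (R : realType)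
    (P : probability T R) (X : R -> {RV P >-> R}) (h : R) (j m i : nat) w : (i <= m)%N ->
  X ((j + i)%:R * h) w - X (j%:R * h) w <= walk_max X h j m w.
Proof.
elim: m i j => [|m ih] i j; first by rewrite leqn0 => /eqP ->; rewrite addn0 subrr.
case: i => [|i] im; first by rewrite addn0 subrr walk_max_ge0.
rewrite /= /pospart le_max; apply/orP; left.
by have := ih i j.+1 im; rewrite addSnnS /step; lra.
Qed.

Lemma walk_max_ex (d : measure_display) (T : measurableType d) (R : realType)
    (P : probability T R) (X : R -> {RV P >-> R}) (h : R) (j m : nat) w :
  exists2 i, (i <= m)%N & walk_max X h j m w = X ((j + i)%:R * h) w - X (j%:R * h) w.
Proof.
elim: m j => [|m ih] j; first by exists 0%N => //; rewrite addn0 subrr.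
have [i im e] := ih j.+1.
rewrite /= /pospart e; have [h1|h1] := leP (step X h j w + (X ((j.+1 + i)%:R * h) w - X (j.+1%:R * h) w)) 0.
  by exists 0%N => //; rewrite addn0 subrr.
by exists i.+1 => //; rewrite -addSnnS /step; ring.
Qed.

(** One-sided limits bound the path near each time, and compactness of [0, 1] makes the bound
    uniform. *)
Lemma cadlag_bounded (R : realType) (x : R -> R) :
  (forall t : R, 0 <= t -> x u @[u --> t^'+] --> x t) ->
  (forall t : R, 0 < t -> cvg (x u @[u --> t^'-])) ->
  exists M : R, forall u, 0 <= u -> u <= 1 -> x u <= M.
Proof.
move=> hr hl.
have cpt : compact (`[0, 1]%classic : set R) by exact: segment_compact.
have := (compact_near_coveringP _).1 cpt _ (@pinfty_nbhs R) (fun M u => 0 <= u -> u <= 1 -> x u <= M) _.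
have hloc (t : R) : (`[0, 1]%classic : set R) t -> \forall u \near t & M \near +oo, 0 <= u -> u <= 1 -> x u <= M.
  rewrite /= in_itv/= => /andP[t0 t1].
  have [B hB] : exists B : R, \forall u \near t, 0 <= u -> x u <= B.
    have nr : \forall u \near t^'+, x u <= x t + 1.
      near=> u; have : `|x t - x u| <= 1 by near: u; exact: (cvgrPdist_le _ _).1 (hr t t0) 1 ltr01.
      by rewrite distrC ler_norml => /andP[_]; lra.
    move: t0; rewrite le_eqVlt => /orP[/eqP t0|t0].
      exists (x t + 1).
      have {}nr : \forall u \near t, t < u -> x u <= x t + 1 by exact: nr.
      apply: filterS nr => u hu u0; have [tu|tu] := ltP t u; first exact: hu.
      have -> : u = t by apply/eqP; rewrite eq_le tu -t0.
      by rewrite lerDl.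
    have [l hl'] := (cvg_ex _).1 (hl t t0).
    have nl : \forall u \near t^'-, x u <= l + 1.
      near=> u; have : `|l - x u| <= 1 by near: u; exact: (cvgrPdist_le _ _).1 hl' 1 ltr01.
      by rewrite distrC ler_norml => /andP[_]; lra.
    exists (Num.max (x t + 1) (l + 1)).
    have {}nr : \forall u \near t, t < u -> x u <= x t + 1 by exact: nr.
    have {}nl : \forall u \near t, u < t -> x u <= l + 1 by exact: nl.
    near=> u => _; rewrite le_max; have [tu|tu|->] := ltgtP t u.
    - by apply/orP; left; move: tu; near: u.
    - by apply/orP; right; move: tu; near: u.
    - by rewrite lerDl ler01.
  exists ([set u | 0 <= u -> x u <= B], [set M | B <= M]).
    by split => //=; apply: nbhs_pinfty_ge; exact: num_real.
  by move=> [u M] /= [h1 h2] u0 _; exact: le_trans (h1 u0) h2.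
move=> /(_ _ hloc) hn.
have [M hM] := filter_ex hn; exists M => u u0 u1; apply: hM => //.
by rewrite /= in_itv/= u0.
Unshelve. all: by end_near. Qed.

Lemma running_sup_ge (d : measure_display) (T : measurableType d) (R : realType)
    (P : probability T R) (X : R -> {RV P >-> R}) (w : T) :
  cadlag_paths X -> forall u : R, 0 <= u -> u <= 1 -> X u w <= running_sup X 1 w.
Proof.
move=> cX u u0 u1; have [hr hl] := cX w.
have [M hM] := cadlag_bounded hr hl.
apply: ub_le_sup; last by exists u => //; rewrite /= in_itv/= u0.
by exists M => _ [v /= + <-]; rewrite in_itv/= => /andP[v0 v1]; exact: hM.
Qed.

(** Grid values never exceed the supremum. Conversely, right-continuity makes a grid point just
    after a nearly optimal time nearly as good. *)
Lemma walk_max_cvg (d : measure_display) (T : measurableType d) (R : realType)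
    (P : probability T R) (X : R -> {RV P >-> R}) (w : T) :
  cadlag_paths X ->
  (fun m : nat => walk_max X (m.+1%:R^-1) 0 m.+1 w) @ \oo --> running_sup X 1 w - X 0 w.
Proof.
move=> cX; have hge := running_sup_ge w cX; have [hr hl] := cX w.
have [W hW] : exists W, W = (fun m : nat => walk_max X (m.+1%:R^-1) 0 m.+1 w) by exists (fun m : nat => walk_max X (m.+1%:R^-1) 0 m.+1 w).
have Wge m i : (i <= m.+1)%N -> X (i%:R * m.+1%:R^-1) w - X 0 w <= W m.
  by move=> im; have := walk_max_ge X (m.+1%:R^-1) 0 w im; rewrite add0n mul0r hW.
rewrite -hW; apply/cvgrPdist_le => e e0.
have hup m : W m <= running_sup X 1 w - X 0 w.
  rewrite hW.
  have [i im ->] := walk_max_ex X (m.+1%:R^-1) 0 m.+1 w.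
  rewrite mul0r add0n; apply: lerB => //; apply: hge; first exact: mulr_ge0.
  by rewrite ler_pdivrMr// mul1r ler_nat.
have hs : has_sup [set X u w | u in `[0, 1]].
  split; first by exists (X 0 w); exists 0 => //; rewrite /= in_itv/= lexx ler01.
  by exists (running_sup X 1 w) => _ [v /= + <-]; rewrite in_itv/= => /andP[v0 v1]; exact: hge.
have e2 : 0 < e / 2 by rewrite divr_gt0.
have [_ [u /= + <-] hu] := sup_adherent e2 hs.
rewrite in_itv/= => /andP[u0 u1].
(* The time 1 has nothing to its right in [0, 1], but it belongs to every grid; any earlier time is
   rounded up strictly. *)
have key : \forall m \near \oo, X u w - e / 2 <= W m + X 0 w.
  move: u1; rewrite le_eqVlt => /orP[/eqP u1|u1].
    near=> m; have := Wge m m.+1 (leqnn _).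
    by rewrite mulfV// u1 => ?; lra.
  have nr : \forall v \near u^'+, X u w - e / 2 <= X v w.
    near=> v; have : `|X u w - X v w| <= e / 2 by near: v; exact: (cvgrPdist_le _ _).1 (hr u u0) _ e2.
    by rewrite ler_norml => /andP[_]; lra.
  have [de /= de0 hde] := (nbhs_ballP _ _).1 (nr : \forall v \near u, u < v -> X u w - e / 2 <= X v w).
  near=> m.
  have m0 : 0 < m.+1%:R :> R by [].
  have um0 : 0 <= u * m.+1%:R by rewrite mulr_ge0.
  have tl : (Num.truncn (u * m.+1%:R))%:R <= u * m.+1%:R by rewrite truncn_le.
  have tg : u * m.+1%:R < (Num.truncn (u * m.+1%:R)).+1%:R by rewrite truncnS_gt.
  set i := (Num.truncn (u * m.+1%:R)).+1.
  have im : (i <= m.+1)%N.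
    rewrite -(ltr_nat R); apply: le_lt_trans tl _.
    by rewrite -[ltRHS]mul1r ltr_pM2r.
  have := Wge _ _ im.
  have : X u w - e / 2 <= X (i%:R * m.+1%:R^-1) w; last by lra.
  have h1 : u < i%:R * m.+1%:R^-1 by rewrite ltr_pdivlMr.
  apply: hde => //=; rewrite /ball/= distrC ger0_norm; last by rewrite subr_ge0 ltW.
  apply: (@le_lt_trans _ _ m.+1%:R^-1).
    rewrite lerBlDl -[leRHS]mul1r -[X in _ <= X](mulfK (lt0r_neq0 m0)) ler_pM2r ?invr_gt0//.
    rewrite mul1r mulrDl mulVf ?lt0r_neq0// /i -natr1 lerD2r//.
  by near: m; exact: near_infty_natSinv_lt (PosNum de0).
near=> m; have h1 := hup m.
have h2 : X u w - e / 2 <= W m + X 0 w by near: m.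
have h3 : running_sup X 1 w - e / 2 < X u w by [].
by rewrite ger0_norm ?subr_ge0//; lra.
Unshelve. all: by end_near. Qed.

(** The f of the overview. [X 0] is subtracted because it vanishes only almost surely, whereas the
    walks start from 0 on every path. *)
Definition supf (d : measure_display) (T : measurableType d) (R : realType)
    (P : probability T R) (X : R -> {RV P >-> R}) (la : R) : R :=
  Ex P (fun w => expR (- (la * (running_sup X 1 w - X 0 w)))).

Lemma measurable_sup_shift (d : measure_display) (T : measurableType d) (R : realType)
    (P : probability T R) (X : R -> {RV P >-> R}) : cadlag_paths X ->
  measurable_fun setT (fun w => running_sup X 1 w - X 0 w).
Proof.
move=> cX.
have mf m : measurable_fun setT (fun w => walk_max X (m.+1%:R^-1) 0 m.+1 w) by exact: measurable_walk_max.
apply: (measurable_fun_cvg (h := fun m w => walk_max X (m.+1%:R^-1) 0 m.+1 w)) => // w _.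
exact: walk_max_cvg.
Qed.

Lemma measurable_running_sup (d : measure_display) (T : measurableType d) (R : realType)
    (P : probability T R) (X : R -> {RV P >-> R}) : cadlag_paths X ->
  measurable_fun setT (running_sup X 1).
Proof.
move=> cX.
have -> : running_sup X 1 = (fun w => (running_sup X 1 w - X 0 w) + X 0 w).
  by apply: funext => w; rewrite subrK.
by apply: measurable_funD; [exact: measurable_sup_shift|exact: measurable_RV].
Qed.

Lemma sup_shift_ge0 (d : measure_display) (T : measurableType d) (R : realType)
    (P : probability T R) (X : R -> {RV P >-> R}) w : cadlag_paths X ->
  0 <= running_sup X 1 w - X 0 w.
Proof. by move=> cX; rewrite subr_ge0; apply: running_sup_ge. Qed.

Lemma umax_limit (d : measure_display) (T : measurableType d) (R : realType)
    (P : probability T R) (X : R -> {RV P >-> R}) (nn : nat -> nat) (la : nat -> R) (l : R) :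
  cadlag_paths X -> nn @ \oo --> \oo -> (forall N, 0 <= la N) -> la @ \oo --> l ->
  (fun N => umax X ((nn N)%:R^-1) (la N) (nn N)) @ \oo --> supf X l.
Proof.
move=> cX hn la0 hla.
have PT : P setT = 1%E by exact: probability_setT.
have i1 : P.-integrable setT (EFin \o (fun _ : T => 1 : R)) by exact: bmeas_integrable (bmeas_cst T 1).
have := @Rintegral_dct _ T R P setT (fun N w => expR (- (la N * walk_max X ((nn N)%:R^-1) 0 (nn N) w)))
  (fun w => expR (- (l * (running_sup X 1 w - X 0 w)))) (fun=> 1) measurableT _ _ _ i1.
move=> /(_ _ _ _)[].
- move=> N; apply: measurable_funexpR; apply: measurable_funN; apply: measurable_funM; first exact: measurable_cst.
  exact: measurable_walk_max.
- move=> w _; apply: (@continuous_cvg _ _ _ _ _ (fun N => - (la N * walk_max X (nn N)%:R^-1 0 (nn N) w)) expR); first exact: continuous_expR.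
  apply: cvgN; apply: cvgM => //.
  have h : (fun m : nat => walk_max X (m%:R^-1) 0 m w) @ \oo --> running_sup X 1 w - X 0 w.
    by have := cvg_shiftS (fun m : nat => walk_max X (m%:R^-1) 0 m w) (nbhs (running_sup X 1 w - X 0 w)); move=> /= <-; exact: walk_max_cvg.
  exact: (@cvg_comp _ _ _ nn (fun m : nat => walk_max X (m%:R^-1) 0 m w) _ _ _ hn h).
- by move=> N w _; apply: exp_neg_norm => //; exact: walk_max_ge0.
by [].
Qed.

(** [Num.truncn] is 0 on negative reals, which is why the preimage of 0 is a half-line. *)
Lemma truncn_setE (R : realType) (n : nat) :
  [set s : R | Num.truncn s = n] = if n is 0 then `]-oo, 1[%classic else `[n%:R, n.+1%:R[%classic.
Proof.
apply/seteqP; split => s.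
  move=> /= h; have := truncnS_gt s; rewrite h; case: n h => [|n] h; first by rewrite /= in_itv/=.
  rewrite /= in_itv/= => ->; rewrite andbT.
  have s0 : 0 <= s by apply: (@le_trans _ _ 1); rewrite // -truncn_gt0 h.
  by rewrite -h truncn_le.
case: n => [|n]; rewrite /= in_itv/=.
  by move=> s1; apply/eqP; rewrite -leqn0 truncn_le_nat.
by move=> h; exact: truncn_def.
Qed.

Lemma measurable_truncn_set (R : realType) (n : nat) :
  measurable ([set s : R | Num.truncn s = n] : set (measurableTypeR R)).
Proof. by rewrite truncn_setE; case: n => [|n]; exact: measurable_itv. Qed.

Lemma pint_truncn_indic (R : realType) (n : nat) :
  pintegrable (\1_[set s : R | Num.truncn s = n]) /\ pint (\1_[set s : R | Num.truncn s = n]) = 1.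
Proof.
have mI : measurable ([set s : R | Num.truncn s = n] : set (measurableTypeR R)) := @measurable_truncn_set R n.
have E : (\int[@lebesgue_measure R]_(x in (`]0%R, +oo[%classic : set R)) (\1_[set s : R | Num.truncn s = n] x)%:E = 1%:E)%E.
  rewrite (@integral_indic _ _ _ (@lebesgue_measure R) _ (@mposR R) _ mI).
  have -> : [set s : R | Num.truncn s = n] `&` `]0, +oo[ = if n is 0 then `]0, 1[%classic else `[n%:R, n.+1%:R[%classic.
    rewrite truncn_setE; case: n {mI} => [|n]; apply/seteqP; split => s /=; rewrite !in_itv/= ?andbT.
    - by move=> [-> ->].
    - by move=> /andP[-> ->].
    - by move=> [/andP[-> ->]].
    - by move=> /andP[h ->]; rewrite h; split => //; apply: lt_le_trans h.
  case: n {mI} => [|n]; apply: etrans (lebesgue_measure_itv _) _; rewrite /= lte_fin ?ltr01 ?ltr_nat ?ltnSn.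
    by rewrite sube0.
  by rewrite EFinN -EFinB -natrB ?leqnSn// subSnn.
split; last by rewrite /pint /Rintegral E.
apply/integrableP; split.
  apply/measurable_EFinP; exact: measurable_indic.
under eq_integral => x _ do rewrite /= ger0_norm//.
by rewrite E ltry.
Qed.

(** A sum is the integral of a step function; Riemann sums thus become integrals to which dominated
    convergence applies. *)
Lemma pint_floor (R : realType) (A : nat -> R) (C c : R) : 0 < c ->
  (forall n, `|A n| <= C * expR (- (c * n%:R))) ->
  measurable_fun setT (fun s : R => A (Num.truncn s)) /\
  pintegrable (fun s => A (Num.truncn s)) /\ pint (fun s => A (Num.truncn s)) = gsum A.
Proof.
move=> c0 hA.
have C0 : 0 <= C by have := hA 0%N; rewrite mulr0 oppr0 expR0 mulr1; exact: le_trans.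
pose phi M (s : R) := \sum_(n < M) A n * \1_[set s : R | Num.truncn s = n] s.
have phiE M s : phi M s = if (Num.truncn s < M)%N then A (Num.truncn s) else 0.
  rewrite /phi; case: ltnP => h.
    rewrite (bigD1 (Ordinal h))//= indicE mem_set//= mulr1 big1 ?addr0// => i hi.
    rewrite indicE memNset ?mulr0//= => e; move: hi; apply/negP; rewrite negbK.
    by apply/eqP/val_inj; rewrite /= e.
  rewrite big1// => i _; rewrite indicE memNset ?mulr0//= => e.
  by have := ltn_ord i; rewrite -e ltnNge h.
have mphi M D : measurable_fun (D : set R) (phi M).
  apply: (measurable_funS measurableT) => //.
  rewrite /phi; apply: measurable_sum => i; apply: measurable_funM; first exact: measurable_cst.
  apply: measurable_indic; exact: measurable_truncn_set.
have cphi s : phi M s @[M --> \oo] --> A (Num.truncn s).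
  apply: cvg_near_cst; near=> M; rewrite phiE ifT//; near: M; exact: nbhs_infty_gt.
have mA : measurable_fun setT (fun s : R => A (Num.truncn s)).
  by apply: (@measurable_fun_cvg _ _ _ _ phi) => // s _; exact: cphi.
have r0 : 0 <= expR (- c) by exact: expR_ge0.
have r1 : expR (- c) < 1 by rewrite -[ltRHS]expR0 ltr_expR oppr_lt0.
have hA' n : `|A n| <= C * expR (- c) ^+ n.
  by apply: le_trans (hA n) _; rewrite -expRM_natl mulrN (mulrC c).
have dphi M (s : R) : 0 < s -> `|phi M s| <= C * expR c * expR (- (c * s)).
  move=> s0; rewrite phiE; case: ifP => _; last by rewrite normr0 !mulr_ge0 ?expR_ge0.
  apply: le_trans (hA _) _; rewrite -mulrA; apply: ler_wpM2l => //.
  rewrite -expRD ler_expR; have := truncnS_gt s; rewrite -natr1 => h.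
  have : c * s <= c * ((Num.truncn s)%:R + 1) by rewrite ler_pM2l// ltW.
  by rewrite mulrDr mulr1; lra.
have [i2 c2] := @pint_dct R phi (fun s => A (Num.truncn s)) (fun s => C * expR c * expR (- (c * s)))
   (fun M => mphi M _) (fun s _ => cphi s) dphi (pintegrableZ _ (exp0_integrable c0)).
split => //; split => //; apply: esym; apply: gsum_eq; rewrite (_ : series A = fun M => pint (phi M))//.
apply: funext => M; rewrite /series /=.
have [_ ->] : pintegrable (phi M) /\ pint (phi M) = \sum_(n < M) A n.
  elim: M => [|M [ihi ih]].
    have E : phi 0%N = fun=> 0 by apply: funext => s; rewrite /phi big_ord0.
    by rewrite E big_ord0; split; [exact: pintegrable0|exact: pint0].
  have [j1 j2] := pint_truncn_indic R M.
  have E : phi M.+1 = fun s => phi M s + A M * \1_[set s : R | Num.truncn s = M] s.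
    by apply: funext => s; rewrite /phi big_ord_recr.
  rewrite E; split; first by apply: pintegrableD => //; exact: pintegrableZ.
  by rewrite pintD//; [rewrite ih pintZ// j2 mulr1 big_ord_recr|exact: pintegrableZ].
by rewrite big_mkord.
Unshelve. all: by end_near. Qed.

Lemma truncn_mesh_cvg (R : realType) (s : R) : 0 < s ->
  (Num.truncn (N.+1%:R * s))%:R / N.+1%:R @[N --> \oo] --> s /\
  (fun N => Num.truncn (N.+1%:R * s)) @ \oo --> \oo.
Proof.
move=> s0; split.
  apply: (@squeeze_cvgr _ _ _ _ (fun N => s - N.+1%:R^-1) (fun=> s)).
  - near=> N; apply/andP; split.
      rewrite lerBlDr -[X in _ <= _ + X]mul1r -mulrDl ler_pdivlMr// mulrC natr1 ltW//.
      exact: truncnS_gt.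
    by rewrite ler_pdivrMr// mulrC truncn_le mulr_ge0// ltW.
  - rewrite -[X in _ --> X]subr0; apply: cvgB; first exact: cvg_cst.
    have := @cvg_natinv R 1; rewrite (_ : (fun n => _) = (fun N => (N.+1%:R : R)^-1))//.
    by apply: funext => N; rewrite addn1.
  - exact: cvg_cst.
apply/cvgnyPge => M; near=> N.
rewrite leqNgt -(ltr_nat R) -leNgt.
have h : M%:R / s <= N.+1%:R.
  near: N; exists (Num.truncn (M%:R / s)) => // N /= hN.
  apply: ltW; apply: lt_le_trans (truncnS_gt _) _; by rewrite ler_nat ltnS.
rewrite ler_nat truncn_ge_nat; last by rewrite mulr_ge0// ltW.
by rewrite -ler_pdivrMr.
Unshelve. all: by end_near. Qed.

(** The sum is the integral of s^j e^(- q s) times [a], with s rounded down to the grid. Rounding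
    loses at most 1, so e^q times the unrounded weight is a majorant. *)
Lemma lapk_riemann (R : realType) (a : nat -> nat -> R) (g : R -> R) (q : R) (j : nat) :
  (j <= 1)%N -> 0 < q -> (forall N n, `|a N n| <= 1) ->
  (forall s : R, 0 < s -> a N (Num.truncn (N.+1%:R * s)) @[N --> \oo] --> g s) ->
  N.+1%:R^-1 * gsum (fun n => (n%:R / N.+1%:R) ^+ j * expR (- (q * (n%:R / N.+1%:R))) * a N n)
    @[N --> \oo] --> lapk j g q.
Proof.
move=> j1 q0 ha hg.
pose A N n := (n%:R / N.+1%:R) ^+ j * expR (- (q * (n%:R / N.+1%:R))) * a N n.
have hA N n : `|A N n| <= (1 + 2 / q) * expR (- (q / 2 / N.+1%:R * n%:R)).
  rewrite /A normrM; have y0 : 0 <= n%:R / N.+1%:R :> R by exact: divr_ge0.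
  have -> : q / 2 / N.+1%:R * n%:R = q / 2 * (n%:R / N.+1%:R) by rewrite -!mulrA (mulrC n%:R).
  move: (n%:R / N.+1%:R) y0 => y y0.
  rewrite -[leRHS]mulr1; apply: ler_pM => //.
  rewrite ger0_norm; last by rewrite mulr_ge0 ?exprn_ge0 ?expR_ge0.
  have -> : expR (- (q * y)) = expR (- (q / 2 * y)) * expR (- (q / 2 * y)).
    by rewrite -expRD; congr expR; field.
  rewrite mulrA; apply: ler_wpM2r; first exact: expR_ge0.
  have p2 : 0 < 2 / q by exact: divr_gt0.
  case: j j1 {A} => [|[|//]] _.
    rewrite expr0 mul1r; apply: (@le_trans _ _ 1); last by rewrite lerDl ltW.
    by rewrite -[leRHS]expR0 ler_expR oppr_le0 mulr_ge0// divr_ge0// ltW.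
  rewrite expr1; apply: (@le_trans _ _ (2 / q)); last by rewrite lerDr.
  rewrite expRN ler_pdivrMr ?expR_gt0//.
  have h := expR_ge1Dx (q / 2 * y).
  have {1}-> : y = 2 / q * (q / 2 * y) by field; rewrite gt_eqF.
  by rewrite ler_pM2l//; lra.
have c0 N : 0 < q / 2 / N.+1%:R by rewrite !divr_gt0.
have E N : N.+1%:R^-1 * gsum (A N) = pint (fun s => A N (Num.truncn (N.+1%:R * s))).
  have [m1 [i1 <-]] := pint_floor (c0 N) (hA N).
  by have [_ ->] := @pint_scale R N.+1%:R (fun s => A N (Num.truncn s)) (ltr0Sn _ _) m1 i1.
rewrite (_ : (fun N => _) = fun N => pint (fun s => A N (Num.truncn (N.+1%:R * s)))); last first.
  by apply: funext => N; rewrite -E.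
have tb N (s : R) : 0 < s -> (Num.truncn (N.+1%:R * s))%:R / N.+1%:R <= s /\
    s - N.+1%:R^-1 <= (Num.truncn (N.+1%:R * s))%:R / N.+1%:R.
  move=> s0; split.
    by rewrite ler_pdivrMr// mulrC truncn_le mulr_ge0// ltW.
  rewrite lerBlDr -[X in _ <= _ + X]mul1r -mulrDl ler_pdivlMr// mulrC natr1 ltW//.
  exact: truncnS_gt.
have h1 N : measurable_fun (`]0, +oo[ : set R) (fun s => A N (Num.truncn (N.+1%:R * s))).
  have [m1 _] := pint_floor (c0 N) (hA N).
  apply: (measurable_funS measurableT) => //.
  apply: (measurableT_comp m1); apply: measurable_funM => //; exact: measurable_cst.
have h2 (s : R) : 0 < s -> A N (Num.truncn (N.+1%:R * s)) @[N --> \oo] --> s ^+ j * expR (- (q * s)) * g s.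
  move=> s0; rewrite /A; apply: cvgM; last exact: hg.
  have cG : {for s, continuous (fun y : R => y ^+ j * expR (- (q * y)))}.
    by apply: cvgM; [exact: exprn_continuous|exact: continuous_expN].
  exact: (@cvg_comp _ _ _ (fun N => (Num.truncn (N.+1%:R * s))%:R / N.+1%:R) _ _ _ _ (truncn_mesh_cvg s0).1 cG).
have h3 N (s : R) : 0 < s -> `|A N (Num.truncn (N.+1%:R * s))| <= expR q * (s ^+ j * expR (- (q * s))).
  move=> s0; have [t1 t2] := tb N s s0.
  have y0 : 0 <= (Num.truncn (N.+1%:R * s))%:R / N.+1%:R :> R by exact: divr_ge0.
  rewrite /A normrM -[leRHS]mulr1; apply: ler_pM => //.
  move: (_ / _) t1 t2 y0 => y t1 t2 y0.
  rewrite ger0_norm; last by rewrite mulr_ge0 ?exprn_ge0 ?expR_ge0.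
  rewrite mulrCA; apply: ler_pM; rewrite ?exprn_ge0 ?expR_ge0//; first by rewrite lerXn2r ?nnegrE// ltW.
  rewrite -expRD ler_expR.
  have : s - 1 <= y by apply: le_trans t2; rewrite lerB// invf_le1// ler1n.
  move=> h; have {h} : q * (s - 1) <= q * y by rewrite ler_pM2l.
  by rewrite mulrBr mulr1 lerNl opprB.
exact: (pint_dct h1 h2 h3 (pintegrableZ _ (exp_integrable j q0))).2.
Unshelve. all: by end_near. Qed.

Lemma cpos_cvg (d : measure_display) (T : measurableType d) (R : realType)
    (P : probability T R) (X : R -> {RV P >-> R}) (la : nat -> R) (l : R) :
  (forall N, 0 <= la N) -> la @ \oo --> l -> (fun N => cpos X (la N)) @ \oo --> cpos X l.
Proof.
move=> la0 hla.
have i1 : P.-integrable setT (EFin \o (fun _ : T => 1 : R)) by exact: bmeas_integrable (bmeas_cst T 1).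
have := @Rintegral_dct _ T R P setT (fun N w => expR (- (la N * pospart (X 1 w))))
  (fun w => expR (- (l * pospart (X 1 w)))) (fun=> 1) measurableT _ _ _ i1.
move=> /(_ _ _ _)[].
- move=> N; apply: measurable_funexpR; apply: measurable_funN; apply: measurable_funM; first exact: measurable_cst.
  by apply: measurable_funpospart; exact: measurable_RV.
- move=> w _; apply: (@continuous_cvg _ _ _ _ _ (fun N => - (la N * pospart (X 1 w))) expR); first exact: continuous_expR.
  by apply: cvgN; apply: cvgMl.
- by move=> N w _; apply: exp_neg_norm => //; exact: pospart_ge0.
by [].
Qed.

Lemma seq_cvg_unique (R : realType) (u : nat -> R) (a b : R) : u @ \oo --> a -> u @ \oo --> b -> a = b.
Proof. by move=> h1 h2; exact: (cvg_unique _ h1 h2). Qed.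

(** Both sides scale to mesh 1 with the same argument. This trades the time horizon n h for the
    horizon 1, on which [umax_limit] operates. *)
Lemma umax_time (d : measure_display) (T : measurableType d) (R : realType)
    (P : probability T R) (X : R -> {RV P >-> R}) (al h : R) (n : nat) :
  Levy_process P X -> strictly_stable P X al -> (0 < n)%N -> 0 < h ->
  umax X (n%:R^-1) ((n%:R * h) `^ al^-1) n = umax X h 1 n.
Proof.
move=> hL st n0 h0; have nr : 0 < n%:R :> R by rewrite ltr0n.
have ni : 0 < n%:R^-1 :> R by rewrite invr_gt0.
have l0 : 0 <= (n%:R * h) `^ al^-1 by exact: powR_ge0.
apply: etrans (umax_scale n hL st ni l0) _; apply: etrans _ (esym (umax_scale n hL st h0 ler01)).
have -> : (n%:R * h) `^ al^-1 * n%:R^-1 `^ al^-1 = 1 * h `^ al^-1; last by [].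
rewrite mul1r -powRM ?ltW// ?mulr_gt0//.
by rewrite mulrAC mulfV ?mul1r// gt_eqF.
Qed.

(** The equation -V' = K V of the overview. Spitzer's recursion for mesh 1 / (N + 1) says that the
    generating function of n a_n is a Cauchy product; after multiplication by the mesh all three
    sums are Riemann sums. *)
Lemma spitzer_laplace (d : measure_display) (T : measurableType d) (R : realType)
    (P : probability T R) (X : R -> {RV P >-> R}) (al q : R) :
  Levy_process P X -> strictly_stable P X al -> 0 < al -> 0 < q ->
  lapk 1 (fun t => supf X (t `^ al^-1)) q =
  lapk 0 (fun t => cpos X (t `^ al^-1)) q * lapk 0 (fun t => supf X (t `^ al^-1)) q.
Proof.
move=> hL st al0 q0; have [_ _ _ cX] := hL.
pose h N : R := N.+1%:R^-1.
have h0 N : 0 < h N by rewrite invr_gt0.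
pose a N n := umax X (h N) 1 n.
(* The recursion sums over k >= 1, so the coefficient at 0 has to vanish; a single grid point does
   not affect the limit. *)
pose b N n : R := if n is 0 then 0 else cpos X ((n%:R * h N) `^ al^-1).
have ha N n : `|a N n| <= 1 by exact: umax_bound.
have hb N n : `|b N n| <= 1.
  by case: n => [|n]; rewrite /b ?normr0//; apply: cpos_bound; exact: powR_ge0.
have cpw (s : R) : 0 < s -> {for s, continuous (@powR R ^~ al^-1)} by move=> s0; exact: continuous_powR.
have ca (s : R) : 0 < s -> a N (Num.truncn (N.+1%:R * s)) @[N --> \oo] --> supf X (s `^ al^-1).
  move=> s0; have [t1 t2] := truncn_mesh_cvg s0.
  have l0 N : 0 <= ((Num.truncn (N.+1%:R * s))%:R * h N) `^ al^-1 by exact: powR_ge0.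
  have c2 : (fun N => ((Num.truncn (N.+1%:R * s))%:R * h N) `^ al^-1) @ \oo --> s `^ al^-1.
    by apply: (@continuous_cvg _ _ _ _ _ (fun N => (Num.truncn (N.+1%:R * s))%:R * h N) (@powR R ^~ al^-1)) t1; exact: cpw.
  have c3 := umax_limit cX t2 l0 c2.
  apply: cvg_trans c3; apply: near_eq_cvg; near=> N.
  have n0 : (0 < Num.truncn (N.+1%:R * s))%N by near: N; exact: (t2 _ (nbhs_infty_gt 0)).
  exact: umax_time hL st n0 (h0 N).
have cb (s : R) : 0 < s -> b N (Num.truncn (N.+1%:R * s)) @[N --> \oo] --> cpos X (s `^ al^-1).
  move=> s0; have [t1 t2] := truncn_mesh_cvg s0.
  have l0 N : 0 <= ((Num.truncn (N.+1%:R * s))%:R * h N) `^ al^-1 by exact: powR_ge0.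
  have c2 : (fun N => ((Num.truncn (N.+1%:R * s))%:R * h N) `^ al^-1) @ \oo --> s `^ al^-1.
    by apply: (@continuous_cvg _ _ _ _ _ (fun N => (Num.truncn (N.+1%:R * s))%:R * h N) (@powR R ^~ al^-1)) t1; exact: cpw.
  have c3 := @cpos_cvg _ _ _ P X _ _ l0 c2.
  apply: cvg_trans c3; apply: near_eq_cvg; near=> N.
  have n0 : (0 < Num.truncn (N.+1%:R * s))%N by near: N; exact: (t2 _ (nbhs_infty_gt 0)).
  by rewrite /b; case: (Num.truncn _) n0.
have r1 := lapk_riemann (leqnn 1) q0 ha ca.
have ra := lapk_riemann (leq0n 1) q0 ha ca.
have rb := lapk_riemann (leq0n 1) q0 hb cb.
apply: (seq_cvg_unique r1).
rewrite (_ : (fun N : nat => _) = (fun N => (N.+1%:R^-1 *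
    gsum (fun n => (n%:R / N.+1%:R) ^+ 0 * expR (- (q * (n%:R / N.+1%:R))) * b N n)) * (N.+1%:R^-1 *
    gsum (fun n => (n%:R / N.+1%:R) ^+ 0 * expR (- (q * (n%:R / N.+1%:R))) * a N n)))).
  by apply: cvgM rb ra.
apply: funext => N.
have x0 : 0 <= expR (- (q * h N)) by exact: expR_ge0.
have x1 : expR (- (q * h N)) < 1 by rewrite -[ltRHS]expR0 ltr_expR oppr_lt0 mulr_gt0.
have xE n : expR (- (q * (n%:R / N.+1%:R))) = expR (- (q * h N)) ^+ n.
  by rewrite -expRM_natl; congr expR; rewrite /h; ring.
have bu n : `|expR (- (q * h N)) ^+ n * b N n| <= 1 * expR (- (q * h N)) ^+ n.
  by rewrite normrM mul1r -[leRHS]mulr1; apply: ler_pM => //; rewrite ger0_norm// exprn_ge0.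
have bv n : `|expR (- (q * h N)) ^+ n * a N n| <= 1 * expR (- (q * h N)) ^+ n.
  by rewrite normrM mul1r -[leRHS]mulr1; apply: ler_pM => //; rewrite ger0_norm// exprn_ge0.
have bu' n : `|h N * (expR (- (q * h N)) ^+ n * b N n)| <= h N * expR (- (q * h N)) ^+ n.
  by rewrite normrM gtr0_norm//; apply: ler_wpM2l; [exact: ltW|rewrite -[leRHS]mul1r].
(* One factor h goes into the [b] series: n h is then the weight of [lapk 1], and the other factor h
   is the mesh in front of the sum. *)
have := gsum_eq (gsum_cauchy x0 x1 bu' bv).
rewrite (gsumZ _ x0 x1 bu).
rewrite (@eq_gsum _ _ (fun n => (n%:R / N.+1%:R) ^+ 1 * expR (- (q * (n%:R / N.+1%:R))) * a N n)); last first.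
  move=> n; rewrite expr1 xE big_ord_recl mulr0 mulr0 mul0r add0r.
  have -> : n%:R / N.+1%:R * expR (- (q * h N)) ^+ n * a N n =
            h N * expR (- (q * h N)) ^+ n * (n%:R * a N n) by rewrite /h; ring.
  rewrite (umax_rec n hL st (h0 N) ler01) mulr_sumr; apply: eq_bigr => i _.
  have -> : expR (- (q * h N)) ^+ n = expR (- (q * h N)) ^+ (lift ord0 i) * expR (- (q * h N)) ^+ (n - lift ord0 i).
    by rewrite -exprD subnKC// lift0.
  rewrite /b lift0 mul1r /a; ring.
move=> ->; rewrite (@eq_gsum _ (fun n => _ ^+ 0 * _ * b N n) (fun n => expR (- (q * h N)) ^+ n * b N n)); last first.
  by move=> n; rewrite expr0 mul1r xE.
rewrite (@eq_gsum _ (fun n => _ ^+ 0 * _ * a N n) (fun n => expR (- (q * h N)) ^+ n * a N n)); last first.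
  by move=> n; rewrite expr0 mul1r xE.
by rewrite -/(h N) [RHS]mulrACA !mulrA.
Unshelve. all: by end_near. Qed.

(** * Fourier inversion of the characteristic function *)

Lemma lapk_vanish (R : realType) (g : R -> R) (M q0 : R) :
  measurable_fun (`]0, +oo[ : set R) g -> (forall u : R, 0 < u -> `|g u| <= M) -> 0 <= q0 ->
  (forall q, q0 < q -> lapk 0 g q = 0) -> forall k q, q0 < q -> lapk k g q = 0.
Proof.
move=> mg gM q00 h0; elim=> [|k ih] q hq; first exact: h0.
have q0' : 0 < q by exact: le_lt_trans hq.
have d1 := lapk_derive k mg gM q0'.
have d2 : is_derive q 1 (lapk k g) 0.
  have dc : is_derive q 1 (fun _ : R => 0 : R) (0 : R) by exact: is_derive_cst.
  apply: (near_eq_is_derive _ dc).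
  near=> p; rewrite ih//; near: p; exact: lt_nbhsr.
have := @derive_val _ _ _ _ _ _ _ d1; rewrite (@derive_val _ _ _ _ _ _ _ d2) => /eqP.
by rewrite eq_sym oppr_eq0 => /eqP.
Unshelve. all: by end_near. Qed.

(** If the transform vanishes beyond [q0], so do its derivatives, hence the Post-Widder means at [t]
    for large k. At a point of continuity these means cannot stay away from [g t]. *)
Lemma lapk_inj0 (R : realType) (g : R -> R) (M q0 t : R) :
  measurable_fun (`]0, +oo[ : set R) g -> (forall u : R, 0 < u -> `|g u| <= M) -> 0 <= q0 ->
  (forall q, q0 < q -> lapk 0 g q = 0) -> 0 < t -> {for t, continuous g} -> g t = 0.
Proof.
move=> mg gM q00 h0 t0 cg.
have hk := lapk_vanish mg gM q00 h0.
have pI k : pwI k t g by apply: lapk_integrable gM _; rewrite // divr_gt0.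
have near0 : \forall k \near \oo, pw k t g = 0.
  near=> k; have kq : q0 < k.+1%:R / t.
    rewrite ltr_pdivlMr//; apply: lt_trans (_ : _ < k%:R) _; last by rewrite ltr_nat.
    by near: k; exact: nbhs_infty_gtr.
  by rewrite /pw -/(lapk k g _) hk// mulr0.
have M0 : 0 <= M by exact: le_trans (normr_ge0 _) (gM 1 ltr01).
have main (f : R -> R) e : 0 < e -> (forall k, pwI k t f) -> (\forall k \near \oo, pw k t f = 0) ->
    (forall u : R, 0 < u -> `|f u| <= M) -> {for t, continuous f} -> 0 <= f t + e.
  move=> e0 fI fn fM cf.
  have [de /= de0 hde] := (nbhs_ballP _ _).1 ((cvgrPdist_le _ _).1 cf e e0).
  pose B := 2 * M / de ^+ 2.
  have hf (u : R) : 0 < u -> f u <= (f t + e) + B * (u - t) ^+ 2.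
    move=> u0; have [ud|ud] := ltP `|t - u| de.
      have := hde u ud; rewrite ler_norml => /andP[h _].
      have : 0 <= B * (u - t) ^+ 2 by rewrite mulr_ge0 ?sqr_ge0// divr_ge0 ?sqr_ge0// mulr_ge0.
      by move: h; lra.
    have h1 : 2 * M <= B * (u - t) ^+ 2.
      rewrite /B mulrAC ler_pdivlMr ?exprn_gt0//; apply: ler_wpM2l; first exact: mulr_ge0.
      rewrite -[leRHS]real_normK ?num_real// distrC.
      by apply: lerXn2r; rewrite ?nnegrE// ltW.
    have := fM u u0; have := fM t t0; rewrite !ler_norml => /andP[h2 _] /andP[_ h3].
    by move: h1 h2 h3; lra.
  have hl : (f t + e) + B * t ^+ 2 / k.+1%:R @[k --> \oo] --> f t + e by exact: cvg_pw_const.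
  have hl2 : - ((f t + e) + B * t ^+ 2 / k.+1%:R) @[k --> \oo] --> - (f t + e) by exact: cvgN.
  rewrite -oppr_le0; apply: (cvg_le_cst hl2); near=> k; rewrite oppr_le0.
  have <- : pw k t f = 0 by near: k.
  exact: pw_le.
apply/eqP; rewrite eq_le; apply/andP; split.
- apply/ler_addgt0Pl => e e0; rewrite -subr_ge0 addr0 -[X in 0 <= X]addrC.
  apply: (main (fun u => - g u)) => //.
  + by move=> k; have [] := pwN (pI k).
  + near=> k; have [_ ->] := pwN (pI k); have -> : pw k t g = 0 by near: k.
    by rewrite oppr0.
  + by move=> u u0; rewrite normrN; exact: gM.
  + exact: cvgN.
- apply/ler_addgt0Pl => e e0; rewrite addrC; exact: main.
Unshelve. all: by end_near. Qed.

Lemma is_derive_cosM (R : realType) (b t : R) : is_derive t 1 (fun t => cos (b * t)) (- b * sin (b * t)).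
Proof.
have h2 : is_derive t 1 (fun t => b * t) b by apply: is_derive_eq; rewrite /GRing.scale/= mulr1.
apply: (is_derive_conv (@is_derive1_comp R _ _ t _ _ (is_derive_cos (b * t)) h2)); ring.
Qed.

Lemma is_derive_sinM (R : realType) (b t : R) : is_derive t 1 (fun t => sin (b * t)) (b * cos (b * t)).
Proof.
have h2 : is_derive t 1 (fun t => b * t) b by apply: is_derive_eq; rewrite /GRing.scale/= mulr1.
apply: (is_derive_conv (@is_derive1_comp R _ _ t _ _ (is_derive_sin (b * t)) h2)); ring.
Qed.

Lemma exp_trig_derive (R : realType) (a b A B t : R) :
  is_derive t 1 (fun t => expR (- (a * t)) * (A * cos (b * t) + B * sin (b * t)))
   (expR (- (a * t)) * ((b * B - a * A) * cos (b * t) + (- (a * B) - b * A) * sin (b * t))).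
Proof.
have h1 := is_derive_expN a t; have h2 := is_derive_cosM b t; have h3 := is_derive_sinM b t.
have h4 : is_derive t 1 (fun t => A * cos (b * t) + B * sin (b * t))
    (A * (- b * sin (b * t)) + B * (b * cos (b * t))) by apply: is_deriveD; exact: is_deriveZ.
apply: (is_derive_conv (is_deriveM h1 h4)); rewrite /GRing.scale/=; ring.
Qed.

Lemma trig_le (R : realType) (A B x : R) : `|A * cos x + B * sin x| <= `|A| + `|B|.
Proof.
apply: le_trans (ler_normD _ _) _; rewrite !normrM; apply: lerD; apply: ler_piMr => //.
  by rewrite ler_norml cos_geN1 cos_le1.
by rewrite ler_norml sin_geN1 sin_le1.
Qed.

Lemma pint_exp_trig (R : realType) (a b A B : R) : 0 < a ->
  pintegrable (fun t => expR (- (a * t)) * (A * cos (b * t) + B * sin (b * t))) /\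
  pint (fun t => expR (- (a * t)) * (A * cos (b * t) + B * sin (b * t))) =
  (a * A + b * B) / (a ^+ 2 + b ^+ 2).
Proof.
move=> a0; have S0 : 0 < a ^+ 2 + b ^+ 2 by rewrite ltr_pwDl ?exprn_gt0 ?sqr_ge0.
have iG : pintegrable (fun t => expR (- (a * t)) * (A * cos (b * t) + B * sin (b * t))).
  apply: (pintegrable_dom _ _ (pintegrableZ (`|A| + `|B|) (exp0_integrable a0))).
    meas.
  move=> x x0; rewrite normrM ger0_norm ?expR_ge0// mulrC; apply: ler_wpM2r; first exact: expR_ge0.
  exact: trig_le.
split => //; pose A' := (- (a * A) - b * B) / (a ^+ 2 + b ^+ 2); pose B' := (b * A - a * B) / (a ^+ 2 + b ^+ 2).
have E : (a * A + b * B) / (a ^+ 2 + b ^+ 2) = 0 - A' by rewrite /A'; ring.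
rewrite E; apply: (@pint_ftc R (fun t => expR (- (a * t)) * (A' * cos (b * t) + B' * sin (b * t)))) => //.
- move=> x x0; apply: (is_derive_conv (exp_trig_derive _ _ _ _ _)).
  by congr (_ * (_ * _ + _ * _)); rewrite /A' /B'; field; rewrite gt_eqF.
- by move=> x x0; apply: is_derive_continuous (exp_trig_derive a b A B x).
- have := is_derive_continuous (exp_trig_derive a b A' B' 0).
  have E0 : expR (- (a * 0)) * (A' * cos (b * 0) + B' * sin (b * 0)) = A'.
    by rewrite !mulr0 oppr0 expR0 cos0 sin0 mulr0 addr0 mulr1 mul1r.
  by move=> h; rewrite -[X in _ --> X]E0; exact: cvg_at_right_filter h.
- have hc : (`|A'| + `|B'|) * expR (- (a * t)) @[t --> +oo] --> 0.
    by rewrite -[X in _ --> X](mulr0 (`|A'| + `|B'|)); apply: cvgMr; exact: cvgy_expN.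
  apply: norm_cvg0; apply: (squeeze_cvgr _ (cvg_cst 0) hc).
  near=> t; rewrite normr_ge0/= normrM ger0_norm ?expR_ge0// mulrC; apply: ler_wpM2r; first exact: expR_ge0.
  exact: trig_le.
Unshelve. all: by end_near. Qed.

Lemma pint_continuous (R : realType) (f : R -> R -> R) (g : R -> R) (a : R) :
  (forall x, measurable_fun (`]0, +oo[ : set R) (f x)) ->
  (forall x y : R, 0 < y -> {for x, continuous (f ^~ y)}) ->
  (forall x y : R, 0 < y -> `|f x y| <= g y) -> pintegrable g ->
  {for a, continuous (fun x => pint (f x))}.
Proof.
move=> mf cf fg ig.
have := @continuity_under_integral R _ _ (@lebesgue_measure R) f _ (@mposR R) (a - 1) (a + 1) _ _ g ig _.
move=> h; apply: h.
- by move=> x _; apply: pintegrable_dom (mf x) _ ig => y y0; exact: fg.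
- by apply: aeW => y /in_pos y0 x _; exact: cf.
- by move=> x _; apply: aeW => y /in_pos y0; exact: fg.
- by rewrite inE/= in_itv/=; lra.
Qed.

Definition poisson (R : realType) (la z : R) : R := la / (la ^+ 2 + z ^+ 2).

Lemma poisson_ge0 (R : realType) (la z : R) : 0 < la -> 0 <= poisson la z.
Proof. by move=> la0; rewrite divr_ge0 ?addr_ge0 ?sqr_ge0// ltW. Qed.

Lemma measurable_poisson (R : realType) (la : R) D : measurable_fun (D : set R) (poisson la).
Proof. by rewrite /poisson; meas. Qed.

(** Both sides are bounded and continuous in x, so their Laplace transforms in x are compared
    instead. Fubini turns the left one into an integral of partial fractions in z^2; restricting to
    q > la keeps q^2 - la^2 nonzero. *)
Lemma fourier_poisson (R : realType) (la x : R) : 0 < la -> 0 < x ->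
  pint (fun z => poisson la z * cos (z * x)) = pi / 2 * expR (- (la * x)).
Proof.
move=> la0 x0; pose f x := pint (fun z => poisson la z * cos (z * x)).
have ip := poisson_integrable la0.
have mF (y : R) : measurable_fun (`]0, +oo[ : set R) (fun z => poisson la z * cos (z * y)).
  by apply: measurable_funM; [exact: measurable_poisson|meas].
have bF (y z : R) : 0 < z -> `|poisson la z * cos (z * y)| <= poisson la z.
  move=> z0; rewrite normrM ger0_norm ?poisson_ge0//; apply: ler_piMr; first exact: poisson_ge0.
  by rewrite ler_norml cos_geN1 cos_le1.
have iF (y : R) : pintegrable (fun z => poisson la z * cos (z * y)).
  by apply: (pintegrable_dom (mF y) _ ip) => z z0; exact: bF.
have cf (y : R) : {for y, continuous f}.
  apply: (@pint_continuous R (fun y z => poisson la z * cos (z * y)) (poisson la)) => //.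
  move=> u z z0; apply: is_derive_continuous; apply: is_deriveZ; exact: is_derive_cosM.
pose D y := f y - pi / 2 * expR (- (la * y)).
have bf (y : R) : `|f y| <= pi / 2.
  by rewrite -(poisson_value la0); apply: le_norm_pint => // z z0; exact: bF.
have cD (y : R) : {for y, continuous D}.
  apply: cvgB; first exact: cf.
  by apply: cvgMr; exact: continuous_expN.
have mD : measurable_fun (`]0, +oo[ : set R) D by apply: pos_continuous_meas => y _; exact: cD.
have mf : measurable_fun (`]0, +oo[ : set R) f by apply: pos_continuous_meas => y _; exact: cf.
have p2 : 0 <= pi / 2 :> R by rewrite divr_ge0// pi_ge0.
have bD (y : R) : 0 < y -> `|D y| <= pi / 2 + pi / 2.
  move=> y0; apply: le_trans (ler_normB _ _) _; apply: lerD => //.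
  rewrite normrM (ger0_norm p2); apply: ler_piMr => //; apply: exp_neg_norm; exact: ltW.
suff : D x = 0 by move/eqP; rewrite subr_eq0 => /eqP.
apply: (lapk_inj0 mD bD (ltW la0)) => // q lq.
have q0 : 0 < q by exact: lt_trans lq.
have ql : 0 < q + la by exact: addr_gt0.
have if1 : pintegrable (fun u => u ^+ 0 * expR (- (q * u)) * f u) by apply: (@lapk_integrable R 0 f (pi / 2) q mf) => // u _; exact: bf.
have ie := pintegrableZ (pi / 2) (exp0_integrable ql).
have -> : lapk 0 D q = lapk 0 f q - pi / 2 * (q + la)^-1.
  rewrite -(pint_exp ql) -pintZ; last exact: exp0_integrable.
  rewrite -pintB//; apply: eq_pint => u u0; rewrite /D expr0 !mul1r mulrBr; congr (_ - _).
  by rewrite (mulrDl q) opprD expRD mulrCA.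
have mP : measurable_fun setT (fun p : R * R => expR (- (q * p.1)) * (poisson la p.2 * cos (p.2 * p.1))).
  by rewrite /poisson; meas.
have bP (u z : R) : 0 < u -> 0 < z ->
    `|expR (- (q * u)) * (poisson la z * cos (z * u))| <= expR (- (q * u)) * poisson la z.
  move=> u0 z0; rewrite normrM ger0_norm ?expR_ge0//; apply: ler_wpM2l; [exact: expR_ge0|exact: bF].
have [_ E] := @pint_fubini R (fun u z => expR (- (q * u)) * (poisson la z * cos (z * u)))
  (fun u => expR (- (q * u))) (poisson la) mP (exp0_integrable q0) ip bP.
have -> : lapk 0 f q = pint (fun u => pint (fun z => expR (- (q * u)) * (poisson la z * cos (z * u)))).
  by apply: eq_pint => u u0; rewrite expr0 mul1r pintZ.
rewrite E.
have dq : q ^+ 2 - la ^+ 2 != 0 by rewrite subr_sqr mulf_neq0 ?gt_eqF// subr_gt0.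
have iq := poisson_integrable q0.
rewrite (@eq_pint R _ (fun z => (q ^+ 2 - la ^+ 2)^-1 * (q * poisson la z - la * poisson q z))); last first.
  move=> z z0; have [i1 e1] := @pint_exp_trig R q z 1 0 q0.
  rewrite (@eq_pint R _ (fun u => poisson la z * (expR (- (q * u)) * (1 * cos (z * u) + 0 * sin (z * u))))); last first.
    by move=> u u0; rewrite mul1r mul0r addr0 mulrCA.
  rewrite pintZ// e1 mulr1 mulr0 addr0 /poisson.
  by field; rewrite dq !gt_eqF ?addr_gt0 ?exprn_gt0.
rewrite pintZ; last by apply: pintegrableB; exact: pintegrableZ.
rewrite pintB; [|exact: pintegrableZ|exact: pintegrableZ].
rewrite (pintZ q ip) (pintZ la iq) !poisson_value//.
move: dq; have -> : q ^+ 2 - la ^+ 2 = (q - la) * (q + la) by ring.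
rewrite mulf_eq0 negb_or => /andP[d1 d2].
by move: d1 d2; generalize (pi : R) => p d1 d2; field; rewrite d1 d2.
Qed.

(** A single conjugate Poisson kernel z / (la^2 + z^2) decays like 1 / z and is not integrable; the
    difference of two is. *)
Definition conj_poisson (R : realType) (la mu z : R) : R :=
  z / (la ^+ 2 + z ^+ 2) - z / (mu ^+ 2 + z ^+ 2).

Lemma conj_poisson_integrable (R : realType) (la mu : R) : 0 < la -> 0 < mu ->
  pintegrable (fun z => `|conj_poisson la mu z|).
Proof.
move=> la0 mu0.
apply: (pintegrable_dom _ _ (pintegrableZ (`|mu ^+ 2 - la ^+ 2| / (2 * mu) / la) (poisson_integrable la0))).
  by rewrite /conj_poisson; meas.
move=> z z0; rewrite normr_id.
have l0 : 0 < la ^+ 2 + z ^+ 2 by rewrite addr_gt0 ?exprn_gt0.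
have m0 : 0 < mu ^+ 2 + z ^+ 2 by rewrite addr_gt0 ?exprn_gt0.
have -> : conj_poisson la mu z = (mu ^+ 2 - la ^+ 2) * (z / (mu ^+ 2 + z ^+ 2)) * (la ^+ 2 + z ^+ 2)^-1.
  by rewrite /conj_poisson; field; rewrite !gt_eqF.
rewrite !normrM [X in _ * _ * X]gtr0_norm ?invr_gt0// [`|z|]gtr0_norm// [`|(mu ^+ 2 + z ^+ 2)^-1|]gtr0_norm ?invr_gt0//.
have -> : `|mu ^+ 2 - la ^+ 2| / (2 * mu) / la * (la / (la ^+ 2 + z ^+ 2)) =
  `|mu ^+ 2 - la ^+ 2| * (2 * mu)^-1 * (la ^+ 2 + z ^+ 2)^-1.
  by move: `|_| => k; field; rewrite !gt_eqF.
apply: ler_wpM2r; first by rewrite invr_ge0 ltW.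
apply: ler_wpM2l => //; rewrite ler_pdivrMr// mulrC ler_pdivlMr ?mulr_gt0//.
by have := sqr_ge0 (mu - z); lra.
Qed.

(** The cosine transform of poisson(la) / la - poisson(mu) / mu is known; its derivative in x, taken
    under the integral, is the negative of the integral wanted. *)
Lemma fourier_conj_poisson (R : realType) (la mu x : R) : 0 < la -> 0 < mu -> 0 < x ->
  pint (fun z => conj_poisson la mu z * sin (z * x)) =
  pi / 2 * (expR (- (la * x)) - expR (- (mu * x))).
Proof.
move=> la0 mu0 x0.
pose f (y z : R) := (la^-1 * poisson la z - mu^-1 * poisson mu z) * cos (z * y).
pose df (y z : R) := (la^-1 * poisson la z - mu^-1 * poisson mu z) * (- z * sin (z * y)).
have il := poisson_integrable la0; have im := poisson_integrable mu0.
have ic (k y : R) : 0 < k -> pintegrable (fun z => poisson k z * cos (z * y)).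
  move=> k0; apply: (pintegrable_dom _ _ (poisson_integrable k0)).
    by apply: measurable_funM; [exact: measurable_poisson|meas].
  move=> z z0; rewrite normrM ger0_norm ?poisson_ge0//; apply: ler_piMr; first exact: poisson_ge0.
  by rewrite ler_norml cos_geN1 cos_le1.
have fE (y z : R) : f y z = la^-1 * (poisson la z * cos (z * y)) - mu^-1 * (poisson mu z * cos (z * y)).
  by rewrite /f mulrBl !mulrA.
have if1 (y : R) : pintegrable (f y).
  apply: (eq_pintegrable (f := fun z => la^-1 * (poisson la z * cos (z * y)) - mu^-1 * (poisson mu z * cos (z * y)))).
    by move=> z _; rewrite fE.
  by apply: pintegrableB; apply: pintegrableZ; exact: ic.
have fval (y : R) : 0 < y -> pint (f y) = pi / 2 * (la^-1 * expR (- (la * y)) - mu^-1 * expR (- (mu * y))).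
  move=> y0; rewrite (eq_pint (fun z _ => fE y z)) pintB; [|by apply: pintegrableZ; exact: ic..].
  rewrite !pintZ; [|exact: ic..].
  rewrite !fourier_poisson//; ring.
have x1 : x < x + 1 by rewrite ltrDl.
have dfE (y z : R) : df y z = - (conj_poisson la mu z * sin (z * y)).
  rewrite /df /conj_poisson /poisson !mulrA mulVf ?gt_eqF// mulVf ?gt_eqF// !mul1r; ring.
have d1 := @pint_derive R f df x 0 (x + 1) _ x0 x1 (fun y _ _ => if1 y) _ (conj_poisson_integrable la0 mu0) _.
have d2 : is_derive x 1 (fun y => pint (f y)) (pi / 2 * (la^-1 * (- la * expR (- (la * x))) - mu^-1 * (- mu * expR (- (mu * x))))).
  apply: (@near_eq_is_derive R R R (fun y => pi / 2 * (la^-1 * expR (- (la * y)) - mu^-1 * expR (- (mu * y))))).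
    by near=> y; rewrite fval//; near: y; exact: lt_nbhsr.
  by apply: is_deriveZ; apply: is_deriveB; apply: is_deriveZ; exact: is_derive_expN.
have h1 (y z : R) : 0 < y -> y < x + 1 -> 0 < z -> is_derive y 1 (f ^~ z) (df y z).
  by move=> y0 y1 z0; apply: is_deriveZ; exact: is_derive_cosM.
have h2 (y z : R) : 0 < y -> y < x + 1 -> 0 < z -> `|df y z| <= `|conj_poisson la mu z|.
  move=> y0 y1 z0; rewrite dfE normrN normrM; apply: ler_piMr => //.
  by rewrite ler_norml sin_geN1 sin_le1.
have := @derive_val _ _ _ _ _ _ _ (d1 h1 h2); rewrite (@derive_val _ _ _ _ _ _ _ d2) => e.
have -> : pint (fun z => conj_poisson la mu z * sin (z * x)) = - pint (df x).
  rewrite -pintN; last first.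
    apply: (pintegrable_dom _ _ (conj_poisson_integrable la0 mu0)).
      by rewrite /df /poisson; meas.
    move=> z z0; rewrite dfE normrN normrM; apply: ler_piMr => //.
    by rewrite ler_norml sin_geN1 sin_le1.
  by apply: eq_pint => z z0; rewrite dfE opprK.
by rewrite -e !mulrA !mulrN !mulVf ?gt_eqF//; ring.
Unshelve. all: by end_near. Qed.

(** Real part of e^(i z x) (1 / (la + i z) - 1 / (mu + i z)). *)
Definition fourier_ker (R : realType) (la mu x z : R) : R :=
  (poisson la z - poisson mu z) * cos (z * x) + conj_poisson la mu z * sin (z * x).

Definition fourier_dom (R : realType) (la mu z : R) : R :=
  poisson la z + poisson mu z + `|conj_poisson la mu z|.

Lemma fourier_dom_integrable (R : realType) (la mu : R) : 0 < la -> 0 < mu ->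
  pintegrable (fourier_dom la mu).
Proof.
move=> la0 mu0; apply: pintegrableD; last exact: conj_poisson_integrable.
by apply: pintegrableD; exact: poisson_integrable.
Qed.

Lemma trig_dom (R : realType) (la mu z C S : R) : 0 < la -> 0 < mu -> `|C| <= 1 -> `|S| <= 1 ->
  `|(poisson la z - poisson mu z) * C + conj_poisson la mu z * S| <= fourier_dom la mu z.
Proof.
move=> la0 mu0 hC hS; apply: le_trans (ler_normD _ _) _; rewrite /fourier_dom; apply: lerD; rewrite normrM.
  apply: le_trans (ler_piMr (normr_ge0 _) hC) _; apply: le_trans (ler_normB _ _) _.
  by rewrite !ger0_norm ?poisson_ge0.
exact: ler_piMr.
Qed.

Lemma cos_norm_le1 (R : realType) (x : R) : `|cos x| <= 1.
Proof. by rewrite ler_norml cos_geN1 cos_le1. Qed.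

Lemma sin_norm_le1 (R : realType) (x : R) : `|sin x| <= 1.
Proof. by rewrite ler_norml sin_geN1 sin_le1. Qed.

(** The cosine part is even in x and the sine part odd. They coincide for x > 0 and cancel for x <
    0, which produces the positive part. *)
Lemma fourier_pair (R : realType) (la mu x : R) : 0 < la -> 0 < mu ->
  pint (fourier_ker la mu x) = pi * (expR (- (la * pospart x)) - expR (- (mu * pospart x))).
Proof.
move=> la0 mu0; have il := poisson_integrable la0; have im := poisson_integrable mu0.
have ic (k y : R) : 0 < k -> pintegrable (fun z => poisson k z * cos (z * y)).
  move=> k0; apply: (pintegrable_dom _ _ (poisson_integrable k0)).
    by apply: measurable_funM; [exact: measurable_poisson|meas].
  move=> z z0; rewrite normrM ger0_norm ?poisson_ge0//; apply: ler_piMr; first exact: poisson_ge0.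
  exact: cos_norm_le1.
have is' (y : R) : pintegrable (fun z => conj_poisson la mu z * sin (z * y)).
  apply: (pintegrable_dom _ _ (conj_poisson_integrable la0 mu0)); first by rewrite /conj_poisson; meas.
  by move=> z z0; rewrite normrM; apply: ler_piMr => //; exact: sin_norm_le1.
have main y : pint (fourier_ker la mu y) = pint (fun z => poisson la z * cos (z * y))
    - pint (fun z => poisson mu z * cos (z * y)) + pint (fun z => conj_poisson la mu z * sin (z * y)).
  have il' := ic la y la0; have im' := ic mu y mu0.
  rewrite -(pintB il' im') -(pintD (pintegrableB il' im') (is' y)).
  by apply: eq_pint => z z0; rewrite /fourier_ker mulrBl.
rewrite main; have [x0|x0|->] := ltgtP x 0.
- have x0' : 0 < - x by rewrite oppr_gt0.
  have -> : pospart x = 0 by rewrite /pospart max_r// ltW.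
  have ec (k : R) : pint (fun z => poisson k z * cos (z * x)) = pint (fun z => poisson k z * cos (z * - x)).
    by apply: eq_pint => z _; rewrite mulrN cosN.
  have es : pint (fun z => conj_poisson la mu z * sin (z * x)) = - pint (fun z => conj_poisson la mu z * sin (z * - x)).
    by rewrite -pintN//; apply: eq_pint => z _; rewrite !mulrN sinN mulrN opprK.
  rewrite !ec es !fourier_poisson// fourier_conj_poisson// !mulr0 !oppr0 expR0; ring.
- rewrite pospart_id ?ltW// !fourier_poisson// fourier_conj_poisson//.
  by generalize (pi : R) => p; field.
- have -> : pospart (0 : R) = 0 by rewrite /pospart max_r.
  rewrite !mulr0 !oppr0 expR0 subrr mulr0.
  have -> : pint (fun z => conj_poisson la mu z * sin (z * 0)) = 0.
    by rewrite -[RHS]pint0; apply: eq_pint => z _; rewrite mulr0 sin0 mulr0.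
  have ec (k : R) : 0 < k -> pint (fun z => poisson k z * cos (z * 0)) = pi / 2.
    by move=> k0; rewrite -(poisson_value k0); apply: eq_pint => z _; rewrite mulr0 cos0 mulr1.
  by rewrite !ec// subrr addr0.
Qed.

Lemma fourier_Ex (d : measure_display) (T : measurableType d) (R : realType) (P : probability T R)
    (Y : T -> R) (la mu : R) : measurable_fun setT Y -> 0 < la -> 0 < mu ->
  pi * (Ex P (fun w => expR (- (la * pospart (Y w)))) - Ex P (fun w => expR (- (mu * pospart (Y w))))) =
  pint (fun z => (poisson la z - poisson mu z) * Ex P (fun w => cos (z * Y w)) +
                 conj_poisson la mu z * Ex P (fun w => sin (z * Y w))).
Proof.
move=> mY la0 mu0.
have be (k : R) : 0 < k -> bmeas (fun w => expR (- (k * pospart (Y w)))).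
  by move=> k0; exact: (bmeas_comp (bmeas_exp (ltW k0)) mY).
have bc z : bmeas (fun w => cos (z * Y w)).
  split; last by exists 1 => w; exact: cos_norm_le1.
  by apply: measurable_funcos; apply: measurable_funM => //; exact: measurable_cst.
have bs z : bmeas (fun w => sin (z * Y w)).
  split; last by exists 1 => w; exact: sin_norm_le1.
  by apply: measurable_funsin; apply: measurable_funM => //; exact: measurable_cst.
have bl := be la la0; have bm := be mu mu0.
rewrite -(ExB P bl bm) -(ExZ P pi (bmeasD bl (bmeasN bm))).
rewrite (@eq_Ex _ _ _ P _ (fun w => pint (fourier_ker la mu (Y w)))); last by move=> w; rewrite fourier_pair.
have mF : measurable_fun setT (fun p : T * R => fourier_ker la mu (Y p.1) p.2).
  rewrite /fourier_ker /poisson /conj_poisson.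
  have m1 : measurable_fun setT (fun p : T * R => p.2 * Y p.1).
    by apply: measurable_funM; [exact: measurable_snd|exact: measurableT_comp mY measurable_fst].
  apply: measurable_funD; apply: measurable_funM; do ?[exact: measurable_funcos|exact: measurable_funsin]; meas.
have bF w (z : R) : 0 < z -> `|fourier_ker la mu (Y w) z| <= fourier_dom la mu z.
  by move=> z0; apply: trig_dom => //; [exact: cos_norm_le1|exact: sin_norm_le1].
have [_ E] := @prob_fubini _ T R P (fun w z => fourier_ker la mu (Y w) z) (fourier_dom la mu) mF
  (fourier_dom_integrable la0 mu0) bF.
apply: (etrans E).
apply: eq_pint => z z0; rewrite -/(Ex P _) /fourier_ker.
rewrite (ExD P (bmeasM (bmeas_cst T (poisson la z - poisson mu z)) (bc z)) (bmeasM (bmeas_cst T (conj_poisson la mu z)) (bs z))).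
by rewrite (ExZ P _ (bc z)) (ExZ P _ (bs z)).
Qed.

Lemma charfun_Ex (d : measure_display) (T : measurableType d) (R : realType) (P : probability T R)
    (X : R -> {RV P >-> R}) (al rho t z : R) : stable_process P X al rho -> 0 <= t -> 0 < z ->
  Ex P (fun w => cos (z * X t w)) =
    expR (- (t * (z `^ al * cos (theta al rho)))) * cos (t * (z `^ al * sin (theta al rho))) /\
  Ex P (fun w => sin (z * X t w)) =
    - (expR (- (t * (z `^ al * cos (theta al rho)))) * sin (t * (z `^ al * sin (theta al rho)))).
Proof.
move=> [_ _ _ hc] t0 z0; have := hc t z t0.
rewrite /charfun /stable_exponent /cexp z0 (lt_gtF z0) gtr0_norm//= unlock.
rewrite -/(theta al rho) => -[].
rewrite !(mulr0, mul0r, mulr1, mul1r, subr0, sub0r, addr0, add0r, expR0, oppr0, oppr_eq0).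
rewrite cosN sinN mulrN => h1 h2; split; [exact: h1|exact: h2].
Qed.

Lemma cpos_stable (d : measure_display) (T : measurableType d) (R : realType)
    (P : probability T R) (X : R -> {RV P >-> R}) (al la t : R) :
  strictly_stable P X al -> 0 < t -> 0 <= la ->
  Ex P (fun w => expR (- (la * pospart (X t w)))) = cpos X (la * t `^ al^-1).
Proof.
move=> st t0 la0.
have mX s := @measurable_RV _ T R P X s.
have mV : measurable_fun setT (fun w => t `^ al^-1 * X 1 w) by apply: measurable_funM; [exact: measurable_cst|exact: mX].
rewrite (law_Ex (mX t) mV _ (bmeas_exp la0)).
  by apply: eq_Ex => w; rewrite pospartM ?powR_ge0// mulrA.
by move=> A mA; have := st t 1 A t0 ler01 mA; rewrite mulr1.
Qed.

Lemma cpos_bmeas (d : measure_display) (T : measurableType d) (R : realType)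
    (P : probability T R) (X : R -> {RV P >-> R}) (al la : R) : 0 <= la ->
  bmeas (fun t : R => cpos X (la * t `^ al^-1)).
Proof.
move=> la0; apply: (@bmeas_Ex _ _ R T R P (fun p : R * T => expR (- (la * p.1 `^ al^-1 * pospart (X 1 p.2))))).
split.
  apply: measurable_funexpR; apply: measurable_funN; apply: measurable_funM.
    apply: measurable_funM; first exact: measurable_cst.
    by apply: measurable_funpowR; exact: measurable_fst.
  apply: measurable_funpospart; exact: measurableT_comp (measurable_RV X 1) measurable_snd.
by exists 1 => p; apply: exp_neg_norm; [rewrite mulr_ge0 ?powR_ge0|exact: pospart_ge0].
Qed.

(** The average of c(la t^(1/al)) over an exponential time of rate 1; by scaling, q K(q) is its
    value at q^(- 1/al). *)
Definition cbar (d : measure_display) (T : measurableType d) (R : realType)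
    (P : probability T R) (X : R -> {RV P >-> R}) (al la : R) : R :=
  pint (fun t => expR (- (1 * t)) * cpos X (la * t `^ al^-1)).

Lemma cbar_integrable (d : measure_display) (T : measurableType d) (R : realType)
    (P : probability T R) (X : R -> {RV P >-> R}) (al la : R) : 0 <= la ->
  pintegrable (fun t => expR (- (1 * t)) * cpos X (la * t `^ al^-1)).
Proof.
move=> la0; have [m _] := cpos_bmeas X al la0.
apply: (pintegrable_dom _ _ (exp0_integrable ltr01)).
  apply: measurable_funM; first by meas.
  exact: (measurable_funS measurableT).
move=> t t0; rewrite normrM ger0_norm ?expR_ge0//; apply: ler_piMr; first exact: expR_ge0.
by apply: cpos_bound; rewrite mulr_ge0 ?powR_ge0.
Qed.

(** Integrating e^(- t) against the characteristic function over t produces 1 / (1 + z^al e^(i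
    theta)), and the Fourier kernel produces 1 / (la + i z) - 1 / (mu + i z). Only differences are
    accessible, as integrability of the kernel requires two parameters. *)
Lemma cbar_sub (d : measure_display) (T : measurableType d) (R : realType)
    (P : probability T R) (X : R -> {RV P >-> R}) (al rho la mu : R) :
  stable_process P X al rho -> - (pi / 2) < theta al rho -> theta al rho < pi / 2 -> 0 < al ->
  0 < la -> 0 < mu ->
  cbar X al la - cbar X al mu = JI al rho la - JI al rho mu.
Proof.
move=> hX t0 t1 al0 la0 mu0; have [hL st _ _] := hX; set th := theta al rho.
have c0 : 0 <= cos th by apply/ltW/cos_gt0_pihalf; rewrite t0 t1.
have pp : pi != 0 :> R by rewrite gt_eqF// pi_gt0.
apply: (mulfI pp); rewrite /cbar -pintB; [|exact: cbar_integrable (ltW _)..].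
pose F (t z : R) := expR (- (1 * t)) * ((poisson la z - poisson mu z) *
    (expR (- (t * (z `^ al * cos th))) * cos (t * (z `^ al * sin th))) +
  conj_poisson la mu z * - (expR (- (t * (z `^ al * cos th))) * sin (t * (z `^ al * sin th)))).
have E1 : pi * pint (fun t => expR (- (1 * t)) * cpos X (la * t `^ al^-1) - expR (- (1 * t)) * cpos X (mu * t `^ al^-1)) =
   pint (fun t => pint (F t)).
  rewrite -pintZ; last by apply: pintegrableB; exact: cbar_integrable (ltW _).
  apply: eq_pint => t tt.
  have eb z : `|expR (- (t * (z `^ al * cos th)))| <= 1.
    by apply: exp_neg_norm; rewrite ?mulr_ge0 ?powR_ge0// ltW.
  rewrite -(cpos_stable st tt (ltW la0)) -(cpos_stable st tt (ltW mu0)) -mulrBr mulrCA.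
  rewrite (fourier_Ex P (measurable_RV X t) la0 mu0).
  rewrite (eq_pint (g := fun z => (poisson la z - poisson mu z) *
    (expR (- (t * (z `^ al * cos th))) * cos (t * (z `^ al * sin th))) +
    conj_poisson la mu z * - (expR (- (t * (z `^ al * cos th))) * sin (t * (z `^ al * sin th))))); last first.
    by move=> z z0; have [-> ->] := charfun_Ex hX (ltW tt) z0.
  rewrite -pintZ//.
  apply: (pintegrable_dom _ _ (fourier_dom_integrable la0 mu0)); first by rewrite /poisson /conj_poisson; meas.
  move=> z z0; apply: trig_dom => //; rewrite ?normrN normrM -[leRHS]mulr1; apply: ler_pM => //.
    exact: cos_norm_le1.
  exact: sin_norm_le1.
rewrite E1.
have mF : measurable_fun setT (fun p : R * R => F p.1 p.2).
  by rewrite /F /poisson /conj_poisson; meas.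
have bF (t z : R) : 0 < t -> 0 < z -> `|F t z| <= expR (- (1 * t)) * fourier_dom la mu z.
  move=> tt z0; have eb : `|expR (- (t * (z `^ al * cos th)))| <= 1.
    by apply: exp_neg_norm; rewrite ?mulr_ge0 ?powR_ge0// ltW.
  rewrite normrM ger0_norm ?expR_ge0//; apply: ler_wpM2l; first exact: expR_ge0.
  apply: trig_dom => //; rewrite ?normrN normrM -[leRHS]mulr1; apply: ler_pM => //.
    exact: cos_norm_le1.
  exact: sin_norm_le1.
have [_ E2] := @pint_fubini R F (fun t => expR (- (1 * t))) (fourier_dom la mu) mF (exp0_integrable ltr01)
   (fourier_dom_integrable la0 mu0) bF.
rewrite E2.
have iW (k : R) : 0 < k -> pintegrable (WI al th k 0 0) by move=> k0; apply: WI_integrable => //; lra.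
rewrite (eq_pint (g := fun z => WI al th la 0 0 z - WI al th mu 0 0 z)); last first.
  move=> z z0; set y := z `^ al; have y0 : 0 <= y by exact: powR_ge0.
  have a0 : 0 < 1 + y * cos th := ltr_pwDl ltr01 (mulr_ge0 y0 c0).
  have [_ e1] := pint_exp_trig (y * sin th) (poisson la z - poisson mu z) (- conj_poisson la mu z) a0.
  rewrite (eq_pint (g := fun t => expR (- ((1 + y * cos th) * t)) * ((poisson la z - poisson mu z) * cos (y * sin th * t) +
     - conj_poisson la mu z * sin (y * sin th * t)))); last first.
    move=> t tt; rewrite /F -/y (mulrDl 1) opprD expRD !(mulrC t).
    have E4 (e f A B C S : R) : e * (A * (f * C) + B * - (f * S)) = e * f * (A * C + - B * S) by ring.
    exact: E4.
  rewrite e1 /WI powRr0 cos0 sin0 sub0r cosN sinN -/y.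
  have -> : (1 + y * cos th) ^+ 2 + (y * sin th) ^+ 2 = den th y.
    rewrite /den !exprMn sin2cos2 sqrrD; ring.
  have d0 := den_gt0 c0 y0.
  have l2 : 0 < la ^+ 2 + z ^+ 2 by rewrite addr_gt0 ?exprn_gt0.
  have m2 : 0 < mu ^+ 2 + z ^+ 2 by rewrite addr_gt0 ?exprn_gt0.
  rewrite /poisson /conj_poisson; move: d0 l2 m2.
  move: (den th y) (la ^+ 2 + z ^+ 2) (mu ^+ 2 + z ^+ 2) (cos th) (sin th) => D L M C S d0 l2 m2.
  by field; rewrite !gt_eqF.
rewrite pintB; [|exact: iW..].
by rewrite /JI -/th -mulrBr mulVKf.
Qed.

Lemma Ex_indic (d : measure_display) (T : measurableType d) (R : realType) (P : probability T R)
    (A : set T) : measurable A -> Ex P (\1_A) = fine (P A).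
Proof.
move=> mA; rewrite /Ex /Rintegral; congr fine.
by rewrite integral_indic// setIT.
Qed.

Lemma cpos_limit (d : measure_display) (T : measurableType d) (R : realType)
    (P : probability T R) (X : R -> {RV P >-> R}) (rho s : R) :
  P [set w | 0 < X 1 w] = rho%:E -> 0 < s ->
  (fun n => cpos X (n.+2%:R * s)) @ \oo --> 1 - rho.
Proof.
move=> hr s0; pose A := [set w | 0 < X 1 w].
have mA : measurable A.
  have -> : A = X 1 @^-1` `]0, +oo[ by apply/seteqP; split => w; rewrite /A /= in_itv/= andbT.
  by apply: measurable_preim; [exact: measurable_RV|exact: measurable_itv].
have i1 : P.-integrable setT (EFin \o (fun _ : T => 1 : R)) by exact: bmeas_integrable (bmeas_cst T 1).
have bA : bmeas (\1_A : T -> R).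
  split; first exact: measurable_indic.
  by exists 1 => w; rewrite indicE; case: (_ \in _); rewrite ?normr1 ?normr0.
have E : Ex P (fun w => 1 - \1_A w) = 1 - rho.
  by rewrite (ExB P (bmeas_cst T 1) bA) Ex_cst Ex_indic// /A hr.
have mf n : measurable_fun setT (fun w => expR (- (n.+2%:R * s * pospart (X 1 w)))).
  apply: measurable_funexpR; apply: measurable_funN; apply: measurable_funM; first exact: measurable_cst.
  by apply: measurable_funpospart; exact: measurable_RV.
have hl w : setT w -> expR (- (n.+2%:R * s * pospart (X 1 w))) @[n --> \oo] --> (1 - \1_A w : R).
  move=> _; rewrite indicE; have [h|h] := ltP 0 (X 1 w).
    rewrite mem_set//= subrr pospart_id ?ltW//.
    have p : 0 < s * X 1 w by exact: mulr_gt0.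
    have := @cvg_comp _ _ _ _ _ _ _ _ (@cvg_natSSy R) (cvgy_expN p).
    apply: cvg_trans; apply: near_eq_cvg; near=> n; rewrite /=; congr (expR (- _)).
    by rewrite [LHS]mulrC mulrA.
  rewrite memNset /A/=; last by apply/negP; rewrite -leNgt.
  rewrite subr0 /pospart max_r//; apply: cvg_near_cst; near=> n.
  by rewrite mulr0 oppr0 expR0.
have hb n w : setT w -> `|expR (- (n.+2%:R * s * pospart (X 1 w)))| <= 1.
  by move=> _; apply: exp_neg_norm; [rewrite mulr_ge0 ?ltW|exact: pospart_ge0].
have [_] := @Rintegral_dct _ T R P setT _ _ (fun=> 1) measurableT mf hl hb i1.
by rewrite -/(Ex P _) E.
Unshelve. all: by end_near. Qed.

Lemma cbar_limit (d : measure_display) (T : measurableType d) (R : realType)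
    (P : probability T R) (X : R -> {RV P >-> R}) (al rho : R) :
  P [set w | 0 < X 1 w] = rho%:E ->
  (fun n => cbar X al n.+2%:R) @ \oo --> 1 - rho.
Proof.
move=> hr.
have mf n : measurable_fun (`]0, +oo[ : set R) (fun t => expR (- (1 * t)) * cpos X (n.+2%:R * t `^ al^-1)).
  exact: pintegrable_meas (cbar_integrable _ _ _).
have hl (t : R) : 0 < t -> expR (- (1 * t)) * cpos X (n.+2%:R * t `^ al^-1) @[n --> \oo] --> expR (- (1 * t)) * (1 - rho).
  by move=> t0; apply: cvgMr; apply: cpos_limit hr _; exact: powR_gt0.
have hb n (t : R) : 0 < t -> `|expR (- (1 * t)) * cpos X (n.+2%:R * t `^ al^-1)| <= expR (- (1 * t)).
  move=> t0; rewrite normrM ger0_norm ?expR_ge0//; apply: ler_piMr; first exact: expR_ge0.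
  by apply: cpos_bound; rewrite mulr_ge0 ?powR_ge0.
have [_] := pint_dct mf hl hb (exp0_integrable ltr01).
rewrite (eq_pint (g := fun t => (1 - rho) * expR (- (1 * t)))); last by move=> t _; rewrite mulrC.
by rewrite pintZ ?pint_exp ?invr1 ?mulr1//; exact: exp0_integrable.
Qed.

Lemma JI_limit (R : realType) (al rho : R) :
  - (pi / 2) < theta al rho -> theta al rho < pi / 2 -> 0 < al ->
  (fun n => JI al rho n.+2%:R) @ \oo --> 0.
Proof.
move=> t0 t1 al0; set th := theta al rho.
have c0 : 0 <= cos th by apply/ltW/cos_gt0_pihalf; rewrite t0 t1.
have im1 : -1 < 0 :> R by lra.
have ib : pintegrable (fun z => 4 * (z `^ 0 / ((1 + z `^ al) * (1 + z)))) := WI_dom_integrable ltr01 im1 al0.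
have dp (k z : R) : 0 < k -> 0 < z -> 0 < (1 + z `^ al) * (k + z).
  by move=> k0 z0; rewrite mulr_gt0 ?addr_gt0 ?powR_gt0.
have hb n (z : R) : 0 < z -> `|WI al th n.+2%:R 0 0 z| <= 4 * (z `^ 0 / ((1 + z `^ al) * (1 + z))).
  move=> z0; apply: le_trans (WI_le _ _ _ c0 (ltr0Sn _ _) z0) _; apply: ler_wpM2l => //.
  apply: ler_wpM2l; first exact: powR_ge0.
  rewrite lef_pV2 ?posrE; [|exact: dp..].
  apply: ler_wpM2l; first by rewrite addr_ge0 ?powR_ge0.
  by rewrite lerD2r ler1n.
have hl (z : R) : 0 < z -> WI al th n.+2%:R 0 0 z @[n --> \oo] --> (0 : R).
  move=> z0; have hc : 4 * (z `^ 0 / (1 + z `^ al)) * (n + 2)%:R^-1 @[n --> \oo] --> (0 : R).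
    by rewrite -[X in _ --> X](mulr0 (4 * (z `^ 0 / (1 + z `^ al)))); apply: cvgMr; exact: cvg_natinv.
  apply: norm_cvg0; apply: (squeeze_cvgr _ (cvg_cst 0) hc).
  near=> n; rewrite normr_ge0/=; apply: le_trans (WI_le _ _ _ c0 (ltr0Sn _ _) z0) _.
  rewrite invfM !mulrA; apply: ler_wpM2l.
    by rewrite !mulr_ge0 ?powR_ge0 ?invr_ge0 ?addr_ge0 ?powR_ge0.
  rewrite lef_pV2 ?posrE ?addr_gt0// ?ltr0n ?addn2//.
  by rewrite lerDl ltW.
have hm n : measurable_fun (`]0, +oo[ : set R) (WI al th n.+2%:R 0 0) by exact: WI_meas.
have [_] := @pint_dct R (fun n => WI al th n.+2%:R 0 0) (fun=> 0) _ hm hl hb ib.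
rewrite pint0 => h; rewrite /JI -/th -[X in _ --> X](mulr0 pi^-1); exact: cvgMr.
Unshelve. all: by end_near. Qed.

(** By [cbar_sub] the difference of the two sides is constant in [la]. As [la] tends to infinity
    [JI] vanishes, while e^(- la x) with x the positive part of X_1 tends to the indicator of X_1 <=
    0, of probability 1 - rho. *)
Lemma cbarE (d : measure_display) (T : measurableType d) (R : realType)
    (P : probability T R) (X : R -> {RV P >-> R}) (al rho la : R) :
  stable_process P X al rho -> - (pi / 2) < theta al rho -> theta al rho < pi / 2 -> 0 < al ->
  0 < la -> cbar X al la = 1 - rho + JI al rho la.
Proof.
move=> hX t0 t1 al0 la0; have [_ _ hr _] := hX.
have E (a b c e : R) : a - b = c - e -> b - e = a - c by lra.
have h : (fun n => cbar X al n.+2%:R - JI al rho n.+2%:R) @ \oo --> 1 - rho - 0.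
  by apply: cvgB; [exact: cbar_limit|exact: JI_limit].
have h2 : (fun n => cbar X al n.+2%:R - JI al rho n.+2%:R) @ \oo --> cbar X al la - JI al rho la.
  apply: cvg_near_cst; near=> n.
  by have := cbar_sub hX t0 t1 al0 la0 (ltr0Sn R n.+1); exact: E.
have E2 (a b c : R) : c - 0 = a - b -> a = c + b by lra.
exact: E2 (seq_cvg_unique h h2).
Unshelve. all: by end_near. Qed.

Lemma lapk_cpos (d : measure_display) (T : measurableType d) (R : realType)
    (P : probability T R) (X : R -> {RV P >-> R}) (al rho q : R) :
  stable_process P X al rho -> - (pi / 2) < theta al rho -> theta al rho < pi / 2 -> 0 < al ->
  0 < q -> lapk 0 (fun t => cpos X (t `^ al^-1)) q = q^-1 * (1 - rho + JI al rho (q `^ (- al^-1))).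
Proof.
move=> hX t0 t1 al0 q0; rewrite -(cbarE hX)// ?powR_gt0//.
have m : measurable_fun setT (fun t : R => expR (- (1 * t)) * cpos X (q `^ (- al^-1) * t `^ al^-1)).
  apply: measurable_funM; first by meas.
  exact: (cpos_bmeas X al (powR_ge0 q (- al^-1))).1.
have [_ <-] := pint_scale q0 m (cbar_integrable X al (powR_ge0 q (- al^-1))).
apply: eq_pint => t tt; rewrite expr0 !mul1r; congr (_ * cpos X _).
rewrite powRM ?(ltW q0) ?(ltW tt)// mulrA -powRD ?(gt_eqF q0) ?implybT//.
by rewrite addNr powRr0 mul1r.
Qed.

(** * The series of W *)

(** The staircase expansion with [M] sent to infinity. The remainder is la^M over a sine that is at
    least c / b^M, so it vanishes once b la <= 1/2. *)
Lemma JI_series (R : realType) (al rho la c b : R) :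
  - (pi / 2) < theta al rho -> theta al rho < pi / 2 -> 0 < al -> 0 < la -> 0 < c -> 1 <= b ->
  (forall n, (0 < n)%N -> c / b ^+ n <= `|sin (n%:R * (pi * al))|) ->
  (forall n, (0 < n)%N -> c / b ^+ n <= `|sin (n%:R * (pi / al))|) ->
  (forall m n : nat, (0 < n)%N -> al * n%:R != m%:R) ->
  b * la `^ al <= 2^-1 -> b * la <= 2^-1 ->
  JI al rho la = rho + gsum (fun n => sratio (pi * al * rho) (pi * al) n * (la `^ al) ^+ n)
    + al^-1 * gsum (fun m => sratio (pi * rho) (pi / al) m * la ^+ m).
Proof.
move=> t0 t1 al0 la0 c0 b1 h1 h2 irr hx hy.
have b0 : 0 < b by exact: lt_le_trans b1.
have lb n : 0 < c / b ^+ n by rewrite divr_gt0// exprn_gt0.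
have s1 n : (0 < n)%N -> sin (n%:R * (pi * al)) != 0.
  by move=> n0; rewrite -normr_gt0; exact: lt_le_trans (h1 n n0).
have s2 n : (0 < n)%N -> sin (n%:R * (pi / al)) != 0.
  by move=> n0; rewrite -normr_gt0; exact: lt_le_trans (h2 n n0).
have half0 : 0 <= 2^-1 :> R by [].
have half1 : 2^-1 < 1 :> R by lra.
have bnd tau om x n : 0 <= x -> b * x <= 2^-1 ->
    (forall n, (0 < n)%N -> c / b ^+ n <= `|sin (n%:R * om)|) ->
    `|sratio tau om n * x ^+ n| <= c^-1 * 2^-1 ^+ n.
  move=> x0 bx hs; rewrite normrM (ger0_norm (exprn_ge0 n x0)).
  apply: (@le_trans _ _ (c^-1 * b ^+ n * x ^+ n)).
    by apply: ler_wpM2r; [exact: exprn_ge0|exact: sratio_le].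
  rewrite -mulrA -exprMn; apply: ler_wpM2l; first by rewrite invr_ge0 ltW.
  by rewrite lerXn2r ?nnegrE// mulr_ge0// ltW.
pose u n := sratio (pi * al * rho) (pi * al) n * (la `^ al) ^+ n.
pose v m := sratio (pi * rho) (pi / al) m * la ^+ m.
have cu : series u @ \oo --> gsum u by apply: (gsum_cvg half0 half1) => n; apply: bnd => //; exact: powR_ge0.
have cv : series v @ \oo --> gsum v by apply: (gsum_cvg half0 half1) => n; apply: bnd => //; exact: ltW.
(* The choice of N that puts al N - (M + 1) into ]0, al[, the range of [RR_le]. *)
pose NN M := (Num.truncn (M.+1%:R / al)).+1.
have N1 M : 0 < al * (NN M)%:R - M.+1%:R.
  by rewrite subr_gt0 mulrC -ltr_pdivrMr//; exact: truncnS_gt.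
have N2 M : al * (NN M)%:R - M.+1%:R < al.
  have hle : al * (Num.truncn (M.+1%:R / al))%:R <= M.+1%:R.
    by rewrite mulrC -ler_pdivlMr// truncn_le divr_ge0// ltW.
  have hne : al * (Num.truncn (M.+1%:R / al))%:R != M.+1%:R.
    have [->|n0] := posnP (Num.truncn (M.+1%:R / al)); last exact: irr.
    by rewrite mulr0 eq_sym pnatr_eq0.
  have : al * (Num.truncn (M.+1%:R / al))%:R < M.+1%:R by rewrite lt_neqAle hne.
  by rewrite /NN -(natr1 (Num.truncn _)) mulrDr mulr1; lra.
have NNy : NN @ \oo --> \oo.
  apply/cvgnyPge => A; near=> M; rewrite -(ler_nat R); apply/ltW.
  apply: le_lt_trans (truncnS_gt _); rewrite ler_pdivlMr//.
  near: M; exists (Num.truncn (A%:R * al)) => // M /= hM.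
  by apply: ltW; apply: lt_le_trans (truncnS_gt _) _; rewrite ler_nat ltnS.
have eu N : (0 < N)%N -> \sum_(1 <= n < N) u n = series u N.
  have u0 : u 0%N = 0 by rewrite /u sratio0 mul0r.
  by move=> n0; rewrite /series/= [RHS]big_ltn// u0 add0r.
have ev M : (0 < M)%N -> \sum_(1 <= m < M) v m = series v M.
  have v0 : v 0%N = 0 by rewrite /v sratio0 mul0r.
  by move=> n0; rewrite /series/= [RHS]big_ltn// v0 add0r.
have hR : (fun M => RR al rho la M.+1 (NN M)) @ \oo --> (0 : R).
  have hb : 4 / al * c^-1 * 2^-1 ^+ M.+1 @[M --> \oo] --> (0 : R).
    rewrite -[X in _ --> X](mulr0 (4 / al * c^-1)); apply: cvgMr.
    have := cvg_shiftS (fun n : nat => (2^-1 : R) ^+ n) (nbhs (0 : R)); move=> /= ->.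
    by apply: cvg_expr; rewrite ger0_norm.
  apply: norm_cvg0; apply: (squeeze_cvgr _ (cvg_cst 0) hb).
  near=> M; rewrite normr_ge0/=; apply: le_trans (RR_le t0 t1 al0 la0 (N1 M) (N2 M)) _.
  rewrite -[leRHS]mulrA; apply: ler_wpM2l; first by rewrite divr_ge0// ltW.
  have sp : 0 < `|sin (M.+1%:R * (pi / al))| by exact: lt_le_trans (h2 M.+1 _).
  rewrite ler_pdivrMr//.
  apply: (@le_trans _ _ (c^-1 * 2^-1 ^+ M.+1 * (c / b ^+ M.+1))); last first.
    apply: ler_wpM2l; last exact: h2.
    by rewrite mulr_ge0 ?invr_ge0 ?exprn_ge0// ltW.
  have -> : c^-1 * 2^-1 ^+ M.+1 * (c / b ^+ M.+1) = (2^-1 / b) ^+ M.+1.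
    by rewrite mulrACA mulVf ?gt_eqF// mul1r -exprVn -exprMn.
  rewrite lerXn2r ?nnegrE// ?(ltW la0)// ?divr_ge0 ?(ltW b0)//.
  by rewrite ler_pdivlMr// mulrC.
have E M : JI al rho la = rho + series u (NN M) + al^-1 * series v M.+1 + RR al rho la M.+1 (NN M).
  rewrite (JI_partial t0 t1 al0 la0 s1 s2 irr (M := M.+1) (N := NN M))//; last by have := N1 M; lra.
  by rewrite -eu// -ev.
have hl : (fun M => rho + series u (NN M) + al^-1 * series v M.+1 + RR al rho la M.+1 (NN M)) @ \oo -->
    rho + gsum u + al^-1 * gsum v + 0.
  apply: cvgD hR; apply: cvgD; first by apply: cvgD; [exact: cvg_cst|exact: (@cvg_comp _ _ _ NN (series u) _ _ _ NNy cu)].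
  by apply: cvgMr; have := cvg_shiftS (series v) (nbhs (gsum v)); move=> /= ->.
have hc : (fun M => rho + series u (NN M) + al^-1 * series v M.+1 + RR al rho la M.+1 (NN M)) @ \oo --> JI al rho la.
  by apply: cvg_near_cst; near=> M; rewrite -E.
by rewrite (seq_cvg_unique hc hl) addr0.
Unshelve. all: by end_near. Qed.

Lemma ode_ratio (R : realType) (f g h : R -> R) (q0 a b : R) :
  (forall q : R, q0 < q -> is_derive q 1 f (f q * h q)) ->
  (forall q : R, q0 < q -> is_derive q 1 g (g q * h q)) ->
  (forall q : R, q0 < q -> 0 < g q) -> q0 < a -> q0 < b -> f a / g a = f b / g b.
Proof.
move=> df dg g0; wlog ab : a b / a <= b.
  by move=> H qa qb; have [ab|ab] := leP a b; [exact: H|apply/esym/H => //; exact: ltW].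
move=> qa qb.
pose r z := f (z + q0) / g (z + q0).
have dr (z : R) : 0 < z -> is_derive z 1 r 0.
  move=> z0; have qz : q0 < z + q0 by rewrite ltrDr.
  have dz : is_derive z 1 (fun z => z + q0) 1 by apply: is_derive_eq; rewrite addr0.
  have d1 := @is_derive1_comp R f (fun z => z + q0) z _ _ (df _ qz) dz.
  have d2 := @is_derive1_comp R g (fun z => z + q0) z _ _ (dg _ qz) dz.
  have gn : g (z + q0) != 0 by rewrite gt_eqF// g0.
  apply: (is_derive_conv (is_derive_div d1 d2 gn)); rewrite /=.
  by move: (f _) (g _) (h _) => F G H; rewrite !mulr1; ring.
have az : 0 < a - q0 by rewrite subr_gt0.
have abz : a - q0 <= b - q0 by rewrite lerD2r.
have e1 : r (a - q0) <= r (b - q0) by apply: (pos_homo az abz dr).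
have e2 : - r (a - q0) <= - r (b - q0).
  apply: (@pos_homo R (fun z => - r z) (fun=> 0)) => // z z0.
  by apply: (is_derive_conv (is_deriveN (dr z z0))); rewrite oppr0.
have : r (a - q0) = r (b - q0) by apply/eqP; rewrite eq_le e1; rewrite lerN2 in e2.
by rewrite /r !subrK.
Qed.

Lemma pint_exp_tail (R : realType) (q s : R) : 0 < q -> 0 <= s ->
  pint (fun x => expR (- (q * x)) * (s <= x)%R%:R) = q^-1 * expR (- (q * s)).
Proof.
move=> q0; rewrite le_eqVlt => /orP[/eqP <-|s0].
  rewrite mulr0 oppr0 expR0 mulr1 -(pint_exp q0); apply: eq_pint => x x0.
  by rewrite ltW// mulr1.
pose g (x : R) := expR (- (q * x)).
have E : pint (fun x => expR (- (q * x)) * (s <= x)%R%:R) = \int[lebesgue_measure]_(x in `[s, +oo[) g x.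
  rewrite -[X in Rintegral _ X](_ : `]0, +oo[ `&` `[s, +oo[ = _); last first.
    apply/seteqP; split => x /=; rewrite !in_itv/= ?andbT; first by case.
    by move=> sx; split => //; exact: lt_le_trans sx.
  rewrite Rintegral_mkcondr; apply: eq_pint => x x0; rewrite patchE /g.
  have [sx|sx] := leP s x; first by rewrite mem_set ?mulr1//= in_itv/= sx.
  by rewrite memNset ?mulr0//= in_itv/= leNgt sx.
rewrite E /Rintegral (@ge0_continuous_FTC2y R g (fun x => - q^-1 * g x) s 0).
- by rewrite sub0e /= /g mulNr opprK.
- by move=> x _; exact: expR_ge0.
- by apply: continuous_subspaceT => x; exact: continuous_expN.
- by rewrite -[X in _ --> X](mulr0 (- q^-1)); apply: cvgMr; exact: cvgy_expN.
- by move=> x _; have [] := is_deriveZ (- q^-1) (is_derive_expN q x).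
- apply: cvg_at_right_filter; apply: cvgMr; exact: continuous_expN.
- move=> x _; rewrite derive1E (@derive_val _ _ _ _ _ _ _ (is_deriveZ (- q^-1) (is_derive_expN q x))).
  by rewrite /GRing.scale/= mulNr mulrA mulrN mulVf ?gt_eqF// mulN1r opprK.
Qed.

Lemma supf_cvg (d : measure_display) (T : measurableType d) (R : realType)
    (P : probability T R) (X : R -> {RV P >-> R}) (la : nat -> R) (l : R) : cadlag_paths X ->
  (forall N, 0 <= la N) -> la @ \oo --> l -> (fun N => supf X (la N)) @ \oo --> supf X l.
Proof.
move=> cX la0 hla.
have i1 : P.-integrable setT (EFin \o (fun _ : T => 1 : R)) by exact: bmeas_integrable (bmeas_cst T 1).
have mS := measurable_sup_shift cX.
have mf N : measurable_fun setT (fun w => expR (- (la N * (running_sup X 1 w - X 0 w)))).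
  apply: measurable_funexpR; apply: measurable_funN; apply: measurable_funM => //; exact: measurable_cst.
have hl w : setT w -> expR (- (la N * (running_sup X 1 w - X 0 w))) @[N --> \oo] --> expR (- (l * (running_sup X 1 w - X 0 w))).
  move=> _; apply: (@continuous_cvg _ _ _ _ _ (fun N => - (la N * (running_sup X 1 w - X 0 w))) expR); first exact: continuous_expR.
  by apply: cvgN; apply: cvgMl.
have hb N w : setT w -> `|expR (- (la N * (running_sup X 1 w - X 0 w)))| <= 1.
  by move=> _; apply: exp_neg_norm => //; exact: sup_shift_ge0.
by have [_] := @Rintegral_dct _ T R P setT _ _ (fun=> 1) measurableT mf hl hb i1.
Qed.

Lemma supf_bmeas (d : measure_display) (T : measurableType d) (R : realType)
    (P : probability T R) (X : R -> {RV P >-> R}) (be : R) : cadlag_paths X ->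
  bmeas (fun t : R => supf X (t `^ be)).
Proof.
move=> cX; apply: (@bmeas_Ex _ _ R T R P (fun p : R * T => expR (- (p.1 `^ be * (running_sup X 1 p.2 - X 0 p.2))))).
split.
  apply: measurable_funexpR; apply: measurable_funN; apply: measurable_funM.
    by apply: measurable_funpowR; exact: measurable_fst.
  exact: (measurableT_comp (measurable_sup_shift cX) measurable_snd).
by exists 1 => p; apply: exp_neg_norm; [exact: powR_ge0|exact: sup_shift_ge0].
Qed.

Lemma supf_bound (d : measure_display) (T : measurableType d) (R : realType)
    (P : probability T R) (X : R -> {RV P >-> R}) (la : R) : cadlag_paths X -> 0 <= la ->
  0 <= supf X la /\ `|supf X la| <= 1.
Proof.
move=> cX la0; split; first by apply: Rintegral_ge0 => w _; exact: expR_ge0.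
apply: Ex_norm_le; last by move=> w; apply: exp_neg_norm => //; exact: sup_shift_ge0.
apply: measurable_funexpR; apply: measurable_funN; apply: measurable_funM; first exact: measurable_cst.
exact: measurable_sup_shift.
Qed.

Lemma supf0 (d : measure_display) (T : measurableType d) (R : realType)
    (P : probability T R) (X : R -> {RV P >-> R}) : supf X 0 = 1.
Proof. by rewrite -[RHS](Ex_cst P); apply: eq_Ex => w; rewrite mul0r oppr0 expR0. Qed.

Lemma gsumS (R : realType) (u : nat -> R) (C r : R) : 0 <= r -> r < 1 ->
  (forall n, `|u n| <= C * r ^+ n) -> gsum u = u 0%N + gsum (fun n => u n.+1).
Proof.
move=> r0 r1 hu; have hu' n : `|u n.+1| <= C * r * r ^+ n.
  by apply: le_trans (hu n.+1) _; rewrite exprS mulrA.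
apply: gsum_eq; have := cvg_shiftS (series u) (nbhs (u 0%N + gsum (fun n => u n.+1))); move=> /= <-.
have -> : (fun n => series u n.+1) = (fun n => u 0%N + series (fun n => u n.+1) n).
  by apply: funext => n; rewrite /series/= big_nat_recl.
by apply: cvgD; [exact: cvg_cst|exact: gsum_cvg hu'].
Qed.

(* The function W of the introduction. *)
Definition sup_lap (d : measure_display) (T : measurableType d) (R : realType)
    (P : probability T R) (X : R -> {RV P >-> R}) (al q : R) : R :=
  q * lapk 0 (fun t => supf X (t `^ al^-1)) q.

(** (q V)' = V - q K V = V (rho - J(q^(- 1/al))), and the symmetry of J turns the bracket into
    J(q^(1/al)). *)
Lemma sup_lap_derive (d : measure_display) (T : measurableType d) (R : realType)
    (P : probability T R) (X : R -> {RV P >-> R}) (al rho q : R) :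
  stable_process P X al rho -> - (pi / 2) < theta al rho -> theta al rho < pi / 2 -> 0 < al ->
  0 < q -> is_derive q 1 (sup_lap X al) (sup_lap X al q * (JI al rho (q `^ al^-1) / q)).
Proof.
move=> hX t0 t1 al0 q0; have [hL st _ _] := hX; have [_ _ _ cX] := hL.
have [mv _] := supf_bmeas al^-1 cX.
have mv' : measurable_fun (`]0, +oo[ : set R) (fun t : R => supf X (t `^ al^-1)) by exact: measurable_funTS.
have bv (t : R) : 0 < t -> `|supf X (t `^ al^-1)| <= 1 by move=> _; exact: (supf_bound cX (powR_ge0 _ _)).2.
have dV := lapk_derive 0 mv' bv q0.
have dq : is_derive q 1 (fun q : R => q) 1 by exact: is_derive_id.
apply: (is_derive_conv (is_deriveM dq dV)).
rewrite /GRing.scale/= (spitzer_laplace hL st al0 q0) (lapk_cpos hX t0 t1 al0 q0) /sup_lap.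
have js := JI_sym t0 t1 al0 (powR_gt0 al^-1 q0).
have -> : JI al rho (q `^ (- al^-1)) = rho - JI al rho (q `^ al^-1).
  have E (a b c : R) : a + b = c -> b = c - a by lra.
  by apply: E; rewrite powRN.
move: (JI _ _ _) (lapk _ _ _) => J V; have qn : q != 0 by rewrite gt_eqF.
by field.
Qed.

(** Replacing t by t / q shows W(q) as an average against e^(- t), independent of q; both the limit
    at infinity and [lapk_supE] use this form. *)
Lemma sup_lapE (d : measure_display) (T : measurableType d) (R : realType)
    (P : probability T R) (X : R -> {RV P >-> R}) (al q : R) : cadlag_paths X -> 0 < q ->
  pintegrable (fun t => expR (- (1 * t)) * supf X (q^-1 `^ al^-1 * t `^ al^-1)) /\
  pint (fun t => expR (- (1 * t)) * supf X (q^-1 `^ al^-1 * t `^ al^-1)) = sup_lap X al q.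
Proof.
move=> cX q0; have qi0 : 0 < q^-1 by rewrite invr_gt0.
have [mv [M hM]] := supf_bmeas al^-1 cX.
have E (t : R) : 0 < t -> expR (- (q * (q^-1 * t))) * supf X ((q^-1 * t) `^ al^-1) =
    expR (- (1 * t)) * supf X (q^-1 `^ al^-1 * t `^ al^-1).
  have qn : q != 0 by rewrite gt_eqF.
  by move=> t0; rewrite (mulVKf qn) mul1r (powRM _ (ltW qi0) (ltW t0)).
have mg : measurable_fun setT (fun t : R => expR (- (q * t)) * supf X (t `^ al^-1)).
  by apply: measurable_funM => //; meas.
have ig : pintegrable (fun t : R => expR (- (q * t)) * supf X (t `^ al^-1)).
  apply: (pintegrable_dom _ _ (exp0_integrable q0)); first exact: measurable_funTS.
  move=> t _; rewrite normrM ger0_norm ?expR_ge0//; apply: ler_piMr; first exact: expR_ge0.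
  exact: (supf_bound cX (powR_ge0 _ _)).2.
have [i1 e1] := pint_scale qi0 mg ig.
split; first exact: (eq_pintegrable E i1).
rewrite -(eq_pint E) e1 invrK /sup_lap; congr (_ * _).
by apply: eq_pint => t _; rewrite expr0 mul1r.
Qed.

Lemma sup_lap_limit (d : measure_display) (T : measurableType d) (R : realType)
    (P : probability T R) (X : R -> {RV P >-> R}) (al : R) : cadlag_paths X -> 0 < al ->
  (fun n => sup_lap X al n.+2%:R) @ \oo --> (1 : R).
Proof.
move=> cX al0; have ai0 : 0 < al^-1 by rewrite invr_gt0.
have mf n : measurable_fun (`]0, +oo[ : set R) (fun t => expR (- (1 * t)) * supf X (n.+2%:R^-1 `^ al^-1 * t `^ al^-1)).
  exact: pintegrable_meas (sup_lapE al cX (ltr0Sn _ _)).1.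
have hl (t : R) : 0 < t -> expR (- (1 * t)) * supf X (n.+2%:R^-1 `^ al^-1 * t `^ al^-1) @[n --> \oo] --> expR (- (1 * t)).
  move=> t0.
  suff : expR (- (1 * t)) * supf X (n.+2%:R^-1 `^ al^-1 * t `^ al^-1) @[n --> \oo] --> expR (- (1 * t)) * supf X 0.
    by rewrite supf0 mulr1.
  apply: cvgMr; apply: supf_cvg => //.
    by move=> n; rewrite mulr_ge0 ?powR_ge0.
  rewrite -[X in _ --> X](mul0r (t `^ al^-1)); apply: cvgMl.
  have h : (fun n => (n.+2%:R^-1 : R)) @ \oo --> (0 : R)^'+ := @cvg_natinvr R.
  have h2 := powR_cvg0 ai0.
  exact: (@cvg_comp _ _ _ (fun n => (n.+2%:R^-1 : R)) (@powR R ^~ al^-1) _ _ _ h h2).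
have hb n (t : R) : 0 < t -> `|expR (- (1 * t)) * supf X (n.+2%:R^-1 `^ al^-1 * t `^ al^-1)| <= expR (- (1 * t)).
  move=> t0; rewrite normrM ger0_norm ?expR_ge0//; apply: ler_piMr; first exact: expR_ge0.
  by apply: (supf_bound cX _).2; rewrite mulr_ge0 ?powR_ge0.
have [_] := pint_dct mf hl hb (exp0_integrable ltr01).
rewrite pint_exp// invr1; apply: cvg_trans; apply: near_eq_cvg; near=> n.
by rewrite (sup_lapE al cX (ltr0Sn _ _)).2.
Unshelve. all: by end_near. Qed.

(** V is nonincreasing in q, and it is positive at some large argument because W tends to 1. *)
Lemma sup_lap_gt0 (d : measure_display) (T : measurableType d) (R : realType)
    (P : probability T R) (X : R -> {RV P >-> R}) (al q : R) : cadlag_paths X -> 0 < al -> 0 < q ->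
  0 < sup_lap X al q.
Proof.
move=> cX al0 q0; rewrite /sup_lap mulr_gt0//.
have h := sup_lap_limit cX al0.
have hlt : (0 : R) < 1 by [].
have [n [hn nq]] : exists n : nat, 0 < sup_lap X al n.+2%:R /\ q <= n.+2%:R.
  have : \forall n \near \oo, 0 < sup_lap X al n.+2%:R /\ q <= n.+2%:R.
    near=> n; split; first by near: n; exact: cvgr_gt h _ hlt.
    near: n; exists (Num.truncn q) => // n /= hn.
    by apply: ltW; apply: lt_le_trans (truncnS_gt _) _; rewrite ler_nat ltnS leqW.
  by move=> /filter_ex.
have n0 : 0 < n.+2%:R :> R by [].
have V0 : 0 < lapk 0 (fun t => supf X (t `^ al^-1)) n.+2%:R by move: hn; rewrite /sup_lap pmulr_rgt0.
apply: lt_le_trans V0 _.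
have [mv _] := supf_bmeas al^-1 cX.
have mv' : measurable_fun (`]0, +oo[ : set R) (fun t : R => supf X (t `^ al^-1)) by exact: measurable_funTS.
have bv (t : R) : 0 < t -> `|supf X (t `^ al^-1)| <= 1 by move=> _; exact: (supf_bound cX (powR_ge0 _ _)).2.
apply: le_pint; [exact: (lapk_integrable _ mv' bv n0)|exact: (lapk_integrable _ mv' bv q0)|].
move=> t t0; rewrite expr0 !mul1r; apply: ler_wpM2r; first exact: (supf_bound cX (powR_ge0 _ _)).1.
by rewrite ler_expR lerN2; apply: ler_wpM2r => //; exact: ltW.
Unshelve. all: by end_near. Qed.

(** By [JI_sym] the right-hand side satisfies the differential equation of the left-hand side, and
    the two agree at q = 1. *)
Lemma sup_lap_sym (d : measure_display) (T : measurableType d) (R : realType)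
    (P : probability T R) (X : R -> {RV P >-> R}) (al rho q : R) :
  stable_process P X al rho -> - (pi / 2) < theta al rho -> theta al rho < pi / 2 -> 0 < al ->
  0 < q -> sup_lap X al q = q `^ rho * sup_lap X al q^-1.
Proof.
move=> hX t0 t1 al0 q0; have [[_ _ _ cX] _ _ _] := hX.
pose W := sup_lap X al; pose h q := JI al rho (q `^ al^-1) / q.
have dW (p : R) : 0 < p -> is_derive p 1 W (W p * h p) by move=> qq; exact: sup_lap_derive.
have W0 (p : R) : 0 < p -> 0 < W p by move=> qq; exact: sup_lap_gt0.
have dY (p : R) : 0 < p -> is_derive p 1 (fun q => q `^ rho * W q^-1) (p `^ rho * W p^-1 * h p).
  move=> qq; have qi : 0 < p^-1 by rewrite invr_gt0.
  have d1 := is_derive_powR rho qq; have d2 := is_derive_inv qq (dW _ qi).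
  apply: (is_derive_conv (is_deriveM d1 d2)).
  have js := JI_sym t0 t1 al0 (powR_gt0 al^-1 qq).
  have e : JI al rho (p^-1 `^ al^-1) = rho - JI al rho (p `^ al^-1).
    have E (a b c : R) : a + b = c -> b = c - a by lra.
    by apply: E; rewrite -(powR_inv1 (ltW qq)) -powRrM mulN1r powRN.
  rewrite /GRing.scale/= /h e powR_subr1//.
  move: (JI _ _ _) (powR _ _) (W _) => J Y V; have qn : p != 0 by rewrite gt_eqF.
  by field.
have Y0 (p : R) : 0 < p -> 0 < p `^ rho * W p^-1.
  by move=> qq; rewrite mulr_gt0 ?powR_gt0// W0// invr_gt0.
have := ode_ratio dW dY Y0 q0 ltr01.
rewrite powR1 invr1 mul1r mulfV ?gt_eqF ?W0// => e.
exact: divr1_eq e.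
Qed.

Definition wcoef (R : realType) (al rho : R) (m n : nat) : R :=
  pcoef (pi * al * rho) (pi * al) n * pcoef (pi * rho) (pi / al) m.

Definition wexp (R : realType) (al : R) (m n : nat) : R := n%:R + m%:R / al.

Lemma wexp_lin (R : realType) (al : R) : 0 < al -> lin_bounded (wexp al).
Proof.
move=> al0; exists (1 + al^-1); first by rewrite addr_ge0// invr_ge0 ltW.
move=> m n; rewrite /wexp ger0_norm; last by rewrite addr_ge0// divr_ge0// ltW.
rewrite mulrDl mul1r; apply: lerD.
  by rewrite -natrM ler_nat (leq_trans (leqnSn n))// leq_pmull.
rewrite mulrC; apply: ler_wpM2l; first by rewrite invr_ge0 ltW.
by rewrite -natrM ler_nat (leq_trans (leqnSn m))// leq_pmulr.
Qed.

Lemma lin_boundedN (R : realType) (e : nat -> nat -> R) : lin_bounded e -> lin_bounded (fun m n => - e m n).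
Proof. by move=> [K K0 hK]; exists K => // m n; rewrite normrN. Qed.

Lemma natr_quarter_le (R : realType) (n : nat) : n%:R * 4^-1 ^+ n <= 2^-1 ^+ n :> R.
Proof.
have -> : 4^-1 = 2^-1 * 2^-1 :> R by field.
rewrite exprMn mulrA -[leRHS]mul1r; apply: ler_wpM2r; first exact: exprn_ge0.
rewrite exprVn ler_pdivrMr ?exprn_gt0// mul1r -natrX ler_nat.
exact/ltnW/ltn_expl.
Qed.

(** The product [U] of the two power series satisfies the equation of [W]: by [pcoef_rec] the
    logarithmic derivative of each factor is a series of sine quotients, and together these are J by
    [JI_series]. The ratio U / W is then constant, and both tend to 1. *)
Lemma wseries (R : realType) (W : R -> R) (al rho c b : R) :
  - (pi / 2) < theta al rho -> theta al rho < pi / 2 -> 0 < al -> 0 < c -> 1 <= b ->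
  (forall n, (0 < n)%N -> c / b ^+ n <= `|sin (n%:R * (pi * al))|) ->
  (forall n, (0 < n)%N -> c / b ^+ n <= `|sin (n%:R * (pi / al))|) ->
  (forall m n : nat, (0 < n)%N -> al * n%:R != m%:R) ->
  (forall q : R, 0 < q -> is_derive q 1 W (W q * (JI al rho (q `^ al^-1) / q))) ->
  (forall q : R, 0 < q -> 0 < W q) -> (fun n => W n.+2%:R) @ \oo --> (1 : R) ->
  exists q0 : R, [/\ 0 <= q0, geo_beyond q0 (wcoef al rho) (fun m n => - wexp al m n) &
    forall q, q0 < q -> W q = dsum (fun m n => wcoef al rho m n * q `^ (- wexp al m n))].
Proof.
move=> t0 t1 al0 c0 b1 h1 h2 irr dW W0 Wl.
have ai0 : 0 < al^-1 by rewrite invr_gt0.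
have b0 : 0 < b by exact: lt_le_trans b1.
have lb n : 0 < c / b ^+ n by rewrite divr_gt0// exprn_gt0.
have s1 n : (0 < n)%N -> sin (n%:R * (pi * al)) != 0.
  by move=> n0; rewrite -normr_gt0; exact: lt_le_trans (h1 n n0).
have s2 n : (0 < n)%N -> sin (n%:R * (pi / al)) != 0.
  by move=> n0; rewrite -normr_gt0; exact: lt_le_trans (h2 n n0).
pose A := b * (1 + c^-1).
have ci0 : 0 < c^-1 by rewrite invr_gt0.
have bA : b <= A by rewrite /A ler_peMr ?(ltW b0)// lerDl ltW.
have A0 : 0 < A by exact: lt_le_trans bA.
pose p := pcoef (pi * al * rho) (pi * al); pose r := pcoef (pi * rho) (pi / al).
have pA n : `|p n| <= A ^+ n by exact: pcoef_le.
have rA n : `|r n| <= A ^+ n by exact: pcoef_le.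
pose a := sratio (pi * al * rho) (pi * al); pose a' := sratio (pi * rho) (pi / al).
have aA n : `|a n| <= c^-1 * A ^+ n.
  apply: le_trans (sratio_le _ c0 b1 h1 n) _; apply: ler_wpM2l; first exact: ltW.
  by rewrite lerXn2r ?nnegrE// ltW.
have aA' n : `|a' n| <= c^-1 * A ^+ n.
  apply: le_trans (sratio_le _ c0 b1 h2 n) _; apply: ler_wpM2l; first exact: ltW.
  by rewrite lerXn2r ?nnegrE// ltW.
(* Beyond [q0] both variables, multiplied by A, are at most 1/4. The quarter leaves room for the
   factor n of a derivative, since n 4^(- n) <= 2^(- n). *)
pose q0 := Num.max (4 * A) ((4 * A) `^ al).
have A4 : 0 < 4 * A by rewrite mulr_gt0.
have q00 : 0 <= q0 by rewrite le_max ltW.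
have hx q : q0 < q -> [/\ 0 < q, A * q^-1 <= 4^-1 & A * q `^ (- al^-1) <= 4^-1].
  move=> qq; have qp : 0 < q by exact: le_lt_trans qq.
  have [k1 k2] : 4 * A < q /\ (4 * A) `^ al < q by move: qq; rewrite gt_max => /andP[].
  split => //.
    by rewrite ler_pdivrMr// mulrC ler_pdivlMr// mulrC ltW.
  rewrite powRN ler_pdivrMr ?powR_gt0// mulrC ler_pdivlMr// mulrC.
  have : ((4 * A) `^ al) `^ al^-1 <= q `^ al^-1.
    by apply: ge0_ler_powR; rewrite ?nnegrE ?powR_ge0// ltW.
  by rewrite -powRrM mulfV ?gt_eqF// powRr1// ltW.
have pw q m n : 0 < q -> q `^ (- wexp al m n) = q^-1 ^+ n * (q `^ (- al^-1)) ^+ m.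
  move=> qp; rewrite /wexp opprD powRD ?(gt_eqF qp) ?implybT//; congr (_ * _).
    by rewrite powRN powR_mulrn ?exprVn// ltW.
  by rewrite -powR_mulrn ?powR_ge0// -powRrM; congr (_ `^ _); ring.
have fourth0 : 0 <= 4^-1 :> R by [].
have fourth1 : 4^-1 < 1 :> R by lra.
have half0 : 0 <= 2^-1 :> R by [].
have half1 : 2^-1 < 1 :> R by lra.
have fb (u : nat -> R) (C x : R) n : (forall n, `|u n| <= C * A ^+ n) -> 0 <= C -> 0 <= x -> A * x <= 4^-1 ->
    `|u n * x ^+ n| <= C * 4^-1 ^+ n.
  move=> hu C0 x0 hAx; rewrite normrM (ger0_norm (exprn_ge0 n x0)).
  apply: (@le_trans _ _ (C * A ^+ n * x ^+ n)).
    by apply: ler_wpM2r; [exact: exprn_ge0|exact: hu].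
  rewrite -mulrA -exprMn; apply: ler_wpM2l => //.
  by rewrite lerXn2r ?nnegrE// mulr_ge0// ltW.
have f2 n : 4^-1 ^+ n <= 2^-1 ^+ n :> R by rewrite lerXn2r ?nnegrE//; lra.
have pA1 n : `|p n| <= 1 * A ^+ n by rewrite mul1r.
have rA1 n : `|r n| <= 1 * A ^+ n by rewrite mul1r.
have gb : geo_beyond q0 (wcoef al rho) (fun m n => - wexp al m n).
  move=> q qq; have [qp x1 x2] := hx q qq; exists 1, 4^-1; split => // m n.
  rewrite pw// /wcoef mulrACA normrM mulrC mul1r; apply: ler_pM => //.
    by have := fb r 1 _ m rA1 ler01 (powR_ge0 _ _) x2; rewrite mul1r.
  by have := fb p 1 q^-1 n pA1 ler01 _ x1; rewrite mul1r invr_ge0; apply; exact: ltW.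
exists q0; split => //.
pose U q := dsum (fun m n => wcoef al rho m n * q `^ (- wexp al m n)).
have UE q : q0 < q -> U q = gsum (fun n => p n * q^-1 ^+ n) * gsum (fun m => r m * (q `^ (- al^-1)) ^+ m).
  move=> qq; have [qp x1 x2] := hx q qq.
  have qi : 0 <= q^-1 by rewrite invr_ge0 ltW.
  rewrite -(dsum_prod fourth0 fourth1 (fun n => fb p 1 _ n pA1 ler01 qi x1) (fun n => fb r 1 _ n rA1 ler01 (powR_ge0 _ _) x2)).
  by apply: eq_dsum => m n; rewrite pw// mulrACA.
have dU q : q0 < q -> is_derive q 1 U (U q * (JI al rho (q `^ al^-1) / q)).
  move=> qq; have [qp x1 x2] := hx q qq.
  have qi : 0 <= q^-1 by rewrite invr_ge0 ltW.
  apply: (is_derive_conv (dsum_derive q00 (lin_boundedN (wexp_lin al0)) gb qq)).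
  set x := q^-1 in x1 qi *; set y := q `^ (- al^-1) in x2 *.
  have y0 : 0 <= y by exact: powR_ge0.
  have bp n := fb p 1 x n pA1 ler01 qi x1.
  have br n := fb r 1 y n rA1 ler01 y0 x2.
  have ba n := fb a _ x n aA (ltW ci0) qi x1.
  have ba' n := fb a' _ y n aA' (ltW ci0) y0 x2.
  have bp2 n : `|p n * x ^+ n| <= 1 * 2^-1 ^+ n by apply: le_trans (bp n) _; rewrite !mul1r.
  have br2 n : `|r n * y ^+ n| <= 1 * 2^-1 ^+ n by apply: le_trans (br n) _; rewrite !mul1r.
  have bnp n : `|n%:R * (p n * x ^+ n)| <= 1 * 2^-1 ^+ n.
    rewrite normrM ger0_norm// mul1r; apply: le_trans (natr_quarter_le R n).
    by apply: ler_wpM2l => //; have := bp n; rewrite mul1r.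
  have bnr n : `|n%:R * (r n * y ^+ n)| <= 1 * 2^-1 ^+ n.
    rewrite normrM ger0_norm// mul1r; apply: le_trans (natr_quarter_le R n).
    by apply: ler_wpM2l => //; have := br n; rewrite mul1r.
  (* The recursion read as an identity of series: z F'(z) is F(z) times the series of quotients. *)
  have cauchy (u w : nat -> R) (z : R) :
      (forall n, n%:R * u n = \sum_(j < n.+1) u j * w (n - j)%N) ->
      (forall n, `|u n * z ^+ n| <= 1 * 4^-1 ^+ n) -> (forall n, `|w n * z ^+ n| <= c^-1 * 4^-1 ^+ n) ->
      gsum (fun n => n%:R * (u n * z ^+ n)) = gsum (fun n => u n * z ^+ n) * gsum (fun n => w n * z ^+ n).
    move=> hr hu hw; rewrite -(gsum_eq (gsum_cauchy fourth0 fourth1 hu hw)).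
    apply: eq_gsum => n; rewrite mulrA hr mulr_suml; apply: eq_bigr => i _.
    have -> : z ^+ n = z ^+ i * z ^+ (n - i) by rewrite -exprD subnKC// -ltnS.
    by rewrite mulrACA.
  have e1 := cauchy p a x (fun n => pcoef_rec _ n s1) bp ba.
  have e2 := cauchy r a' y (fun n => pcoef_rec _ n s2) br ba'.
  have js := JI_sym t0 t1 al0 (powR_gt0 al^-1 qp).
  have yi : (q `^ al^-1)^-1 = y by rewrite /y powRN.
  have yp : 0 < y by rewrite powR_gt0.
  have yal : y `^ al = x.
    by rewrite /y -powRrM mulNr mulVf ?gt_eqF// powR_inv1// ltW.
  have bl z : A * z <= 4^-1 -> 0 <= z -> b * z <= 2^-1.
    by move=> hz z0; have : b * z <= A * z by [apply: ler_wpM2r]; lra.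
  have bx : b * y `^ al <= 2^-1 by rewrite yal; exact: bl.
  have eJ := JI_series t0 t1 al0 yp c0 b1 h1 h2 irr bx (bl _ x2 y0).
  rewrite yal -/a -/a' in eJ.
  have -> : JI al rho (q `^ al^-1) = - (gsum (fun n => a n * x ^+ n) + al^-1 * gsum (fun m => a' m * y ^+ m)).
    by move: js; rewrite yi eJ; set Z := JI _ _ _; move: (gsum _) (gsum _) => G H; lra.
  have T n m : wcoef al rho m n * - wexp al m n * q `^ (- wexp al m n - 1) =
      - x * ((n%:R * (p n * x ^+ n)) * (r m * y ^+ m) + al^-1 * ((p n * x ^+ n) * (m%:R * (r m * y ^+ m)))).
    rewrite powR_subr1// pw// -/x -/y /wcoef -/(p n) -/(r m) /wexp.
    by move: (p n) (r m) (x ^+ n) (y ^+ m) => P Q X Y; ring.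
  rewrite (eq_dsum (fun m n => T n m)).
  have g1 : dgeo 1 2^-1 (fun m n => (n%:R * (p n * x ^+ n)) * (r m * y ^+ m)).
    move=> m n; rewrite normrM mulrC mul1r; apply: ler_pM => //; first by have := br2 m; rewrite mul1r.
    by have := bnp n; rewrite mul1r.
  have g2 : dgeo 1 2^-1 (fun m n => (p n * x ^+ n) * (m%:R * (r m * y ^+ m))).
    move=> m n; rewrite normrM mulrC mul1r; apply: ler_pM => //; first by have := bnr m; rewrite mul1r.
    by have := bp2 n; rewrite mul1r.
  have g3 : dgeo al^-1 2^-1 (fun m n => al^-1 * ((p n * x ^+ n) * (m%:R * (r m * y ^+ m)))).
    move=> m n; rewrite normrM (gtr0_norm ai0) -[leRHS]mulrA; apply: ler_wpM2l; first exact: ltW.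
    by have := g2 m n; rewrite mul1r.
  have g4 : dgeo (1 + al^-1) 2^-1 (fun m n => (n%:R * (p n * x ^+ n)) * (r m * y ^+ m) + al^-1 * ((p n * x ^+ n) * (m%:R * (r m * y ^+ m)))).
    move=> m n; apply: le_trans (ler_normD _ _) _; rewrite !mulrDl; apply: lerD; [exact: g1|exact: g3].
  rewrite (dsumZ (- x) half0 half1 g4) (dsumD half0 half1 g1 g3) (dsumZ al^-1 half0 half1 g2).
  rewrite (dsum_prod half0 half1 bnp br2) (dsum_prod half0 half1 bp2 bnr) e1 e2 UE// -/x -/y.
  by move: (gsum _) (gsum _) (gsum _) (gsum _) => G1 G2 G3 G4; rewrite /x; ring.
have kq0 : \forall k \near \oo, q0 < k.+2%:R.
  near=> k; near: k; exists (Num.truncn q0) => // k /= hk.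
  by apply: lt_le_trans (truncnS_gt _) _; rewrite ler_nat ltnS leqW.
have G1 (u : nat -> R) (z : R) : (forall n, `|u n| <= 1 * A ^+ n) -> u 0%N = 1 -> 0 <= z -> A * z <= 4^-1 ->
    `|gsum (fun n => u n * z ^+ n) - 1| <= 2 * A * z.
  move=> hu u0 z0 hz; have bz n := fb u 1 z n hu ler01 z0 hz.
  have -> : gsum (fun n => u n * z ^+ n) = 1 + gsum (fun n => u n.+1 * z ^+ n.+1).
    by rewrite (gsumS fourth0 fourth1 bz) u0 expr0 mulr1.
  rewrite addrAC subrr add0r.
  have hb n : `|u n.+1 * z ^+ n.+1| <= (A * z) * 4^-1 ^+ n.
    rewrite normrM (ger0_norm (exprn_ge0 _ z0)).
    apply: (@le_trans _ _ ((A * z) ^+ n.+1)).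
      by rewrite exprMn; apply: ler_wpM2r; [exact: exprn_ge0|have := hu n.+1; rewrite mul1r].
    have Az : 0 <= A * z by rewrite mulr_ge0// ltW.
    by rewrite exprS; apply: ler_wpM2l => //; rewrite lerXn2r ?nnegrE.
  apply: le_trans (gsum_le fourth0 fourth1 hb) _.
  have Az : 0 <= A * z by rewrite mulr_ge0// ltW.
  have -> : (A * z) / (1 - 4^-1) = 4 / 3 * (A * z) by field.
  by rewrite -mulrA; lra.
have G2 (u : nat -> R) (z : nat -> R) : (forall n, `|u n| <= 1 * A ^+ n) -> u 0%N = 1 ->
    (forall k, 0 <= z k) -> (\forall k \near \oo, A * z k <= 4^-1) -> z @ \oo --> (0 : R) ->
    gsum (fun n => u n * z k ^+ n) @[k --> \oo] --> (1 : R).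
  move=> hu u0 z0 hz zl; apply/subr_cvg0; apply: norm_cvg0.
  have hb : 2 * A * z k @[k --> \oo] --> (0 : R).
    by rewrite -[X in _ --> X](mulr0 (2 * A)); exact: cvgMr.
  apply: (squeeze_cvgr _ (cvg_cst 0) hb); near=> k; rewrite normr_ge0/=; apply: G1 => //.
  by near: k.
have p0 tau om : pcoef tau om 0 = 1 by rewrite /pcoef /sprod big_ord0 expr0 mulr1.
have Ul : (fun n => U n.+2%:R) @ \oo --> (1 : R).
  have hP : gsum (fun n => p n * (k.+2%:R^-1) ^+ n) @[k --> \oo] --> (1 : R).
    apply: (G2 p (fun k => k.+2%:R^-1)) => //; first exact: p0.
      by near=> k; have [] // := hx k.+2%:R; near: k.
    have := @cvg_natinv R 2; rewrite (_ : (fun n => _) = (fun k => (k.+2%:R : R)^-1))//.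
    by apply: funext => k; rewrite addn2.
  have hQ : gsum (fun m => r m * (k.+2%:R `^ (- al^-1)) ^+ m) @[k --> \oo] --> (1 : R).
    apply: (G2 r (fun k => k.+2%:R `^ (- al^-1))) => //; first exact: p0.
      by near=> k; have [] // := hx k.+2%:R; near: k.
    have h := @cvg_natinvr R; have h3 := powR_cvg0 ai0.
    have h4 := @cvg_comp _ _ _ (fun n => (n.+2%:R^-1 : R)) (@powR R ^~ al^-1) _ _ _ h h3.
    apply: cvg_trans h4; apply: near_eq_cvg; near=> k.
    by rewrite /= -(powR_inv1 (ler0n _ _)) -powRrM mulN1r.
  have h : gsum (fun n => p n * (k.+2%:R^-1) ^+ n) * gsum (fun m => r m * (k.+2%:R `^ (- al^-1)) ^+ m) @[k --> \oo] --> (1 * 1 : R).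
    exact: cvgM.
  rewrite mulr1 in h; apply: cvg_trans h; apply: near_eq_cvg; near=> k.
  by rewrite UE//; near: k.
move=> q qq; have [qp _ _] := hx q qq.
have W0' (k : R) : q0 < k -> 0 < W k by move=> h; apply: W0; exact: le_lt_trans h.
have dW' (k : R) : q0 < k -> is_derive k 1 W (W k * (JI al rho (k `^ al^-1) / k)).
  by move=> h; apply: dW; exact: le_lt_trans h.
have l1 : (fun k => U k.+2%:R / W k.+2%:R) @ \oo --> (1 / 1 : R).
  by apply: cvgM => //; apply: cvgV => //; exact: oner_neq0.
have l2 : (fun k => U k.+2%:R / W k.+2%:R) @ \oo --> U q / W q.
  apply: cvg_near_cst; near=> k; apply/esym; apply: (ode_ratio dU dW' W0') => //.
  by near: k.
have := seq_cvg_unique l2 l1; rewrite divr1 => /divr1_eq <-.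
by [].
Unshelve. all: by end_near. Qed.

(** * Inversion of the Laplace transforms *)

Lemma geo_beyond_shift (R : realType) (q0 x : R) (a e : nat -> nat -> R) : 0 <= q0 ->
  geo_beyond q0 a e -> geo_beyond q0 a (fun m n => e m n + x).
Proof.
move=> q00 ha q qq; have qp : 0 < q by exact: le_lt_trans qq.
have [C [r [r0 r1 hr]]] := ha q qq; exists (q `^ x * C), r; split => // m n.
rewrite powRD ?(gt_eqF qp) ?implybT// mulrA mulrC normrM (ger0_norm (powR_ge0 _ _)) -!mulrA.
by apply: ler_wpM2l; [exact: powR_ge0|rewrite !mulrA; exact: hr].
Qed.

Lemma geo_beyond_powR (R : realType) (q0 x : R) (a e : nat -> nat -> R) : 0 <= q0 -> 0 < x ->
  geo_beyond q0 a e -> geo_beyond (q0 `^ x^-1) a (fun m n => x * e m n).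
Proof.
move=> q00 x0 ha q qq; have qp : 0 < q by exact: le_lt_trans (powR_ge0 _ _) qq.
have qx : q0 < q `^ x.
  have : (q0 `^ x^-1) `^ x < q `^ x by apply: gt0_ltr_powR; rewrite ?nnegrE ?powR_ge0// ltW.
  by rewrite -powRrM mulVf ?gt_eqF// powRr1.
have [C [r [r0 r1 hr]]] := ha _ qx; exists C, r; split => // m n.
by rewrite powRrM.
Qed.

Lemma geo_beyond0_powR (R : realType) (x : R) (a e : nat -> nat -> R) :
  geo_beyond 0 a e -> geo_beyond 0 a (fun m n => x * e m n).
Proof.
move=> ha q q0; have [C [r [r0 r1 hr]]] := ha _ (powR_gt0 x q0); exists C, r; split => // m n.
by rewrite powRrM.
Qed.

Lemma geo_beyondN (R : realType) (q0 : R) (a e : nat -> nat -> R) :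
  geo_beyond q0 a e -> geo_beyond q0 (fun m n => - a m n) e.
Proof.
move=> ha q qq; have [C [r [r0 r1 hr]]] := ha q qq; exists C, r; split => // m n.
by rewrite mulNr normrN.
Qed.

Lemma eq_geo_beyond (R : realType) (q0 : R) (a a' e e' : nat -> nat -> R) :
  (forall m n, a m n = a' m n) -> (forall m n, e m n = e' m n) -> geo_beyond q0 a e -> geo_beyond q0 a' e'.
Proof.
move=> ea ee ha q qq; have [C [r [r0 r1 hr]]] := ha q qq; exists C, r; split => // m n.
by rewrite -ea -ee.
Qed.

Lemma dsumN (R : realType) (C r : R) (u : nat -> nat -> R) : 0 <= r -> r < 1 -> dgeo C r u ->
  dsum (fun m n => - u m n) = - dsum u.
Proof.
move=> r0 r1 hu; rewrite -mulN1r -(dsumZ (-1) r0 r1 hu).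
by apply: eq_dsum => m n; rewrite mulN1r.
Qed.

(** The first inversion: negative exponents, geometric coefficients, no weight required. *)
Lemma pw_easy (R : realType) (g : R -> R) (M q0 A d : R) (c sg : nat -> nat -> R) :
  measurable_fun (`]0, +oo[ : set R) g -> (forall u : R, 0 < u -> `|g u| <= M) -> 0 <= q0 ->
  (forall u v : R, 0 < u -> u <= v -> g v <= g u) ->
  1 <= A -> 0 < d -> (forall m n, `|c m n| <= A ^+ (m + n)) -> (forall m n, d * (m + n)%:R <= sg m n) ->
  lin_bounded sg -> geo_beyond q0 c (fun m n => - sg m n - 1) ->
  (forall q, q0 < q -> lapk 0 g q = dsum (fun m n => c m n * q `^ (- sg m n - 1))) ->
  geo_beyond 0 (fun m n => c m n * rGamma (1 + sg m n)) sg /\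
  forall t : R, 0 < t -> g t = dsum (fun m n => c m n * rGamma (1 + sg m n) * t `^ sg m n).
Proof.
move=> mg gM q00 gmono A1 d0 hc hs ls gb hl.
have dom (t : R) : 0 < t -> exists (C r : R) (k0 : nat), [/\ 0 <= r, r < 1 & forall k, (k0 <= k)%N ->
     dgeo C r (fun m n => c m n * ((k.+1%:R / t) `^ (- sg m n) * gauss k (- sg m n)))].
  by move=> t0; exact: easy_dom A1 d0 t0 hc hs ls.
have [h1 h2] := pw_series mg gM q00 gmono (lin_boundedN ls) gb hl dom; split.
  by apply: eq_geo_beyond h1 => m n; rewrite opprK.
by move=> t t0; rewrite (h2 t t0); apply: eq_dsum => m n; rewrite !opprK.
Qed.

(** The second inversion: positive exponents, where the weight 1 / Gamma(1 + be s) left by the first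
    one pays for the growth of the Gauss factors. *)
Lemma pw_hard (R : realType) (g : R -> R) (M q0 A d be : R) (c s : nat -> nat -> R) :
  measurable_fun (`]0, +oo[ : set R) g -> (forall u : R, 0 < u -> `|g u| <= M) -> 0 <= q0 ->
  (forall u v : R, 0 < u -> u <= v -> g v <= g u) -> 1 < be ->
  1 <= A -> 0 < d -> (forall m n, `|c m n| <= A ^+ (m + n)) -> (forall m n, d * (m + n)%:R <= s m n) ->
  lin_bounded s -> geo_beyond q0 (fun m n => c m n * rGamma (1 + be * s m n)) (fun m n => s m n - 1) ->
  (forall q, q0 < q -> lapk 0 g q = dsum (fun m n => c m n * rGamma (1 + be * s m n) * q `^ (s m n - 1))) ->
  geo_beyond 0 (fun m n => c m n * rGamma (1 + be * s m n) * rGamma (1 - s m n)) (fun m n => - s m n) /\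
  forall t : R, 0 < t -> g t = dsum (fun m n => c m n * rGamma (1 + be * s m n) * rGamma (1 - s m n) * t `^ (- s m n)).
Proof.
move=> mg gM q00 gmono be1 A1 d0 hc hs ls gb hl.
apply: (pw_series mg gM q00 gmono ls gb hl) => t t0.
have ti : 0 < t^-1 by rewrite invr_gt0.
have [C hC] := hard_dom be1 A1 d0 ti hc hs.
exists C, 2^-1, 0%N; split => //; first by lra.
move=> k _ m n; apply: le_trans (hC m n).
have s0 : 0 <= s m n by apply: le_trans (hs m n); rewrite mulr_ge0// ltW.
rewrite normrM; apply: ler_wpM2l => //.
rewrite powRM ?invr_ge0 ?(ltW t0)// (mulrC (k.+1%:R `^ _)) -mulrA normrM ger0_norm ?powR_ge0//.
by apply: ler_wpM2l; [exact: powR_ge0|exact: gauss_le].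
Qed.

Lemma normr_bool_le1 (R : realType) (b : bool) : `|b%:R| <= 1 :> R.
Proof. by case: b; rewrite ?normr1 ?normr0. Qed.

Definition supG (d : measure_display) (T : measurableType d) (R : realType)
    (P : probability T R) (X : R -> {RV P >-> R}) (x : R) : R :=
  Ex P (fun w => (running_sup X 1 w - X 0 w <= x)%R%:R).

Lemma supG_joint (d : measure_display) (T : measurableType d) (R : realType)
    (P : probability T R) (X : R -> {RV P >-> R}) : cadlag_paths X ->
  bmeas (fun p : R * T => (running_sup X 1 p.2 - X 0 p.2 <= p.1)%R%:R : R).
Proof.
move=> cX; pose A := [set p : R * T | running_sup X 1 p.2 - X 0 p.2 <= p.1].
have mA : measurable A.
  have -> : A = (fun p : R * T => running_sup X 1 p.2 - X 0 p.2 - p.1) @^-1` `]-oo, 0].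
    by apply/seteqP; split => p; rewrite /A /= in_itv/= subr_le0.
  apply: measurable_preim; last exact: measurable_itv.
  apply: measurable_funB; last exact: measurable_fst.
  exact: (measurableT_comp (measurable_sup_shift cX) measurable_snd).
have E : (fun p : R * T => (running_sup X 1 p.2 - X 0 p.2 <= p.1)%R%:R : R) = \1_A.
  apply: funext => p; rewrite indicE /A; case: leP => h; first by rewrite mem_set.
  by rewrite memNset//=; apply/negP; rewrite -ltNge.
rewrite E; split; first exact: measurable_indic.
by exists 1 => p; rewrite indicE; exact: normr_bool_le1.
Qed.

Lemma supG_bmeas (d : measure_display) (T : measurableType d) (R : realType)
    (P : probability T R) (X : R -> {RV P >-> R}) (x : R) : cadlag_paths X ->
  bmeas (fun w => (running_sup X 1 w - X 0 w <= x)%R%:R : R).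
Proof.
by move=> cX; exact: (bmeas_comp (supG_joint cX) (measurable_pair1 x)).
Qed.

Lemma supG_meas (d : measure_display) (T : measurableType d) (R : realType)
    (P : probability T R) (X : R -> {RV P >-> R}) : cadlag_paths X ->
  measurable_fun setT (supG X).
Proof. by move=> cX; have [] := bmeas_Ex P (supG_joint cX). Qed.

Lemma supG_bound (d : measure_display) (T : measurableType d) (R : realType)
    (P : probability T R) (X : R -> {RV P >-> R}) (x : R) : cadlag_paths X -> `|supG X x| <= 1.
Proof.
move=> cX; apply: Ex_norm_le; first by have [] := supG_bmeas x cX.
by move=> w; exact: normr_bool_le1.
Qed.

Lemma supG_homo (d : measure_display) (T : measurableType d) (R : realType)
    (P : probability T R) (X : R -> {RV P >-> R}) (x y : R) : cadlag_paths X -> x <= y ->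
  supG X x <= supG X y.
Proof.
move=> cX xy; apply: Ex_le; [exact: supG_bmeas|exact: supG_bmeas|move=> w].
rewrite ler_nat; case: (leP (running_sup X 1 w - X 0 w) x) => // h.
by rewrite (le_trans h xy).
Qed.

Lemma sup_cdfE (d : measure_display) (T : measurableType d) (R : realType)
    (P : probability T R) (X : R -> {RV P >-> R}) (x : R) : Levy_process P X ->
  sup_cdf P X x = supG X x.
Proof.
move=> [P0 _ _ cX]; pose A := [set w | running_sup X 1 w <= x].
have mA : measurable A.
  have -> : A = running_sup X 1 @^-1` `]-oo, x] by apply/seteqP; split => w; rewrite /A /= in_itv.
  by apply: measurable_preim; [exact: measurable_running_sup|exact: measurable_itv].
rewrite /sup_cdf -/A -Ex_indic//.
apply: (Ex_ae (measurable_start X) P0).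
- split; first exact: measurable_indic.
  by exists 1 => w; rewrite indicE; exact: normr_bool_le1.
- exact: supG_bmeas.
- move=> w /= ->; rewrite subr0 indicE /A; case: leP => h; first by rewrite mem_set.
  by rewrite memNset//=; apply/negP; rewrite -ltNge.
Qed.

Lemma lapk_supG (d : measure_display) (T : measurableType d) (R : realType)
    (P : probability T R) (X : R -> {RV P >-> R}) (q : R) : cadlag_paths X -> 0 < q ->
  lapk 0 (supG X) q = q^-1 * supf X q.
Proof.
move=> cX q0; have [mj _] := supG_joint cX.
have mF : measurable_fun setT (fun p : T * R => expR (- (q * p.2)) * (running_sup X 1 p.1 - X 0 p.1 <= p.2)%R%:R).
  apply: measurable_funM; first by meas.
  have ms : measurable_fun setT (fun p : T * R => (p.2, p.1)) by apply: measurable_fun_pair; [exact: measurable_snd|exact: measurable_fst].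
  exact: (measurableT_comp mj ms).
have bF w (x : R) : 0 < x -> `|expR (- (q * x)) * (running_sup X 1 w - X 0 w <= x)%R%:R| <= expR (- (q * x)).
  move=> x0; rewrite normrM ger0_norm ?expR_ge0//; apply: ler_piMr; first exact: expR_ge0.
  exact: normr_bool_le1.
have [_ E] := @prob_fubini _ T R P (fun w x => expR (- (q * x)) * (running_sup X 1 w - X 0 w <= x)%R%:R) _ mF
  (exp0_integrable q0) bF.
have be : bmeas (fun w => expR (- (q * (running_sup X 1 w - X 0 w)))).
  split; last by exists 1 => w; apply: exp_neg_norm; [exact: ltW|exact: sup_shift_ge0].
  apply: measurable_funexpR; apply: measurable_funN; apply: measurable_funM; first exact: measurable_cst.
  exact: measurable_sup_shift.
rewrite /supf -(ExZ P q^-1 be); apply: etrans (etrans (esym E) _).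
  apply: eq_pint => x x0; rewrite expr0 mul1r -/(Ex P _) /supG ExZ//; exact: supG_bmeas.
by apply: eq_Ex => w; rewrite pint_exp_tail//; exact: sup_shift_ge0.
Qed.

Lemma wcoef_le (R : realType) (al rho c b : R) : 0 < c -> 1 <= b ->
  (forall n, (0 < n)%N -> c / b ^+ n <= `|sin (n%:R * (pi * al))|) ->
  (forall n, (0 < n)%N -> c / b ^+ n <= `|sin (n%:R * (pi / al))|) ->
  forall m n, `|wcoef al rho m n| <= (b * (1 + c^-1)) ^+ (m + n).
Proof.
move=> c0 b1 h1 h2 m n; rewrite /wcoef normrM mulrC exprD; apply: ler_pM => //.
  exact: pcoef_le.
exact: pcoef_le.
Qed.

Lemma wexp_ge (R : realType) (al : R) : 0 < al -> exists2 d : R, 0 < d & forall m n, d * (m + n)%:R <= wexp al m n.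
Proof.
move=> al0; exists (Num.min 1 al^-1); first by rewrite lt_min ltr01 invr_gt0.
move=> m n; rewrite /wexp natrD mulrDr addrC; apply: lerD.
  by rewrite -[leRHS]mul1r; apply: ler_wpM2r => //; rewrite ge_min lexx.
by rewrite [leRHS]mulrC; apply: ler_wpM2r => //; rewrite ge_min lexx orbT.
Qed.

Lemma dsum_density (R : realType) (F : R -> R) (K e : nat -> nat -> R) :
  lin_bounded e -> geo_beyond 0 K e ->
  (forall x : R, 0 < x -> F x = dsum (fun m n => K m n * x `^ e m n)) ->
  forall x : R, 0 < x -> is_derive x 1 F (dsum (fun m n => K m n * e m n * x `^ (e m n - 1))).
Proof.
move=> le gb hF x x0.
apply: (near_eq_is_derive _ (dsum_derive (lexx 0) le gb x0)).
by near=> y; rewrite hF//; near: y; exact: lt_nbhsr.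
Unshelve. all: by end_near. Qed.

Lemma lapkN (R : realType) (g : R -> R) (M q : R) :
  measurable_fun (`]0, +oo[ : set R) g -> (forall u : R, 0 < u -> `|g u| <= M) -> 0 < q ->
  lapk 0 (fun u => - g u) q = - lapk 0 g q.
Proof.
move=> mg gM q0; rewrite /lapk -(pintN (lapk_integrable 0 mg gM q0)).
by apply: eq_pint => u _; rewrite mulrN.
Qed.

(** Inverting in time turns q^(- wexp) into t^wexp / Gamma(1 + wexp), a series for [supf] at every
    argument. The exponents of its Laplace variable are s = al wexp, so the weight has be = 1/al > 1
    for the inversion in space. *)
Lemma sup_series_lt1 (d : measure_display) (T : measurableType d) (R : realType)
    (P : probability T R) (X : R -> {RV P >-> R}) (al rho A q0 : R) :
  cadlag_paths X -> 0 < al -> al < 1 -> 1 <= A -> (forall m n, `|wcoef al rho m n| <= A ^+ (m + n)) ->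
  0 <= q0 -> geo_beyond q0 (wcoef al rho) (fun m n => - wexp al m n) ->
  (forall q, q0 < q -> sup_lap X al q = dsum (fun m n => wcoef al rho m n * q `^ (- wexp al m n))) ->
  geo_beyond 0 (fun m n => wcoef al rho m n * rGamma (1 + wexp al m n) * rGamma (1 - al * wexp al m n))
    (fun m n => - (al * wexp al m n)) /\
  forall x : R, 0 < x -> supG X x =
    dsum (fun m n => wcoef al rho m n * rGamma (1 + wexp al m n) * rGamma (1 - al * wexp al m n) * x `^ (- (al * wexp al m n))).
Proof.
move=> cX al0 al1 A1 hA q00 gb hW.
have ai0 : 0 < al^-1 by rewrite invr_gt0.
have [mv _] := supf_bmeas al^-1 cX.
have mv' : measurable_fun (`]0, +oo[ : set R) (fun t : R => supf X (t `^ al^-1)) by exact: measurable_funTS.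
have bv (t : R) : 0 < t -> `|supf X (t `^ al^-1)| <= 1 by move=> _; exact: (supf_bound cX (powR_ge0 _ _)).2.
have be (k : R) : 0 <= k -> bmeas (fun w => expR (- (k * (running_sup X 1 w - X 0 w)))).
  move=> k0; split; last by exists 1 => w; apply: exp_neg_norm => //; exact: sup_shift_ge0.
  apply: measurable_funexpR; apply: measurable_funN; apply: measurable_funM; first exact: measurable_cst.
  exact: measurable_sup_shift.
have vmono (u v : R) : 0 < u -> u <= v -> supf X (v `^ al^-1) <= supf X (u `^ al^-1).
  move=> u0 uv; apply: Ex_le; [exact: be (powR_ge0 _ _)|exact: be (powR_ge0 _ _)|move=> w].
  rewrite ler_expR lerN2; apply: ler_wpM2r; first exact: sup_shift_ge0.
  by apply: ge0_ler_powR; rewrite ?nnegrE ?(ltW ai0) ?(ltW u0)// (le_trans (ltW u0)).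
have [dd dd0 hd] := wexp_ge al0.
have hl q : q0 < q -> lapk 0 (fun t => supf X (t `^ al^-1)) q = dsum (fun m n => wcoef al rho m n * q `^ (- wexp al m n - 1)).
  move=> qq; have qp : 0 < q by exact: le_lt_trans qq.
  have qn : q != 0 by rewrite gt_eqF.
  have [C [r [r0 r1 hr]]] := gb q qq.
  have -> : lapk 0 (fun t => supf X (t `^ al^-1)) q = q^-1 * sup_lap X al q by rewrite /sup_lap mulKf.
  rewrite (hW q qq) -(dsumZ q^-1 r0 r1 hr); apply: eq_dsum => m n.
  by rewrite powR_subr1// mulrCA (mulrC q^-1).
have [g1 e1] := pw_easy mv' bv q00 vmono A1 dd0 hA hd (wexp_lin al0) (geo_beyond_shift (-1) q00 gb) hl.
have g2 := geo_beyond0_powR al g1.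
have f1 (la : R) : 0 < la -> supf X la = dsum (fun m n => wcoef al rho m n * rGamma (1 + wexp al m n) * la `^ (al * wexp al m n)).
  move=> la0; have := e1 (la `^ al) (powR_gt0 al la0).
  have -> : (la `^ al) `^ al^-1 = la by rewrite -powRrM mulfV ?gt_eqF// powRr1// ltW.
  move=> ->.
  by apply: eq_dsum => m n; rewrite powRrM.
pose s m n := al * wexp al m n.
have ls : lin_bounded s.
  have [K K0 hK] := wexp_lin al0; exists (al * K); first by rewrite mulr_ge0// ltW.
  by move=> m n; rewrite /s normrM gtr0_norm// -mulrA; apply: ler_wpM2l; [exact: ltW|exact: hK].
have sw m n : al^-1 * s m n = wexp al m n by rewrite /s mulKf// gt_eqF.
have g3 : geo_beyond 0 (fun m n => - wcoef al rho m n * rGamma (1 + al^-1 * s m n)) (fun m n => s m n - 1).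
  apply: (geo_beyond_shift (-1) (lexx 0)).
  apply: eq_geo_beyond (geo_beyondN g2) => // m n.
  by rewrite sw mulNr.
have mG : measurable_fun (`]0, +oo[ : set R) (supG X) by apply: measurable_funTS; exact: supG_meas.
have bG (u : R) : 0 < u -> `|supG X u| <= 1 by move=> _; exact: supG_bound.
(* The Post-Widder lemmas require nonincreasing functions, and a distribution function increases;
   hence the sign. *)
have mNG : measurable_fun (`]0, +oo[ : set R) (fun u => - supG X u) by exact: measurable_funN.
have bNG (u : R) : 0 < u -> `|- supG X u| <= 1 by move=> _; rewrite normrN; exact: supG_bound.
have Gmono (u v : R) : 0 < u -> u <= v -> - supG X v <= - supG X u.
  by move=> _ uv; rewrite lerN2; exact: supG_homo.
have hlN q : 0 < q -> lapk 0 (fun u => - supG X u) q = dsum (fun m n => - wcoef al rho m n * rGamma (1 + al^-1 * s m n) * q `^ (s m n - 1)).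
  move=> qp; rewrite (lapkN mG bG qp) (lapk_supG cX qp) (f1 q qp).
  have [C [r [r0 r1 hr]]] := g2 q qp.
  rewrite -mulNr -(dsumZ (- q^-1) r0 r1 hr); apply: eq_dsum => m n.
  rewrite sw powR_subr1//.
  by move: (wcoef _ _ _ _) (rGamma _) (powR _ _) => a b c; ring.
have hd2 m n : al * dd * (m + n)%:R <= s m n by rewrite -mulrA; apply: ler_wpM2l; [exact: ltW|exact: hd].
have hAN m n : `|- wcoef al rho m n| <= A ^+ (m + n) by rewrite normrN.
have al1' : 1 < al^-1 by rewrite invf_gt1.
have [g4 e4] := pw_hard mNG bNG (lexx 0) Gmono al1' A1 (mulr_gt0 al0 dd0) hAN hd2 ls g3 hlN.
split.
  apply: eq_geo_beyond (geo_beyondN g4) => // m n.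
  by rewrite sw !mulNr opprK.
move=> x x0; rewrite -[LHS]opprK (e4 x x0).
have [C [r [r0 r1 hr]]] := g4 x x0.
rewrite -(dsumN r0 r1 hr); apply: eq_dsum => m n.
by rewrite sw !mulNr opprK.
Qed.

(* The distribution function of the supremum up to an independent exponential time. *)
Definition supE (d : measure_display) (T : measurableType d) (R : realType)
    (P : probability T R) (X : R -> {RV P >-> R}) (al x : R) : R :=
  pint (fun t => expR (- (1 * t)) * supG X (x * t `^ (- al^-1))).

Lemma supE_integrable (d : measure_display) (T : measurableType d) (R : realType)
    (P : probability T R) (X : R -> {RV P >-> R}) (al x : R) : cadlag_paths X ->
  pintegrable (fun t => expR (- (1 * t)) * supG X (x * t `^ (- al^-1))).
Proof.
move=> cX; apply: (pintegrable_dom _ _ (exp0_integrable ltr01)).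
  apply: measurable_funTS; apply: measurable_funM; first by meas.
  apply: (measurableT_comp (supG_meas cX)); apply: measurable_funM; first exact: measurable_cst.
  by meas.
move=> t t0; rewrite normrM ger0_norm ?expR_ge0//; apply: ler_piMr; first exact: expR_ge0.
exact: supG_bound.
Qed.

Lemma supE_joint (d : measure_display) (T : measurableType d) (R : realType)
    (P : probability T R) (X : R -> {RV P >-> R}) (al k : R) : cadlag_paths X ->
  measurable_fun setT (fun p : R * R => expR (- (k * p.1)) * (expR (- (1 * p.2)) * supG X (p.1 * p.2 `^ (- al^-1)))).
Proof.
move=> cX; apply: measurable_funM; first by meas.
apply: measurable_funM; first by meas.
by apply: (measurableT_comp (supG_meas cX)); meas.
Qed.

Lemma supE_joint_le (d : measure_display) (T : measurableType d) (R : realType)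
    (P : probability T R) (X : R -> {RV P >-> R}) (al k x t : R) : cadlag_paths X ->
  `|expR (- (k * x)) * (expR (- (1 * t)) * supG X (x * t `^ (- al^-1)))| <= expR (- (k * x)) * expR (- (1 * t)).
Proof.
move=> cX; rewrite normrM (ger0_norm (expR_ge0 _)); apply: ler_wpM2l; first exact: expR_ge0.
rewrite normrM (ger0_norm (expR_ge0 _)); apply: ler_piMr; first exact: expR_ge0.
exact: supG_bound.
Qed.

Lemma supE_fubini (d : measure_display) (T : measurableType d) (R : realType)
    (P : probability T R) (X : R -> {RV P >-> R}) (al q : R) : cadlag_paths X -> 0 < q ->
  pintegrable (fun x => expR (- (q * x)) * supE X al x) /\
  pint (fun x => expR (- (q * x)) * supE X al x) =
  pint (fun t => pint (fun x => expR (- (q * x)) * (expR (- (1 * t)) * supG X (x * t `^ (- al^-1))))).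
Proof.
move=> cX q0.
have [i1 e1] := @pint_fubini R (fun x t => expR (- (q * x)) * (expR (- (1 * t)) * supG X (x * t `^ (- al^-1))))
  (fun x => expR (- (q * x))) (fun t => expR (- (1 * t))) (supE_joint al q cX)
  (exp0_integrable q0) (exp0_integrable ltr01) (fun x t _ _ => supE_joint_le al q x t cX).
have E (x : R) : 0 < x -> pint (fun t => expR (- (q * x)) * (expR (- (1 * t)) * supG X (x * t `^ (- al^-1)))) =
    expR (- (q * x)) * supE X al x.
  by move=> _; rewrite (pintZ _ (supE_integrable al x cX)).
split; first exact: (eq_pintegrable E i1).
exact: (etrans (esym (eq_pint E)) e1).
Qed.

Lemma supE_meas (d : measure_display) (T : measurableType d) (R : realType)
    (P : probability T R) (X : R -> {RV P >-> R}) (al : R) : cadlag_paths X ->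
  measurable_fun (`]0, +oo[ : set R) (supE X al).
Proof.
move=> cX; have [i1 _] := supE_fubini al cX ltr01.
apply: (eq_measurable_fun (fun x => expR x * (expR (- (1 * x)) * supE X al x))).
  by move=> x _; rewrite mulrA -expRD mul1r subrr expR0 mul1r.
apply: measurable_funM; last exact: (pintegrable_meas i1).
by apply: measurable_funTS; exact: measurable_expR.
Qed.

Lemma supE_bound (d : measure_display) (T : measurableType d) (R : realType)
    (P : probability T R) (X : R -> {RV P >-> R}) (al x : R) : cadlag_paths X -> `|supE X al x| <= 1.
Proof.
move=> cX; rewrite -[leRHS]invr1 -(pint_exp ltr01).
apply: le_norm_pint; [exact: supE_integrable|exact: exp0_integrable|move=> t t0].
rewrite normrM ger0_norm ?expR_ge0//; apply: ler_piMr; first exact: expR_ge0.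
exact: supG_bound.
Qed.

(** After Fubini, scaling x at fixed t reduces the inner integral to [lapk_supG] at la t^(1/al); the
    average over t is then [sup_lapE]. *)
Lemma lapk_supE (d : measure_display) (T : measurableType d) (R : realType)
    (P : probability T R) (X : R -> {RV P >-> R}) (al la : R) : cadlag_paths X -> 0 < al -> 0 < la ->
  lapk 0 (supE X al) la = la^-1 * sup_lap X al (la `^ (- al)).
Proof.
move=> cX al0 la0; have ln : la != 0 by rewrite gt_eqF.
have [_ e1] := supE_fubini al cX la0.
apply: etrans (etrans e1 _); first by apply: eq_pint => x _; rewrite expr0 mul1r.
have [i2 <-] := sup_lapE al cX (powR_gt0 (- al) la0).
rewrite -(pintZ _ i2); apply: eq_pint => t t0.
have c0 : 0 < t `^ (- al^-1) by rewrite powR_gt0.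
have cn : t `^ (- al^-1) != 0 by rewrite gt_eqF.
have k0 : 0 < la * t `^ al^-1 by rewrite mulr_gt0// powR_gt0.
have tt' : t `^ al^-1 * t `^ (- al^-1) = 1 by rewrite -powRD ?(gt_eqF t0) ?implybT// subrr powRr0.
have E (x : R) : 0 < x -> expR (- (la * x)) * (expR (- (1 * t)) * supG X (x * t `^ (- al^-1))) =
    expR (- (1 * t)) * (expR (- (la * t `^ al^-1 * (t `^ (- al^-1) * x))) * supG X (t `^ (- al^-1) * x)).
  move=> x0; rewrite mulrCA; congr (_ * (expR (- _) * _)); last by rewrite mulrC.
  by rewrite mulrA -[in RHS](mulrA la) tt' mulr1.
rewrite (eq_pint E).
have mh : measurable_fun setT (fun y : R => expR (- (la * t `^ al^-1 * y)) * supG X y).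
  by apply: measurable_funM; [meas|exact: supG_meas].
have ih : pintegrable (fun y : R => expR (- (la * t `^ al^-1 * y)) * supG X y).
  apply: (pintegrable_dom _ _ (exp0_integrable k0)); first exact: measurable_funTS.
  move=> y _; rewrite normrM ger0_norm ?expR_ge0//; apply: ler_piMr; [exact: expR_ge0|exact: supG_bound].
have [i3 e3] := pint_scale c0 mh ih.
rewrite (pintZ _ i3) e3.
have -> : pint (fun y : R => expR (- (la * t `^ al^-1 * y)) * supG X y) = (la * t `^ al^-1)^-1 * supf X (la * t `^ al^-1).
  by rewrite -(lapk_supG cX k0); apply: eq_pint => y _; rewrite expr0 mul1r.
have -> : (la `^ (- al))^-1 `^ al^-1 = la.
  by rewrite powRN invrK -powRrM mulfV ?gt_eqF// powRr1// ltW.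
have tn : t `^ al^-1 != 0 by rewrite gt_eqF// powR_gt0.
have -> : t `^ (- al^-1) = (t `^ al^-1)^-1 by rewrite powRN.
move: tn; move: (supf X (la * t `^ al^-1)) (expR (- (1 * t))) (t `^ al^-1) => S e y yn.
by field; rewrite ln yn.
Qed.

Lemma sup_series_gt1 (d : measure_display) (T : measurableType d) (R : realType)
    (P : probability T R) (X : R -> {RV P >-> R}) (al rho A q0 : R) :
  cadlag_paths X -> 1 < al -> 0 <= rho -> 1 <= A -> (forall m n, `|wcoef al rho m n| <= A ^+ (m + n)) ->
  (forall q : R, 0 < q -> sup_lap X al q = q `^ rho * sup_lap X al q^-1) ->
  0 <= q0 -> geo_beyond q0 (wcoef al rho) (fun m n => - wexp al m n) ->
  (forall q, q0 < q -> sup_lap X al q = dsum (fun m n => wcoef al rho m n * q `^ (- wexp al m n))) ->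
  geo_beyond 0 (fun m n => wcoef al rho m n * rGamma (1 + al * (rho + wexp al m n)) * rGamma (1 - (rho + wexp al m n)))
    (fun m n => al * (rho + wexp al m n)) /\
  forall x : R, 0 < x -> supG X x =
    dsum (fun m n => wcoef al rho m n * rGamma (1 + al * (rho + wexp al m n)) * rGamma (1 - (rho + wexp al m n)) *
       x `^ (al * (rho + wexp al m n))).
Proof.
move=> cX al1 rho0 A1 hA Wsym q00 gb hW.
have al0 : 0 < al by exact: lt_trans al1.
have ai0 : 0 < al^-1 by rewrite invr_gt0.
have [dd dd0 hd] := wexp_ge al0.
pose s m n := rho + wexp al m n; pose sg m n := al * s m n.
have ls : lin_bounded s.
  have [K K0 hK] := wexp_lin al0; exists (rho + K); first by rewrite addr_ge0.
  move=> m n; apply: le_trans (ler_normD _ _) _; rewrite mulrDl; apply: lerD => //.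
  by rewrite ger0_norm// ler_peMr// -natrM ler1n muln_gt0.
have lsg : lin_bounded sg.
  have [K K0 hK] := ls; exists (al * K); first by rewrite mulr_ge0// ltW.
  by move=> m n; rewrite /sg normrM gtr0_norm// -mulrA; apply: ler_wpM2l; [exact: ltW|exact: hK].
have hds m n : dd * (m + n)%:R <= s m n by apply: le_trans (hd m n) _; rewrite lerDr.
have hdsg m n : al * dd * (m + n)%:R <= sg m n by rewrite -mulrA; apply: ler_wpM2l; [exact: ltW|exact: hds].
have hAN m n : `|- wcoef al rho m n| <= A ^+ (m + n) by rewrite normrN.
pose q1 := q0 `^ al^-1.
have q10 : 0 <= q1 by exact: powR_ge0.
have g1 : geo_beyond q1 (fun m n => - wcoef al rho m n) (fun m n => - sg m n - 1).
  have h := geo_beyond_shift (- (al * rho) - 1) q10 (geo_beyondN (geo_beyond_powR q00 al0 gb)).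
  by apply: eq_geo_beyond h => // m n; rewrite /sg /s; ring.
have mE := supE_meas al cX.
have bE (u : R) : 0 < u -> `|supE X al u| <= 1 by move=> _; exact: supE_bound.
have mNE : measurable_fun (`]0, +oo[ : set R) (fun u => - supE X al u) by exact: measurable_funN.
have bNE (u : R) : 0 < u -> `|- supE X al u| <= 1 by move=> _; rewrite normrN; exact: supE_bound.
have Emono (u v : R) : 0 < u -> u <= v -> - supE X al v <= - supE X al u.
  move=> _ uv; rewrite lerN2; apply: le_pint; [exact: supE_integrable|exact: supE_integrable|move=> t t0].
  apply: ler_wpM2l; first exact: expR_ge0.
  by apply: supG_homo => //; apply: ler_wpM2r => //; exact: powR_ge0.
have hlE la : q1 < la -> lapk 0 (fun u => - supE X al u) la = dsum (fun m n => - wcoef al rho m n * la `^ (- sg m n - 1)).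
  move=> ql; have l0 : 0 < la by exact: le_lt_trans ql.
  have lq : q0 < la `^ al.
    have : (q0 `^ al^-1) `^ al < la `^ al by apply: gt0_ltr_powR; rewrite ?nnegrE ?powR_ge0// ltW.
    by rewrite -powRrM mulVf ?gt_eqF// powRr1.
  rewrite (lapkN mE bE l0) (lapk_supE cX al0 l0) (Wsym _ (powR_gt0 _ l0)).
  have -> : (la `^ (- al))^-1 = la `^ al by rewrite powRN invrK.
  rewrite (hW _ lq).
  have [C [r [r0 r1 hr]]] := gb _ lq.
  rewrite mulrA -mulNr -(dsumZ _ r0 r1 hr); apply: eq_dsum => m n.
  have -> : la `^ (- sg m n - 1) = la^-1 * ((la `^ (- al)) `^ rho * (la `^ al) `^ (- wexp al m n)).
    rewrite powR_subr1// -!powRrM -powRD ?(gt_eqF l0) ?implybT// mulrC; congr (_ * _ `^ _).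
    by rewrite /sg /s; ring.
  by move: (wcoef _ _ _ _) (powR _ _) (powR _ _) => a b c; ring.
have [g2 e2] := pw_easy mNE bNE q10 Emono A1 (mulr_gt0 al0 dd0) hAN hdsg lsg g1 hlE.
pose G (u : R) := supG X (u `^ (- al^-1)).
have mG : measurable_fun setT G by apply: (measurableT_comp (supG_meas cX)); meas.
have mG' : measurable_fun (`]0, +oo[ : set R) G by exact: measurable_funTS.
have bG (u : R) : 0 < u -> `|G u| <= 1 by move=> _; exact: supG_bound.
have Gmono (u v : R) : 0 < u -> u <= v -> G v <= G u.
  move=> u0 uv; apply: supG_homo => //; have v0 : 0 < v by exact: lt_le_trans uv.
  rewrite !powRN lef_pV2 ?posrE ?powR_gt0//.
  by apply: ge0_ler_powR; rewrite ?nnegrE//; exact: ltW.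
have hlG q : 0 < q -> lapk 0 G q = q^-1 * supE X al (q `^ al^-1).
  move=> qp.
  have mh : measurable_fun setT (fun t : R => expR (- (1 * t)) * supG X (q `^ al^-1 * t `^ (- al^-1))).
    apply: measurable_funM; first by meas.
    apply: (measurableT_comp (supG_meas cX)); apply: measurable_funM; first exact: measurable_cst.
    by meas.
  have [_ <-] := pint_scale qp mh (supE_integrable al _ cX).
  apply: eq_pint => u u0; rewrite expr0 !mul1r /G; congr (_ * supG X _).
  by rewrite powRM ?(ltW qp) ?(ltW u0)// mulrA -powRD ?(gt_eqF qp) ?implybT// subrr powRr0 mul1r.
have sgs m n : al * s m n = sg m n by [].
have g3 : geo_beyond 0 (fun m n => wcoef al rho m n * rGamma (1 + al * s m n)) (fun m n => s m n - 1).
  have h := geo_beyond0_powR al^-1 (geo_beyondN g2).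
  apply: eq_geo_beyond (geo_beyond_shift (-1) (lexx 0) h) => m n.
    by rewrite mulNr opprK.
  by rewrite /sg mulKf// gt_eqF.
have hl3 q : 0 < q -> lapk 0 G q = dsum (fun m n => wcoef al rho m n * rGamma (1 + al * s m n) * q `^ (s m n - 1)).
  move=> qp; have qa : 0 < q `^ al^-1 by rewrite powR_gt0.
  have [C [r [r0 r1 hr]]] := g2 _ qa.
  rewrite (hlG q qp) -[supE _ _ _]opprK (e2 _ qa) mulrN -mulNr -(dsumZ _ r0 r1 hr); apply: eq_dsum => m n.
  rewrite powR_subr1// -powRrM (_ : al^-1 * sg m n = s m n); last by rewrite /sg mulKf// gt_eqF.
  rewrite /sg; move: (wcoef _ _ _ _) (rGamma _) (powR _ _) => a b c; ring.
have [g4 e4] := pw_hard mG' bG (lexx 0) Gmono al1 A1 dd0 hA hds ls g3 hl3.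
split.
  by apply: eq_geo_beyond (geo_beyond0_powR (- al) g4) => m n //; rewrite mulrNN.
move=> x x0; have xa : 0 < x `^ (- al) by rewrite powR_gt0.
have -> : supG X x = G (x `^ (- al)).
  by rewrite /G -powRrM mulrNN mulfV ?gt_eqF// powRr1// ltW.
rewrite (e4 _ xa); apply: eq_dsum => m n.
by rewrite -powRrM mulrNN.
Qed.

(** The claim is |al (1/2 - rho)| < 1/2. For al < 1 it is immediate; for al > 1 admissibility says
    that al rho lies between al - 1 and 1, so the quantity is at most 1 - al/2. *)
Lemma admissible_theta (R : realType) (al rho : R) : admissible al rho -> al != 1 ->
  [/\ 0 < al, 0 < rho, - (pi / 2) < theta al rho & theta al rho < pi / 2].
Proof.
move=> h an1.
have [a0 r0 h1 h2] : [/\ 0 < al, 0 < rho, al * (2^-1 - rho) < 2^-1 & - 2^-1 < al * (2^-1 - rho)].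
  case: h => [[/andP[a0 a1] /andP[r0 r1]]|[a1 _]|[/andP[a1 a2] /andP[r1 r2]]].
  - by split => //; nra.
  - by rewrite a1 eqxx in an1.
  - have a0 : 0 < al by lra.
    have e1 : al * al^-1 = 1 by rewrite mulfV// gt_eqF.
    have q1 : al^-1 < 1 by rewrite invf_lt1.
    have i1 : al * (1 - al^-1) <= al * rho by rewrite ler_pM2l.
    have i2 : al * rho <= al * al^-1 by rewrite ler_pM2l.
    by split => //; [lra|nra|nra].
have p0 : 0 < pi :> R by exact: pi_gt0.
have e : theta al rho = pi * (al * (2^-1 - rho)) by rewrite /theta mulrA.
split => //; rewrite e; [rewrite -mulrN|]; by rewrite ltr_pM2l.
Qed.

Lemma sprod_range (R : realType) (tau om : R) (n : nat) :
  sprod tau om n = \prod_(1 <= j < n.+1) (sin (tau + j.-1%:R * om) / sin (j%:R * om)).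
Proof. by rewrite /sprod big_add1 big_mkord. Qed.

Lemma wcoef_sin_prod (R : realType) (al rho : R) (m n : nat) : al != 0 ->
  wcoef al rho m n = (-1) ^+ (m + n) * sin_prod al rho m n.
Proof.
move=> a0; rewrite /wcoef /pcoef /sin_prod exprD.
have -> : \prod_(1 <= j < m.+1) (sin (pi / al * (al * rho + j%:R - 1)) / sin (pi * j%:R / al)) =
    sprod (pi * rho) (pi / al) m.
  rewrite sprod_range; apply: eq_big_nat => j /andP[j0 _].
  have -> : j%:R = j.-1%:R + 1 :> R by rewrite natr1 prednK.
  by congr (sin _ / sin _); generalize (pi : R) => p; field.
have -> : \prod_(1 <= j < n.+1) (sin (pi * al * (rho + j%:R - 1)) / sin (pi * al * j%:R)) =
    sprod (pi * al * rho) (pi * al) n.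
  rewrite sprod_range; apply: eq_big_nat => j /andP[j0 _].
  have -> : j%:R = j.-1%:R + 1 :> R by rewrite natr1 prednK.
  by congr (sin _ / sin _); ring.
by move: (sprod _ _ n) (sprod _ _ m) => a b; ring.
Qed.

Lemma dsumS (R : realType) (C r : R) (u : nat -> nat -> R) : 0 <= r -> r < 1 -> dgeo C r u ->
  (forall m, u m 0%N = 0) -> dsum u = dsum (fun m n => u m n.+1).
Proof.
move=> r0 r1 hu u0; rewrite /dsum (gsumS r0 r1 (dgeo_gsum r0 r1 hu)).
rewrite (_ : gsum (fun m => u m 0%N) = 0) ?add0r//.
apply: gsum_eq; rewrite (_ : series _ = fun=> 0); first exact: cvg_cst.
by apply: funext => N; rewrite /series/= big1.
Qed.

Lemma nonLiouville_irr (R : realType) (al : R) : ~ (@setL R `|` @rational R) al ->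
  al != 1 /\ forall m n : nat, (0 < n)%N -> al * n%:R != m%:R.
Proof.
move=> h; have [c c0 hc] := nonLiouville_lb h.
have irr m n : (0 < n)%N -> al * n%:R != m%:R.
  move=> n0; rewrite -subr_eq0 -normr_gt0; apply: lt_le_trans (hc m n n0).
  by rewrite mulr_gt0// exprn_gt0// invr_gt0.
split => //; have := irr 1%N 1%N isT; by rewrite mulr1.
Qed.

Lemma iterated_scale (R : realType) (C r k : R) (u B : nat -> nat -> R) : 0 <= r -> r < 1 ->
  dgeo C r u -> 0 < k -> (forall m n, u m n = k * B m n) ->
  exists s : R, iterated_sum B s /\ dsum u = k * s.
Proof.
move=> r0 r1 hu k0 uB; have kn : k != 0 by rewrite gt_eqF.
have hB : dgeo (k^-1 * C) r B.
  move=> m n; have -> : B m n = k^-1 * u m n by rewrite uB mulKf.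
  rewrite normrM gtr0_norm ?invr_gt0// -!mulrA; apply: ler_wpM2l; first by rewrite invr_ge0 ltW.
  by rewrite mulrA; exact: hu.
exists (dsum B); split; first exact: dsum_iterated r0 r1 hB.
by rewrite -(dsumZ k r0 r1 hB); apply: eq_dsum => m n; rewrite uB.
Qed.

Theorem theorem2 (d : measure_display) (T : measurableType d) (R : realType)
    (P : probability T R) (X : R -> {RV P >-> R}) (alpha rho : R)
    (hadm : admissible alpha rho)
    (hX : stable_process P X alpha rho)
    (halpha : ~ (@setL R `|` @rational R) alpha) :
  forall x : R, 0 < x ->
    derivable (sup_cdf P X) x 1 /\
    (0 < alpha < 1 ->
       exists s : R,
         iterated_sum (fun m n => coef_b alpha rho m n.+1 *
                                  x `^ (- m%:R - alpha * n%:R)) s /\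
         sup_density P X x = x `^ (- 1 - alpha) * s) /\
    (1 < alpha < 2 ->
       exists s : R,
         iterated_sum (fun m n => coef_a alpha rho m n *
                                  x `^ (m%:R + alpha * n%:R)) s /\
         sup_density P X x = x `^ (alpha * rho - 1) * s).
Proof.
move=> x x0; have [an1 irr] := nonLiouville_irr halpha.
have [al0 r0 t0 t1] := admissible_theta hadm an1.
have [hL _ _ _] := hX; have [_ _ _ cX] := hL.
have [c [b [c0 b1 h1 h2]]] := sin_alpha_lb al0 halpha.
have an0 : alpha != 0 by rewrite gt_eqF.
have A1 : 1 <= b * (1 + c^-1).
  by apply: mulr_ege1 => //; rewrite lerDl invr_ge0 ltW.
have hA := @wcoef_le R alpha rho c b c0 b1 h1 h2.
have [q0 [q00 gb hW]] := wseries t0 t1 al0 c0 b1 h1 h2 irr (fun q => sup_lap_derive hX t0 t1 al0)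
  (fun q => sup_lap_gt0 cX al0) (sup_lap_limit cX al0).
have lw := wexp_lin al0.
have aw m n : alpha * wexp alpha m n = m%:R + alpha * n%:R.
  by rewrite /wexp mulrDr addrC mulrCA mulfV// mulr1.
have lin_scale (e : nat -> nat -> R) : lin_bounded e -> lin_bounded (fun m n => alpha * e m n).
  move=> [K K0 hK]; exists (alpha * K); first by rewrite mulr_ge0// ltW.
  by move=> m n; rewrite normrM gtr0_norm// -mulrA; apply: ler_wpM2l; [exact: ltW|exact: hK].
have [al1|al1|/eqP] := ltgtP alpha 1; last by rewrite (negbTE an1).
- have [gF eF] := sup_series_lt1 cX al0 al1 A1 hA q00 gb hW.
  have le := lin_boundedN (lin_scale _ lw).
  have dF := dsum_density le gF (fun y y0 => etrans (sup_cdfE y hL) (eF y y0)) x0.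
  have [C [r [rr0 rr1 hr]]] := geo_beyond_deriv (lexx 0) le gF x0.
  split; first by have [] := dF.
  split=> [_|/andP[]]; last by lra.
  rewrite /sup_density derive1E (@derive_val _ _ _ _ _ _ _ dF).
  set u := (fun m n => _) in hr; rewrite -/u.
  have uE m n : u m n = coef_b alpha rho m n * x `^ (- 1 - m%:R - alpha * n%:R).
    rewrite /u /coef_b aw wcoef_sin_prod//.
    have -> : 1 + wexp alpha m n = 1 + n%:R + m%:R / alpha by rewrite /wexp addrA.
    have -> : - (m%:R + alpha * n%:R) - 1 = - 1 - m%:R - alpha * n%:R by ring.
    have -> : - m%:R - alpha * n%:R = - (m%:R + alpha * n%:R) by ring.
    (* The exponent brought down by the derivative is absorbed: 1 / Gamma(- y) = - y / Gamma(1 -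
       y). *)
    rewrite [rGamma (- _)]rGammaS (_ : - (m%:R + alpha * n%:R) + 1 = 1 - (m%:R + alpha * n%:R)); last by rewrite addrC.
    by move: (rGamma _) (rGamma _) (sin_prod _ _ _ _) (powR _ _) => G G' S p; ring.
  (* 1 / Gamma(- m) = 0: the column n = 0 drops out, and this is why the series carries b_(m,n+1)
     and the prefactor x^(-1-alpha). *)
  have u0 m : u m 0%N = 0.
    rewrite uE /coef_b mulr0 subr0 (_ : rGamma (- m%:R) = 0); last exact: rGammaN.
    by rewrite mulr0 !mul0r.
  rewrite (dsumS rr0 rr1 hr u0).
  have hr' : dgeo (C * r) r (fun m n => u m n.+1).
    by move=> m n; apply: le_trans (hr m n.+1) _; rewrite exprS mulrACA mulrA mulrAC -!mulrA lexx.
  apply: (iterated_scale rr0 rr1 hr' (powR_gt0 _ x0)) => m n.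
  rewrite uE mulrCA -powRD ?(gt_eqF x0) ?implybT//; congr (_ * _ `^ _).
  by rewrite -natr1; ring.
- have [gF eF] := sup_series_gt1 cX al1 (ltW r0) A1 hA (fun q => sup_lap_sym hX t0 t1 al0) q00 gb hW.
  have lr : lin_bounded (fun m n => rho + wexp alpha m n).
    have [K K0 hK] := lw; exists (rho + K); first by rewrite addr_ge0// ltW.
    move=> m n; apply: le_trans (ler_normD _ _) _; rewrite mulrDl; apply: lerD => //.
    by rewrite gtr0_norm// ler_peMr ?(ltW r0)// -natrM ler1n muln_gt0.
  have le := lin_scale _ lr.
  have dF := dsum_density le gF (fun y y0 => etrans (sup_cdfE y hL) (eF y y0)) x0.
  have [C [r [rr0 rr1 hr]]] := geo_beyond_deriv (lexx 0) le gF x0.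
  split; first by have [] := dF.
  split=> [/andP[]|_]; first by lra.
  rewrite /sup_density derive1E (@derive_val _ _ _ _ _ _ _ dF).
  apply: (iterated_scale rr0 rr1 hr (powR_gt0 _ x0)) => m n.
  have eE : alpha * (rho + wexp alpha m n) = alpha * rho + m%:R + alpha * n%:R by rewrite mulrDr aw addrA.
  rewrite [RHS]mulrCA -powRD ?(gt_eqF x0) ?implybT// /coef_a wcoef_sin_prod// eE.
  have -> : alpha * rho + m%:R + alpha * n%:R - 1 = alpha * rho - 1 + (m%:R + alpha * n%:R) by ring.
  have -> : 1 - (rho + wexp alpha m n) = 1 - rho - n%:R - m%:R / alpha by rewrite /wexp; ring.
  (* Again the exponent y is absorbed, through 1 / Gamma(y) = y / Gamma(1 + y). *)
  rewrite [rGamma (alpha * rho + _ + _)]rGammaS (addrC _ 1).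
  move: (rGamma _) (rGamma _) (sin_prod _ _ _ _) (powR _ _) => G G' S p; ring.
Qed.
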